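(* Let $\mathbb{H}$ be the upper half-plane. For $\tau\in\mathbb{H}$ and $s>0$ let $$X_\tau(s)=\left\{\frac{1}{(m\tau+n)^2\,|m\tau+n|^s}\ :\ m,n\in\mathbb{Z},\ \gcd(m,n)=1\right\},\qquad \widehat{A}(X_\tau(s);t)=\prod_{x\in X_\tau(s)}Q_{\widehat A}(xt),\qquad Q_{\widehat A}(w)=\frac{\frac12\sqrt{w}}{\sinh(\frac12\sqrt{w})}.$$ Then, as functions of $(z,\tau)\in\mathbb{C}\times\mathbb{H}$ (with $z$ not a nonzero element of the lattice $\mathbb{Z}\tau+\mathbb{Z}$), $$\lim_{s\to0^+}\widehat{A}\big(X_\tau(s);(2\pi i z)^2\big)=\exp\left((2\pi i z)^2\cdot\frac{G_2^\star(\tau)}{2}\right)\cdot Q_W(z),$$ where $G_2^\star(\tau)=\frac{1}{4\pi\operatorname{Im}(\tau)}+G_2(\tau)$ and $Q_W$ is the characteristic series of the Witten genus, $$Q_W(z)=\exp\left(\sum_{k\ge2}\frac{G_{2k}(\tau)(2\pi i z)^{2k}}{(2k)!}\right).$$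
   Context: Notation: $q=e^{2\pi i\tau}$. For integers $k\ge1$, $G_{2k}(\tau)=-\frac{B_{2k}}{2k}+2\sum_{n\ge1}\sigma_{2k-1}(n)q^n$, where $B_{2k}$ is the $2k$-th Bernoulli number and $\sigma_\nu(n)=\sum_{d\mid n}d^\nu$ (e.g. $G_2(\tau)=-\frac1{12}+2\sum_{n\ge1}\sigma_1(n)q^n$). $Q_{\widehat A}(w)=1-\frac{w}{24}+\frac{7w^2}{5760}-\cdots$ is an even function of $\sqrt w$, hence a well-defined meromorphic function of $w\in\mathbb{C}$. $X_\tau(s)$ is a set: the coprime pairs $(m,n)$ and $(-m,-n)$ give the same element, which is counted once in the product. The displayed series defining $Q_W(z)$ converges for $z$ near $0$; for other $z$, $Q_W(z)$ denotes its meromorphic continuation to $z\in\mathbb{C}$ (holomorphic away from the nonzero points of $\mathbb{Z}\tau+\mathbb{Z}$). *)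

(* Defs.v *)
(* Stdlib reals and Coquelicot, with Coquelicot's complex numbers [C]. *)
From Stdlib Require Import Reals ZArith List Lra.
From Coquelicot Require Import Coquelicot.

Open Scope R_scope.

(* ** Elementary complex functions *)

Definition Cexp (z : C) : C :=
  (exp (Re z) * cos (Im z), exp (Re z) * sin (Im z)).

Definition Csinh (z : C) : C := ((Cexp z - Cexp (- z)) / 2)%C.

(* Principal branch. [Q_Ahat] below does not depend on this choice, because
   u / sinh u is even. *)
Definition Csqrt (w : C) : C :=
  (sqrt ((Cmod w + Re w) / 2),
   (if Rle_dec 0 (Im w) then 1 else -1) * sqrt ((Cmod w - Re w) / 2)).

Lemma Csqrt_sqr (w : C) : (Csqrt w * Csqrt w)%C = w.
Proof.
destruct w as [a b].
set (M := Cmod (a, b)).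
assert (HM : M * M = a * a + b * b).
{ unfold M, Cmod; simpl. rewrite sqrt_sqrt; [ring | nra]. }
assert (HM0 : 0 <= M) by apply Cmod_ge_0.
assert (Hp : 0 <= (M + a) / 2) by nra.
assert (Hm : 0 <= (M - a) / 2) by nra.
unfold Csqrt, Cmult; simpl; fold M.
assert (Hpm : sqrt ((M + a) / 2) * sqrt ((M - a) / 2) = Rabs b / 2).
{ rewrite <- sqrt_mult by assumption.
  replace ((M + a) / 2 * ((M - a) / 2)) with (Rsqr (b / 2))
    by (unfold Rsqr; nra).
  rewrite sqrt_Rsqr_abs, Rabs_div by lra.
  now rewrite (Rabs_right 2) by lra. }
pose proof (sqrt_sqrt _ Hp). pose proof (sqrt_sqrt _ Hm).
unfold Rabs in Hpm.
f_equal; destruct (Rle_dec 0 b); destruct (Rcase_abs b); nra.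
Qed.

(* Value [1] at the removable singularity [w = 0].  Division by zero in [C]
   is total, so the value at a pole is meaningless; see [Q_Ahat_pole]. *)
Definition Q_Ahat (w : C) : C :=
  if Ceq_dec w 0 then RtoC 1
  else (Csqrt w / 2 / Csinh (Csqrt w / 2))%C.

Definition Q_Ahat_pole (w : C) : Prop :=
  w <> RtoC 0 /\ Csinh (Csqrt w / 2)%C = RtoC 0.

(* ** Products over a set of complex numbers *)

(* The finite subsets of [A], directed by inclusion; a finite subset is
   represented by a duplicate-free list. *)
Definition finite_subsets (A : C -> Prop) (P : list C -> Prop) : Prop :=
  exists L0 : list C, List.Forall A L0 /\
    forall L : list C, NoDup L -> List.Forall A L -> incl L0 L -> P L.

Instance finite_subsets_filter (A : C -> Prop) :
  ProperFilter (finite_subsets A).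
Proof.
split; [| split].
- intros P [L0 [HA H]]. exists (nodup Ceq_dec L0). apply H.
  + apply NoDup_nodup.
  + rewrite Forall_forall in *. intros x Hx. apply HA.
    now apply (nodup_In Ceq_dec).
  + intros x Hx. now apply nodup_In.
- exists nil. auto.
- intros P Q [L1 [HA1 H1]] [L2 [HA2 H2]]. exists (L1 ++ L2). split.
  + now apply Forall_app.
  + intros L HL HA Hi. apply incl_app_inv in Hi. destruct Hi. auto.
- intros P Q HPQ [L0 [HA H]]. exists L0. auto.
Qed.

Definition Cprod_list (f : C -> C) (L : list C) : C :=
  fold_right Cmult (RtoC 1) (map f L).

Definition is_Cprod (A : C -> Prop) (f : C -> C) (l : C) : Prop :=
  filterlim (Cprod_list f) (finite_subsets A) (locally l).

Definition ex_Cprod (A : C -> Prop) (f : C -> C) : Prop :=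
  exists l : C, is_Cprod A f l.

Definition Cprod (A : C -> Prop) (f : C -> C) : C :=
  @iota C_CompleteNormedModule (is_Cprod A f).

(* ** The A-hat genus of X_tau(s) *)

Definition X (tau : C) (s : R) (x : C) : Prop :=
  exists m n : Z, Z.gcd m n = 1%Z /\
    let w := (IZR m * tau + IZR n)%C in
    x = (/ (w ^ 2 * Rpower (Cmod w) s))%C.

Definition Ahat (A : C -> Prop) (t : C) : C :=
  Cprod A (fun x => Q_Ahat (x * t)%C).

Definition Ahat_converges (A : C -> Prop) (t : C) : Prop :=
  ex_Cprod A (fun x => Q_Ahat (x * t)%C).

Definition Ahat_pole (A : C -> Prop) (t : C) : Prop :=
  exists x : C, A x /\ Q_Ahat_pole (x * t)%C.

(* ** Eisenstein series *)

(* [bernoulli_upto n] is correct on the indices [k <= n].  It uses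
   sum_{j <= n} binomial(n+1, j) B_j = 0 for n >= 1, so B_1 = -1/2. *)
Fixpoint bernoulli_upto (n : nat) : nat -> R :=
  match n with
  | O => fun _ => 1
  | S p => fun k =>
      if Nat.leb k p then bernoulli_upto p k
      else - sum_f_R0 (fun j => Binomial.C (n + 1) j * bernoulli_upto p j) p
             / INR (n + 1)
  end.

Definition bernoulli (n : nat) : R := bernoulli_upto n n.

Definition sum_div_pow (nu n : nat) : nat :=
  list_sum (map (fun d => Nat.pow d nu)
    (filter (fun d => Nat.eqb (Nat.modulo n d) 0) (seq 1 n))).

Definition Cseries (a : nat -> C) : C :=
  @iota C_CompleteNormedModule (fun l : C => is_series a l).

Definition qexp (tau : C) : C := Cexp (2 * PI * Ci * tau)%C.

(* [G2k k] is the series of weight [2 * k], for [1 <= k]. *)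
Definition G2k (k : nat) (tau : C) : C :=
  (- (bernoulli (2 * k) / INR (2 * k))%R
   + 2 * Cseries (fun j =>
       INR (sum_div_pow (2 * k - 1) (S j)) * qexp tau ^ (S j)))%C.

Definition G2_star (tau : C) : C :=
  ((/ (4 * PI * Im tau))%R + G2k 1 tau)%C.

(* ** The characteristic series of the Witten genus *)

Definition nonzero_lattice_point (tau z : C) : Prop :=
  z <> RtoC 0 /\ exists m n : Z, z = (IZR m * tau + IZR n)%C.

(* The summand of index [k = j + 2] in the exponent of Q_W(z). *)
Definition Q_W_term (tau z : C) (j : nat) : C :=
  let k := (j + 2)%nat in
  (G2k k tau * (2 * PI * Ci * z) ^ (2 * k) / INR (fact (2 * k)))%C.

Definition holomorphic_at (f : C -> C) (z : C) : Prop :=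
  locally z (fun w : C => ex_derive f w).

Definition meromorphic_at (f : C -> C) (z : C) : Prop :=
  exists (N : nat) (g : C -> C), holomorphic_at g z /\
    locally' z (fun w : C => f w = (g w / (w - z) ^ N)%C).

(* [QW] is the meromorphic continuation to C of the exponential of the series.
   By the identity theorem these conditions determine [QW] off the nonzero
   lattice points; its values at those points are arbitrary. *)
Definition is_Q_W (tau : C) (QW : C -> C) : Prop :=
  locally (RtoC 0) (fun z : C =>
    exists l : C, is_series (Q_W_term tau z) l /\ QW z = Cexp l) /\
  (forall z : C, meromorphic_at QW z) /\
  (forall z : C, ~ nonzero_lattice_point tau z -> holomorphic_at QW z).

(* Main.v *)
Require Import Defs.
From Stdlib Require Import Reals ZArith List Permutation Lra Lia Psatz ClassicalEpsilon.
From Coquelicot Require Import Coquelicot.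
Import ListNotations.
Open Scope R_scope.

(** The genus is a product of values of [Q_Ahat] over a lattice, and [Q_Ahat] is itself the inverse of a product.
    By Euler's formula (Csinh_fprod)
    [sinh h / h] is the product of the [1 + h^2 / (pi k)^2], so [1 / Q_Ahat (w)] is the product over
    [k >= 1] of the [1 + w / (2 pi k)^2]. At [w = (2 pi i z)^2 / (u^2 |u|^s)] with [u = m tau + n] the factor is
    [1 - a], where [a = z^2 / (k^2 u^2 |u|^s)]. When [k] runs through the positive integers and [u] through the
    primitive points up to sign, [k u] runs through the nonzero lattice points up to sign. So the reciprocal of
    the genus is an absolutely convergent product, a deformation of the product of the [1 - z^2 / v^2] over half
    of the lattice (Ahat_product). It has no poles, and it vanishes where the genus has poles.

    For [s = 0] this product converges only conditionally. Each factor is therefore written as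
    [(1 - a) exp a] times [exp (- a)]. The primary factors [(1 - a) exp a] differ from [1] by [O(a^2)], uniformly
    in [s], and dominated convergence applies to their product. What is left is [exp] of minus the sum of the
    [a]. This sum is [z^2 zeta(2) / zeta(2 + s)] times the sum of [1 / (v^2 |v|^s)] over half of
    the lattice, the Eisenstein series of weight two with Hecke's regularization. Its limit is found row by row
    (hecke_limit): the summands are compared with the increments of an explicit primitive along the row. The
    differences are dominated by [|v|^(-3)]; the increments telescope to a multiple of
    [s m^(- 1 - s)] in the row [m], and their sum over [m] tends to [- pi / (2 Im tau)] because
    [s zeta(1 + s)] tends to [1]. This term becomes the non-holomorphic part of [G2_star]. Together: the
    limit of the genus is the inverse of the product of the primary factors times an exponential (Ahat_limit).

    The product of the primary factors is then evaluated by rows, in Eisenstein's order (half_product). A row is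
    a quotient of sines by Euler's product, that is, a factor
    [(1 - exp x q^m) (1 - exp (- x) q^m) / (1 - q^m)^2] with [x = 2 pi i z] (row_product), and the row [m = 0]
    gives [sinh (x / 2) / (x / 2)]. Eisenstein's row sums enter both here and through Hecke's limit,
    and cancel. The limit is [exp (- pi z^2 / (2 Im tau))] times [1 / denom].

    It remains to recognize [Q_Witten], which is [1 / denom] times a Gaussian factor, as the continuation of the
    characteristic series. Since [denom] is explicit, [Q_Witten] is defined everywhere. The [q]-product
    is an entire power series that satisfies a functional equation (qprod_functional); splitting off finitely
    many factors shows that [1 / denom] is meromorphic, and its poles are nonzero lattice points. Near the
    origin the logarithm of [1 / denom] is expanded. The logarithm of [(x / 2) / sinh (x / 2)] has the
    Bernoulli numbers in its coefficients (logsinh_exp, by a differential equation), and the logarithm of the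
    [q]-product is an absolutely convergent triple series, whose sum over two of the indices produces the divisor
    sums (lterm_sum_divisors). Both together give the series with coefficients [G2k k tau] for all
    [k >= 1], and the Gaussian factor removes the term [k = 1] (Q_Witten_series).

    Except for the symmetric limits along single rows, sums and products over lattice points are unconditional,
    as in the definition of the genus; the rules for reindexing, Fubini's theorem and dominated convergence are
    proved for both at once. *)

(** * Limits of complex-valued maps *)

Lemma clim_iff {T} (F : (T -> Prop) -> Prop) {FF : Filter F} (f : T -> C) (l : C) :
  filterlim f F (locally l) <->
  forall eps : R, 0 < eps -> F (fun x => Cmod (f x - l)%C < eps).
Proof.
split.
- intros H eps He.
  apply (H (fun w => Cmod (w - l)%C < eps)).
  assert (H2 : 0 < sqrt 2) by (apply sqrt_lt_R0; lra).
  assert (Hd : 0 < eps / sqrt 2) by (apply Rdiv_lt_0_compat; lra).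
  exists (mkposreal _ Hd). intros w Hw.
  apply C_NormedModule_mixin_compat2 in Hw. simpl in Hw.
  replace (sqrt 2 * (eps / sqrt 2)) with eps in Hw by (field; lra). exact Hw.
- intros H P [eps HP]. unfold filtermap.
  apply (filter_imp (fun x => Cmod (f x - l)%C < eps)).
  + intros x Hx. apply HP. apply C_NormedModule_mixin_compat1. exact Hx.
  + apply H. apply cond_pos.
Qed.

Lemma clim_unique {T} (F : (T -> Prop) -> Prop) {FF : ProperFilter F} (f : T -> C) (l l' : C) :
  filterlim f F (locally l) -> filterlim f F (locally l') -> l = l'.
Proof.
intros H1 H2. exact (filterlim_locally_unique (K := C_AbsRing) (V := C_NormedModule) f l l' H1 H2).
Qed.

Lemma Cmod_sub_sym (a b : C) : Cmod (a - b)%C = Cmod (b - a)%C.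
Proof. rewrite <- Cmod_opp. f_equal. ring. Qed.

Lemma Cmod_sub_eq0 (a b : C) : Cmod (a - b)%C = 0 -> a = b.
Proof.
intros H. apply Cmod_eq_0 in H. replace a with ((a - b) + b)%C by ring. rewrite H. ring.
Qed.

Lemma Cmod_tri3 (a b c : C) : Cmod (a - c)%C <= Cmod (a - b)%C + Cmod (b - c)%C.
Proof. replace (a - c)%C with ((a - b) + (b - c))%C by ring. apply Cmod_triangle. Qed.

(** Unconditional sums and products obey the same rules (reindexing, Fubini, dominated limits); the rules
    are proved once, for a topological commutative monoid on [C]. *)
Record Cmonoid (op : C -> C -> C) (e : C) : Prop := {
  mon_assoc : forall a b c, op a (op b c) = op (op a b) c;
  mon_comm : forall a b, op a b = op b a;
  mon_unit : forall a, op e a = a;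
  mon_cont : forall a b eps, 0 < eps -> exists d, 0 < d /\
     forall a' b', Cmod (a' - a)%C < d -> Cmod (b' - b)%C < d -> Cmod (op a' b' - op a b)%C < eps }.

Lemma Cplus_monoid : Cmonoid Cplus (RtoC 0).
Proof.
split; intros; try ring.
exists (eps / 2). split; [lra|]. intros a' b' Ha Hb.
replace (a' + b' - (a + b))%C with ((a' - a) + (b' - b))%C by ring.
eapply Rle_lt_trans; [apply Cmod_triangle|]. lra.
Qed.

Lemma Cmult_monoid : Cmonoid Cmult (RtoC 1).
Proof.
split; intros; try ring.
set (M := Cmod a + Cmod b + 1).
assert (HM : 1 <= M) by (unfold M; pose proof (Cmod_ge_0 a); pose proof (Cmod_ge_0 b); lra).
exists (Rmin 1 (eps / (2 * M))). split.
{ apply Rmin_pos; [lra|]. apply Rdiv_lt_0_compat; lra. }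
intros a' b' Ha Hb.
assert (Ha1 := Rlt_le_trans _ _ _ Ha (Rmin_r _ _)).
assert (Hb1 := Rlt_le_trans _ _ _ Hb (Rmin_r _ _)).
assert (Hb2 := Rlt_le_trans _ _ _ Hb (Rmin_l _ _)).
replace (a' * b' - a * b)%C with ((a' - a) * b' + a * (b' - b))%C by ring.
eapply Rle_lt_trans; [apply Cmod_triangle|]. rewrite !Cmod_mult.
assert (Hb3 : Cmod b' <= M).
{ replace b' with ((b' - b) + b)%C by ring.
  eapply Rle_trans; [apply Cmod_triangle|]. unfold M. pose proof (Cmod_ge_0 a). lra. }
assert (Ha3 : Cmod a <= M) by (unfold M; pose proof (Cmod_ge_0 b); lra).
apply Rle_lt_trans with (Cmod (a' - a)%C * M + M * Cmod (b' - b)%C).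
{ apply Rplus_le_compat.
  - apply Rmult_le_compat_l; [apply Cmod_ge_0|exact Hb3].
  - apply Rmult_le_compat_r; [apply Cmod_ge_0|exact Ha3]. }
replace eps with (eps / (2 * M) * M + M * (eps / (2 * M))) by (field; lra).
apply Rplus_lt_compat; [apply Rmult_lt_compat_r; lra|apply Rmult_lt_compat_l; lra].
Qed.

Lemma clim_mult {T} (F : (T -> Prop) -> Prop) {FF : Filter F} (f g : T -> C) l m :
  filterlim f F (locally l) -> filterlim g F (locally m) ->
  filterlim (fun x => f x * g x)%C F (locally (l * m)%C).
Proof.
intros Hf Hg. apply (clim_iff F). intros eps Heps.
destruct (mon_cont _ _ Cmult_monoid l m eps Heps) as [d [Hd H]].
generalize (filter_and _ _ (proj1 (clim_iff F _ _) Hf d Hd) (proj1 (clim_iff F _ _) Hg d Hd)).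
apply filter_imp. intros x [H1 H2]. now apply H.
Qed.

Lemma clim_plus {T} (F : (T -> Prop) -> Prop) {FF : Filter F} (f g : T -> C) l m :
  filterlim f F (locally l) -> filterlim g F (locally m) ->
  filterlim (fun x => f x + g x)%C F (locally (l + m)%C).
Proof.
intros Hf Hg. apply (clim_iff F). intros eps Heps.
destruct (mon_cont _ _ Cplus_monoid l m eps Heps) as [d [Hd H]].
generalize (filter_and _ _ (proj1 (clim_iff F _ _) Hf d Hd) (proj1 (clim_iff F _ _) Hg d Hd)).
apply filter_imp. intros x [H1 H2]. now apply H.
Qed.

Lemma clim_inv {T} (F : (T -> Prop) -> Prop) {FF : Filter F} (f : T -> C) l : l <> RtoC 0 ->
  filterlim f F (locally l) -> filterlim (fun x => / f x)%C F (locally (/ l)%C).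
Proof.
intros Hl Hf. apply (clim_iff F). intros eps Heps.
assert (Hm : 0 < Cmod l) by now apply Cmod_gt_0.
set (d := Rmin (Cmod l / 2) (eps * (Cmod l * Cmod l) / 2)).
assert (Hd : 0 < d).
{ apply Rmin_pos; [lra|]. assert (0 < eps * (Cmod l * Cmod l)) by (repeat apply Rmult_lt_0_compat; lra). lra. }
generalize (proj1 (clim_iff F _ _) Hf d Hd). apply filter_imp. intros x H1.
set (p := f x) in *.
assert (Hp : Cmod l / 2 <= Cmod p).
{ assert (H0 : Cmod l <= Cmod (l - p)%C + Cmod p).
  { replace l with ((l - p) + p)%C at 1 by ring. apply Cmod_triangle. }
  rewrite Cmod_sub_sym in H0. assert (H2 := Rmin_l (Cmod l / 2) (eps * (Cmod l * Cmod l) / 2)).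
  fold d in H2. lra. }
assert (Hp0 : p <> RtoC 0) by (apply Cmod_gt_0; lra).
replace (/ p - / l)%C with ((l - p) / (p * l))%C by (field; now split).
rewrite Cmod_div by now apply Cmult_neq_0. rewrite Cmod_mult, Cmod_sub_sym.
apply Rlt_div_l; [nra|].
apply Rlt_le_trans with (1 := H1). eapply Rle_trans; [apply Rmin_r|].
assert (Cmod l / 2 * Cmod l <= Cmod p * Cmod l) by (apply Rmult_le_compat_r; lra).
nra.
Qed.

Lemma clim_ext_loc {T} (F : (T -> Prop) -> Prop) {FF : Filter F} (f g : T -> C) l :
  F (fun x => f x = g x) -> filterlim f F (locally l) -> filterlim g F (locally l).
Proof. intros H. apply filterlim_ext_loc. exact H. Qed.

Lemma Cmod_le_sum z : Cmod z <= Rabs (Re z) + Rabs (Im z).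
Proof.
destruct z as [a b]. replace (a, b) with (RtoC a + Ci * RtoC b)%C at 1.
- eapply Rle_trans; [apply Cmod_triangle|]. rewrite Cmod_mult, Cmod_Ci, !Cmod_R. simpl. lra.
- apply injective_projections; simpl; ring.
Qed.

Lemma rlim_iff {T} (F : (T -> Prop) -> Prop) {FF : Filter F} (f : T -> R) l :
  filterlim f F (locally l) <-> forall eps, 0 < eps -> F (fun x => Rabs (f x - l) < eps).
Proof.
split.
- intros H eps Heps. apply (H (fun y => Rabs (y - l) < eps)). now exists (mkposreal eps Heps).
- intros H P [d Hd]. unfold filtermap. generalize (H d (cond_pos d)). apply filter_imp.
  intros x Hx. apply Hd. exact Hx.
Qed.

Lemma clim_pair {T} (F : (T -> Prop) -> Prop) {FF : Filter F} (f g : T -> R) a b :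
  filterlim f F (locally a) -> filterlim g F (locally b) ->
  filterlim (fun x => (f x, g x) : C) F (locally ((a, b) : C)).
Proof.
intros Hf Hg. apply (clim_iff F). intros eps Heps.
assert (He : 0 < eps / 2) by lra.
generalize (filter_and _ _ (proj1 (rlim_iff F f a) Hf _ He) (proj1 (rlim_iff F g b) Hg _ He)). apply filter_imp.
intros x [H1 H2]. eapply Rle_lt_trans; [apply Cmod_le_sum|]. simpl. unfold Rminus in *. lra.
Qed.

Lemma clim_opp {T} (F : (T -> Prop) -> Prop) {FF : Filter F} (f : T -> C) l :
  filterlim f F (locally l) -> filterlim (fun x => - f x)%C F (locally (- l)%C).
Proof.
intros H. apply (clim_ext_loc F (fun x => (-1) * f x)%C); [apply filter_forall; intros; ring|].
replace (- l)%C with ((-1) * l)%C by ring. apply (clim_mult F); [apply filterlim_const|easy].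
Qed.

Lemma clim_minus {T} (F : (T -> Prop) -> Prop) {FF : Filter F} (f g : T -> C) l m :
  filterlim f F (locally l) -> filterlim g F (locally m) ->
  filterlim (fun x => f x - g x)%C F (locally (l - m)%C).
Proof. intros Hf Hg. apply (clim_plus F); [easy|]. now apply (clim_opp F). Qed.

Lemma clim_RtoC {T} (F : (T -> Prop) -> Prop) {FF : Filter F} (f : T -> R) l :
  filterlim f F (locally l) -> filterlim (fun x => RtoC (f x)) F (locally (RtoC l)).
Proof. intros H. apply (clim_pair F); [easy|apply filterlim_const]. Qed.

Lemma skolem {A B} (P : A -> B -> Prop) : (forall x, exists y, P x y) -> exists f, forall x, P x (f x).
Proof.
intros H. exists (fun x => proj1_sig (constructive_indefinite_description _ (H x))).
intros x. apply proj2_sig.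
Qed.

(** * Finite sums and products over lists *)

Definition lfold {I} (op : C -> C -> C) (e : C) (f : I -> C) (L : list I) : C :=
  fold_right op e (map f L).

Definition lsum {I} (g : I -> R) (L : list I) : R := fold_right Rplus 0 (map g L).

Section Lists.
Context {I : Type}.
Implicit Types (L : list I) (g : I -> R) (f : I -> C).

Lemma lsum_app g L L' : lsum g (L ++ L') = lsum g L + lsum g L'.
Proof. unfold lsum. induction L as [|a L IH]; simpl; [ring|]. rewrite IH. ring. Qed.

Lemma lsum_perm g L L' : Permutation L L' -> lsum g L = lsum g L'.
Proof. unfold lsum. induction 1; simpl; lra. Qed.

Lemma lsum_le g g' L : (forall i, In i L -> g i <= g' i) -> lsum g L <= lsum g' L.
Proof.
unfold lsum. induction L as [|a L IH]; simpl; intros H; [lra|].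
apply Rplus_le_compat; [apply H; now left|apply IH; intros; apply H; now right].
Qed.

Lemma lsum_nonneg g L : (forall i, In i L -> 0 <= g i) -> 0 <= lsum g L.
Proof.
unfold lsum. induction L as [|a L IH]; simpl; intros H; [lra|].
apply Rplus_le_le_0_compat; [apply H; now left|apply IH; intros; apply H; now right].
Qed.

Lemma lsum_scal c g L : lsum (fun i => c * g i) L = c * lsum g L.
Proof. unfold lsum. induction L as [|a L IH]; simpl; [ring|]. rewrite IH. ring. Qed.

Lemma lsum_add g g' L : lsum (fun i => g i + g' i) L = lsum g L + lsum g' L.
Proof. unfold lsum. induction L as [|a L IH]; simpl; [ring|]. rewrite IH. ring. Qed.

Section Fold.
Context {op : C -> C -> C} {e : C} (M : Cmonoid op e).

Lemma lfold_app f L L' : lfold op e f (L ++ L') = op (lfold op e f L) (lfold op e f L').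
Proof using M.
unfold lfold. induction L as [|a L IH]; simpl; [now rewrite (mon_unit _ _ M)|].
rewrite IH. apply (mon_assoc _ _ M).
Qed.

Lemma lfold_perm f L L' : Permutation L L' -> lfold op e f L = lfold op e f L'.
Proof using M.
unfold lfold. induction 1; simpl; [easy|now rewrite IHPermutation| |congruence].
rewrite !(mon_assoc _ _ M). now rewrite (mon_comm _ _ M (f y)).
Qed.

Lemma lfold_ext f f' L : (forall i, In i L -> f i = f' i) -> lfold op e f L = lfold op e f' L.
Proof using.
unfold lfold. intros H. f_equal. apply map_ext_in. exact H.
Qed.

Lemma lfold_op f f' L :
  lfold op e (fun i => op (f i) (f' i)) L = op (lfold op e f L) (lfold op e f' L).
Proof using M.
unfold lfold. induction L as [|a L IH]; simpl; [now rewrite (mon_unit _ _ M)|].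
rewrite IH, <- !(mon_assoc _ _ M). f_equal. rewrite !(mon_assoc _ _ M). f_equal.
apply (mon_comm _ _ M).
Qed.
End Fold.

Lemma Cmod_lsum_le f L : Cmod (lfold Cplus (RtoC 0) f L) <= lsum (fun i => Cmod (f i)) L.
Proof.
unfold lfold, lsum. induction L as [|a L IH]; simpl; [rewrite Cmod_0; lra|].
eapply Rle_trans; [apply Cmod_triangle|]. lra.
Qed.

(** [|1 + u| <= exp |u|], and [f p - 1 = (f - 1) p + (p - 1)] for the induction. This is what makes
    products of families behave like sums: a product is close to [1] when the sum of the [|f - 1|] is small. *)
Lemma Cmod_lprod_sub1 f L :
  Cmod (lfold Cmult (RtoC 1) f L - 1)%C <= exp (lsum (fun i => Cmod (f i - 1)%C) L) - 1 /\
  Cmod (lfold Cmult (RtoC 1) f L) <= exp (lsum (fun i => Cmod (f i - 1)%C) L).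
Proof.
unfold lfold, lsum. induction L as [|a L [IH1 IH2]]; simpl.
- rewrite exp_0. replace (1 - 1)%C with (RtoC 0) by ring. rewrite Cmod_0, Cmod_1. lra.
- set (p := fold_right Cmult 1%C (map f L)) in *.
  set (u := fold_right Rplus 0 _) in *.
  rewrite exp_plus. set (x := Cmod (f a - 1)%C).
  assert (Hx : 0 <= x) by apply Cmod_ge_0.
  assert (He : 1 + x <= exp x) by apply exp_ineq1_le.
  assert (Hu := exp_pos u).
  split.
  + replace (f a * p - 1)%C with ((f a - 1) * p + (p - 1))%C by ring.
    eapply Rle_trans; [apply Cmod_triangle|]. rewrite Cmod_mult. fold x.
    assert (x * Cmod p <= x * exp u) by (apply Rmult_le_compat_l; lra). nra.
  + rewrite Cmod_mult.
    assert (Cmod (f a) <= 1 + x).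
    { replace (f a) with (1 + (f a - 1))%C by ring.
      eapply Rle_trans; [apply Cmod_triangle|]. rewrite Cmod_1. fold x. lra. }
    pose proof (Cmod_ge_0 (f a)). pose proof (Cmod_ge_0 p).
    apply Rmult_le_compat; lra.
Qed.

Lemma ieq_dec (i j : I) : {i = j} + {i <> j}.
Proof. apply excluded_middle_informative. Qed.

(** Cauchy estimates compare a partial sum with a smaller one; the difference is the partial sum over [L']. *)
Lemma split_list L0 L : NoDup L0 -> NoDup L -> incl L0 L ->
  exists L', Permutation L (L0 ++ L') /\ NoDup L' /\ (forall i, In i L' -> In i L /\ ~ In i L0).
Proof.
intros H0 H Hi.
exists (filter (fun i => if in_dec ieq_dec i L0 then false else true) L).
assert (HF : forall i, In i (filter (fun i => if in_dec ieq_dec i L0 then false else true) L) <->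
   In i L /\ ~ In i L0).
{ intros i. rewrite filter_In. destruct (in_dec ieq_dec i L0); intuition congruence. }
split; [|split].
- apply NoDup_Permutation; [easy| |].
  + apply NoDup_app; [easy|now apply NoDup_filter|].
    intros a Ha Hb. apply HF in Hb. tauto.
  + intros x. rewrite in_app_iff, HF. destruct (in_dec ieq_dec x L0); intuition.
- now apply NoDup_filter.
- intros i Hin. now apply HF.
Qed.
End Lists.

(** * Unconditional convergence of families *)

(** The filter of finite subsets of a subset [A] of an arbitrary index type; over [C] it is
    [finite_subsets]. *)
Definition fin_sub {I} (A : I -> Prop) (P : list I -> Prop) : Prop :=
  exists L0 : list I, List.Forall A L0 /\
    forall L : list I, NoDup L -> List.Forall A L -> incl L0 L -> P L.

#[export] Instance fin_sub_filter {I} (A : I -> Prop) : ProperFilter (fin_sub A).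
Proof.
split; [| split].
- intros P [L0 [HA H]]. exists (nodup ieq_dec L0). apply H.
  + apply NoDup_nodup.
  + rewrite Forall_forall in *. intros x Hx. apply HA.
    now apply (nodup_In ieq_dec).
  + intros x Hx. now apply nodup_In.
- exists nil. auto.
- intros P Q [L1 [HA1 H1]] [L2 [HA2 H2]]. exists (L1 ++ L2). split.
  + now apply Forall_app.
  + intros L HL HA Hi. apply incl_app_inv in Hi. destruct Hi. auto.
- intros P Q HPQ [L0 [HA H]]. exists L0. auto.
Qed.

Lemma fin_sub_nodup {I} (A : I -> Prop) (P : list I -> Prop) : fin_sub A P ->
  exists L0 : list I, NoDup L0 /\ List.Forall A L0 /\
    forall L : list I, NoDup L -> List.Forall A L -> incl L0 L -> P L.
Proof.
intros [L0 [HA H]]. exists (nodup ieq_dec L0).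
split; [apply NoDup_nodup|]. split.
- rewrite Forall_forall in *. intros x Hx. apply HA. now apply (nodup_In ieq_dec).
- intros L HL HLA Hi. apply H; [easy..|]. intros x Hx. apply Hi. now apply nodup_In.
Qed.

Definition is_fam (op : C -> C -> C) (e : C) {I} (A : I -> Prop) (f : I -> C) (l : C) : Prop :=
  filterlim (lfold op e f) (fin_sub A) (locally l).

Notation is_fsum := (is_fam Cplus (RtoC 0)).
Notation is_fprod := (is_fam Cmult (RtoC 1)).

(** Absolute convergence, for nonnegative families, in the form that comparisons produce. *)
Definition summable {I} (A : I -> Prop) (g : I -> R) : Prop :=
  (forall i, A i -> 0 <= g i) /\
  exists B, forall L, NoDup L -> List.Forall A L -> lsum g L <= B.

Section Summable.
Context {I : Type}.
Implicit Types (A : I -> Prop) (g : I -> R).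

(** The finite partial sums come close to their supremum, and adding disjoint indices cannot exceed it. *)
Lemma summable_tail A g : summable A g -> forall eps, 0 < eps ->
  exists L0, NoDup L0 /\ List.Forall A L0 /\
   forall L, NoDup L -> List.Forall A L -> (forall i, In i L -> ~ In i L0) -> lsum g L < eps.
Proof.
intros [Hg [B HB]] eps He.
set (E := fun x => exists L, NoDup L /\ List.Forall A L /\ x = lsum g L).
destruct (completeness E) as [m [Hub Hlub]].
- exists B. intros x [L [H1 [H2 ->]]]. now apply HB.
- exists 0. exists nil. split; [constructor|]. split; [constructor|]. reflexivity.
- destruct (Classical_Prop.classic (exists x, E x /\ m - eps < x)) as [[x [[L0 [H1 [H2 ->]]] Hx]]|Hn].
  + exists L0. split; [easy|]. split; [easy|]. intros L HL HA Hd.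
    assert (Hle : lsum g (L0 ++ L) <= m).
    { apply Hub. exists (L0 ++ L). split; [|split; [now apply Forall_app|easy]].
      apply NoDup_app; [easy..|]. intros a Ha Hb. now apply (Hd a). }
    rewrite lsum_app in Hle. lra.
  + exfalso. assert (m <= m - eps); [|lra]. apply Hlub. intros x Hx.
    apply Rnot_lt_le. intros Hlt. apply Hn. exists x. now split.
Qed.

Lemma summable_le A g g' : (forall i, A i -> 0 <= g i <= g' i) -> summable A g' -> summable A g.
Proof.
intros Hle [Hg [B HB]]. split; [intros i Hi; now apply Hle|].
exists B. intros L HL HA. apply Rle_trans with (lsum g' L); [|now apply HB].
apply lsum_le. intros i Hi. rewrite Forall_forall in HA. now apply Hle, HA.
Qed.

Lemma summable_subset A A' g : (forall i, A i -> A' i) -> summable A' g -> summable A g.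
Proof.
intros Hs [Hg [B HB]]. split; [auto|]. exists B. intros L HL HA. apply HB; [easy|].
eapply Forall_impl; [|exact HA]. exact Hs.
Qed.

Lemma summable_scal A c g : 0 <= c -> summable A g -> summable A (fun i => c * g i).
Proof.
intros Hc [Hg [B HB]]. split.
- intros i Hi. apply Rmult_le_pos; auto.
- exists (c * B). intros L HL HA. rewrite lsum_scal. apply Rmult_le_compat_l; auto.
Qed.

Lemma summable_plus A g g' : summable A g -> summable A g' -> summable A (fun i => g i + g' i).
Proof.
intros [Hg [B HB]] [Hg' [B' HB']]. split.
- intros i Hi. apply Rplus_le_le_0_compat; auto.
- exists (B + B'). intros L HL HA. rewrite lsum_add. apply Rplus_le_compat; auto.
Qed.

Lemma summable_ext A g g' : (forall i, A i -> g i = g' i) -> summable A g -> summable A g'.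
Proof.
intros He Hs. apply (summable_le A g' g); [|easy]. intros i Hi. rewrite <- He by easy.
destruct Hs as [Hs _]. split; [now apply Hs|lra].
Qed.

Lemma lsum_incl g L L' : NoDup L -> NoDup L' -> incl L L' -> (forall i, In i L' -> 0 <= g i) ->
  lsum g L <= lsum g L'.
Proof.
intros H H' Hi Hg. destruct (split_list L L' H H' Hi) as [L1 [Hp [_ HL1]]].
rewrite (lsum_perm g _ _ Hp), lsum_app.
assert (0 <= lsum g L1); [|lra]. apply lsum_nonneg. intros i Hin. apply Hg, HL1, Hin.
Qed.
End Summable.

Lemma lsum_le_prefix (g : nat -> R) L : NoDup L -> (forall k, 0 <= g k) ->
  lsum g L <= lsum g (seq 0 (S (list_max L))).
Proof.
intros HL Hg. apply lsum_incl; [easy|apply seq_NoDup| |auto].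
intros i Hi. apply in_seq. split; [lia|].
assert (Hm := proj1 (list_max_le L (list_max L)) (le_n _)). rewrite Forall_forall in Hm.
specialize (Hm i Hi). lia.
Qed.

Lemma lsum_map {I J} (g : J -> R) (h : I -> J) L : lsum g (map h L) = lsum (fun i => g (h i)) L.
Proof. unfold lsum. now rewrite map_map. Qed.

Lemma lfold_map {I J} op e (f : J -> C) (h : I -> J) L :
  lfold op e f (map h L) = lfold op e (fun i => f (h i)) L.
Proof. unfold lfold. now rewrite map_map. Qed.

Lemma NoDup_map_inj {I J} (h : I -> J) (A : I -> Prop) L :
  (forall i j, A i -> A j -> h i = h j -> i = j) -> List.Forall A L -> NoDup L -> NoDup (map h L).
Proof.
intros Hinj HA HL. induction L as [|a L IH]; simpl; [constructor|].
inversion HL; inversion HA; subst. constructor; [|auto].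
rewrite in_map_iff. intros [b [Hb Hin]]. rewrite Forall_forall in H6.
apply Hinj in Hb; auto. now subst b.
Qed.

Lemma summable_inj {I J} (h : I -> J) (A : I -> Prop) (B : J -> Prop) (g : J -> R) :
  (forall i j, A i -> A j -> h i = h j -> i = j) -> (forall i, A i -> B (h i)) ->
  summable B g -> summable A (fun i => g (h i)).
Proof.
intros Hinj HAB [Hg [b Hb]]. split; [auto|]. exists b. intros L HL HA.
rewrite <- lsum_map. apply Hb.
- now apply (NoDup_map_inj h A).
- apply Forall_map. eapply Forall_impl; [|exact HA]. exact HAB.
Qed.

(** Tonelli's theorem in terms of bounds: a finite set of pairs meets finitely many columns only. *)
Lemma summable_dep {I J} (A : I -> Prop) (g : I * J -> R) (B : I -> J -> Prop) (G : I -> R) :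
  (forall i j, A i -> B i j -> 0 <= g (i, j)) ->
  (forall i, A i -> forall L, NoDup L -> List.Forall (B i) L -> lsum (fun j => g (i, j)) L <= G i) ->
  summable A G ->
  summable (fun p => A (fst p) /\ B (fst p) (snd p)) g.
Proof.
intros Hg HG [HG0 [b Hb]]. split.
{ intros [i j] [H1 H2]. now apply Hg. }
exists b. intros L HL HA.
(* induction over the set of first components, one column being split off at each step *)
assert (Key : forall LI : list I, NoDup LI -> List.Forall A LI -> forall L : list (I * J), NoDup L ->
  List.Forall (fun p => A (fst p) /\ B (fst p) (snd p)) L ->
  (forall p, In p L -> In (fst p) LI) -> lsum g L <= lsum G LI).
{ clear L HL HA. induction LI as [|a LI IH]; intros HI HAI L HL HA Hin.
  - destruct L as [|p L]; [unfold lsum; simpl; lra|]. destruct (Hin p); now left.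
  - inversion HI as [|? ? Hna HI']; inversion HAI as [|? ? Ha HAI']; subst.
    set (L1 := filter (fun p => if ieq_dec (fst p) a then true else false) L).
    assert (HL1 : forall p, In p L1 <-> In p L /\ fst p = a).
    { intros p. unfold L1. rewrite filter_In. destruct (ieq_dec (fst p) a); intuition congruence. }
    destruct (split_list L1 L) as [L2 [Hp [HL2 Hin2]]]; [now apply NoDup_filter|easy| |].
    { intros p Hp'. now apply HL1. }
    rewrite (lsum_perm g _ _ Hp), lsum_app. change (lsum G (a :: LI)) with (G a + lsum G LI).
    rewrite Forall_forall in HA.
    apply Rplus_le_compat.
    + apply Rle_trans with (lsum (fun j => g (a, j)) (map snd L1)).
      * rewrite lsum_map. apply lsum_le. intros [i j] Hij. apply HL1 in Hij.
        simpl in *. destruct Hij as [_ ->]. lra.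
      * apply HG; [easy| |].
        -- apply (NoDup_map_inj snd (fun p => fst p = a)).
           ++ intros [? ?] [? ?]; simpl; intros; congruence.
           ++ apply Forall_forall. intros p Hp1. now apply HL1.
           ++ now apply NoDup_filter.
        -- apply Forall_map, Forall_forall. intros p Hp1. apply HL1 in Hp1. destruct Hp1 as [Hp1 <-].
           now apply HA.
    + apply IH; [easy|easy|easy| |].
      * apply Forall_forall. intros p Hp1. apply HA. now apply Hin2.
      * intros p Hp1. apply Hin2 in Hp1. destruct Hp1 as [Hp1 Hp2].
        destruct (Hin p Hp1) as [Heq|]; [|easy]. exfalso. apply Hp2. now apply HL1. }
set (LI := nodup ieq_dec (map fst L)).
assert (HLI : List.Forall A LI).
{ apply Forall_forall. intros i Hi. apply nodup_In, in_map_iff in Hi. destruct Hi as [p [<- Hp]].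
  rewrite Forall_forall in HA. now apply HA. }
apply Rle_trans with (lsum G LI).
- apply Key; [apply NoDup_nodup|easy|easy|easy|].
  intros p Hp. apply nodup_In, in_map. exact Hp.
- apply Hb; [apply NoDup_nodup|easy].
Qed.

Lemma summable_prod {I J} (A : I -> Prop) (B : J -> Prop) (a : I -> R) (b : J -> R) :
  summable A a -> summable B b ->
  summable (fun p => A (fst p) /\ B (snd p)) (fun p => a (fst p) * b (snd p)).
Proof.
intros Ha [Hb [M HM]].
assert (HM0 : 0 <= M) by (apply (HM nil); constructor).
apply (summable_dep A _ (fun _ => B) (fun i => M * a i)); simpl.
- intros i j Hi Hj. apply Rmult_le_pos; [now apply Ha|auto].
- intros i Hi L HL HBL. rewrite lsum_scal, Rmult_comm.
  apply Rmult_le_compat_r; [now apply Ha|auto].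
- now apply summable_scal.
Qed.

Lemma exp_mono x y : x <= y -> exp x <= exp y.
Proof. intros [H| ->]; [left; now apply exp_increasing|right; reflexivity]. Qed.

Section Families.
Context {op : C -> C -> C} {e : C} (M : Cmonoid op e).

Lemma fam_cauchy {I} (A : I -> Prop) (f : I -> C) :
  (forall eps, 0 < eps -> exists L0, NoDup L0 /\ List.Forall A L0 /\
     forall L, NoDup L -> List.Forall A L -> incl L0 L ->
       Cmod (lfold op e f L - lfold op e f L0)%C <= eps) ->
  exists l, is_fam op e A f l.
Proof using.
intros H.
apply (proj1 (filterlim_locally_cauchy (U := C_CompleteNormedModule) (F := fin_sub A) (lfold op e f))).
intros eps.
destruct (H (eps / 4)) as [L0 [H0 [HA0 HL]]]; [pose proof (cond_pos eps); lra|].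
exists (fun L => Cmod (lfold op e f L - lfold op e f L0)%C <= eps / 4). split.
- exists L0. split; [easy|]. intros L H1 H2 H3. now apply HL.
- intros u v Hu Hv. apply C_NormedModule_mixin_compat1.
  change (Cmod (lfold op e f v - lfold op e f u)%C < eps).
  eapply Rle_lt_trans; [apply (Cmod_tri3 _ (lfold op e f L0))|].
  rewrite (Cmod_sub_sym (lfold op e f L0)). pose proof (cond_pos eps). lra.
Qed.

(** Estimates of the partial sums (or products) over all large finite sets pass to the limit. *)
Lemma fam_closed {I} (A : I -> Prop) (f : I -> C) l c eps :
  is_fam op e A f l -> fin_sub A (fun L => Cmod (lfold op e f L - c)%C <= eps) ->
  Cmod (l - c)%C <= eps.
Proof using.
intros H Hc. apply le_epsilon. intros d Hd.
assert (H1 := proj1 (clim_iff (fin_sub A) _ _) H d Hd). clear H; rename H1 into H.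
assert (HH := filter_and _ _ Hc H). apply filter_ex in HH. destruct HH as [L [H1 H2]].
eapply Rle_trans; [apply (Cmod_tri3 _ (lfold op e f L))|].
rewrite (Cmod_sub_sym l). lra.
Qed.

Lemma lfold_lim {I S} (F : (S -> Prop) -> Prop) {FF : Filter F} (f : S -> I -> C) (f0 : I -> C) L :
  (forall i, In i L -> filterlim (fun s => f s i) F (locally (f0 i))) ->
  filterlim (fun s => lfold op e (f s) L) F (locally (lfold op e f0 L)).
Proof using M.
induction L as [|a L IH]; intros H.
- apply filterlim_const.
- apply (clim_iff F). intros eps Heps.
  destruct (mon_cont _ _ M (f0 a) (lfold op e f0 L) eps Heps) as [d [Hd Hop]].
  assert (Ha := proj1 (clim_iff F _ _) (H a (or_introl eq_refl)) d Hd).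
  assert (HL := proj1 (clim_iff F _ _) (IH (fun i Hi => H i (or_intror Hi))) d Hd).
  generalize (filter_and _ _ Ha HL). apply filter_imp. intros s [H1 H2]. now apply Hop.
Qed.

(** Dominated convergence in abstract form: the finite partial sums (or products) converge
    uniformly in the parameter, so the limit in the parameter passes inside. *)
Lemma fam_exchange {I S} (F : (S -> Prop) -> Prop) {FF : ProperFilter F} (A : I -> Prop)
  (f : S -> I -> C) (f0 : I -> C) (l : S -> C) (l0 : C) :
  (forall eps, 0 < eps -> exists L0, NoDup L0 /\ List.Forall A L0 /\
     F (fun s => forall L, NoDup L -> List.Forall A L -> incl L0 L ->
       Cmod (lfold op e (f s) L - lfold op e (f s) L0)%C <= eps)) ->
  (forall i, A i -> filterlim (fun s => f s i) F (locally (f0 i))) ->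
  F (fun s => is_fam op e A (f s) (l s)) -> is_fam op e A f0 l0 ->
  filterlim l F (locally l0).
Proof using M.
intros Hu Hp Hl H0. apply (clim_iff F). intros eps Heps.
destruct (Hu (eps / 4)) as [L0 [HN0 [HA0 HF]]]; [lra|].
assert (H1 := proj1 (clim_iff (fin_sub A) _ _) H0 (eps / 4) ltac:(lra)).
destruct (fin_sub_nodup _ _ H1) as [L2 [HN2 [HA2 H2]]].
set (L1 := nodup ieq_dec (L0 ++ L2)).
assert (HN1 : NoDup L1) by apply NoDup_nodup.
assert (HA1 : List.Forall A L1).
{ rewrite Forall_forall in *. intros i Hi. apply nodup_In, in_app_iff in Hi. destruct Hi; auto. }
assert (Hi0 : incl L0 L1) by (intros i Hi; apply nodup_In, in_app_iff; now left).
assert (Hi2 : incl L2 L1) by (intros i Hi; apply nodup_In, in_app_iff; now right).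
specialize (H2 L1 HN1 HA1 Hi2).
assert (H3 : filterlim (fun s => lfold op e (f s) L1) F (locally (lfold op e f0 L1))).
{ refine (lfold_lim F f f0 L1 _). intros i Hi. apply Hp. rewrite Forall_forall in HA1. now apply HA1. }
assert (H4 := proj1 (clim_iff F _ _) H3 (eps / 4) ltac:(lra)).
generalize (filter_and _ _ (filter_and _ _ HF Hl) H4). apply filter_imp.
intros s [[Ha Hb] Hc].
assert (Hd : Cmod (l s - lfold op e (f s) L0)%C <= eps / 4).
{ apply (fam_closed A (f s)); [easy|]. exists L0. split; [easy|]. auto. }
specialize (Ha L1 HN1 HA1 Hi0).
eapply Rle_lt_trans; [apply (Cmod_tri3 _ (lfold op e (f s) L0))|].
eapply Rle_lt_trans.
{ apply Rplus_le_compat_l, (Cmod_tri3 _ (lfold op e (f s) L1)). }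
eapply Rle_lt_trans.
{ apply Rplus_le_compat_l, Rplus_le_compat_l, (Cmod_tri3 _ (lfold op e f0 L1)). }
rewrite (Cmod_sub_sym (lfold op e (f s) L0)). lra.
Qed.

Lemma fam_ext {I} (A : I -> Prop) (f f' : I -> C) l :
  (forall i, A i -> f i = f' i) -> is_fam op e A f l -> is_fam op e A f' l.
Proof using.
intros He. apply filterlim_ext_loc. exists nil. split; [constructor|].
intros L _ HA _. apply lfold_ext. rewrite Forall_forall in HA. auto.
Qed.

Lemma fam_subset_ext {I} (A A' : I -> Prop) (f : I -> C) l :
  (forall i, A i <-> A' i) -> is_fam op e A f l -> is_fam op e A' f l.
Proof using.
intros He H P HP. destruct (H P HP) as [L0 [HA HL]]. exists L0. split.
- eapply Forall_impl; [|exact HA]. intros i. apply He.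
- intros L HN HAL. apply HL; [easy|]. eapply Forall_impl; [|exact HAL]. intros i. apply He.
Qed.

Lemma fam_unique {I} (A : I -> Prop) (f : I -> C) l l' :
  is_fam op e A f l -> is_fam op e A f l' -> l = l'.
Proof using. apply (clim_unique (fin_sub A)). Qed.

Lemma fam_op {I} (A : I -> Prop) (f f' : I -> C) l l' :
  is_fam op e A f l -> is_fam op e A f' l' ->
  is_fam op e A (fun i => op (f i) (f' i)) (op l l').
Proof using M.
intros H H'. apply (clim_iff (fin_sub A)). intros eps Heps.
destruct (mon_cont _ _ M l l' eps Heps) as [d [Hd Hop]].
generalize (filter_and _ _ (proj1 (clim_iff (fin_sub A) _ _) H d Hd)
  (proj1 (clim_iff (fin_sub A) _ _) H' d Hd)). apply filter_imp.
intros L [H1 H2]. rewrite (lfold_op M). now apply Hop.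
Qed.

Lemma fam_reindex {I J} (h : I -> J) (A : I -> Prop) (B : J -> Prop) (f : J -> C) l :
  (forall i j, A i -> A j -> h i = h j -> i = j) ->
  (forall i, A i -> B (h i)) -> (forall j, B j -> exists i, A i /\ h i = j) ->
  is_fam op e A (fun i => f (h i)) l -> is_fam op e B f l.
Proof using M.
intros Hinj HAB Hsur H P HP. destruct (H P HP) as [L0 [HA0 HL0]].
exists (map h L0). split.
{ apply Forall_map. eapply Forall_impl; [|exact HA0]. exact HAB. }
intros L HN HB Hi.
(* pull the list back along the bijection *)
assert (Hpull : exists K, List.Forall A K /\ map h K = L).
{ clear HN Hi. induction L as [|b L IH].
  - exists nil. split; [constructor|easy].
  - inversion HB; subst. destruct IH as [K [HK1 HK2]]; [easy|].
    destruct (Hsur b) as [a [Ha Hb]]; [easy|].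
    exists (a :: K). split; [now constructor|]. simpl. now rewrite Hb, HK2. }
destruct Hpull as [K [HK1 <-]]. rewrite lfold_map. apply HL0.
- eapply NoDup_map_inv; exact HN.
- easy.
- intros i Hi0. assert (Hin : In (h i) (map h K)) by (apply Hi; now apply in_map).
  apply in_map_iff in Hin. destruct Hin as [k [Hk Hk2]].
  rewrite Forall_forall in *. apply Hinj in Hk; auto. now subst k.
Qed.

(** Fubini. The combination of the fibre limits over a finite set [K] of the base is approximated by a finite
    combination of the original family, over indices that lie above [K] and contain any prescribed
    finite set of indices above [K]. *)
Lemma fam_fubini {I J} (phi : I -> J) (A : I -> Prop) (B : J -> Prop) (f : I -> C) (c : J -> C) l :
  (forall i, A i -> B (phi i)) ->
  (forall j, B j -> is_fam op e (fun i => A i /\ phi i = j) f (c j)) ->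
  is_fam op e A f l -> is_fam op e B c l.
Proof using M.
intros HAB Hc H. apply (clim_iff (fin_sub B)). intros eps Heps.
assert (H1 := proj1 (clim_iff (fin_sub A) _ _) H (eps / 2) ltac:(lra)).
destruct (fin_sub_nodup _ _ H1) as [L0 [HN0 [HA0 HL0]]].
exists (map phi L0). split.
{ apply Forall_map. eapply Forall_impl; [|exact HA0]. exact HAB. }
intros K HNK HBK HiK.
(* L0 is the set beyond which all partial combinations are close to l *)
assert (Key : forall K, NoDup K -> List.Forall B K -> forall d, 0 < d ->
  exists L, NoDup L /\ List.Forall A L /\ (forall i, In i L -> In (phi i) K) /\
    (forall i, In i L0 -> In (phi i) K -> In i L) /\
    Cmod (lfold op e f L - lfold op e c K)%C < d).
{ clear K HNK HBK HiK. induction K as [|b K IH]; intros HNK HBK d Hd.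
  - exists nil. split; [constructor|]. split; [constructor|]. split; [easy|]. split; [easy|].
    unfold lfold; simpl. replace (e - e)%C with (RtoC 0) by ring. now rewrite Cmod_0.
  - inversion HNK as [|? ? Hnb HNK']; inversion HBK as [|? ? Hb HBK']; subst.
    destruct (mon_cont _ _ M (c b) (lfold op e c K) d Hd) as [d' [Hd' Hop]].
    destruct (IH HNK' HBK' d' Hd') as [L [HL1 [HL2 [HL3 [HL4 HL5]]]]].
    assert (Hcb := proj1 (clim_iff (fin_sub _) _ _) (Hc b Hb) d' Hd').
    destruct (fin_sub_nodup _ _ Hcb) as [L1 [HN1 [HA1 HF1]]].
    set (L2 := nodup ieq_dec (L1 ++ filter (fun i => if ieq_dec (phi i) b then true else false) L0)).
    assert (HL2b : forall i, In i L2 -> A i /\ phi i = b).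
    { intros i Hi. unfold L2 in Hi. apply nodup_In, in_app_iff in Hi. rewrite Forall_forall in *.
      destruct Hi as [Hi|Hi]; [now apply HA1|]. apply filter_In in Hi.
      destruct (ieq_dec (phi i) b); [|easy]. split; [now apply HA0|easy]. }
    assert (H2 : Cmod (lfold op e f L2 - c b)%C < d').
    { apply HF1; [apply NoDup_nodup| |].
      - apply Forall_forall. exact HL2b.
      - intros i Hi. apply nodup_In, in_app_iff. now left. }
    exists (L2 ++ L). split; [|split; [|split; [|split]]].
    + apply NoDup_app; [apply NoDup_nodup|easy|].
      intros i Hi1 Hi2. apply HL2b in Hi1. apply HL3 in Hi2. destruct Hi1 as [_ Hi1].
      rewrite Hi1 in Hi2. easy.
    + apply Forall_app. split; [|easy]. apply Forall_forall. intros i Hi. now apply HL2b.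
    + intros i Hi. apply in_app_iff in Hi. destruct Hi as [Hi|Hi].
      * left. symmetry. now apply HL2b.
      * right. auto.
    + intros i Hi0 [Hi|Hi]; apply in_app_iff.
      * left. unfold L2. apply nodup_In, in_app_iff. right. apply filter_In. split; [easy|].
        destruct (ieq_dec (phi i) b); congruence.
      * right. auto.
    + rewrite (lfold_app M). change (lfold op e c (b :: K)) with (op (c b) (lfold op e c K)).
      now apply Hop. }
destruct (Key K HNK HBK (eps / 2)) as [L [HL1 [HL2 [_ [HL4 HL5]]]]]; [lra|].
assert (H2 : Cmod (lfold op e f L - l)%C < eps / 2).
{ apply HL0; [easy|easy|]. intros i Hi. apply HL4; [easy|]. apply HiK. now apply in_map. }
eapply Rle_lt_trans; [apply (Cmod_tri3 _ (lfold op e f L))|].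
rewrite (Cmod_sub_sym (lfold op e c K)). lra.
Qed.

Lemma fam_seq {I} (A : I -> Prop) (f : I -> C) l (Ls : nat -> list I) :
  (forall n, NoDup (Ls n)) -> (forall n, List.Forall A (Ls n)) ->
  (forall i, A i -> exists N, forall n, (N <= n)%nat -> In i (Ls n)) ->
  is_fam op e A f l -> filterlim (fun n => lfold op e f (Ls n)) eventually (locally l).
Proof using.
intros HN HA He H P HP. destruct (H P HP) as [L0 [HA0 HL0]].
assert (Hex : exists N, forall n, (N <= n)%nat -> incl L0 (Ls n)).
{ clear HL0. induction L0 as [|a L0 IH].
  - exists 0%nat. intros n _ i [].
  - inversion HA0; subst. destruct IH as [N1 HN1]; [easy|]. destruct (He a) as [N2 HN2]; [easy|].
    exists (max N1 N2). intros n Hn i [<-|Hi]; [apply HN2; lia|apply (HN1 n); [lia|easy]]. }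
destruct Hex as [N HNi]. exists N. intros n Hn. apply HL0; auto.
Qed.
End Families.

Lemma fam_finite {op e} (M : Cmonoid op e) {I} (A : I -> Prop) (f : I -> C) L :
  NoDup L -> List.Forall A L -> (forall i, A i -> ~ In i L -> f i = e) ->
  is_fam op e A f (lfold op e f L).
Proof.
intros HN HA He. apply (clim_iff (fin_sub A)). intros eps Heps.
exists L. split; [easy|]. intros K HNK HAK HiK.
destruct (split_list L K HN HNK HiK) as [L' [Hp [_ HL']]].
rewrite (lfold_perm M _ _ _ Hp), (lfold_app M).
assert (E : lfold op e f L' = e).
{ clear Hp. unfold lfold. induction L' as [|a L' IH]; simpl; [easy|].
  rewrite IH by (intros i Hi; apply HL'; now right).
  rewrite He, (mon_unit _ _ M).
  - easy.
  - rewrite Forall_forall in HAK. apply HAK, HL'. now left.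
  - apply HL'. now left. }
rewrite E, (mon_comm _ _ M), (mon_unit _ _ M).
replace (lfold op e f L - lfold op e f L)%C with (RtoC 0) by ring. now rewrite Cmod_0.
Qed.

Lemma dominated_sum_cauchy {I S} (F : (S -> Prop) -> Prop) {FF : Filter F} (A : I -> Prop)
  (f : S -> I -> C) (g : I -> R) : summable A g ->
  F (fun s => forall i, A i -> Cmod (f s i) <= g i) ->
  forall eps, 0 < eps -> exists L0, NoDup L0 /\ List.Forall A L0 /\
     F (fun s => forall L, NoDup L -> List.Forall A L -> incl L0 L ->
       Cmod (lfold Cplus (RtoC 0) (f s) L - lfold Cplus (RtoC 0) (f s) L0)%C <= eps).
Proof.
intros Hg HF eps Heps. destruct (summable_tail A g Hg eps Heps) as [L0 [HN0 [HA0 HL0]]].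
exists L0. split; [easy|]. split; [easy|]. revert HF. apply filter_imp.
intros s Hs L HN HA Hi. destruct (split_list L0 L HN0 HN Hi) as [L' [Hp [HN' HL']]].
rewrite (lfold_perm Cplus_monoid _ _ _ Hp), (lfold_app Cplus_monoid).
replace (_ - _)%C with (lfold Cplus (RtoC 0) (f s) L') by ring.
eapply Rle_trans; [apply Cmod_lsum_le|]. rewrite Forall_forall in HA.
apply Rle_trans with (lsum g L').
- apply lsum_le. intros i Hi'. apply Hs, HA. now apply HL'.
- apply Rlt_le, HL0; [easy| |].
  + apply Forall_forall. intros i Hi'. apply HA. now apply HL'.
  + intros i Hi'. now apply HL'.
Qed.

(** The partial product over [L0] is bounded by [exp B], where [B] bounds the sums of [g], and the remaining
    factors multiply to within [exp (tail) - 1] of [1]. *)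
Lemma dominated_prod_cauchy {I S} (F : (S -> Prop) -> Prop) {FF : Filter F} (A : I -> Prop)
  (f : S -> I -> C) (g : I -> R) : summable A g ->
  F (fun s => forall i, A i -> Cmod (f s i - 1)%C <= g i) ->
  forall eps, 0 < eps -> exists L0, NoDup L0 /\ List.Forall A L0 /\
     F (fun s => forall L, NoDup L -> List.Forall A L -> incl L0 L ->
       Cmod (lfold Cmult (RtoC 1) (f s) L - lfold Cmult (RtoC 1) (f s) L0)%C <= eps).
Proof.
intros Hg HF eps Heps.
destruct (proj2 Hg) as [B HB].
assert (HeB := exp_pos B).
(* the tail bound that makes exp B * (exp tail - 1) <= eps *)
assert (Hd : 0 < ln (1 + eps / exp B)).
{ rewrite <- ln_1. apply ln_increasing; [lra|]. assert (0 < eps / exp B) by (now apply Rdiv_lt_0_compat). lra. }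
destruct (summable_tail A g Hg _ Hd) as [L0 [HN0 [HA0 HL0]]].
exists L0. split; [easy|]. split; [easy|]. revert HF. apply filter_imp.
intros s Hs L HN HA Hi. destruct (split_list L0 L HN0 HN Hi) as [L' [Hp [HN' HL']]].
rewrite (lfold_perm Cmult_monoid _ _ _ Hp), (lfold_app Cmult_monoid).
set (p0 := lfold Cmult (RtoC 1) (f s) L0). set (p' := lfold Cmult (RtoC 1) (f s) L').
replace (p0 * p' - p0)%C with (p0 * (p' - 1))%C by ring. rewrite Cmod_mult.
rewrite Forall_forall in HA, HA0.
assert (H1 : Cmod p0 <= exp B).
{ eapply Rle_trans; [apply Cmod_lprod_sub1|]. apply exp_mono. apply Rle_trans with (lsum g L0).
  - apply lsum_le. intros i Hi'. now apply Hs, HA0.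
  - apply HB; [easy|]. now apply Forall_forall. }
assert (H2 : Cmod (p' - 1)%C <= eps / exp B).
{ eapply Rle_trans; [apply Cmod_lprod_sub1|].
  assert (Hx : lsum (fun i => Cmod (f s i - 1)%C) L' <= ln (1 + eps / exp B)).
  { apply Rle_trans with (lsum g L').
    - apply lsum_le. intros i Hi'. apply Hs, HA. now apply HL'.
    - apply Rlt_le, HL0; [easy| |].
      + apply Forall_forall. intros i Hi'. apply HA. now apply HL'.
      + intros i Hi'. now apply HL'. }
  apply exp_mono in Hx. rewrite exp_ln in Hx; [lra|].
  assert (0 < eps / exp B) by (now apply Rdiv_lt_0_compat). lra. }
apply Rle_trans with (exp B * (eps / exp B)).
- apply Rmult_le_compat; try apply Cmod_ge_0; easy.
- right. field. lra.
Qed.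

(** The trivial filter; with it families without a parameter are instances of families with one. *)
Definition at_point (P : unit -> Prop) : Prop := P tt.

#[export] Instance at_point_filter : ProperFilter at_point.
Proof.
unfold at_point. split; [|split].
- intros P H. now exists tt.
- easy.
- now split.
- intros P Q H. apply H.
Qed.

Lemma fsum_exists {I} (A : I -> Prop) (f : I -> C) (g : I -> R) :
  summable A g -> (forall i, A i -> Cmod (f i) <= g i) -> exists l, is_fsum A f l.
Proof.
intros Hg Hf. apply fam_cauchy. intros eps Heps.
exact (dominated_sum_cauchy at_point A (fun _ => f) g Hg Hf eps Heps).
Qed.

Lemma fprod_exists {I} (A : I -> Prop) (f : I -> C) (g : I -> R) :
  summable A g -> (forall i, A i -> Cmod (f i - 1)%C <= g i) -> exists l, is_fprod A f l.
Proof.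
intros Hg Hf. apply fam_cauchy. intros eps Heps.
exact (dominated_prod_cauchy at_point A (fun _ => f) g Hg Hf eps Heps).
Qed.

(** Tannery's theorem, for sums and for products: dominated convergence of a family in a parameter. *)
Lemma fsum_tannery {I S} (F : (S -> Prop) -> Prop) {FF : ProperFilter F} (A : I -> Prop)
  (f : S -> I -> C) (g : I -> R) (f0 : I -> C) (l : S -> C) (l0 : C) : summable A g ->
  F (fun s => forall i, A i -> Cmod (f s i) <= g i) ->
  (forall i, A i -> filterlim (fun s => f s i) F (locally (f0 i))) ->
  F (fun s => is_fsum A (f s) (l s)) -> is_fsum A f0 l0 ->
  filterlim l F (locally l0).
Proof.
intros Hg HF. apply (fam_exchange Cplus_monoid F). now apply (dominated_sum_cauchy F A f g).
Qed.

Lemma fprod_tannery {I S} (F : (S -> Prop) -> Prop) {FF : ProperFilter F} (A : I -> Prop)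
  (f : S -> I -> C) (g : I -> R) (f0 : I -> C) (l : S -> C) (l0 : C) : summable A g ->
  F (fun s => forall i, A i -> Cmod (f s i - 1)%C <= g i) ->
  (forall i, A i -> filterlim (fun s => f s i) F (locally (f0 i))) ->
  F (fun s => is_fprod A (f s) (l s)) -> is_fprod A f0 l0 ->
  filterlim l F (locally l0).
Proof.
intros Hg HF. apply (fam_exchange Cmult_monoid F). now apply (dominated_prod_cauchy F A f g).
Qed.

Lemma lprod_neq0 {I} (f : I -> C) L : (forall i, In i L -> f i <> RtoC 0) ->
  lfold Cmult (RtoC 1) f L <> RtoC 0.
Proof.
unfold lfold. induction L as [|a L IH]; simpl; intros H.
- apply C1_nz.
- apply Cmult_neq_0; [apply H; now left|apply IH; intros; apply H; now right].
Qed.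

Lemma fprod_zero {I} (A : I -> Prop) (f : I -> C) l i : A i -> f i = 0 -> is_fprod A f l -> l = 0.
Proof.
intros Hi Hf H. apply (clim_unique (fin_sub A) (lfold Cmult (RtoC 1) f) l 0 H).
apply (clim_ext_loc (fin_sub A) (fun _ => RtoC 0)); [|apply filterlim_const].
exists [i]. split; [now repeat constructor|]. intros L _ _ Hin.
assert (Hi' : In i L) by (apply Hin; now left). clear Hin.
symmetry. unfold lfold. induction L as [|a L IH]; [easy|]. simpl.
destruct Hi' as [->|Hi']; [rewrite Hf; ring|]. rewrite IH by easy. ring.
Qed.

(** Beyond a finite set of indices the factors multiply to within [1 / 2] of [1], so the product differs
    from a nonzero finite product [p0] by at most [|p0| / 2]. *)
Lemma fprod_neq0 {I} (A : I -> Prop) (f : I -> C) (g : I -> R) l :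
  summable A g -> (forall i, A i -> Cmod (f i - 1)%C <= g i) -> is_fprod A f l ->
  (forall i, A i -> f i <> RtoC 0) -> l <> RtoC 0.
Proof.
intros Hg Hf Hl H0.
assert (Hd : 0 < ln (3 / 2)) by (rewrite <- ln_1; apply ln_increasing; lra).
destruct (summable_tail A g Hg _ Hd) as [L0 [HN0 [HA0 HL0]]].
set (p0 := lfold Cmult (RtoC 1) f L0).
assert (Hp0 : 0 < Cmod p0).
{ apply Cmod_gt_0, lprod_neq0. intros i Hi. apply H0. rewrite Forall_forall in HA0. now apply HA0. }
assert (Hle : Cmod (l - p0)%C <= Cmod p0 / 2).
{ apply (fam_closed (op := Cmult) (e := RtoC 1) A f); [easy|]. exists L0. split; [easy|]. intros L HN HA Hi.
  destruct (split_list L0 L HN0 HN Hi) as [L' [Hp [HN' HL']]].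
  rewrite (lfold_perm Cmult_monoid _ _ _ Hp), (lfold_app Cmult_monoid). fold p0.
  set (p' := lfold Cmult (RtoC 1) f L').
  replace (p0 * p' - p0)%C with (p0 * (p' - 1))%C by ring. rewrite Cmod_mult.
  assert (Cmod (p' - 1)%C <= 1 / 2); [|pose proof (Cmod_ge_0 p0); nra].
  eapply Rle_trans; [apply Cmod_lprod_sub1|]. rewrite Forall_forall in HA.
  assert (Hx : lsum (fun i => Cmod (f i - 1)%C) L' <= ln (3 / 2)).
  { apply Rle_trans with (lsum g L').
    - apply lsum_le. intros i Hi'. apply Hf, HA. now apply HL'.
    - apply Rlt_le, HL0; [easy| |].
      + apply Forall_forall. intros i Hi'. apply HA. now apply HL'.
      + intros i Hi'. now apply HL'. }
  apply exp_mono in Hx. rewrite exp_ln in Hx; lra. }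
intros ->. rewrite Cmod_sub_sym in Hle. replace (p0 - 0)%C with p0 in Hle by ring. lra.
Qed.

Lemma fprod_inv {I} (A : I -> Prop) (f : I -> C) l : l <> RtoC 0 ->
  (forall i, A i -> f i <> RtoC 0) ->
  is_fprod A f l -> is_fprod A (fun i => / f i)%C (/ l)%C.
Proof.
intros Hl Hf H.
apply (clim_ext_loc (fin_sub A) (fun L => / lfold Cmult (RtoC 1) f L)%C); [|now apply (clim_inv (fin_sub A))].
exists nil. split; [constructor|]. intros L _ HA _. rewrite Forall_forall in HA.
unfold lfold. induction L as [|a L IH]; simpl; [field|].
rewrite <- IH by (intros; apply HA; now right).
assert (f a <> RtoC 0) by (apply Hf, HA; now left).
assert (fold_right Cmult 1%C (map f L) <> RtoC 0).
{ apply lprod_neq0. intros i Hi. apply Hf, HA. now right. }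
field. now split.
Qed.

Lemma fam_morphism {op e op' e'} {I} (A : I -> Prop) (f : I -> C) (h : C -> C) l :
  h e = e' -> (forall a b, h (op a b) = op' (h a) (h b)) ->
  filterlim h (locally l) (locally (h l)) ->
  is_fam op e A f l -> is_fam op' e' A (fun i => h (f i)) (h l).
Proof.
intros He Hop Hc H.
apply filterlim_ext with (fun L => h (lfold op e f L)).
- intros L. unfold lfold. induction L as [|a L IH]; simpl; [easy|]. now rewrite Hop, IH.
- eapply filterlim_comp; [exact H|exact Hc].
Qed.

Lemma fsum_scal {I} (A : I -> Prop) (f : I -> C) c l :
  is_fsum A f l -> is_fsum A (fun i => c * f i)%C (c * l)%C.
Proof.
intros H. apply (fam_morphism (op := Cplus) (e := RtoC 0) A f (fun z => c * z)%C).
- ring.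
- intros; ring.
- apply (clim_mult (locally l)); [apply filterlim_const|apply filterlim_id].
- exact H.
Qed.

Lemma fsum_minus {I} (A : I -> Prop) (f f' : I -> C) l l' :
  is_fsum A f l -> is_fsum A f' l' -> is_fsum A (fun i => f i - f' i)%C (l - l')%C.
Proof.
intros H H'. unfold Cminus. apply (fam_op Cplus_monoid); [easy|].
replace (- l')%C with ((-1) * l')%C by ring.
apply fam_ext with (fun i => (-1) * f' i)%C; [intros; ring|]. now apply fsum_scal.
Qed.

(** * Families indexed by the natural numbers *)

Definition all_nat (n : nat) : Prop := True.

Lemma lfold_seq_sum_n (f : nat -> C) n :
  lfold Cplus (RtoC 0) f (seq 0 (S n)) = sum_n f n.
Proof.
induction n as [|n IH].
- rewrite sum_O. unfold lfold. simpl. ring.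
- rewrite seq_S, (lfold_app Cplus_monoid), IH, sum_Sn. unfold lfold at 1. simpl.
  change plus with Cplus. ring.
Qed.

Lemma fsum_is_series (f : nat -> C) l : is_fsum all_nat f l -> is_series f l.
Proof.
intros H.
assert (H1 : filterlim (fun n => lfold Cplus (RtoC 0) f (seq 0 (S n))) eventually (locally l)).
{ apply (fam_seq all_nat f l); [..|exact H].
  - intros n. apply seq_NoDup.
  - intros n. apply Forall_forall. easy.
  - intros i _. exists i. intros n Hn. apply in_seq. lia. }
unfold is_series. revert H1. apply filterlim_ext. intros n. apply lfold_seq_sum_n.
Qed.

Lemma fprod_nat_seq (f : nat -> C) l : is_fprod all_nat f l ->
  filterlim (fun n => lfold Cmult (RtoC 1) f (seq 0 n)) eventually (locally l).
Proof.
apply fam_seq.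
- intros n. apply seq_NoDup.
- intros n. apply Forall_forall. easy.
- intros i _. exists (S i). intros n Hn. apply in_seq. lia.
Qed.

Lemma lsum_seq_sum_n (g : nat -> R) n : lsum g (seq 0 (S n)) = sum_n g n.
Proof.
induction n as [|n IH].
- rewrite sum_O. unfold lsum. simpl. ring.
- rewrite seq_S, lsum_app, IH, sum_Sn. unfold lsum. simpl. change plus with Rplus. ring.
Qed.

Lemma summable_of_bound (g : nat -> R) B : (forall n, 0 <= g n) ->
  (forall n, lsum g (seq 0 n) <= B) -> summable all_nat g.
Proof.
intros Hg HB. split; [auto|]. exists B. intros L HL _.
eapply Rle_trans; [now apply lsum_le_prefix|apply HB].
Qed.

Lemma summable_of_series (g : nat -> R) : (forall n, 0 <= g n) -> ex_series g -> summable all_nat g.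
Proof.
intros Hg Hs. apply (summable_of_bound g (Series g)); [easy|].
intros n. apply Rle_trans with (lsum g (seq 0 (S n))).
- rewrite seq_S, lsum_app. unfold lsum at 3. simpl. specialize (Hg n). lra.
- rewrite lsum_seq_sum_n. apply Series_correct in Hs.
  apply is_lim_seq_incr_compare with (u := sum_n g); [exact Hs|].
  intros k. rewrite sum_Sn. change plus with Rplus. specialize (Hg (S k)). lra.
Qed.

Lemma series_is_fsum (f : nat -> C) l : summable all_nat (fun n => Cmod (f n)) ->
  is_series f l -> is_fsum all_nat f l.
Proof.
intros Hs Hl. destruct (fsum_exists all_nat f _ Hs) as [l' Hl']; [intros; lra|].
assert (l = l'); [|now subst].
apply fsum_is_series in Hl'. exact (clim_unique eventually (sum_n f) l l' Hl Hl').
Qed.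

(** * Powers of the moduli of lattice points *)

Lemma Rpower_pos x a : 0 < Rpower x a.
Proof. apply exp_pos. Qed.

Lemma Rpower_nonpos_anti x y a : 0 < x -> x <= y -> a <= 0 -> Rpower y a <= Rpower x a.
Proof.
intros Hx Hxy Ha. unfold Rpower. apply exp_mono.
assert (ln x <= ln y) by (apply ln_le; lra). nra.
Qed.

Lemma Rpower_m1 x : 0 < x -> Rpower x (-1) = / x.
Proof. intros Hx. replace (-1) with (- (1)) by ring. rewrite Rpower_Ropp, Rpower_1; lra. Qed.

Lemma Rpower_m2 x : 0 < x -> Rpower x (-2) = / (x * x).
Proof.
intros Hx. replace (-2) with (- INR 2) by (simpl; lra).
rewrite Rpower_Ropp, Rpower_pow by lra. f_equal. ring.
Qed.

Lemma is_derive_Rpower x a : 0 < x -> is_derive (fun t => Rpower t a) x (a * Rpower x (a - 1)).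
Proof.
intros Hx. unfold Rpower. auto_derive; [lra|].
replace ((a - 1) * ln x) with (a * ln x + - ln x) by ring.
rewrite exp_plus, exp_Ropp, exp_ln by lra. field. lra.
Qed.

(** By the mean value theorem [sg * c ^ (- 1 - sg)], for some [c] between [x] and [x + 1], is a difference of
    values of [t ^ (- sg)]; these differences telescope when powers are summed. *)
Lemma Rpower_step x sg : 0 < x -> 0 < sg ->
  sg * Rpower (x + 1) (- 1 - sg) <= Rpower x (- sg) - Rpower (x + 1) (- sg)
    <= sg * Rpower x (- 1 - sg).
Proof.
intros Hx Hs.
destruct (MVT_gen (fun t => Rpower t (- sg)) x (x + 1) (fun t => - sg * Rpower t (- sg - 1)))
  as [c [Hc He]].
- intros t Ht. apply is_derive_Rpower. rewrite Rmin_left in Ht by lra. lra.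
- intros t Ht. rewrite Rmin_left in Ht by lra.
  apply derivable_continuous_pt. exists (- sg * Rpower t (- sg - 1)).
  apply is_derive_Reals, is_derive_Rpower. lra.
- rewrite Rmin_left, Rmax_right in Hc by lra.
  replace (- sg - 1) with (- 1 - sg) in He by ring.
  assert (H1 : Rpower (x + 1) (-1 - sg) <= Rpower c (-1 - sg)) by (apply Rpower_nonpos_anti; lra).
  assert (H2 : Rpower c (-1 - sg) <= Rpower x (-1 - sg)) by (apply Rpower_nonpos_anti; lra).
  nra.
Qed.

Lemma summable_nat_pow a : 1 < a -> summable all_nat (fun n => Rpower (1 + INR n) (- a)).
Proof.
intros Ha. apply (summable_of_bound _ (1 + / (a - 1))); [intros n; apply Rlt_le, Rpower_pos|].
assert (H : forall n, lsum (fun n => Rpower (1 + INR n) (- a)) (seq 0 (S n))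
   <= 1 + / (a - 1) * (1 - Rpower (1 + INR n) (- (a - 1)))).
{ induction n as [|n IH].
  - unfold lsum; simpl. rewrite Rplus_0_r. rewrite Rplus_0_r. unfold Rpower. rewrite ln_1, !Rmult_0_r, exp_0. lra.
  - rewrite seq_S, lsum_app.
    change (lsum (fun n => Rpower (1 + INR n) (- a)) [(0 + S n)%nat])
      with (Rpower (1 + INR (S n)) (- a) + 0).
    assert (Hn := pos_INR n).
    destruct (Rpower_step (1 + INR n) (a - 1)) as [H1 _]; [lra|lra|].
    replace (1 + INR n + 1) with (1 + INR (S n)) in H1 by (rewrite S_INR; ring).
    replace (-1 - (a - 1)) with (- a) in H1 by ring.
    assert (H2 : Rpower (1 + INR (S n)) (- a) <= / (a - 1) *
      (Rpower (1 + INR n) (- (a - 1)) - Rpower (1 + INR (S n)) (- (a - 1)))).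
    { apply Rmult_le_reg_l with (a - 1); [lra|]. rewrite <- Rmult_assoc, Rinv_r by lra. lra. }
    lra. }
intros [|n].
- unfold lsum; simpl. assert (0 < / (a - 1)) by (apply Rinv_0_lt_compat; lra). lra.
- eapply Rle_trans; [apply H|].
  assert (0 < / (a - 1)) by (apply Rinv_0_lt_compat; lra).
  assert (H1 := Rpower_pos (1 + INR n) (- (a - 1))). nra.
Qed.

Definition all_Z (n : Z) : Prop := True.

Lemma summable_Z (g : nat -> R) : summable all_nat g -> summable all_Z (fun n => g (Z.abs_nat n)).
Proof.
intros [Hg [B HB]]. split; [intros; now apply Hg|]. exists (B + B). intros L HL _.
set (L1 := filter (fun n => (0 <=? n)%Z) L).
assert (HL1 : forall n, In n L1 <-> In n L /\ (0 <= n)%Z).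
{ intros n. unfold L1. rewrite filter_In, Z.leb_le. easy. }
destruct (split_list L1 L) as [L2 [Hp [HN2 HL2]]]; [now apply NoDup_filter|easy| |].
{ intros n Hn. now apply HL1. }
rewrite (lsum_perm _ _ _ Hp), lsum_app.
apply Rplus_le_compat; rewrite <- (lsum_map g Z.abs_nat); apply HB.
- apply (NoDup_map_inj _ (fun n => (0 <= n)%Z)); [intros; lia| |now apply NoDup_filter].
  apply Forall_forall. intros n Hn. now apply HL1.
- apply Forall_forall. easy.
- apply (NoDup_map_inj _ (fun n => (n < 0)%Z)); [intros; lia| |easy].
  apply Forall_forall. intros n Hn. apply HL2 in Hn. destruct Hn as [Hn1 Hn2].
  destruct (Z.le_gt_cases 0 n); [|lia]. exfalso. apply Hn2. now apply HL1.
- apply Forall_forall. easy.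
Qed.

Definition pt (tau : C) (p : Z * Z) : C := (IZR (fst p) * tau + IZR (snd p))%C.

Definition nonzero (p : Z * Z) : Prop := p <> (0, 0)%Z.

Lemma Re_pt tau p : Re (pt tau p) = IZR (fst p) * Re tau + IZR (snd p).
Proof. destruct tau as [a b], p as [m n]. unfold pt. simpl. ring. Qed.

Lemma Im_pt tau p : Im (pt tau p) = IZR (fst p) * Im tau.
Proof. destruct tau as [a b], p as [m n]. unfold pt. simpl. ring. Qed.

Lemma IZR_abs_nat n : INR (Z.abs_nat n) = Rabs (IZR n).
Proof. now rewrite INR_IZR_INZ, Zabs2Nat.id_abs, abs_IZR. Qed.

(** The norm [|m tau + n|^2] dominates [m^2 + n^2], and so the product [(1 + |m|) (1 + |n|)]. In this form it
    compares lattice sums with products of two sums over the integers. *)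
Lemma pt_lower (tau : C) : 0 < Im tau -> exists d, 0 < d /\ forall p, nonzero p ->
  d * ((1 + Rabs (IZR (fst p))) * (1 + Rabs (IZR (snd p)))) <= Cmod (pt tau p) ^ 2.
Proof.
intros Ht. set (a := Re tau) in *. set (b := Im tau) in *.
exists (b * b / (1 + 2 * (a * a) + 2 * (b * b)) / 3).
assert (HK : 0 < 1 + 2 * (a * a) + 2 * (b * b)) by nra.
split. { repeat apply Rdiv_lt_0_compat; nra. }
intros [m n] Hp. rewrite Cmod2_alt, Re_pt, Im_pt. simpl fst. simpl snd. fold a b.
set (x := IZR m). set (y := IZR n).
assert (Hx : Rabs x <= x * x /\ Rabs y <= y * y /\ 1 <= x * x + y * y).
{ assert (Hz : forall k : Z, Rabs (IZR k) <= IZR k * IZR k).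
  { intros k. rewrite <- abs_IZR, <- mult_IZR. apply IZR_le. destruct (Z.abs_spec k) as [[? ->]|[? ->]]; nia. }
  split; [apply Hz|split; [apply Hz|]].
  unfold x, y. rewrite <- !mult_IZR, <- plus_IZR. apply IZR_le.
  assert (m <> 0 \/ n <> 0)%Z by (destruct (Z.eq_dec m 0), (Z.eq_dec n 0); subst; auto; now elim Hp).
  nia. }
destruct Hx as [H1 [H2 H3]].
assert (Hxy : Rabs x * Rabs y <= (x * x + y * y) / 2).
{ rewrite <- Rabs_mult. assert (0 <= (x + y) * (x + y)) by apply Rle_0_sqr. assert (0 <= (x - y) * (x - y)) by apply Rle_0_sqr. apply Rabs_le. split; lra. }
assert (H4 : (1 + Rabs x) * (1 + Rabs y) <= 3 * (x * x + y * y)) by nra.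
set (Q := (x * a + y) ^ 2 + (x * b) ^ 2).
assert (H5 : b * b * (x * x + y * y) <= (1 + 2 * (a * a) + 2 * (b * b)) * Q).
{ unfold Q. assert (y * y <= 2 * (x * a + y) ^ 2 + 2 * (x * x) * (a * a)).
  { assert (0 <= (x * a + y + x * a) ^ 2) by apply pow2_ge_0. nra. }
  assert (0 <= (x * a + y) ^ 2) by apply pow2_ge_0.
  assert (0 <= a * a) by nra. nra. }
apply Rle_trans with (b * b / (1 + 2 * (a * a) + 2 * (b * b)) / 3 * (3 * (x * x + y * y))).
- apply Rmult_le_compat_l; [|easy]. apply Rlt_le. repeat apply Rdiv_lt_0_compat; nra.
- replace (_ / _ / 3 * _) with (b * b * (x * x + y * y) / (1 + 2 * (a * a) + 2 * (b * b))) by (field; lra).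
  apply Rle_div_l; lra.
Qed.

Lemma pt_neq0 tau p : 0 < Im tau -> nonzero p -> 0 < Cmod (pt tau p).
Proof.
intros Ht Hp. destruct (pt_lower tau Ht) as [d [Hd H]]. specialize (H p Hp).
assert (0 < d * ((1 + Rabs (IZR (fst p))) * (1 + Rabs (IZR (snd p))))).
{ apply Rmult_lt_0_compat; [easy|].
  pose proof (Rabs_pos (IZR (fst p))). pose proof (Rabs_pos (IZR (snd p))).
  apply Rmult_lt_0_compat; lra. }
pose proof (Cmod_ge_0 (pt tau p)). destruct H1 as [|H1]; [easy|]. rewrite <- H1 in H. nra.
Qed.

Lemma pt_min tau : 0 < Im tau -> exists d, 0 < d <= 1 /\ forall p, nonzero p -> d <= Cmod (pt tau p).
Proof.
intros Ht. destruct (pt_lower tau Ht) as [d [Hd H]].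
assert (Hm : 0 < Rmin d 1) by (apply Rmin_pos; lra).
exists (Rmin d 1). pose proof (Rmin_l d 1). pose proof (Rmin_r d 1).
split; [lra|]. intros p Hp. specialize (H p Hp).
pose proof (Rabs_pos (IZR (fst p))). pose proof (Rabs_pos (IZR (snd p))).
assert (1 <= (1 + Rabs (IZR (fst p))) * (1 + Rabs (IZR (snd p)))) by nra.
assert (d <= Cmod (pt tau p) ^ 2) by nra.
pose proof (Cmod_ge_0 (pt tau p)).
apply Rnot_lt_le. intros Hlt. nra.
Qed.

Lemma lattice_summable tau a : 0 < Im tau -> 2 < a ->
  summable nonzero (fun p => Rpower (Cmod (pt tau p)) (- a)).
Proof.
intros Ht Ha. destruct (pt_lower tau Ht) as [d [Hd H]].
set (g := fun n => Rpower (1 + INR n) (- (a / 2))).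
apply summable_le with (g' := fun p => Rpower d (- (a / 2)) *
  (g (Z.abs_nat (fst p)) * g (Z.abs_nat (snd p)))).
- intros p Hp. split; [apply Rlt_le, Rpower_pos|].
  assert (H0 := pt_neq0 tau p Ht Hp). specialize (H p Hp).
  replace (- a) with (INR 2 * - (a / 2)) by (simpl; field).
  rewrite <- Rpower_mult, Rpower_pow by easy.
  assert (H1 : 0 < 1 + Rabs (IZR (fst p))) by (pose proof (Rabs_pos (IZR (fst p))); lra).
  assert (H2 : 0 < 1 + Rabs (IZR (snd p))) by (pose proof (Rabs_pos (IZR (snd p))); lra).
  assert (H3 := Rmult_lt_0_compat _ _ H1 H2).
  unfold g. rewrite !IZR_abs_nat, !Rpower_mult_distr by easy.
  apply Rpower_nonpos_anti; [|easy|lra]. now apply Rmult_lt_0_compat.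
- apply summable_scal; [apply Rlt_le, Rpower_pos|].
  assert (Hg : summable all_Z (fun n => g (Z.abs_nat n))) by (apply summable_Z, summable_nat_pow; lra).
  eapply summable_subset; [|exact (summable_prod _ _ _ _ Hg Hg)].
  easy.
Qed.

(** * Complex derivatives *)

Lemma locally_Cmod (z : C) (P : C -> Prop) :
  locally z P <-> exists d, 0 < d /\ forall w, Cmod (w - z)%C < d -> P w.
Proof.
split.
- intros H. assert (H1 : filterlim (fun w : C => w) (locally z) (locally z)) by apply filterlim_id.
  destruct H as [d Hd]. exists d. split; [apply cond_pos|].
  intros w Hw. apply Hd. apply C_NormedModule_mixin_compat1. exact Hw.
- intros [d [Hd H]].
  assert (H1 := proj1 (clim_iff (locally z) (fun w : C => w) z) (filterlim_id _ _) d Hd).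
  revert H1. apply filter_imp. exact H.
Qed.

(** Caratheodory's form of the derivative; it makes the rules of calculus purely algebraic. *)
Definition cderiv (f : C -> C) (z l : C) : Prop :=
  exists phi : C -> C, (forall w, f w = (f z + phi w * (w - z))%C) /\ phi z = l /\
    filterlim phi (locally z) (locally l).

Lemma cderiv_ex_derive f z l : cderiv f z l -> @ex_derive C_AbsRing C_NormedModule f z.
Proof.
intros [phi [Hf [Hz Hlim]]]. exists l. split.
- apply is_linear_scal_l.
- intros x Hx.
  apply (is_filter_lim_locally_unique (K := C_AbsRing) (V := AbsRing_NormedModule C_AbsRing)) in Hx.
  subst x. intros eps. apply locally_C.
  assert (H := proj1 (clim_iff (locally z) phi l) Hlim eps (cond_pos eps)).
  revert H. apply filter_imp. intros w Hw.
  change (Cmod ((f w - f z) - (w - z) * l)%C <= eps * Cmod (w - z)%C).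
  rewrite Hf. replace (_ - (w - z) * l)%C with ((phi w - l) * (w - z))%C by ring.
  rewrite Cmod_mult. apply Rmult_le_compat_r; [apply Cmod_ge_0|lra].
Qed.

Lemma cderiv_cont f z l : cderiv f z l -> filterlim f (locally z) (locally (f z)).
Proof.
intros [phi [Hf [Hz Hlim]]].
apply (clim_ext_loc (locally z) (fun w => f z + phi w * (w - z))%C).
{ apply filter_forall. intros w. symmetry. apply Hf. }
replace (locally (f z)) with (locally (f z + l * (z - z))%C) by (f_equal; ring).
apply (clim_plus (locally z)); [apply filterlim_const|].
apply (clim_mult (locally z)); [exact Hlim|]. apply (clim_plus (locally z)); [apply filterlim_id|apply filterlim_const].
Qed.

(** The quotients of the differences are the only candidate for [phi]; the quadratic bound makes them converge. *)
Lemma cderiv_of_quadratic f z l K d : 0 < d ->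
  (forall w, Cmod (w - z)%C < d -> Cmod (f w - f z - l * (w - z))%C <= K * Cmod (w - z)%C ^ 2) ->
  cderiv f z l.
Proof.
intros Hd H.
exists (fun w => if Ceq_dec w z then l else ((f w - f z) / (w - z))%C).
assert (Hne : forall w, w <> z -> (w - z)%C <> RtoC 0).
{ intros w Hw H0. apply Hw. apply Cmod_sub_eq0. rewrite H0. apply Cmod_0. }
split; [|split].
- intros w. destruct (Ceq_dec w z) as [->|Hw]; [ring|]. field. now apply Hne.
- destruct (Ceq_dec z z); congruence.
- apply (clim_iff (locally z)). intros eps Heps. apply locally_Cmod.
  assert (HK : 0 < Rabs K + 1) by (pose proof (Rabs_pos K); lra).
  exists (Rmin d (eps / (Rabs K + 1))). split.
  { apply Rmin_pos; [easy|]. now apply Rdiv_lt_0_compat. }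
  intros w Hw. assert (Hw1 := Rlt_le_trans _ _ _ Hw (Rmin_l _ _)).
  assert (Hw2 := Rlt_le_trans _ _ _ Hw (Rmin_r _ _)).
  destruct (Ceq_dec w z) as [->|Hn].
  + replace (l - l)%C with (RtoC 0) by ring. now rewrite Cmod_0.
  + assert (H0 := Hne w Hn). assert (Hp := proj1 (Cmod_gt_0 _) H0).
    replace ((f w - f z) / (w - z) - l)%C with ((f w - f z - l * (w - z)) / (w - z))%C by (field; easy).
    rewrite Cmod_div by easy. apply Rlt_div_l; [easy|].
    eapply Rle_lt_trans; [now apply H|].
    assert (K <= Rabs K) by apply Rle_abs.
    apply Rlt_div_r in Hw2; [|easy]. nra.
Qed.

Lemma cderiv_const c z : cderiv (fun _ => c) z 0.
Proof. exists (fun _ => RtoC 0). split; [intros; ring|]. split; [easy|apply filterlim_const]. Qed.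

Lemma cderiv_id z : cderiv (fun w => w) z 1.
Proof. exists (fun _ => RtoC 1). split; [intros; ring|]. split; [easy|apply filterlim_const]. Qed.

Lemma cderiv_plus f g z l m : cderiv f z l -> cderiv g z m -> cderiv (fun w => f w + g w)%C z (l + m)%C.
Proof.
intros [p [Hf [Hp Hpl]]] [q [Hg [Hq Hql]]]. exists (fun w => p w + q w)%C. split; [|split].
- intros w. rewrite (Hf w), (Hg w). ring.
- now rewrite Hp, Hq.
- apply (clim_plus (locally z)); [easy|easy].
Qed.

Lemma cderiv_mult f g z l m : cderiv f z l -> cderiv g z m ->
  cderiv (fun w => f w * g w)%C z (l * g z + f z * m)%C.
Proof.
intros Hcf Hcg. assert (Hgc := cderiv_cont _ _ _ Hcg).
destruct Hcf as [p [Hf [Hp Hpl]]]. destruct Hcg as [q [Hg [Hq Hql]]].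
exists (fun w => p w * g w + f z * q w)%C. split; [|split].
- intros w. rewrite (Hf w). rewrite (Hg w). ring.
- now rewrite Hp, Hq.
- apply (clim_plus (locally z)); [|].
  + apply (clim_mult (locally z)); [easy|easy].
  + apply (clim_mult (locally z)); [apply filterlim_const|easy].
Qed.

Lemma cderiv_scal c f z l : cderiv f z l -> cderiv (fun w => c * f w)%C z (c * l)%C.
Proof.
intros H. replace (c * l)%C with (0 * f z + c * l)%C by ring.
apply (cderiv_mult (fun _ => c) f); [apply cderiv_const|easy].
Qed.

Lemma cderiv_comp f g z l m : cderiv f (g z) l -> cderiv g z m -> cderiv (fun w => f (g w)) z (l * m)%C.
Proof.
intros [p [Hf [Hp Hpl]]] Hcg. assert (Hgc := cderiv_cont _ _ _ Hcg).
destruct Hcg as [q [Hg [Hq Hql]]].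
exists (fun w => p (g w) * q w)%C. split; [|split].
- intros w. rewrite (Hf (g w)). rewrite (Hg w) at 2. ring.
- now rewrite Hp, Hq.
- apply (clim_mult (locally z)); [|easy]. eapply filterlim_comp; [exact Hgc|exact Hpl].
Qed.

Lemma cderiv_ext_loc f g z l : (exists d, 0 < d /\ forall w, Cmod (w - z)%C < d -> f w = g w) ->
  cderiv f z l -> cderiv g z l.
Proof.
intros [d [Hd He]] [p [Hf [Hp Hpl]]].
assert (Hz : f z = g z).
{ apply He. replace (z - z)%C with (RtoC 0) by ring. now rewrite Cmod_0. }
exists (fun w => if Rlt_dec (Cmod (w - z)%C) d then p w else ((g w - g z) / (w - z))%C).
split; [|split].
- intros w. destruct (Rlt_dec (Cmod (w - z)%C) d) as [Hw|Hw].
  + rewrite <- He, <- Hz by easy. apply Hf.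
  + field. intros H0. apply Hw. now rewrite H0, Cmod_0.
- destruct (Rlt_dec (Cmod (z - z)%C) d) as [Hw|Hw]; [easy|].
  exfalso. apply Hw. replace (z - z)%C with (RtoC 0) by ring. now rewrite Cmod_0.
- apply (clim_ext_loc (locally z) p); [|easy].
  apply locally_Cmod. exists d. split; [easy|]. intros w Hw.
  now destruct (Rlt_dec (Cmod (w - z)%C) d).
Qed.

Lemma Cinv_deriv z : z <> RtoC 0 -> cderiv Cinv z (- / (z * z))%C.
Proof.
intros Hz. assert (Hm := proj1 (Cmod_gt_0 _) Hz).
exists (fun w => if Ceq_dec w 0 then ((/ w - / z) / (w - z))%C else (- / (z * w))%C).
split; [|split].
- intros w. destruct (Ceq_dec w 0) as [->|Hw].
  + assert ((0 - z)%C <> RtoC 0).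
    { intros H. apply Hz. replace z with (- (0 - z))%C by ring. rewrite H. ring. }
    replace ((/ 0 - / z) / (0 - z) * (0 - z))%C with (/ 0 - / z)%C; [ring|].
    unfold Cdiv. rewrite <- Cmult_assoc, Cinv_l by easy. ring.
  + field. now split.
- destruct (Ceq_dec z 0); [easy|]. easy.
- apply (clim_ext_loc (locally z) (fun w => - / (z * w))%C).
  + apply locally_Cmod. exists (Cmod z). split; [easy|]. intros w Hw.
    destruct (Ceq_dec w 0) as [->|]; [|easy].
    exfalso. rewrite Cmod_sub_sym in Hw. replace (z - 0)%C with z in Hw by ring. lra.
  + replace (- / (z * z))%C with ((-1) * / (z * z))%C by ring.
    apply (clim_ext_loc (locally z) (fun w => (-1) * / (z * w))%C); [apply filter_forall; intros; ring|].
    apply (clim_mult (locally z)); [apply filterlim_const|].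
    apply (clim_inv (locally z)); [now apply Cmult_neq_0|].
    apply (clim_mult (locally z)); [apply filterlim_const|apply filterlim_id].
Qed.

Lemma cderiv_inv f z l : f z <> RtoC 0 -> cderiv f z l ->
  cderiv (fun w => / f w)%C z (- / (f z * f z) * l)%C.
Proof. intros H0 H. apply (cderiv_comp Cinv f); [now apply Cinv_deriv|easy]. Qed.

Lemma cderiv_eq f z l l' : l = l' -> cderiv f z l -> cderiv f z l'.
Proof. now intros ->. Qed.

(** Along the segment from [0] to [z] this is the statement for functions of a real variable. *)
Lemma cderiv_zero_const f r z : (forall w, Cmod w < r -> cderiv f w 0) -> Cmod z < r -> f z = f 0.
Proof.
intros H Hz. set (g := fun t : R => f (RtoC t * z)%C).
assert (Hg : g 0 = g 1).
{ apply (eq_is_derive (V := C_R_NormedModule) g 0 1); [|lra].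
  intros t Ht.
  assert (Ht2 : Cmod (RtoC t * z)%C < r).
  { rewrite Cmod_mult, Cmod_R, Rabs_right by lra. pose proof (Cmod_ge_0 z). nra. }
  destruct (H _ Ht2) as [p [Hf [Hp Hpl]]].
  split; [apply is_linear_scal_l|].
  intros x Hx.
  apply (is_filter_lim_locally_unique (K := R_AbsRing) (V := AbsRing_NormedModule R_AbsRing)) in Hx.
  subst x. intros eps. unfold g.
  assert (Hc : filterlim (fun s : R => (RtoC s * z)%C) (locally t) (locally (RtoC t * z)%C)).
  { apply (clim_iff (locally t)). intros e He.
    assert (Hm := Cmod_ge_0 z).
    assert (Hd : 0 < e / (Cmod z + 1)) by (apply Rdiv_lt_0_compat; lra).
    exists (mkposreal _ Hd). intros s Hs.
    replace (RtoC s * z - RtoC t * z)%C with (RtoC (s - t) * z)%C by (rewrite RtoC_minus; ring).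
    rewrite Cmod_mult, Cmod_R. change (Rabs (s - t) < e / (Cmod z + 1)) in Hs.
    apply Rlt_div_r in Hs; [|lra]. pose proof (Rabs_pos (s - t)). nra. }
  assert (Hm := Cmod_ge_0 z).
  assert (Hd : 0 < eps / (Cmod z + 1)) by (apply Rdiv_lt_0_compat; [apply cond_pos|lra]).
  assert (H1 := filterlim_comp _ _ _ _ _ _ _ _ Hc Hpl).
  assert (H2 := proj1 (clim_iff (locally t) _ _) H1 _ Hd).
  revert H2. apply filter_imp. intros s Hs. simpl in Hs.
  rewrite <- Cmod_norm.
  match goal with |- Cmod ?u <= _ => replace u with (RtoC (s - t) * z * p (RtoC s * z))%C end.
  2: { rewrite (Hf (RtoC s * z)%C). rewrite RtoC_minus.
       generalize (p (RtoC s * z)%C) (f (RtoC t * z)%C). intros P a.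
       destruct P, a, z. unfold minus, plus, opp, scal, zero; simpl.
       apply injective_projections; simpl; unfold plus, opp, scal, zero; simpl; unfold mult; simpl; ring. }
  rewrite !Cmod_mult, Cmod_R.
  change (norm (minus s t)) with (Rabs (s - t)).
  replace (p (RtoC s * z) - 0)%C with (p (RtoC s * z))%C in Hs by ring.
  apply Rlt_div_r in Hs; [|lra].
  pose proof (Rabs_pos (s - t)). pose proof (Cmod_ge_0 (p (RtoC s * z)%C)).
  assert (Cmod z * Cmod (p (RtoC s * z)%C) <= eps) by nra. nra. }
unfold g in Hg. replace (RtoC 0 * z)%C with (RtoC 0) in Hg by ring.
replace (RtoC 1 * z)%C with z in Hg by ring. now rewrite Hg.
Qed.

(** * The complex exponential function and power series *)

(** The operations of the module structure on [C] hide from [ring] those of the field. *)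
Ltac cring :=
  try change plus with Cplus; try change opp with Copp; try change scal with Cmult;
  match goal with |- @eq _ ?a ?b => change (@eq C a b) end; simpl; ring.

Lemma Cexp_plus a b : Cexp (a + b)%C = (Cexp a * Cexp b)%C.
Proof.
destruct a as [a1 a2], b as [b1 b2]. unfold Cexp. simpl.
rewrite exp_plus, cos_plus, sin_plus. apply injective_projections; simpl; ring.
Qed.

Lemma Cexp_0 : Cexp 0 = 1.
Proof. unfold Cexp. simpl. rewrite exp_0, cos_0, sin_0. apply injective_projections; simpl; ring. Qed.

Lemma Cmod_Cexp z : Cmod (Cexp z) = exp (Re z).
Proof.
unfold Cexp, Cmod. simpl.
replace (_ + _) with (Rsqr (exp (Re z))).
- apply sqrt_Rsqr, Rlt_le, exp_pos.
- unfold Rsqr. assert (H := sin2_cos2 (Im z)). unfold Rsqr in H.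
  transitivity (exp (Re z) * exp (Re z) * (sin (Im z) * sin (Im z) + cos (Im z) * cos (Im z))).
  + rewrite H. ring.
  + ring.
Qed.

Lemma Cexp_neq0 z : Cexp z <> RtoC 0.
Proof. apply Cmod_gt_0. rewrite Cmod_Cexp. apply exp_pos. Qed.

Lemma Cexp_opp z : Cexp (- z)%C = (/ Cexp z)%C.
Proof.
assert (H := Cexp_neq0 z).
assert (H1 : (Cexp (- z) * Cexp z)%C = 1).
{ rewrite <- Cexp_plus. replace (- z + z)%C with (RtoC 0) by ring. apply Cexp_0. }
replace (Cexp (- z)) with ((Cexp (- z) * Cexp z) * / Cexp z)%C by (field; easy).
rewrite H1. ring.
Qed.

Lemma Cexp_nat z n : Cexp (INR n * z)%C = (Cexp z ^ n)%C.
Proof.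
induction n as [|n IH].
- simpl. replace (0 * z)%C with (RtoC 0) by ring. apply Cexp_0.
- rewrite S_INR, RtoC_plus. replace ((INR n + 1) * z)%C with (z + INR n * z)%C by ring.
  rewrite Cexp_plus, IH. easy.
Qed.

Lemma exp_sub1_bound a : Rabs a <= 1 / 2 -> Rabs (exp a - 1 - a) <= 2 * a ^ 2.
Proof.
intros Ha. apply Rabs_le_between in Ha.
assert (H1 := exp_ineq1_le a). assert (H2 := exp_ineq1_le (- a)).
rewrite exp_Ropp in H2. assert (Hp := exp_pos a).
assert (H3 : (1 + - a) * exp a <= 1).
{ replace 1 with (/ exp a * exp a) at 2 by (field; lra). apply Rmult_le_compat_r; lra. }
rewrite Rabs_right by lra. nra.
Qed.

Lemma sin_abs_le b : Rabs (sin b) <= Rabs b.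
Proof.
destruct (MVT_gen sin 0 b cos) as [c [_ Hc]].
- intros; apply is_derive_Reals, derivable_pt_lim_sin.
- intros; apply derivable_continuous_pt, derivable_pt_sin.
- rewrite sin_0 in Hc. replace (sin b) with (cos c * b) by lra.
  rewrite Rabs_mult. pose proof (COS_bound c). assert (Rabs (cos c) <= 1) by (apply Rabs_le; lra).
  pose proof (Rabs_pos b). nra.
Qed.

Lemma cos_sub1_bound b : Rabs (cos b - 1) <= b ^ 2.
Proof.
assert (H : cos b = 1 - 2 * (sin (b / 2) * sin (b / 2))).
{ replace b with (2 * (b / 2)) at 1 by field. rewrite cos_2a_sin. ring. }
assert (H1 := sin_abs_le (b / 2)).
rewrite H. replace (1 - 2 * (sin (b / 2) * sin (b / 2)) - 1) with (- (2 * (sin (b / 2) * sin (b / 2)))) by ring.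
rewrite Rabs_Ropp, Rabs_right.
- apply Rsqr_le_abs_1 in H1. unfold Rsqr in H1. nra.
- pose proof (Rle_0_sqr (sin (b / 2))). unfold Rsqr in *. lra.
Qed.

Lemma sin_sub_bound b : Rabs b <= 1 -> Rabs (sin b - b) <= b ^ 2.
Proof.
intros Hb. destruct (MVT_gen (fun t => sin t - t) 0 b (fun t => cos t - 1)) as [c [Hc He]].
- intros t _. auto_derive; [easy|ring].
- intros t _. apply derivable_continuous_pt. exists (cos t - 1).
  apply is_derive_Reals. auto_derive; [easy|ring].
- rewrite sin_0 in He. replace (sin b - b) with ((cos c - 1) * b) by lra.
  assert (Hcb : Rabs c <= Rabs b).
  { unfold Rmin, Rmax in Hc. destruct (Rle_dec 0 b); unfold Rabs; destruct (Rcase_abs c), (Rcase_abs b); lra. }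
  rewrite Rabs_mult. assert (H := cos_sub1_bound c).
  assert (Hc2 : c ^ 2 <= b ^ 2). { apply Rsqr_le_abs_1 in Hcb. unfold Rsqr in Hcb. lra. }
  pose proof (Rabs_pos b). pose proof (pow2_ge_0 b). pose proof (Rabs_pos (cos c - 1)). nra.
Qed.

Lemma im_le_Cmod z : Rabs (Im z) <= Cmod z.
Proof. eapply Rle_trans; [apply Rmax_r|apply Rmax_Cmod]. Qed.

Lemma Cexp_sub1_local h : Cmod h < 1 / 2 -> Cmod (Cexp h - 1 - h)%C <= 20 * Cmod h ^ 2.
Proof.
intros Hh. destruct h as [a b].
assert (Ha := re_le_Cmod (a, b)). assert (Hb := im_le_Cmod (a, b)). simpl in Ha, Hb.
set (M := Cmod (a, b)) in *.
assert (HM : 0 <= M) by apply Cmod_ge_0.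
assert (Ha2 : a ^ 2 <= M ^ 2).
{ rewrite <- (pow2_abs a). apply pow_incr. pose proof (Rabs_pos a). lra. }
assert (Hb2 : b ^ 2 <= M ^ 2).
{ rewrite <- (pow2_abs b). apply pow_incr. pose proof (Rabs_pos b). lra. }
assert (H1 := exp_sub1_bound a ltac:(lra)).
assert (H2 := cos_sub1_bound b). assert (H3 := sin_sub_bound b ltac:(lra)).
assert (H4 := sin_abs_le b).
assert (He : Rabs (exp a - 1) <= 2 * M).
{ replace (exp a - 1) with ((exp a - 1 - a) + a) by ring.
  eapply Rle_trans; [apply Rabs_triang|]. nra. }
assert (He2 : exp a <= 2).
{ apply Rabs_le_between in He. lra. }
assert (Hep := exp_pos a).
eapply Rle_trans; [apply Cmod_le_sum|]. simpl.
replace (exp a * cos b + - (1) + - a) with ((exp a - 1 - a) + exp a * (cos b - 1)) by ring.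
replace (exp a * sin b + - 0 + - b) with ((exp a - 1) * sin b + (sin b - b)) by ring.
assert (T1 := Rabs_triang (exp a - 1 - a) (exp a * (cos b - 1))).
assert (T2 := Rabs_triang ((exp a - 1) * sin b) (sin b - b)).
rewrite Rabs_mult, (Rabs_right (exp a)) in T1 by lra. rewrite Rabs_mult in T2.
assert (T3 : exp a * Rabs (cos b - 1) <= 2 * M ^ 2).
{ apply Rmult_le_compat; [lra|apply Rabs_pos|lra|lra]. }
assert (T4 : Rabs (exp a - 1) * Rabs (sin b) <= (2 * M) * M).
{ apply Rmult_le_compat; [apply Rabs_pos|apply Rabs_pos|lra|lra]. }
nra.
Qed.

Lemma Cexp_deriv z : cderiv Cexp z (Cexp z).
Proof.
apply cderiv_of_quadratic with (K := Cmod (Cexp z) * 20) (d := 1 / 2); [lra|].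
intros w Hw.
replace (Cexp w) with (Cexp z * Cexp (w - z))%C by (rewrite <- Cexp_plus; f_equal; ring).
replace (_ - _ - _)%C with (Cexp z * (Cexp (w - z) - 1 - (w - z)))%C by ring.
rewrite Cmod_mult, Rmult_assoc. apply Rmult_le_compat_l; [apply Cmod_ge_0|].
now apply Cexp_sub1_local.
Qed.

Lemma Cexp_cont z : filterlim Cexp (locally z) (locally (Cexp z)).
Proof. eapply cderiv_cont, Cexp_deriv. Qed.

Lemma Cseries_eq a l : is_series a l -> Cseries a = l.
Proof.
intros H. apply (iota_unique (V := C_CompleteNormedModule)); [|exact H].
intros l' H'. exact (clim_unique eventually (sum_n a) l' l H' H).
Qed.

Definition ps (a : nat -> C) (z : C) : C := Cseries (fun n => a n * z ^ n)%C.

(** The coefficients of a power series of radius of convergence at least [R]. *)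
Definition geom_bounded (a : nat -> C) (R : R) : Prop := exists B, forall n, Cmod (a n) * R ^ n <= B.

Lemma square_geom x : 1 < x -> exists K, 0 <= K /\ forall n, (INR n + 1) ^ 2 <= K * x ^ n.
Proof.
intros Hx. set (y := sqrt x).
assert (Hy : 1 < y). { unfold y. rewrite <- sqrt_1. apply sqrt_lt_1; lra. }
assert (Hyy : y * y = x) by (apply sqrt_sqrt; lra).
assert (Hk : 0 < / (y - 1)) by (apply Rinv_0_lt_compat; lra).
exists ((1 + / (y - 1)) ^ 2). split; [apply pow2_ge_0|].
intros n. rewrite <- Hyy, Rpow_mult_distr.
assert (H := poly n (y - 1) ltac:(lra)).
replace (1 + (y - 1)) with y in H by ring.
assert (Hn := pos_INR n).
assert (H1 : 1 <= y ^ n) by (apply pow_R1_Rle; lra).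
assert (H2 : INR n <= / (y - 1) * y ^ n).
{ apply Rmult_le_reg_l with (y - 1); [lra|]. rewrite <- Rmult_assoc, Rinv_r by lra. lra. }
assert (H3 : INR n + 1 <= (1 + / (y - 1)) * y ^ n) by lra.
replace ((1 + / (y - 1)) ^ 2 * (y ^ n * y ^ n)) with (((1 + / (y - 1)) * y ^ n) ^ 2) by ring.
apply pow_incr. lra.
Qed.

(** The factor [(n + 1) ^ 2] leaves room for two derivatives; it is absorbed by the geometric growth from [r]
    to a radius between [r] and [R]. *)
Lemma ps_summable a R r : geom_bounded a R -> 0 <= r < R ->
  summable all_nat (fun n => Cmod (a n) * r ^ n * (INR n + 1) ^ 2).
Proof.
intros [B HB] [Hr HrR].
(* ratios: r < m < R with m = (r + R) / 2 *)
set (m := (r + R) / 2).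
assert (Hm : 0 < m) by (unfold m; lra).
destruct (square_geom (R / m)) as [K [HK0 HK]]. { apply Rlt_div_r; unfold m; lra. }
assert (HB0 : 0 <= B).
{ eapply Rle_trans; [|apply (HB 0%nat)]. simpl. pose proof (Cmod_ge_0 (a 0%nat)). lra. }
apply summable_le with (g' := fun n => (B * K) * (r / m) ^ n).
- intros n _. split.
  { apply Rmult_le_pos; [apply Rmult_le_pos; [apply Cmod_ge_0|now apply pow_le]|apply pow2_ge_0]. }
  specialize (HB n). specialize (HK n).
  assert (Hrn : 0 <= r ^ n) by now apply pow_le.
  unfold Rdiv in *. rewrite Rpow_mult_distr, pow_inv in *.
  assert (Hmn : 0 < m ^ n) by now apply pow_lt.
  apply Rle_trans with (Cmod (a n) * r ^ n * (K * (R ^ n * / m ^ n))).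
  { apply Rmult_le_compat_l; [|easy]. apply Rmult_le_pos; [apply Cmod_ge_0|easy]. }
  replace (Cmod (a n) * r ^ n * (K * (R ^ n * / m ^ n)))
    with ((Cmod (a n) * R ^ n) * (K * (r ^ n * / m ^ n))) by ring.
  replace (B * K * (r ^ n * / m ^ n)) with (B * (K * (r ^ n * / m ^ n))) by ring.
  apply Rmult_le_compat_r; [|easy].
  repeat apply Rmult_le_pos; [easy|easy|]. apply Rlt_le, Rinv_0_lt_compat. easy.
- apply summable_scal; [now apply Rmult_le_pos|].
  assert (H0 : 0 <= r / m) by (apply Rdiv_le_0_compat; lra).
  apply summable_of_series; [intros n; now apply pow_le|].
  apply ex_series_geom. rewrite Rabs_right by lra. apply Rlt_div_l; unfold m; lra.
Qed.

Lemma ps_fsum a R z : geom_bounded a R -> Cmod z < R ->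
  summable all_nat (fun n => Cmod (a n * z ^ n)%C) /\
  is_fsum all_nat (fun n => a n * z ^ n)%C (ps a z) /\
  is_series (fun n => a n * z ^ n)%C (ps a z).
Proof.
intros Ha Hz.
assert (Hs : summable all_nat (fun n => Cmod (a n * z ^ n)%C)).
{ apply summable_le with (2 := ps_summable a R (Cmod z) Ha (conj (Cmod_ge_0 z) Hz)).
  intros n _. split; [apply Cmod_ge_0|]. rewrite Cmod_mult, Cmod_pow.
  assert (0 <= Cmod (a n) * Cmod z ^ n) by (apply Rmult_le_pos; [apply Cmod_ge_0|apply pow_le, Cmod_ge_0]).
  pose proof (pos_INR n). assert (1 <= (INR n + 1) ^ 2) by nra. nra. }
destruct (fsum_exists all_nat (fun n => a n * z ^ n)%C _ Hs) as [l Hl]; [intros; lra|].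
assert (Hl2 := fsum_is_series _ _ Hl).
assert (He : ps a z = l) by now apply Cseries_eq.
rewrite He. easy.
Qed.

Lemma ps_0 a : ps a 0 = a 0%nat.
Proof.
apply Cseries_eq. apply is_series_decr_1.
apply (filterlim_ext (fun _ => RtoC 0)).
- intros n. symmetry. induction n as [|n IH].
  + rewrite sum_O. simpl. ring.
  + rewrite sum_Sn, IH. change plus with Cplus. simpl. ring.
- match goal with |- filterlim _ _ (locally ?u) => replace u with (RtoC 0) end.
  + apply filterlim_const.
  + change plus with Cplus. change opp with Copp. simpl. ring.
Qed.

(** The Taylor remainder of the power function is at most [n^2 r^(n-1) |w - z|^2]. Both sides are multiplied
    by [r], so that the exponent [n - 1] does not occur. *)
Lemma pow_taylor r w z n : 0 <= r -> Cmod w <= r -> Cmod z <= r ->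
  Cmod (w ^ S n - z ^ S n - INR (S n) * z ^ n * (w - z))%C * r <=
    INR n ^ 2 * r ^ n * Cmod (w - z)%C ^ 2.
Proof.
intros Hr Hw Hz. induction n as [|n IH].
- replace (w ^ 1 - z ^ 1 - INR 1 * z ^ 0 * (w - z))%C with (RtoC 0) by (simpl; ring).
  rewrite Cmod_0. simpl. lra.
- set (E := (w ^ S n - z ^ S n - INR (S n) * z ^ n * (w - z))%C) in *.
  replace (w ^ S (S n) - z ^ S (S n) - INR (S (S n)) * z ^ S n * (w - z))%C
    with (w * E + INR (S n) * z ^ n * ((w - z) * (w - z)))%C.
  2: { unfold E. rewrite (S_INR (S n)), RtoC_plus. simpl Cpow. ring. }
  set (h := Cmod (w - z)%C) in *. assert (Hh : 0 <= h) by apply Cmod_ge_0.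
  assert (Hn := pos_INR n). assert (Hrn : 0 <= r ^ n) by now apply pow_le.
  assert (H1 : Cmod (w * E + INR (S n) * z ^ n * ((w - z) * (w - z)))%C <= r * Cmod E + INR (S n) * r ^ n * h ^ 2).
  { eapply Rle_trans; [apply Cmod_triangle|]. rewrite !Cmod_mult, Cmod_pow, Cmod_R. fold h.
    rewrite (Rabs_right (INR (S n))) by (apply Rle_ge, pos_INR).
    apply Rplus_le_compat.
    - apply Rmult_le_compat_r; [apply Cmod_ge_0|easy].
    - replace (h ^ 2) with (h * h) by ring. apply Rmult_le_compat_r; [nra|].
      apply Rmult_le_compat_l; [apply pos_INR|]. apply pow_incr. split; [apply Cmod_ge_0|easy]. }
  apply Rle_trans with ((r * Cmod E + INR (S n) * r ^ n * h ^ 2) * r).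
  { now apply Rmult_le_compat_r. }
  rewrite S_INR in *. simpl (r ^ S n).
  assert (H2 : r * (Cmod E * r) <= r * (INR n ^ 2 * r ^ n * h ^ 2)) by now apply Rmult_le_compat_l.
  assert (H3 : 0 <= r * r ^ n * h ^ 2) by (repeat apply Rmult_le_pos; nra).
  nra.
Qed.

Lemma Cmod_fsum_le {I} (A : I -> Prop) (f : I -> C) l B : is_fsum A f l ->
  (forall L, NoDup L -> List.Forall A L -> lsum (fun i => Cmod (f i)) L <= B) -> Cmod l <= B.
Proof.
intros Hl HB. replace l with (l - 0)%C by ring.
apply (fam_closed (op := Cplus) (e := RtoC 0) A f); [easy|].
exists nil. split; [constructor|]. intros L HN HA _.
replace (_ - 0)%C with (lfold Cplus (RtoC 0) f L) by ring.
eapply Rle_trans; [apply Cmod_lsum_le|auto].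
Qed.

Lemma geom_bounded_derivative a R R' : 0 < R' < R -> geom_bounded a R ->
  geom_bounded (fun n => INR (S n) * a (S n))%C R'.
Proof.
intros HR Ha. destruct (ps_summable a R R' Ha) as [_ [B HB]]; [lra|].
exists (B / R'). intros n.
assert (H1 : Cmod (a (S n)) * R' ^ S n * (INR (S n) + 1) ^ 2 + 0 <= B).
{ apply (HB [S n]); [repeat constructor; easy|repeat constructor]. }
rewrite Rplus_0_r in H1.
rewrite Cmod_mult, Cmod_R, Rabs_right by (apply Rle_ge, pos_INR).
apply (Rle_div_r _ B R'); [lra|]. eapply Rle_trans; [|exact H1].
replace (INR (S n) * Cmod (a (S n)) * R' ^ n * R') with (Cmod (a (S n)) * R' ^ S n * INR (S n)) by (simpl; ring).
apply Rmult_le_compat_l.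
- apply Rmult_le_pos; [apply Cmod_ge_0|apply pow_le; lra].
- pose proof (pos_INR (S n)). nra.
Qed.

(** The Taylor remainders of the terms add up to at most a multiple of [|w - z|^2]. *)
Lemma ps_deriv a R z : geom_bounded a R -> Cmod z < R ->
  cderiv (ps a) z (ps (fun n => INR (S n) * a (S n))%C z).
Proof.
intros Ha Hz. assert (Hz0 := Cmod_ge_0 z).
set (r := (Cmod z + R) / 2).
assert (Hr : 0 < r) by (unfold r; lra).
assert (HrR : r < R) by (unfold r; lra).
destruct (ps_summable a R r Ha) as [_ [B HB]]; [lra|].
assert (Ha' : geom_bounded (fun n => INR (S n) * a (S n))%C r) by (apply (geom_bounded_derivative a R); [lra|easy]).
apply cderiv_of_quadratic with (K := B / (r * r)) (d := r - Cmod z); [unfold r; lra|].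
intros w Hw.
assert (Hwr : Cmod w <= r).
{ replace w with ((w - z) + z)%C by ring. eapply Rle_trans; [apply Cmod_triangle|]. lra. }
destruct (ps_fsum a R w Ha ltac:(lra)) as [_ [_ Sw]].
destruct (ps_fsum a R z Ha ltac:(lra)) as [_ [_ Sz]].
destruct (ps_fsum _ r z Ha' ltac:(unfold r; lra)) as [_ [_ Sd]].
set (u := fun n => (a (S n) * (w ^ S n - z ^ S n - INR (S n) * z ^ n * (w - z)))%C).
assert (Su : is_series u (ps a w - ps a z - ps (fun n => INR (S n) * a (S n))%C z * (w - z))%C).
{ assert (S1 := is_series_minus _ _ _ _ Sw Sz).
  assert (S2 : is_series (fun n => plus (a (S n) * w ^ S n)%C (opp (a (S n) * z ^ S n)%C)) (ps a w - ps a z)%C).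
  { apply (is_series_incr_1 (fun n => plus (a n * w ^ n)%C (opp (a n * z ^ n)%C))).
    match goal with |- is_series _ ?v => replace v with (plus (ps a w) (opp (ps a z))) end; [exact S1|]. simpl pow. cring. }
  assert (S3 := is_series_minus _ _ _ _ S2 (is_series_scal (w - z)%C _ _ Sd)).
  replace (_ - _ * (w - z))%C with (plus (ps a w - ps a z)%C
    (opp (scal (w - z)%C (ps (fun n => INR (S n) * a (S n))%C z)))).
  - revert S3. apply is_series_ext. intros n. unfold u.
    cring.
  - cring. }
set (h := Cmod (w - z)%C) in *. assert (Hh : 0 <= h) by apply Cmod_ge_0.
assert (Hbound : forall n, Cmod (u n) <= (h ^ 2 / (r * r)) * (Cmod (a (S n)) * r ^ S n * (INR (S n) + 1) ^ 2)).
{ intros n. unfold u. rewrite Cmod_mult.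
  assert (H := pow_taylor r w z n (Rlt_le _ _ Hr) Hwr ltac:(unfold r; lra)). fold h in H.
  apply Rle_trans with (Cmod (a (S n)) * (INR n ^ 2 * r ^ n * h ^ 2 / r)).
  { apply Rmult_le_compat_l; [apply Cmod_ge_0|]. apply Rle_div_r; lra. }
  replace (h ^ 2 / (r * r) * (Cmod (a (S n)) * r ^ S n * (INR (S n) + 1) ^ 2))
    with (Cmod (a (S n)) * ((INR (S n) + 1) ^ 2 * r ^ n * h ^ 2 / r)) by (simpl; field; lra).
  apply Rmult_le_compat_l; [apply Cmod_ge_0|].
  apply Rmult_le_compat_r; [apply Rlt_le, Rinv_0_lt_compat, Hr|].
  apply Rmult_le_compat_r; [apply pow2_ge_0|].
  apply Rmult_le_compat_r; [apply pow_le; lra|].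
  rewrite S_INR. pose proof (pos_INR n). nra. }
set (G := fun n => (h ^ 2 / (r * r)) * (Cmod (a (S n)) * r ^ S n * (INR (S n) + 1) ^ 2)) in *.
assert (Hc : 0 <= h ^ 2 / (r * r)) by (apply Rdiv_le_0_compat; nra).
assert (HG : forall L, NoDup L -> lsum G L <= B / (r * r) * h ^ 2).
{ intros L HL. unfold G. rewrite lsum_scal.
  replace (B / (r * r) * h ^ 2) with (h ^ 2 / (r * r) * B) by (field; lra).
  apply Rmult_le_compat_l; [easy|].
  rewrite <- (lsum_map (fun n => Cmod (a n) * r ^ n * (INR n + 1) ^ 2) S). apply HB.
  - apply (NoDup_map_inj S all_nat); [intros; congruence|apply Forall_forall; easy|easy].
  - apply Forall_forall. easy. }
assert (Fu : is_fsum all_nat u (ps a w - ps a z - ps (fun n => INR (S n) * a (S n))%C z * (w - z))%C).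
{ apply series_is_fsum; [|exact Su].
  split; [intros; apply Cmod_ge_0|]. exists (B / (r * r) * h ^ 2). intros L HL _.
  eapply Rle_trans; [|exact (HG L HL)]. apply lsum_le. intros; apply Hbound. }
apply (Cmod_fsum_le all_nat u _ _ Fu). intros L HL _.
eapply Rle_trans; [|exact (HG L HL)]. apply lsum_le. intros; apply Hbound.
Qed.

Lemma ps_ext a b z : (forall n, a n = b n) -> ps a z = ps b z.
Proof.
intros H. unfold ps. f_equal. apply FunctionalExtensionality.functional_extensionality.
intros n. now rewrite H.
Qed.

Definition inv_fact (n : nat) : C := RtoC (/ INR (fact n)).

Lemma exp_lsum_le a L : 0 <= a -> NoDup L -> lsum (fun n => / INR (fact n) * a ^ n) L <= exp a.
Proof.
intros Ha HL. set (g := fun n => / INR (fact n) * a ^ n).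
assert (Hp : forall k, 0 <= g k).
{ intros k. apply Rmult_le_pos; [apply Rlt_le, Rinv_0_lt_compat, INR_fact_lt_0|now apply pow_le]. }
eapply Rle_trans; [now apply lsum_le_prefix|]. rewrite lsum_seq_sum_n.
assert (He : is_series g (exp a)).
{ generalize (is_exp_Reals a). apply is_series_ext. intros k.
  change scal with Rmult. change pow_n with pow. unfold g. rewrite Rmult_comm. easy. }
apply is_lim_seq_incr_compare with (u := sum_n g); [exact He|].
intros k. rewrite sum_Sn. change plus with Rplus. specialize (Hp (S k)). lra.
Qed.

Lemma inv_fact_bound R : 0 <= R -> geom_bounded inv_fact R.
Proof.
intros HR. exists (exp R). intros n. unfold inv_fact.
rewrite Cmod_R, Rabs_right by (apply Rle_ge, Rlt_le, Rinv_0_lt_compat, INR_fact_lt_0).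
eapply Rle_trans; [|apply (exp_lsum_le R [n]); [easy|repeat constructor; easy]].
unfold lsum. simpl. lra.
Qed.

Lemma fact_ratio n : INR (S n) * / INR (fact (S n)) = / INR (fact n).
Proof.
assert (H := INR_fact_neq_0 n). assert (INR (S n) <> 0) by now apply not_0_INR.
rewrite fact_simpl, mult_INR. field. now split.
Qed.

Lemma Cexp_series z : ps inv_fact z = Cexp z.
Proof.
set (f := fun w => (ps inv_fact w * Cexp (- w))%C).
assert (Hf : f z = f 0).
{ apply (cderiv_zero_const f (Cmod z + 1)); [|lra]. intros w _. unfold f.
  eapply cderiv_eq; [|apply cderiv_mult].
  3: { apply (cderiv_comp Cexp (fun w => - w)%C); [apply Cexp_deriv|].
       eapply cderiv_ext_loc with (fun w => (-1) * w)%C.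
       - exists 1. split; [lra|]. intros; ring.
       - apply cderiv_scal, cderiv_id. }
  2: { apply (ps_deriv inv_fact (Cmod w + 1)); [apply inv_fact_bound; pose proof (Cmod_ge_0 w); lra|lra]. }
  rewrite (ps_ext _ inv_fact).
  - ring.
  - intros n. unfold inv_fact. rewrite <- RtoC_mult. f_equal. apply fact_ratio. }
unfold f in Hf. rewrite ps_0 in Hf. replace (- 0)%C with (RtoC 0) in Hf by ring.
rewrite Cexp_0, Cexp_opp in Hf. unfold inv_fact in Hf at 2. simpl in Hf.
assert (H0 := Cexp_neq0 z).
replace (ps inv_fact z) with (ps inv_fact z * / Cexp z * Cexp z)%C by (field; easy).
rewrite Hf, Rinv_1. ring.
Qed.

(** * The product formula for the hyperbolic sine *)

(** The entire function [(exp x - 1) / x]. It replaces [sinh] wherever the value at the zero [x = 0] matters,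
    by [sinh h = h exp (- h) E (2 h)]. *)
Definition expm1_over (x : C) : C := ps (fun n => inv_fact (S n)) x.

Lemma expm1_bound R : 0 <= R -> geom_bounded (fun n => inv_fact (S n)) R.
Proof.
intros HR. destruct (inv_fact_bound (R + 1)) as [B HB]; [lra|].
exists B. intros n. eapply Rle_trans; [|exact (HB (S n))].
apply Rmult_le_compat_l; [apply Cmod_ge_0|].
apply Rle_trans with ((R + 1) ^ n); [apply pow_incr; lra|]. simpl.
assert (0 <= (R + 1) ^ n) by (apply pow_le; lra). nra.
Qed.

Lemma expm1_over_eq x : (x * expm1_over x)%C = (Cexp x - 1)%C.
Proof.
assert (Hx := Cmod_ge_0 x).
destruct (ps_fsum _ (Cmod x + 1) x (expm1_bound (Cmod x + 1) ltac:(lra)) ltac:(lra)) as [_ [_ H1]].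
destruct (ps_fsum _ (Cmod x + 1) x (inv_fact_bound (Cmod x + 1) ltac:(lra)) ltac:(lra)) as [_ [_ H2]].
rewrite Cexp_series in H2.
assert (H3 : is_series (fun n => inv_fact (S n) * x ^ S n)%C (Cexp x - 1)%C).
{ apply (is_series_incr_1 (fun n => inv_fact n * x ^ n)%C).
  match goal with |- is_series _ ?v => replace v with (Cexp x) end; [exact H2|].
  unfold inv_fact. change (INR (fact 0)) with 1. rewrite Rinv_1. cring. }
assert (H4 := is_series_scal x _ _ H1).
apply (is_series_ext _ (fun n => inv_fact (S n) * x ^ S n)%C) in H4.
- exact (clim_unique eventually _ _ _ H4 H3).
- intros n. cring.
Qed.

Lemma expm1_over_0 : expm1_over 0 = 1.
Proof. unfold expm1_over. rewrite ps_0. unfold inv_fact. simpl. now rewrite Rinv_1. Qed.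

Lemma expm1_over_deriv z : exists l, cderiv expm1_over z l.
Proof.
eexists. apply (ps_deriv _ (Cmod z + 1)); [apply expm1_bound; pose proof (Cmod_ge_0 z); lra|lra].
Qed.

Lemma expm1_over_cont z : filterlim expm1_over (locally z) (locally (expm1_over z)).
Proof. destruct (expm1_over_deriv z) as [l Hl]. eapply cderiv_cont; exact Hl. Qed.

Lemma expm1_over_mod x : Cmod (expm1_over x) <= exp (Cmod x).
Proof.
assert (Hx := Cmod_ge_0 x).
destruct (ps_fsum _ (Cmod x + 1) x (expm1_bound (Cmod x + 1) ltac:(lra)) ltac:(lra)) as [_ [H1 _]].
apply (Cmod_fsum_le _ _ _ _ H1). intros L HL _.
apply Rle_trans with (lsum (fun n => / INR (fact n) * Cmod x ^ n) L); [|now apply exp_lsum_le].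
apply lsum_le. intros n _. rewrite Cmod_mult, Cmod_pow.
apply Rmult_le_compat_r; [now apply pow_le|]. unfold inv_fact.
rewrite Cmod_R, Rabs_right by (apply Rle_ge, Rlt_le, Rinv_0_lt_compat, INR_fact_lt_0).
apply Rinv_le_contravar; [apply INR_fact_lt_0|]. apply le_INR. simpl. pose proof (lt_O_fact n). lia.
Qed.

Lemma Csinh_expm1 h : Csinh h = (h * (Cexp (- h) * expm1_over (2 * h)))%C.
Proof.
assert (H := expm1_over_eq (2 * h)). unfold Csinh.
assert (E : Cexp (2 * h) = (Cexp h * Cexp h)%C) by (rewrite <- Cexp_plus; f_equal; ring).
rewrite E in H. rewrite Cexp_opp. assert (H0 := Cexp_neq0 h).
replace (h * (/ Cexp h * expm1_over (2 * h)))%C with (/ Cexp h * (2 * h * expm1_over (2 * h)) / 2)%C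
  by (field; easy).
rewrite H. field. easy.
Qed.

Lemma Csinh_bound r h : Cmod h <= r -> Cmod (Csinh h) <= exp (3 * r) * Cmod h.
Proof.
intros Hh. rewrite Csinh_expm1, !Cmod_mult, Cmod_Cexp, Rmult_comm.
apply Rmult_le_compat_r; [apply Cmod_ge_0|].
assert (H0 := expm1_over_mod (2 * h)).
rewrite Cmod_mult, Cmod_R, Rabs_right in H0 by lra.
assert (H1 : Re (- h)%C <= Cmod h).
{ rewrite <- Cmod_opp. eapply Rle_trans; [apply Rle_abs|apply re_le_Cmod]. }
replace (3 * r) with (r + 2 * r) by ring. rewrite exp_plus.
apply Rmult_le_compat; [apply Rlt_le, exp_pos|apply Cmod_ge_0| |].
- apply exp_mono. lra.
- eapply Rle_trans; [exact H0|]. apply exp_mono. lra.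
Qed.

Lemma Csinh_double y : (Csinh (2 * y) * Csinh (2 * y))%C =
  (4 * (Csinh y * Csinh y) * (1 + Csinh y * Csinh y))%C.
Proof.
unfold Csinh. replace (- (2 * y))%C with (- y + - y)%C by ring.
replace (2 * y)%C with (y + y)%C by ring. rewrite !Cexp_plus, !Cexp_opp.
assert (H0 := Cexp_neq0 y). field. easy.
Qed.

Lemma Csinh_quad y : Csinh (4 * y) = (2 * Csinh (2 * y) * (1 + 2 * (Csinh y * Csinh y)))%C.
Proof.
unfold Csinh. replace (- (4 * y))%C with (- y + - y + (- y + - y))%C by ring.
replace (4 * y)%C with (y + y + (y + y))%C by ring.
replace (- (2 * y))%C with (- y + - y)%C by ring.
replace (2 * y)%C with (y + y)%C by ring. rewrite !Cexp_plus, !Cexp_opp.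
assert (H0 := Cexp_neq0 y). field. easy.
Qed.

(** The angles [theta] and [pi / 2 - theta] of the finite product formula are grouped in pairs. *)
Lemma lprod_reflect (g : nat -> C) M : (1 <= M)%nat ->
  lfold Cmult (RtoC 1) g (seq 1 (2 * M - 1)) =
  (g M * lfold Cmult (RtoC 1) (fun k => g k * g (2 * M - k)%nat) (seq 1 (M - 1)))%C.
Proof.
intros HM. rewrite (lfold_op Cmult_monoid).
rewrite <- (lfold_map Cmult (RtoC 1) g (fun k => (2 * M - k)%nat)).
rewrite <- (lfold_app Cmult_monoid).
change (g M * ?u)%C with (Cmult (g M) u).
change (Cmult (g M) (lfold Cmult (RtoC 1) g ?L)) with (lfold Cmult (RtoC 1) g (M :: L)).
apply (lfold_perm Cmult_monoid). apply NoDup_Permutation.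
- apply seq_NoDup.
- constructor.
  + rewrite in_app_iff, in_map_iff, in_seq. intros [H|[k [Hk H]]]; [lia|]. apply in_seq in H. lia.
  + apply NoDup_app.
    * apply seq_NoDup.
    * apply (NoDup_map_inj _ (fun k => (k < M)%nat)); [intros; lia| |apply seq_NoDup].
      apply Forall_forall. intros k Hk. apply in_seq in Hk. lia.
    * intros a Ha Hb. apply in_seq in Ha. apply in_map_iff in Hb. destruct Hb as [k [Hk H]].
      apply in_seq in H. lia.
- intros k. simpl. rewrite in_app_iff, in_map_iff, !in_seq. split.
  + intros Hk. destruct (Nat.lt_trichotomy k M) as [H|[H|H]]; [right; left; lia|left; lia|].
    right; right. exists (2 * M - k)%nat. rewrite in_seq. lia.
  + intros [H|[H|[j [Hj H]]]]; [lia|lia|]. apply in_seq in H. lia.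
Qed.

Definition half_angle (M k : nat) : R := INR k * PI / (2 * INR M).

Lemma half_angle_sin_pos M k : (1 <= k <= M)%nat -> 0 < sin (half_angle M k).
Proof.
intros Hk. assert (0 < INR k) by (apply lt_0_INR; lia). assert (0 < INR M) by (apply lt_0_INR; lia).
assert (INR k <= INR M) by (apply le_INR; lia). assert (Hpi := PI_RGT_0).
apply sin_gt_0; unfold half_angle.
- apply Rdiv_lt_0_compat; nra.
- apply Rlt_div_l; nra.
Qed.

(** Euler's finite product, by induction for [M] a power of two. The duplication step rests on
    [1 + A (1 + A) / (B (1 - B)) = (1 + A / B) (1 + A / (1 - B))] with [A = sinh^2 y], [B = sin^2 theta]. *)
Lemma Csinh_finite_product j y : let M := (2 ^ j)%nat in
  Csinh (2 * INR M * y)%C = (INR M * Csinh (2 * y) *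
    lfold Cmult (RtoC 1) (fun k => 1 + Csinh y * Csinh y / RtoC (sin (half_angle M k) ^ 2)) (seq 1 (M - 1)))%C.
Proof.
revert y. induction j as [|j IH]; intros y; cbv zeta in *.
- simpl. unfold lfold. simpl. replace (2 * 1 * y)%C with (2 * y)%C by ring. ring.
- set (M := (2 ^ j)%nat) in *.
  assert (HM : (1 <= M)%nat) by (unfold M; apply Nat.neq_0_lt_0, Nat.pow_nonzero; lia).
  replace (2 ^ S j)%nat with (2 * M)%nat by reflexivity.
  rewrite lprod_reflect by easy.
  assert (HM0 : 0 < INR M) by (apply lt_0_INR; lia).
  rewrite mult_INR. change (INR 2) with 2.
  replace (2 * RtoC (2 * INR M) * y)%C with (2 * INR M * (2 * y))%C by (rewrite RtoC_mult; ring).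
  rewrite IH. replace (2 * (2 * y))%C with (4 * y)%C by ring. rewrite Csinh_quad.
  set (A := (Csinh y * Csinh y)%C).
  assert (Hmid : RtoC (sin (half_angle (2 * M) M) ^ 2) = RtoC (1 / 2)).
  { f_equal. unfold half_angle. rewrite mult_INR. change (INR 2) with 2.
    replace (INR M * PI / (2 * (2 * INR M))) with (PI / 4) by (field; lra).
    rewrite sin_PI4. assert (H := Rlt_sqrt2_0). unfold Rdiv. rewrite Rpow_mult_distr, pow_inv.
    rewrite pow2_sqrt by lra. field. }
  rewrite Hmid.
  rewrite (lfold_ext (I := nat) (op := Cmult) (e := RtoC 1)
    (fun k => 1 + Csinh (2 * y) * Csinh (2 * y) / RtoC (sin (half_angle M k) ^ 2))%C
    (fun k => (1 + A / RtoC (sin (half_angle (2 * M) k) ^ 2)) *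
              (1 + A / RtoC (sin (half_angle (2 * M) (2 * M - k)) ^ 2)))%C).
  + rewrite !RtoC_mult. replace (RtoC (1 / 2)) with (/ 2)%C by (rewrite <- RtoC_inv by lra; f_equal; field).
    field. 
  + intros k Hk. apply in_seq in Hk.
    assert (Hk0 : 0 < INR k) by (apply lt_0_INR; lia).
    rewrite Csinh_double. fold A.
    set (th := half_angle (2 * M) k).
    assert (E1 : half_angle M k = 2 * th).
    { unfold th, half_angle. rewrite mult_INR. change (INR 2) with 2. field. lra. }
    assert (E2 : half_angle (2 * M) (2 * M - k) = PI / 2 - th).
    { unfold th, half_angle. rewrite minus_INR, mult_INR by lia. change (INR 2) with 2. field. lra. }
    rewrite E1, E2, sin_shift, sin_2a.
    assert (Hs : 0 < sin th) by (apply half_angle_sin_pos; lia).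
    assert (Hc : 0 < cos th).
    { rewrite <- sin_shift, <- E2. apply half_angle_sin_pos; lia. }
    assert (Hsc : (RtoC (sin th) * RtoC (sin th) + RtoC (cos th) * RtoC (cos th))%C = RtoC 1).
    { rewrite <- !RtoC_mult, <- RtoC_plus. f_equal. assert (H := sin2_cos2 th). unfold Rsqr in H. exact H. }
    simpl pow. rewrite !RtoC_mult.
    assert (Hs' : RtoC (sin th) <> RtoC 0) by (intros H; apply RtoC_inj in H; lra).
    assert (Hc' : RtoC (cos th) <> RtoC 0) by (intros H; apply RtoC_inj in H; lra).
    set (s := RtoC (sin th)) in *. set (c := RtoC (cos th)) in *.
    transitivity (1 + 4 * A * ((s * s + c * c) + A) / (2 * s * c * (2 * s * c * 1)))%C.
    { now rewrite Hsc. }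
    field. now split.
Qed.

Lemma clim_div_INR (x : C) : filterlim (fun n => x / INR n)%C eventually (locally (RtoC 0)).
Proof.
apply (clim_iff eventually). intros eps Heps.
assert (Hx := Cmod_ge_0 x).
destruct (archimed_cor1 (eps / (Cmod x + 1))) as [N [HN HN0]]; [apply Rdiv_lt_0_compat; lra|].
exists N. intros n Hn.
assert (Hn0 : 0 < INR N) by now apply lt_0_INR.
assert (HNn : INR N <= INR n) by now apply le_INR.
replace (x / INR n - 0)%C with (x * / INR n)%C by (unfold Cdiv; ring).
rewrite Cmod_mult, Cmod_inv, Cmod_R, Rabs_right by (try (intros H; apply RtoC_inj in H); lra).
assert (Hi : / INR n <= / INR N) by (apply Rinv_le_contravar; lra).
assert (Hi0 : 0 < / INR n) by (apply Rinv_0_lt_compat; lra).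
apply Rle_lt_trans with ((Cmod x + 1) * / INR N); [nra|].
rewrite Rmult_comm. apply (Rlt_div_r _ _ (Cmod x + 1)); lra.
Qed.

Lemma pow2_filter : filterlim (fun j => (2 ^ j)%nat) eventually eventually.
Proof. apply eventually_subseq. intros n. simpl. pose proof (Nat.pow_nonzero 2 n). lia. Qed.

(** This is [sinh' 0 = 1]. For [x] imaginary it gives the limits of the sines in the finite products. *)
Lemma INR_Csinh_div_lim (x : C) :
  filterlim (fun n => INR n * Csinh (x / INR n))%C eventually (locally x).
Proof.
apply (clim_ext_loc eventually (fun n => x * (Cexp (- (x / INR n)) * expm1_over (2 * (x / INR n))))%C).
- exists 1%nat. intros n Hn. rewrite Csinh_expm1.
  assert (RtoC (INR n) <> RtoC 0). { intros H. apply RtoC_inj in H. apply INR_eq with (m := 0%nat) in H. lia. }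
  field. easy.
- assert (H := clim_div_INR x).
  replace (locally x) with (locally (x * (Cexp (- 0) * expm1_over (2 * 0)))%C).
  2: { f_equal. replace (- 0)%C with (RtoC 0) by ring. replace (2 * 0)%C with (RtoC 0) by ring.
       rewrite Cexp_0, expm1_over_0. ring. }
  apply (clim_mult eventually); [apply filterlim_const|]. apply (clim_mult eventually).
  + apply (filterlim_comp _ _ _ (fun n => - (x / INR n))%C Cexp _ (locally (- 0)%C)); [|apply Cexp_cont].
    apply (clim_ext_loc eventually (fun n => (-1) * (x / INR n))%C); [apply filter_forall; intros; ring|].
    replace (- 0)%C with ((-1) * 0)%C by ring.
    apply (clim_mult eventually); [apply filterlim_const|exact H].
  + apply (filterlim_comp _ _ _ (fun n => 2 * (x / INR n))%C expm1_over _ (locally (2 * 0)%C)); [|apply expm1_over_cont].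
    apply (clim_mult eventually); [apply filterlim_const|exact H].
Qed.

Lemma sin_lower t : 0 <= t <= PI / 2 -> t / 3 <= sin t.
Proof.
intros Ht. assert (H4 := PI_4).
destruct (pre_sin_bound t 0) as [H _]; [lra|lra|].
unfold sin_approx, sin_term in H. simpl in H. nra.
Qed.

Lemma Csinh_imag t : Csinh (Ci * RtoC t) = (Ci * RtoC (sin t))%C.
Proof.
unfold Csinh. rewrite Cexp_opp.
assert (E : Cexp (Ci * t) = (RtoC (cos t) + Ci * RtoC (sin t))%C).
{ unfold Cexp. simpl. replace (0 * t - 1 * 0) with 0 by ring. replace (0 * 0 + 1 * t) with t by ring.
  rewrite exp_0. apply injective_projections; simpl; ring. }
assert (E' : (/ Cexp (Ci * t))%C = (RtoC (cos t) - Ci * RtoC (sin t))%C).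
{ rewrite <- Cexp_opp. unfold Cexp. simpl.
  replace (- (0 * t - 1 * 0)) with 0 by ring. replace (- (0 * 0 + 1 * t)) with (- t) by ring.
  rewrite exp_0, cos_neg, sin_neg. apply injective_projections; simpl; ring. }
rewrite E', E. field.
Qed.

Definition inv_square (k : nat) : R := / ((INR k + 1) * (INR k + 1)).

Lemma inv_square_summable : summable all_nat inv_square.
Proof.
apply summable_ext with (2 := summable_nat_pow 2 ltac:(lra)).
intros k _. assert (H := pos_INR k). unfold inv_square.
rewrite Rpower_m2 by lra. f_equal. ring.
Qed.

Lemma inv_square_pos k : 0 < inv_square k.
Proof. apply Rinv_0_lt_compat. pose proof (pos_INR k). nra. Qed.

Definition sinh_factor (x : C) (k : nat) : C := (1 + x * x * RtoC (inv_square k / (PI * PI)))%C.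

(** Euler's product as limit of the finite products: with [x = 2 M y] their factors tend to the factors of the
    infinite product, and they are dominated uniformly in [M], because [sin t >= t / 3]. *)
Lemma Csinh_fprod x : x <> RtoC 0 -> is_fprod all_nat (sinh_factor x) (Csinh x / x)%C.
Proof.
intros Hx. assert (Hpi := PI_RGT_0). assert (Hx0 := Cmod_ge_0 x).
assert (Hpi0 : RtoC PI <> RtoC 0) by (intros H; apply RtoC_inj in H; lra).
(* the factors of the finite product of order j, completed by 1 *)
set (f := fun (j k : nat) => if Nat.ltb (S k) (2 ^ j) then
   (1 + Csinh (x / INR (2 * 2 ^ j)) * Csinh (x / INR (2 * 2 ^ j)) / RtoC (sin (half_angle (2 ^ j) (S k)) ^ 2))%C
   else RtoC 1).
set (l := fun j => (Csinh x / (INR (2 ^ j) * Csinh (x / INR (2 ^ j))))%C).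
set (K := (exp (3 * Cmod x) * Cmod x) ^ 2).
assert (HM0 : forall j, 0 < INR (2 ^ j)).
{ intros j. apply lt_0_INR, Nat.neq_0_lt_0, Nat.pow_nonzero. lia. }
assert (Hg : summable all_nat (fun k => K * inv_square k)).
{ apply summable_scal; [apply pow2_ge_0|apply inv_square_summable]. }
assert (Hf : forall j k, Cmod (f j k - 1)%C <= K * inv_square k).
{ intros j k. unfold f. assert (HK := inv_square_pos k).
  destruct (Nat.ltb_spec (S k) (2 ^ j)) as [Hk|Hk].
  2: { replace (1 - 1)%C with (RtoC 0) by ring. rewrite Cmod_0. apply Rmult_le_pos; [apply pow2_ge_0|lra]. }
  specialize (HM0 j). set (M := (2 ^ j)%nat) in *.
  match goal with |- Cmod (RtoC 1 + ?u - RtoC 1)%C <= _ => replace (1 + u - 1)%C with u by ring end.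
  assert (Hth : 0 < half_angle M (S k) /\ half_angle M (S k) <= PI / 2).
  { unfold half_angle. assert (0 < INR (S k)) by (apply lt_0_INR; lia).
    assert (INR (S k) <= INR M) by (apply le_INR; lia). split.
    - apply Rdiv_lt_0_compat; nra.
    - apply Rle_div_l; nra. }
  assert (Hs := sin_lower (half_angle M (S k)) ltac:(lra)).
  assert (Hs2 : (INR k + 1) / (2 * INR M) <= sin (half_angle M (S k))).
  { eapply Rle_trans; [|exact Hs]. unfold half_angle. rewrite S_INR.
    replace ((INR k + 1) * PI / (2 * INR M) / 3) with ((INR k + 1) / (2 * INR M) * (PI / 3)) by (field; lra).
    assert (0 < (INR k + 1) / (2 * INR M)) by (apply Rdiv_lt_0_compat; pose proof (pos_INR k); lra).
    assert (3 < PI) by (pose proof PI2_3_2; lra). nra. }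
  assert (Hk1 : 0 < INR k + 1) by (pose proof (pos_INR k); lra).
  set (sn := sin (half_angle M (S k))) in *.
  assert (Hsn : 0 < sn) by (eapply Rlt_le_trans; [|exact Hs2]; apply Rdiv_lt_0_compat; lra).
  set (y := (x / INR (2 * M))%C).
  assert (Hy : Cmod y = Cmod x / (2 * INR M)).
  { unfold y. rewrite mult_INR. change (INR 2) with 2.
    rewrite Cmod_div, Cmod_R, Rabs_right by (try (intros H; apply RtoC_inj in H); lra). easy. }
  assert (Hy1 : Cmod y <= Cmod x).
  { rewrite Hy. apply Rle_div_l; [lra|]. assert (1 <= INR M) by (apply (le_INR 1); lia). nra. }
  assert (Hsy := Csinh_bound (Cmod x) y Hy1).
  rewrite Cmod_div, Cmod_mult, Cmod_R, Rabs_right by (try (intros H; apply RtoC_inj in H); nra).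
  apply Rle_div_l; [nra|].
  apply Rle_trans with ((exp (3 * Cmod x) * Cmod y) ^ 2).
  { simpl. rewrite Rmult_1_r. apply Rmult_le_compat; try apply Cmod_ge_0; easy. }
  apply Rle_trans with (K * inv_square k * ((INR k + 1) / (2 * INR M)) ^ 2).
  { right. unfold K, inv_square. rewrite Hy. field. lra. }
  apply Rmult_le_compat_l; [apply Rmult_le_pos; [apply pow2_ge_0|lra]|].
  apply pow_incr. split; [|easy]. apply Rdiv_le_0_compat; lra. }
assert (Hlim : forall k, filterlim (fun j => f j k) eventually (locally (sinh_factor x k))).
{ intros k.
  set (t := ((INR k + 1) * PI / 2)).
  assert (Ht : 0 < t) by (unfold t; pose proof (pos_INR k); nra).
  assert (Ht0 : (Ci * t)%C <> RtoC 0).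
  { apply Cmult_neq_0; [apply Cmod_gt_0; rewrite Cmod_Ci; lra|intros H; apply RtoC_inj in H; lra]. }
  set (A := fun j => (INR (2 * 2 ^ j) * Csinh (x / INR (2 * 2 ^ j)))%C).
  set (B := fun j => (INR (2 ^ j) * Csinh (Ci * t / INR (2 ^ j)))%C).
  assert (HA : filterlim A eventually (locally x)).
  { apply (filterlim_comp _ _ _ (fun j => (2 * 2 ^ j)%nat) (fun n => INR n * Csinh (x / INR n))%C _ eventually).
    - apply eventually_subseq. intros n. simpl. pose proof (Nat.pow_nonzero 2 n). lia.
    - apply INR_Csinh_div_lim. }
  assert (HB : filterlim B eventually (locally (Ci * t)%C)).
  { apply (filterlim_comp _ _ _ (fun j => (2 ^ j)%nat) (fun n => INR n * Csinh (Ci * t / INR n))%C _ eventually).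
    - apply pow2_filter.
    - apply INR_Csinh_div_lim. }
  apply (clim_ext_loc eventually (fun j => 1 + (-1 / 4) * ((A j * A j) * / (B j * B j)))%C).
  - exists (S k). intros j Hj. unfold f.
    assert (Hlt : (S k < 2 ^ j)%nat). { pose proof (Nat.pow_gt_lin_r 2 j). lia. }
    destruct (Nat.ltb_spec (S k) (2 ^ j)) as [_|]; [|lia].
    specialize (HM0 j). unfold A, B.
    replace (Ci * t / INR (2 ^ j))%C with (Ci * RtoC (half_angle (2 ^ j) (S k)))%C.
    2: { unfold half_angle, t. rewrite S_INR, !RtoC_div, !RtoC_mult by lra.
         field; repeat split; easy || (intros H; apply RtoC_inj in H; lra). }
    rewrite Csinh_imag. rewrite mult_INR. change (INR 2) with 2. rewrite RtoC_mult.
    set (y := (x / _)%C). set (sn := sin _). simpl pow. rewrite Rmult_1_r, (RtoC_mult sn).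
    assert (Hsn : sn <> 0). { unfold sn. assert (H := half_angle_sin_pos (2 ^ j) (S k) ltac:(lia)). lra. }
    assert (Hsn' : RtoC sn <> RtoC 0) by (intros H; apply RtoC_inj in H; easy).
    assert (HM' : RtoC (INR (2 ^ j)) <> RtoC 0) by (intros H; apply RtoC_inj in H; lra).
    assert (Hci : (Ci * Ci)%C = RtoC (-1)) by (apply injective_projections; simpl; ring).
    replace ((INR (2 ^ j) * (Ci * sn)) * (INR (2 ^ j) * (Ci * sn)))%C
      with ((Ci * Ci) * (INR (2 ^ j) * sn * (INR (2 ^ j) * sn)))%C by ring.
    rewrite Hci. field; repeat split; easy || (intros H; apply RtoC_inj in H; lra).
  - replace (sinh_factor x k) with (1 + (-1 / 4) * ((x * x) * / ((Ci * t) * (Ci * t))))%C.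
    + apply (clim_plus eventually); [apply filterlim_const|].
      apply (clim_mult eventually); [apply filterlim_const|].
      apply (clim_mult eventually); [now apply (clim_mult eventually)|].
      apply (clim_inv eventually); [now apply Cmult_neq_0|]. now apply (clim_mult eventually).
    + unfold sinh_factor, inv_square, t.
      assert (Hci : (Ci * Ci)%C = RtoC (-1)) by (apply injective_projections; simpl; ring).
      assert (Hk1 : 0 < INR k + 1) by (pose proof (pos_INR k); lra).
      replace (/ ((INR k + 1) * (INR k + 1)) / (PI * PI)) with (/ 4 * / (t * t)) by (unfold t; field; lra).
      fold t. rewrite RtoC_mult, !RtoC_inv, RtoC_mult by nra.
      replace (Ci * t * (Ci * t))%C with (Ci * Ci * (t * t))%C by ring. rewrite Hci.
      field; repeat split; easy || (intros H; apply RtoC_inj in H; lra). }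
(* by the finite formula the products of the f j are the quotients l j *)
assert (Hl : filterlim l eventually (locally (Csinh x / x)%C)).
{ unfold l. apply (clim_mult eventually); [apply filterlim_const|].
  apply (clim_inv eventually); [easy|].
  apply (filterlim_comp _ _ _ (fun j => (2 ^ j)%nat) (fun n => INR n * Csinh (x / INR n))%C _ eventually);
    [apply pow2_filter|apply INR_Csinh_div_lim]. }
destruct (fprod_exists all_nat (sinh_factor x) (fun k => K * inv_square k) Hg) as [p Hp].
{ intros k _. apply le_epsilon. intros eps Heps.
  assert (H := proj1 (clim_iff eventually _ _) (Hlim k) eps Heps). destruct H as [N HN].
  specialize (HN N (le_n _)). specialize (Hf N k).
  eapply Rle_trans; [apply (Cmod_tri3 _ (f N k))|]. rewrite Cmod_sub_sym in HN. lra. }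
assert (Hlp : filterlim l eventually (locally p)).
{ apply (fprod_tannery eventually all_nat f (fun k => K * inv_square k) (sinh_factor x)); try easy.
  - apply filter_forall. intros j k _. apply Hf.
  - assert (Hne : eventually (fun j => (INR (2 ^ j) * Csinh (x / INR (2 ^ j)))%C <> RtoC 0)).
    { assert (H := filterlim_comp _ _ _ _ _ _ _ _ pow2_filter (INR_Csinh_div_lim x)).
      assert (Hm : 0 < Cmod x) by now apply Cmod_gt_0.
      generalize (proj1 (clim_iff eventually _ _) H (Cmod x) Hm). apply filter_imp.
      intros j Hj H0. rewrite H0, Cmod_sub_sym in Hj. replace (x - 0)%C with x in Hj by ring. lra. }
    revert Hne. apply filter_imp. intros j Hne.
    specialize (HM0 j).
    assert (E := Csinh_finite_product j (x / INR (2 * 2 ^ j))%C). cbv zeta in E.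
    assert (HMc : RtoC (INR (2 ^ j)) <> RtoC 0) by (intros H; apply RtoC_inj in H; lra).
    assert (H2c : RtoC 2 <> RtoC 0) by (intros H; apply RtoC_inj in H; lra).
    rewrite mult_INR in E. change (INR 2) with 2 in E. rewrite RtoC_mult in E.
    replace (2 * INR (2 ^ j) * (x / (2 * INR (2 ^ j))))%C with x in E by (field; easy).
    replace (2 * (x / (2 * INR (2 ^ j))))%C with (x / INR (2 ^ j))%C in E by (field; easy).
    assert (El : l j = lfold Cmult (RtoC 1) (f j) (seq 0 (2 ^ j - 1))).
    { unfold l. rewrite E.
      rewrite <- (seq_shift (2 ^ j - 1) 0), lfold_map.
      match goal with |- (?a * ?u / ?a)%C = ?v => assert (Huv : u = v) end.
      { apply lfold_ext. intros k Hk. apply in_seq in Hk. unfold f.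
        destruct (Nat.ltb_spec (S k) (2 ^ j)); [|lia].
        rewrite mult_INR. change (INR 2) with 2. rewrite RtoC_mult. easy. }
      rewrite Huv. field. split; [|easy]. intros H. apply Hne. rewrite H. ring. }
    rewrite El. apply (fam_finite Cmult_monoid).
    + apply seq_NoDup.
    + apply Forall_forall. easy.
    + intros k _ Hk. unfold f. destruct (Nat.ltb_spec (S k) (2 ^ j)); [|easy].
      exfalso. apply Hk, in_seq. lia. }
rewrite (clim_unique eventually _ _ _ Hl Hlp). exact Hp.
Qed.

(** * Hecke's limit: the Eisenstein series of weight two *)

Lemma mean_value (f g : R -> R) a b : a <= b -> (forall t, is_derive f t (g t)) ->
  exists c, a <= c <= b /\ f b - f a = g c * (b - a).
Proof.
intros Hab H. destruct (MVT_gen f a b g) as [c [Hc He]].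
- intros; apply H.
- intros t _. apply derivable_continuous_pt. exists (g t). now apply is_derive_Reals.
- rewrite Rmin_left, Rmax_right in Hc by easy. now exists c.
Qed.

(** Over a unit step the increment of a primitive [psi] of [f] is a value of [f], which differs from [f x] by at
    most the largest derivative of [f] on the step. *)
Lemma increment_error (psi f g : R -> R) x B :
  (forall t, is_derive psi t (f t)) -> (forall t, is_derive f t (g t)) ->
  (forall t, x <= t <= x + 1 -> Rabs (g t) <= B) ->
  Rabs (f x - (psi (x + 1) - psi x)) <= B.
Proof.
intros Hpsi Hf Hg.
destruct (mean_value psi f x (x + 1) ltac:(lra) Hpsi) as [c [Hc E1]].
destruct (mean_value f g x c ltac:(lra) Hf) as [d [Hd E2]].
specialize (Hg d ltac:(lra)).
replace (f x - (psi (x + 1) - psi x)) with (- (g d * (c - x))).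
- rewrite Rabs_Ropp, Rabs_mult, (Rabs_right (c - x)) by lra.
  pose proof (Rabs_pos (g d)). nra.
- rewrite <- E2. replace (x + 1 - x) with 1 in E1 by ring. lra.
Qed.

(** For [e = 1] this is the arctangent. For [e > 1] it enters the primitive of the regularized summand of the
    Eisenstein series; all that matters is that its supremum tends to [pi / 2] as [e] tends to [1], which follows
    from the bounds [(1 + v^2)^(1 - e) atan v <= theta e v <= atan v]. *)
Definition theta (e v : R) : R := RInt (fun t => Rpower (1 + t * t) (- e)) 0 v.

Lemma theta_integrand_cont e t : continuous (fun t => Rpower (1 + t * t) (- e)) t.
Proof.
apply (ex_derive_continuous (K := R_AbsRing) (V := R_NormedModule)). unfold Rpower. auto_derive.
assert (0 <= t * t) by apply Rle_0_sqr. lra.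
Qed.

Lemma theta_ex_RInt e a b : ex_RInt (fun t => Rpower (1 + t * t) (- e)) a b.
Proof. apply (ex_RInt_continuous (V := R_CompleteNormedModule)). intros; apply theta_integrand_cont. Qed.

Lemma theta_deriv e v : is_derive (theta e) v (Rpower (1 + v * v) (- e)).
Proof.
apply (is_derive_RInt (V := R_NormedModule) (fun t => Rpower (1 + t * t) (- e)) _ 0).
- apply filter_forall. intros x. apply (RInt_correct (V := R_CompleteNormedModule)), theta_ex_RInt.
- apply theta_integrand_cont.
Qed.

Lemma theta_0 e : theta e 0 = 0.
Proof. apply (RInt_point (V := R_CompleteNormedModule)). Qed.

Lemma theta_odd e v : theta e (- v) = - theta e v.
Proof.
assert (H : forall t, is_derive (fun t => theta e (- t) + theta e t) t 0).
{ intros t. replace 0 with (plus (scal (opp one) (Rpower (1 + (- t) * (- t)) (- e))) (Rpower (1 + t * t) (- e))).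
  - apply (is_derive_plus (K := R_AbsRing) (V := R_NormedModule)); [|apply theta_deriv].
    apply (is_derive_comp (K := R_AbsRing) (V := R_NormedModule) (theta e) Ropp); [apply theta_deriv|].
    apply (is_derive_opp (K := R_AbsRing) (V := R_NormedModule) (fun x => x)), (is_derive_id (K := R_AbsRing)).
  - change plus with Rplus. change scal with Rmult. change opp with Ropp. change one with 1.
    replace (- t * - t) with (t * t) by ring. match goal with |- @eq _ ?a ?b => change (@eq R a b) end. ring. }
destruct (Rle_dec 0 v) as [Hv|Hv].
- destruct (mean_value _ _ 0 v Hv H) as [c [_ Hc]]. rewrite Ropp_0, theta_0 in Hc. lra.
- destruct (mean_value _ _ v 0 ltac:(lra) H) as [c [_ Hc]]. rewrite Ropp_0, theta_0 in Hc. lra.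
Qed.

Lemma theta_mono e v w : v <= w -> theta e v <= theta e w.
Proof.
intros H. destruct (mean_value _ _ v w H (theta_deriv e)) as [c [_ Hc]].
pose proof (Rpower_pos (1 + c * c) (- e)). nra.
Qed.

Lemma theta_le_atan e v : 1 <= e -> 0 <= v -> theta e v <= atan v.
Proof.
intros He Hv.
assert (H : forall t, is_derive (fun t => atan t - theta e t) t (/ (1 + t * t) - Rpower (1 + t * t) (- e))).
{ intros t. apply (is_derive_minus (K := R_AbsRing) (V := R_NormedModule)); [|apply theta_deriv].
  apply is_derive_Reals. replace (t * t) with (t ^ 2) by ring. apply derivable_pt_lim_atan. }
destruct (mean_value _ _ 0 v Hv H) as [c [_ Hc]]. rewrite theta_0, atan_0 in Hc.
assert (Rpower (1 + c * c) (- e) <= / (1 + c * c)).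
{ assert (0 <= c * c) by apply Rle_0_sqr. rewrite <- Rpower_m1 by lra. apply Rle_Rpower; lra. }
nra.
Qed.

Lemma theta_ge_atan e v : 1 <= e -> 0 <= v -> Rpower (1 + v * v) (1 - e) * atan v <= theta e v.
Proof.
intros He Hv. set (k := Rpower (1 + v * v) (1 - e)).
assert (H : forall t, is_derive (fun t => theta e t - k * atan t) t (Rpower (1 + t * t) (- e) - k * / (1 + t * t))).
{ intros t. apply (is_derive_minus (K := R_AbsRing) (V := R_NormedModule)); [apply theta_deriv|].
  apply (is_derive_scal atan).
  apply is_derive_Reals. replace (t * t) with (t ^ 2) by ring. apply derivable_pt_lim_atan. }
destruct (mean_value _ _ 0 v Hv H) as [c [Hc E]]. rewrite theta_0, atan_0 in E.
assert (k * / (1 + c * c) <= Rpower (1 + c * c) (- e)).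
{ assert (0 <= c * c) by apply Rle_0_sqr. replace (- e) with ((1 - e) + -1) by ring.
  rewrite Rpower_plus, Rpower_m1 by lra. apply Rmult_le_compat_r.
  - apply Rlt_le, Rinv_0_lt_compat. lra.
  - apply Rpower_nonpos_anti; nra. }
nra.
Qed.

Lemma theta_abs e v : 1 <= e -> Rabs (theta e v) <= PI / 2.
Proof.
intros He. assert (H : forall w, 0 <= w -> 0 <= theta e w <= PI / 2).
{ intros w Hw. split.
  - rewrite <- (theta_0 e). now apply theta_mono.
  - eapply Rle_trans; [now apply theta_le_atan|]. apply Rlt_le, atan_bound. }
destruct (Rle_dec 0 v) as [Hv|Hv].
- specialize (H v Hv). rewrite Rabs_right; lra.
- specialize (H (- v) ltac:(lra)). rewrite theta_odd in H. rewrite Rabs_left1; lra.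
Qed.

Lemma theta_limit e : 1 <= e -> exists K, K <= PI / 2 /\ (forall v, theta e v <= K) /\
  forall eps, 0 < eps -> exists v0, forall v, v0 <= v -> K - eps < theta e v.
Proof.
intros He. destruct (completeness (fun x => exists v, x = theta e v)) as [K [Hub Hlub]].
- exists (PI / 2). intros x [v ->]. eapply Rle_trans; [apply Rle_abs|now apply theta_abs].
- exists 0. exists 0. now rewrite theta_0.
- exists K. split; [|split].
  + apply Hlub. intros x [v ->]. eapply Rle_trans; [apply Rle_abs|now apply theta_abs].
  + intros v. apply Hub. now exists v.
  + intros eps Heps. destruct (Classical_Prop.classic (exists v, K - eps < theta e v)) as [[v Hv]|Hn].
    * exists v. intros w Hw. eapply Rlt_le_trans; [exact Hv|]. now apply theta_mono.
    * exfalso. assert (K <= K - eps); [|lra]. apply Hlub. intros x [v ->].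
      apply Rnot_lt_le. intros H. apply Hn. now exists v.
Qed.

Definition theta_sup (e : R) : R :=
  match Rle_dec 1 e with
  | left H => proj1_sig (constructive_indefinite_description _ (theta_limit e H))
  | right _ => 0
  end.

Lemma theta_sup_spec e : 1 <= e -> theta_sup e <= PI / 2 /\ (forall v, theta e v <= theta_sup e) /\
  forall eps, 0 < eps -> exists v0, forall v, v0 <= v -> theta_sup e - eps < theta e v.
Proof.
intros He. unfold theta_sup. destruct (Rle_dec 1 e) as [H|]; [|easy].
exact (proj2_sig (constructive_indefinite_description _ (theta_limit e H))).
Qed.

Lemma at_right_0_iff (P : R -> Prop) : at_right 0 P <-> exists d, 0 < d /\ forall s, 0 < s < d -> P s.
Proof.
split.
- intros [d H]. exists d. split; [apply cond_pos|]. intros s Hs. apply H; [|lra].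
  change (Rabs (s - 0) < d). rewrite Rabs_right; lra.
- intros [d [Hd H]]. exists (mkposreal d Hd). intros s Hs Hs0. apply H.
  change (Rabs (s - 0) < d) in Hs. apply Rabs_lt_between in Hs. lra.
Qed.

Lemma theta_sup_lim : filterlim (fun s => theta_sup (1 + s / 2)) (at_right 0) (locally (PI / 2)).
Proof.
apply (rlim_iff (at_right 0)). intros eps Heps. apply at_right_0_iff.
(* fix v with atan v close to pi / 2 first; then the factor (1 + v^2)^(- s / 2) tends to 1 with s *)
assert (Hv : exists v, 0 <= v /\ PI / 2 - eps / 2 < atan v).
{ assert (Hpi := PI_RGT_0).
  set (a := Rmax 0 (PI / 2 - eps / 4)).
  assert (Ha : 0 <= a < PI / 2).
  { unfold a. split; [apply Rmax_l|]. apply Rmax_lub_lt; lra. }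
  exists (tan a). split.
  - rewrite <- tan_0. destruct (proj1 Ha) as [H|H]; [|rewrite <- H; lra].
    apply Rlt_le, tan_increasing; lra.
  - rewrite atan_tan by lra. assert (PI / 2 - eps / 4 <= a) by apply Rmax_r. lra. }
destruct Hv as [v [Hv0 Hv]].
assert (Hc : filterlim (fun s => Rpower (1 + v * v) (- (s / 2))) (locally 0) (locally (Rpower (1 + v * v) (- (0 / 2))))).
{ apply (ex_derive_continuous (K := R_AbsRing) (V := R_NormedModule)
    (fun s => Rpower (1 + v * v) (- (s / 2)))). unfold Rpower. auto_derive. easy. }
replace (Rpower (1 + v * v) (- (0 / 2))) with 1 in Hc.
2: { unfold Rpower. replace (- (0 / 2) * _) with 0 by field. now rewrite exp_0. }
assert (Hpi := PI_RGT_0).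
assert (He2 : 0 < eps / (2 * PI)) by (apply Rdiv_lt_0_compat; lra).
destruct (proj1 (rlim_iff (locally 0) _ _) Hc (eps / (2 * PI)) He2) as [d Hd].
exists d. split; [apply cond_pos|]. intros s Hs.
assert (Hk : Rabs (Rpower (1 + v * v) (- (s / 2)) - 1) < eps / (2 * PI)).
{ apply Hd. change (Rabs (s - 0) < d). rewrite Rabs_right; lra. }
destruct (theta_sup_spec (1 + s / 2) ltac:(lra)) as [H1 [H2 _]].
specialize (H2 v). assert (H3 := theta_ge_atan (1 + s / 2) v ltac:(lra) Hv0).
replace (1 - (1 + s / 2)) with (- (s / 2)) in H3 by ring.
set (k := Rpower (1 + v * v) (- (s / 2))) in *.
assert (Hat : 0 <= atan v < PI / 2).
{ split; [|apply atan_bound]. rewrite <- atan_0. destruct Hv0 as [H|<-]; [|lra].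
  apply Rlt_le, atan_increasing. easy. }
apply Rabs_lt_between in Hk.
assert (Hm : (1 - eps / (2 * PI)) * atan v <= k * atan v) by (apply Rmult_le_compat_r; lra).
assert (Hm2 : eps / (2 * PI) * atan v <= eps / (2 * PI) * (PI / 2)) by (apply Rmult_le_compat_l; lra).
replace (eps / (2 * PI) * (PI / 2)) with (eps / 4) in Hm2 by (field; lra).
apply Rabs_lt_between. lra.
Qed.

(** Hecke's regularization of [w ^ (-2)]. At the points [m tau + n] with coprime [m], [n] its values
    form the set [X tau s]. *)
Definition hecke (s : R) (w : C) : C := (/ (w ^ 2 * Rpower (Cmod w) s))%C.

(** On a horizontal line [x + i Y], with [e = 1 + s / 2], the summand and its primitive in [x]:
    the primitive is [- 1 / (e w |w|^s)], corrected by a multiple of [theta]. *)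
Definition line_re (e Y x : R) : R := (x * x - Y * Y) * Rpower (x * x + Y * Y) (-1 - e).
Definition line_im (e Y x : R) : R := -2 * x * Y * Rpower (x * x + Y * Y) (-1 - e).
Definition line_theta (e Y x : R) : R := Rpower (Y * Y) (- e) * Y * theta e (x / Y).
Definition prim_re (e Y x : R) : R :=
  (- x * Rpower (x * x + Y * Y) (- e) - (e - 1) * line_theta e Y x) / e.
Definition prim_im (e Y x : R) : R := Y * Rpower (x * x + Y * Y) (- e) / e.

Lemma r2_pos Y x : 0 < Y -> 0 < x * x + Y * Y.
Proof. intros H. assert (0 <= x * x) by apply Rle_0_sqr. nra. Qed.

Lemma is_derive_r2pow Y a x : 0 < Y -> is_derive (fun t => Rpower (t * t + Y * Y) a) x
  (2 * x * (a * Rpower (x * x + Y * Y) (a - 1))).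
Proof.
intros HY. assert (H := r2_pos Y x HY).
apply (is_derive_comp (fun t => Rpower t a) (fun t => t * t + Y * Y)).
- now apply is_derive_Rpower.
- auto_derive; [easy|ring].
Qed.

Lemma is_derive_mult_R f g x lf lg : is_derive f x lf -> is_derive g x lg ->
  is_derive (fun t => f t * g t) x (lf * g x + f x * lg).
Proof. intros H1 H2. apply (is_derive_mult f g); try easy. intros; apply Rmult_comm. Qed.

Lemma line_theta_deriv e Y x : 0 < Y -> is_derive (line_theta e Y) x (Rpower (x * x + Y * Y) (- e)).
Proof.
intros HY. unfold line_theta.
assert (H1 : is_derive (fun t => theta e (t / Y)) x (/ Y * Rpower (1 + x / Y * (x / Y)) (- e))).
{ apply (is_derive_comp (theta e) (fun t => t / Y)); [apply theta_deriv|]. auto_derive; [easy|]. field. lra. }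
replace (Rpower (x * x + Y * Y) (- e))
  with (Rpower (Y * Y) (- e) * Y * (/ Y * Rpower (1 + x / Y * (x / Y)) (- e))).
- now apply (is_derive_scal (fun t => theta e (t / Y))).
- rewrite Rmult_assoc, <- (Rmult_assoc Y), Rinv_r, Rmult_1_l by lra.
  assert (H : 0 <= x / Y * (x / Y)) by apply Rle_0_sqr.
  rewrite Rpower_mult_distr by nra. f_equal. field. lra.
Qed.

Lemma Rpower_S r a : 0 < r -> Rpower r (a + 1) = Rpower r a * r.
Proof. intros H. now rewrite Rpower_plus, Rpower_1. Qed.

Lemma prim_re_deriv e Y x : 0 < Y -> 0 < e -> is_derive (prim_re e Y) x (line_re e Y x).
Proof.
intros HY He. assert (H := r2_pos Y x HY).
assert (H1 := is_derive_r2pow Y (- e) x HY). assert (H2 := line_theta_deriv e Y x HY).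
assert (H3 : is_derive (fun t => - t) x (-1)) by (auto_derive; [easy|ring]).
assert (H4 := is_derive_mult_R _ _ _ _ _ H3 H1).
assert (H5 := is_derive_minus _ _ _ _ _ H4 (is_derive_scal _ x (e - 1) _ H2)).
assert (H6 := is_derive_scal _ x (/ e) _ H5).
unfold prim_re. eapply is_derive_ext; [|replace (line_re e Y x) with
  (/ e * minus (-1 * Rpower (x * x + Y * Y) (- e) + - x * (2 * x * (- e * Rpower (x * x + Y * Y) (- e - 1))))
      ((e - 1) * Rpower (x * x + Y * Y) (- e))); [exact H6|]].
- intros t. change minus with Rminus. simpl. unfold Rdiv. apply Rmult_comm.
- assert (E : Rpower (x * x + Y * Y) (- e) = Rpower (x * x + Y * Y) (-1 - e) * (x * x + Y * Y)).
  { rewrite <- Rpower_S by easy. f_equal. ring. }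
  unfold line_re. change minus with Rminus. rewrite E. replace (- e - 1) with (-1 - e) by ring.
  match goal with |- @eq _ ?a ?b => change (@eq R a b) end. field. lra.
Qed.

Lemma prim_im_deriv e Y x : 0 < Y -> 0 < e -> is_derive (prim_im e Y) x (line_im e Y x).
Proof.
intros HY He. assert (H := r2_pos Y x HY).
assert (H6 := is_derive_scal _ x (Y / e) _ (is_derive_r2pow Y (- e) x HY)).
unfold prim_im. eapply is_derive_ext; [|replace (line_im e Y x) with
  (Y / e * (2 * x * (- e * Rpower (x * x + Y * Y) (- e - 1)))); [exact H6|]].
- intros t. simpl. field. lra.
- unfold line_im. replace (- e - 1) with (-1 - e) by ring. field. lra.
Qed.

Definition line_re' (e Y x : R) : R :=
  2 * x * Rpower (x * x + Y * Y) (-1 - e) +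
  (x * x - Y * Y) * (2 * x * ((-1 - e) * Rpower (x * x + Y * Y) (-1 - e - 1))).
Definition line_im' (e Y x : R) : R :=
  -2 * Y * Rpower (x * x + Y * Y) (-1 - e) +
  -2 * x * Y * (2 * x * ((-1 - e) * Rpower (x * x + Y * Y) (-1 - e - 1))).

Lemma line_re_deriv e Y x : 0 < Y -> is_derive (line_re e Y) x (line_re' e Y x).
Proof.
intros HY. unfold line_re, line_re'.
apply (is_derive_mult_R (fun t => t * t - Y * Y) (fun t => Rpower (t * t + Y * Y) (-1 - e))); [auto_derive; [easy|ring]|exact (is_derive_r2pow Y (-1 - e) x HY)].
Qed.

Lemma line_im_deriv e Y x : 0 < Y -> is_derive (line_im e Y) x (line_im' e Y x).
Proof.
intros HY. unfold line_im, line_im'.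
apply (is_derive_mult_R (fun t => -2 * t * Y) (fun t => Rpower (t * t + Y * Y) (-1 - e))); [auto_derive; [easy|ring]|exact (is_derive_r2pow Y (-1 - e) x HY)].
Qed.

Lemma Rpower_sqrt_r2 r a : 0 < r -> Rpower (sqrt r) a = Rpower r (a / 2).
Proof. intros H. rewrite <- Rpower_sqrt, Rpower_mult by easy. f_equal. field. Qed.

Lemma line'_bound e Y x : 0 < Y -> 1 <= e <= 2 ->
  Rabs (line_re' e Y x) <= 14 * Rpower (sqrt (x * x + Y * Y)) (- (2 * e + 1)) /\
  Rabs (line_im' e Y x) <= 14 * Rpower (sqrt (x * x + Y * Y)) (- (2 * e + 1)).
Proof.
intros HY He. assert (H := r2_pos Y x HY). set (q := x * x + Y * Y) in *.
assert (Hs : 0 < sqrt q) by now apply sqrt_lt_R0.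
assert (Hsq : sqrt q * sqrt q = q) by (apply sqrt_sqrt; lra).
assert (HX : Rabs x <= sqrt q).
{ rewrite <- sqrt_Rsqr_abs. apply sqrt_le_1; unfold Rsqr, q; nra. }
assert (HYs : Y <= sqrt q).
{ rewrite <- (Rabs_right Y) by lra. rewrite <- sqrt_Rsqr_abs. apply sqrt_le_1; unfold Rsqr, q; nra. }
(* all terms are multiples of p = q ^ (-2 - e) *)
set (p := Rpower q (-1 - e - 1)).
assert (Hp : 0 < p) by apply Rpower_pos.
assert (E1 : Rpower q (-1 - e) = p * q).
{ unfold p. rewrite <- Rpower_S by easy. f_equal. ring. }
assert (E2 : Rpower (sqrt q) (- (2 * e + 1)) = p * (q * sqrt q)).
{ rewrite Rpower_sqrt_r2 by easy. unfold p.
  transitivity (Rpower q (-1 - e - 1) * (q * Rpower q (/ 2))).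
  - rewrite <- Rmult_assoc, <- Rpower_S, <- Rpower_plus by easy. f_equal. field.
  - now rewrite Rpower_sqrt. }
rewrite E2. unfold line_re', line_im'. fold q. fold p. rewrite E1.
assert (Hx1 : - sqrt q <= x <= sqrt q) by (apply Rabs_le_between; lra).
assert (Hxx : 0 <= x * x <= q) by (unfold q; nra).
assert (Hd : - q <= x * x - Y * Y <= q) by (unfold q; nra).
split.
- replace (_ + _) with (p * (x * (2 * q - 2 * (1 + e) * (x * x - Y * Y)))) by ring.
  rewrite Rabs_mult, (Rabs_right p) by lra.
  replace (14 * (p * (q * sqrt q))) with (p * (sqrt q * (14 * q))) by ring.
  apply Rmult_le_compat_l; [lra|]. rewrite Rabs_mult.
  apply Rmult_le_compat; try apply Rabs_pos; [easy|]. apply Rabs_le. split; nra.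
- replace (_ + _) with (p * (Y * (-2 * q + 4 * (1 + e) * (x * x)))) by ring.
  rewrite Rabs_mult, (Rabs_right p) by lra.
  replace (14 * (p * (q * sqrt q))) with (p * (sqrt q * (14 * q))) by ring.
  apply Rmult_le_compat_l; [lra|]. rewrite Rabs_mult.
  apply Rmult_le_compat; try apply Rabs_pos; [rewrite Rabs_right; lra|]. apply Rabs_le. split; nra.
Qed.

Definition prim (s : R) (w : C) : C :=
  (prim_re (1 + s / 2) (Im w) (Re w), prim_im (1 + s / 2) (Im w) (Re w)).

(** The error of replacing a summand by the increment of the primitive to the next point of the row. *)
Definition hecke_err (s : R) (w : C) : C := (hecke s w - (prim s (w + 1) - prim s w))%C.

Lemma Cmod_r2 w : Cmod w = sqrt (Re w * Re w + Im w * Im w).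
Proof. unfold Cmod, Re, Im. f_equal. ring. Qed.

Lemma hecke_line s w : 0 < Im w ->
  hecke s w = (line_re (1 + s / 2) (Im w) (Re w), line_im (1 + s / 2) (Im w) (Re w)).
Proof.
intros HY. assert (H := r2_pos (Im w) (Re w) HY).
unfold hecke. rewrite Cmod_r2.
destruct w as [x Y]. simpl in *. rewrite Rpower_sqrt_r2 by easy.
set (q := x * x + Y * Y) in *.
set (v := (line_re (1 + s / 2) Y x, line_im (1 + s / 2) Y x)).
set (u := ((x, Y) * ((x, Y) * 1) * Rpower q (s / 2))%C).
assert (Huv : (v * u)%C = 1).
{ unfold v, u, line_re, line_im. fold q.
  assert (E : Rpower q (-1 - (1 + s / 2)) * Rpower q (s / 2) * (q * q) = 1).
  { rewrite <- Rpower_plus. replace (-1 - (1 + s / 2) + s / 2) with (-2) by field.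
    rewrite Rpower_m2 by easy. field. lra. }
  set (a := Rpower q (-1 - (1 + s / 2))) in *. set (b := Rpower q (s / 2)) in *.
  apply injective_projections; simpl.
  - transitivity (a * b * (q * q)); [unfold q; ring|exact E].
  - ring. }
assert (Hu : u <> RtoC 0).
{ intros H0. rewrite H0 in Huv. replace (v * 0)%C with (RtoC 0) in Huv by ring.
  apply RtoC_inj in Huv. lra. }
replace v with (v * u * / u)%C by (field; easy). rewrite Huv. ring.
Qed.

(** The error is bounded by the derivative of [hecke s] along the row, which is of the size [|w| ^ (-3 - s)]; so
    the errors are summable over the lattice uniformly in [s], although the summands are not. *)
Lemma hecke_err_bound y0 : 0 < y0 -> exists K, 0 <= K /\ forall s w, 0 <= s <= 1 -> y0 <= Im w ->
  Cmod (hecke_err s w) <= K * Rpower (Cmod w) (- (3)).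
Proof.
intros Hy. set (k := 1 + / y0).
assert (Hk : 1 < k) by (unfold k; assert (0 < / y0) by (now apply Rinv_0_lt_compat); lra).
exists (28 * k ^ 5). split; [apply Rmult_le_pos; [lra|apply pow_le; lra]|].
intros s w Hs Hw. assert (HY : 0 < Im w) by lra.
assert (Hw0 : y0 <= Cmod w). { eapply Rle_trans; [exact Hw|]. eapply Rle_trans; [apply Rle_abs|apply im_le_Cmod]. }
unfold hecke_err. rewrite hecke_line by easy. unfold prim.
replace (Im (w + 1)%C) with (Im w) by (destruct w; simpl; ring).
replace (Re (w + 1)%C) with (Re w + 1) by (destruct w; simpl; ring).
assert (Hm := Cmod_r2 w).
set (e := 1 + s / 2) in *. set (x := Re w) in *. set (Y := Im w) in *.
set (B := 14 * (k ^ 5 * Rpower (Cmod w) (- (3)))).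
assert (HB : forall t, x <= t <= x + 1 -> 14 * Rpower (sqrt (t * t + Y * Y)) (- (2 * e + 1)) <= B).
{ intros t Ht. unfold B. apply Rmult_le_compat_l; [lra|].
  assert (Hq := r2_pos Y t HY).
  set (m := sqrt (t * t + Y * Y)).
  assert (Hm0 : 0 < m) by now apply sqrt_lt_R0.
  assert (HmY : Y <= m).
  { unfold m. rewrite <- (Rabs_right Y) at 1 by lra. rewrite <- sqrt_Rsqr_abs.
    apply sqrt_le_1; unfold Rsqr; nra. }
  (* moving by at most one changes the modulus by at most the factor k *)
  assert (Hkm : Cmod w <= k * m).
  { assert (H1 : Cmod w <= m + 1).
    { replace w with ((t, Y) + RtoC (x - t))%C.
      - eapply Rle_trans; [apply Cmod_triangle|]. rewrite Cmod_R.
        apply Rplus_le_compat.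
        + right. rewrite Cmod_r2. reflexivity.
        + apply Rabs_le. lra.
      - unfold x, Y. destruct w. apply injective_projections; simpl; ring. }
    assert (1 <= / y0 * m). { apply Rmult_le_reg_l with y0; [easy|]. rewrite <- Rmult_assoc, Rinv_r by lra. lra. }
    unfold k. lra. }
  assert (Hwk : 0 < Cmod w / k) by (apply Rdiv_lt_0_compat; lra).
  apply Rle_trans with (Rpower (Cmod w / k) (- (2 * e + 1))).
  { apply Rpower_nonpos_anti; [easy| |unfold e; lra]. apply Rle_div_l; lra. }
  replace (- (2 * e + 1)) with (- s + - (3)) by (unfold e; field).
  unfold Rdiv. rewrite <- Rpower_mult_distr by (try apply Rinv_0_lt_compat; lra).
  rewrite Rpower_plus. assert (Hki : 0 < / k) by (apply Rinv_0_lt_compat; lra).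
  assert (E1 : Rpower (Cmod w) (- s) <= k).
  { apply Rle_trans with (Rpower (/ k) (- s)).
    - apply Rpower_nonpos_anti; [easy| |lra].
      apply Rle_trans with y0; [|easy]. rewrite <- (Rinv_inv y0). apply Rinv_le_contravar.
      + now apply Rinv_0_lt_compat.
      + unfold k. lra.
    - unfold Rpower. rewrite ln_Rinv by lra. replace (- s * - ln k) with (s * ln k) by ring.
      apply Rle_trans with (exp (1 * ln k)).
      + apply exp_mono. assert (0 <= ln k) by (rewrite <- ln_1; apply ln_le; lra). nra.
      + rewrite Rmult_1_l, exp_ln; lra. }
  assert (E2 : Rpower (/ k) (- s + - (3)) <= k ^ 4).
  { unfold Rpower. rewrite ln_Rinv by lra.
    replace ((- s + - (3)) * - ln k) with ((s + 3) * ln k) by ring.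
    rewrite <- Rpower_pow by lra. unfold Rpower. apply exp_mono.
    assert (0 <= ln k) by (rewrite <- ln_1; apply ln_le; lra). simpl. nra. }
  assert (Hp3 := Rpower_pos (Cmod w) (- (3))). assert (Hps := Rpower_pos (Cmod w) (- s)).
  assert (Hpk := Rpower_pos (/ k) (- s + - (3))).
  assert (Rpower (Cmod w) (- s) * Rpower (/ k) (- s + - (3)) <= k * k ^ 4) by (apply Rmult_le_compat; lra).
  replace (k ^ 5) with (k * k ^ 4) by ring. nra. }
assert (He : 1 <= e <= 2) by (unfold e; lra).
eapply Rle_trans; [apply Cmod_le_sum|]. simpl.
assert (H1 : Rabs (line_re e Y x - (prim_re e Y (x + 1) - prim_re e Y x)) <= B).
{ apply (increment_error (prim_re e Y) (line_re e Y) (line_re' e Y)).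
  - intros t. apply prim_re_deriv; lra.
  - intros t. now apply line_re_deriv.
  - intros t Ht. eapply Rle_trans; [apply line'_bound; [easy|lra]|auto]. }
assert (H2 : Rabs (line_im e Y x - (prim_im e Y (x + 1) - prim_im e Y x)) <= B).
{ apply (increment_error (prim_im e Y) (line_im e Y) (line_im' e Y)).
  - intros t. apply prim_im_deriv; lra.
  - intros t. now apply line_im_deriv.
  - intros t Ht. eapply Rle_trans; [apply line'_bound; [easy|lra]|auto]. }
unfold Rminus in *. unfold B in *. lra.
Qed.

Definition upper (p : Z * Z) : Prop := (0 < fst p)%Z.

Lemma upper_nonzero p : upper p -> nonzero p.
Proof. intros H ->. unfold upper in H. simpl in H. lia. Qed.

Lemma Im_pt_upper tau p : 0 < Im tau -> upper p -> Im tau <= Im (pt tau p).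
Proof.
intros Ht Hp. rewrite Im_pt. assert (1 <= IZR (fst p)) by (apply IZR_le; unfold upper in Hp; lia). nra.
Qed.

Lemma Cmod_hecke s w : 0 < Cmod w -> Cmod (hecke s w) = Rpower (Cmod w) (- (2 + s)).
Proof.
intros Hw. unfold hecke. assert (Hp := Rpower_pos (Cmod w) s).
assert (w <> RtoC 0) by now apply Cmod_gt_0.
rewrite Cmod_inv.
- rewrite Cmod_mult, Cmod_pow, Cmod_R, Rabs_right by lra.
  rewrite Rpower_Ropp, Rpower_plus. f_equal. f_equal.
  replace 2 with (INR 2) by (simpl; lra). now rewrite Rpower_pow.
- apply Cmult_neq_0; [now apply Cpow_nz|]. intros H0. apply RtoC_inj in H0. lra.
Qed.

Lemma rlim_at_right_of_ex_derive (f : R -> R) : ex_derive f 0 ->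
  filterlim f (at_right 0) (locally (f 0)).
Proof.
intros H P HP. unfold filtermap, at_right. apply filter_le_within.
exact (ex_derive_continuous (K := R_AbsRing) (V := R_NormedModule) f 0 H P HP).
Qed.

Lemma rlim_small_bounded {T} (F : (T -> Prop) -> Prop) {FF : Filter F} (f g : T -> R) B :
  filterlim f F (locally 0) -> F (fun x => Rabs (g x) <= B) ->
  filterlim (fun x => f x * g x) F (locally 0).
Proof.
intros Hf Hg. apply (rlim_iff F). intros eps Heps.
assert (HB : 0 < Rabs B + 1) by (pose proof (Rabs_pos B); lra).
assert (He : 0 < eps / (Rabs B + 1)) by now apply Rdiv_lt_0_compat.
generalize (filter_and _ _ (proj1 (rlim_iff F _ _) Hf _ He) Hg).
apply filter_imp. intros x [H1 H2]. rewrite Rminus_0_r in *. rewrite Rabs_mult.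
apply Rlt_div_r in H1; [|easy].
assert (H3 := Rle_abs B). pose proof (Rabs_pos (f x)). pose proof (Rabs_pos (g x)). nra.
Qed.

(** The term with [theta] carries the factor [e - 1 = s / 2] and [theta] is bounded; so [theta] need not be
    differentiated in [e]. *)
Lemma prim_lim w : 0 < Im w ->
  filterlim (fun s => prim s w) (at_right 0) (locally (prim 0 w)).
Proof.
intros HY. assert (H := r2_pos (Im w) (Re w) HY).
set (x := Re w) in *. set (Y := Im w) in *.
unfold prim. fold x Y. apply (clim_pair (at_right 0)).
- set (f1 := fun s => (- x * Rpower (x * x + Y * Y) (- (1 + s / 2))) / (1 + s / 2)).
  set (f2 := fun s => (s / 2) * (Rpower (Y * Y) (- (1 + s / 2)) * Y) / (1 + s / 2)).
  apply (filterlim_ext_loc (fun s => f1 s - f2 s * theta (1 + s / 2) (x / Y))).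
  { apply at_right_0_iff. exists 1. split; [lra|]. intros s Hs.
    unfold f1, f2, prim_re, line_theta. field. lra. }
  replace (prim_re (1 + 0 / 2) Y x) with (f1 0 - 0).
  2: { unfold f1, prim_re. field. }
  assert (H1 : filterlim f1 (at_right 0) (locally (f1 0))).
  { apply rlim_at_right_of_ex_derive. unfold f1, Rpower. auto_derive. lra. }
  assert (H2 : filterlim f2 (at_right 0) (locally (f2 0))).
  { apply rlim_at_right_of_ex_derive. unfold f2, Rpower. auto_derive. lra. }
  replace (f2 0) with 0 in H2 by (unfold f2; field).
  assert (H3 : filterlim (fun s => f2 s * theta (1 + s / 2) (x / Y)) (at_right 0) (locally 0)).
  { apply (rlim_small_bounded (at_right 0) _ _ (PI / 2)); [easy|].
    apply at_right_0_iff. exists 1. split; [lra|]. intros s Hs. apply theta_abs. lra. }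
  apply (rlim_iff (at_right 0)). intros eps Heps.
  assert (He : 0 < eps / 2) by lra.
  generalize (filter_and _ _ (proj1 (rlim_iff (at_right 0) _ _) H1 _ He)
    (proj1 (rlim_iff (at_right 0) _ _) H3 _ He)). apply filter_imp.
  intros s [Ha Hb]. apply Rabs_lt_between in Ha, Hb. apply Rabs_lt_between. lra.
- apply (rlim_at_right_of_ex_derive (fun s => prim_im (1 + s / 2) Y x)).
  unfold prim_im, Rpower. auto_derive. lra.
Qed.

Lemma hecke_lim w : 0 < Cmod w ->
  filterlim (fun s => hecke s w) (at_right 0) (locally (hecke 0 w)).
Proof.
intros Hw. assert (H0 : w <> RtoC 0) by now apply Cmod_gt_0.
unfold hecke. apply (clim_inv (at_right 0)).
- apply Cmult_neq_0; [now apply Cpow_nz|]. intros H1. apply RtoC_inj in H1.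
  pose proof (Rpower_pos (Cmod w) 0). lra.
- apply (clim_mult (at_right 0)); [apply filterlim_const|].
  apply (clim_pair (at_right 0)); [|apply filterlim_const].
  apply rlim_at_right_of_ex_derive. unfold Rpower. auto_derive. easy.
Qed.

Lemma hecke_err_lim w : 0 < Im w ->
  filterlim (fun s => hecke_err s w) (at_right 0) (locally (hecke_err 0 w)).
Proof.
intros HY. assert (Hw : 0 < Cmod w).
{ eapply Rlt_le_trans; [exact HY|]. eapply Rle_trans; [apply Rle_abs|apply im_le_Cmod]. }
assert (HY1 : 0 < Im (w + 1)%C) by (destruct w; simpl in *; lra).
unfold hecke_err. apply (clim_minus (at_right 0)); [now apply hecke_lim|].
apply (clim_minus (at_right 0)); now apply prim_lim.
Qed.

Definition zs (N : nat) : list Z := map (fun k => (Z.of_nat k - Z.of_nat N)%Z) (seq 0 (2 * N + 1)).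

Lemma zs_In N n : In n (zs N) <-> (- Z.of_nat N <= n <= Z.of_nat N)%Z.
Proof.
unfold zs. rewrite in_map_iff. split.
- intros [k [<- Hk]]. apply in_seq in Hk. lia.
- intros Hn. exists (Z.to_nat (n + Z.of_nat N)). rewrite in_seq. lia.
Qed.

Lemma zs_NoDup N : NoDup (zs N).
Proof.
apply (NoDup_map_inj _ all_nat); [intros; lia|apply Forall_forall; easy|apply seq_NoDup].
Qed.

Lemma zs_telescope (g : Z -> C) N :
  lfold Cplus (RtoC 0) (fun n => g (n + 1)%Z - g n)%C (zs N) = (g (Z.of_nat N + 1)%Z - g (- Z.of_nat N)%Z)%C.
Proof.
unfold zs. rewrite lfold_map.
assert (H : forall k, lfold Cplus (RtoC 0) (fun i => g (Z.of_nat i - Z.of_nat N + 1)%Z - g (Z.of_nat i - Z.of_nat N)%Z)%C (seq 0 k)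
  = (g (Z.of_nat k - Z.of_nat N)%Z - g (- Z.of_nat N)%Z)%C).
{ induction k as [|k IH].
  - unfold lfold. simpl. ring.
  - rewrite seq_S, (lfold_app Cplus_monoid), IH. unfold lfold. cbn [map fold_right]. rewrite Nat.add_0_l.
    replace (Z.of_nat k - Z.of_nat N + 1)%Z with (Z.of_nat (S k) - Z.of_nat N)%Z by lia. ring. }
rewrite H. do 2 f_equal. lia.
Qed.

Lemma row_seq {op e} (A : Z * Z -> Prop) (f : Z * Z -> C) m l :
  (forall n, A (m, n)) -> is_fam op e (fun p => A p /\ fst p = m) f l ->
  filterlim (fun N => lfold op e (fun n => f (m, n)) (zs N)) eventually (locally l).
Proof.
intros HA H.
assert (H1 := fam_seq (op := op) (e := e) (fun p => A p /\ fst p = m) f l (fun N => map (pair m) (zs N))).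
apply (filterlim_ext (fun N => lfold op e f (map (pair m) (zs N)))).
- intros N. apply lfold_map.
- apply H1; [..|exact H].
  + intros N. apply (NoDup_map_inj _ (fun _ => True)); [intros; congruence|apply Forall_forall; easy|apply zs_NoDup].
  + intros N. apply Forall_map, Forall_forall. intros n _. simpl. now split.
  + intros [m' n] [_ Hm]. simpl in Hm. subst m'. exists (Z.abs_nat n). intros N HN.
    apply in_map, zs_In. lia.
Qed.

Lemma pt_succ tau m n : pt tau (m, n + 1)%Z = (pt tau (m, n) + 1)%C.
Proof. unfold pt. simpl. rewrite plus_IZR, RtoC_plus. ring. Qed.

(** Far out on a horizontal line the powers of [|w|] in [prim] vanish and only the term with [theta] survives, with
    opposite signs at the two ends. *)
Lemma prim_far s Y : 0 < Y -> 0 <= s -> forall eps, 0 < eps -> exists x0, forall x, x0 <= x ->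
  let T := (s / 2) * (Rpower (Y * Y) (- (1 + s / 2)) * Y * theta_sup (1 + s / 2)) / (1 + s / 2) in
  Cmod (prim s (x, Y) - (- RtoC T))%C < eps /\ Cmod (prim s ((- x)%R, Y) - RtoC T)%C < eps.
Proof.
intros HY Hs eps Heps.
set (e := 1 + s / 2). assert (He : 1 <= e) by (unfold e; lra).
set (c := Rpower (Y * Y) (- e) * Y).
assert (Hc : 0 < c) by (unfold c; apply Rmult_lt_0_compat; [apply Rpower_pos|easy]).
destruct (theta_sup_spec e He) as [HK1 [HK2 HK3]].
set (K := theta_sup e) in *.
set (d := eps / 4 / (1 + s / 2 * c)).
assert (Hsc : 0 <= s / 2 * c) by (apply Rmult_le_pos; lra).
assert (Hd : 0 < d) by (unfold d; repeat apply Rdiv_lt_0_compat; lra).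
destruct (HK3 d Hd) as [v0 Hv0].
exists (Rmax 1 (Rmax (v0 * Y) (4 * (1 + Y) / eps))).
intros x Hx. cbv zeta.
assert (Hx1 := Rle_trans _ _ _ (Rmax_l _ _) Hx).
assert (Hx2 := Rle_trans _ _ _ (Rmax_r _ _) Hx).
assert (Hx3 := Rle_trans _ _ _ (Rmax_l _ _) Hx2).
assert (Hx4 := Rle_trans _ _ _ (Rmax_r _ _) Hx2).
assert (Hv : v0 <= x / Y) by (apply Rle_div_r; lra).
assert (Hth := Hv0 _ Hv). assert (Hth2 := HK2 (x / Y)).
fold e. fold c.
set (q := Rpower (x * x + Y * Y) (- e)).
assert (Hq : q <= / (x * x)).
{ apply Rle_trans with (Rpower (x * x + Y * Y) (-1)).
  - apply Rle_Rpower; nra.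
  - rewrite Rpower_m1 by nra. apply Rinv_le_contravar; nra. }
assert (Hq0 : 0 < q) by apply Rpower_pos.
assert (Hxq : x * q <= eps / 4 /\ Y * q <= eps / 4).
{ assert (Hix : / x <= eps / (4 * (1 + Y))).
  { apply Rle_trans with (/ (4 * (1 + Y) / eps)).
    - apply Rinv_le_contravar; [apply Rdiv_lt_0_compat; lra|easy].
    - right. field. lra. }
  assert (E : (1 + Y) * / x <= eps / 4).
  { apply Rle_trans with ((1 + Y) * (eps / (4 * (1 + Y)))); [apply Rmult_le_compat_l; lra|]. right. field. lra. }
  assert (Hxi : 0 < / x) by (apply Rinv_0_lt_compat; lra).
  assert (Hxqi : x * q <= / x).
  { apply Rle_trans with (x * / (x * x)); [apply Rmult_le_compat_l; lra|]. right. field. lra. }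
  assert (Hq1 : q <= / x) by nra.
  split; nra. }
assert (Hdc : s / 2 * c * d <= eps / 4).
{ unfold d. replace (s / 2 * c * (eps / 4 / (1 + s / 2 * c))) with (s / 2 * c * (eps / 4) / (1 + s / 2 * c)) by (field; lra).
  apply Rle_div_l; nra. }
assert (Hee : 0 < / e <= 1).
{ split; [apply Rinv_0_lt_compat; lra|]. rewrite <- Rinv_1. apply Rinv_le_contravar; lra. }
assert (Hbound : Rabs (- (x * q) - (e - 1) * (c * theta e (x / Y)) + s / 2 * (c * K)) <= eps / 2 /\ Rabs (Y * q) <= eps / 4).
{ split.
  - replace (e - 1) with (s / 2) by (unfold e; ring).
    replace (- (x * q) - s / 2 * (c * theta e (x / Y)) + s / 2 * (c * K))
      with (s / 2 * c * (K - theta e (x / Y)) - x * q) by ring.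
    assert (0 <= s / 2 * c * (K - theta e (x / Y)) <= s / 2 * c * d).
    { split; [apply Rmult_le_pos; lra|apply Rmult_le_compat_l; lra]. }
    apply Rabs_le. assert (0 <= x * q) by nra. lra.
  - rewrite Rabs_right; nra. }
destruct Hbound as [Hb1 Hb2].
assert (Hsm : forall u, Rabs u <= eps / 2 -> Rabs (u * / e) <= eps / 2).
{ intros u Hu. rewrite Rabs_mult, (Rabs_right (/ e)) by lra. pose proof (Rabs_pos u). nra. }
assert (Hsm2 : forall u, Rabs u <= eps / 4 -> Rabs (u * / e) <= eps / 4).
{ intros u Hu. rewrite Rabs_mult, (Rabs_right (/ e)) by lra. pose proof (Rabs_pos u). nra. }
apply Hsm in Hb1. apply Hsm2 in Hb2.
split; (eapply Rle_lt_trans; [apply Cmod_le_sum|]); unfold prim; fold e; simpl;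
  unfold prim_re, prim_im, line_theta; fold c.
- fold q.
  replace ((- x * q - (e - 1) * (c * theta e (x / Y))) / e + - - (s / 2 * (c * K) / e))
    with ((- (x * q) - (e - 1) * (c * theta e (x / Y)) + s / 2 * (c * K)) * / e) by (field; lra).
  replace (Y * q / e + - - 0) with (Y * q * / e) by (field; lra). lra.
- replace (- x * - x) with (x * x) by ring. fold q.
  replace (- x / Y) with (- (x / Y)) by (field; lra). rewrite theta_odd.
  replace ((- - x * q - (e - 1) * (c * - theta e (x / Y))) / e + - (s / 2 * (c * K) / e))
    with (- ((- (x * q) - (e - 1) * (c * theta e (x / Y)) + s / 2 * (c * K)) * / e)) by (field; lra).
  replace (Y * q / e + - 0) with (Y * q * / e) by (field; lra). rewrite Rabs_Ropp. lra.
Qed.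

Definition row_defect (s Y : R) : R :=
  - (s * Rpower Y (-1 - s) * theta_sup (1 + s / 2) / (1 + s / 2)).

(** The increments telescope, and [theta] jumps by [2 theta_sup] along the row. The factor [s] in [row_defect] is
    harmless in one row, but summed over all rows it meets the pole of the zeta function: this is
    the source of the non-holomorphic term of [G2_star]. *)
Lemma row_telescope tau m s : 0 < Im tau -> (0 < m)%Z -> 0 <= s ->
  filterlim (fun N => lfold Cplus (RtoC 0) (fun n => prim s (pt tau (m, n) + 1) - prim s (pt tau (m, n)))%C (zs N))
    eventually (locally (RtoC (row_defect s (IZR m * Im tau)))).
Proof.
intros Ht Hm Hs. set (Y := IZR m * Im tau).
assert (HY : 0 < Y) by (apply Rmult_lt_0_compat; [now apply IZR_lt|easy]).
set (x := IZR m * Re tau).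
assert (Hpt : forall n, pt tau (m, n) = (x + IZR n, Y) :> C).
{ intros n. apply injective_projections; simpl; unfold x, Y, Re, Im; ring. }
apply (clim_ext_loc eventually (fun N => prim s (pt tau (m, Z.of_nat N + 1)%Z) - prim s (pt tau (m, - Z.of_nat N)%Z))%C).
{ apply filter_forall. intros N. rewrite <- (zs_telescope (fun n => prim s (pt tau (m, n))) N).
  apply lfold_ext. intros n _. now rewrite pt_succ. }
apply (clim_iff eventually). intros eps Heps.
destruct (prim_far s Y HY Hs (eps / 2) ltac:(lra)) as [x0 Hx0]. cbv zeta in Hx0.
set (T := s / 2 * (Rpower (Y * Y) (- (1 + s / 2)) * Y * theta_sup (1 + s / 2)) / (1 + s / 2)) in Hx0.
destruct (INR_unbounded (Rabs x0 + Rabs x)) as [N0 HN0].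
exists N0. intros N HN. apply le_INR in HN.
assert (HT : row_defect s Y = - T - T).
{ unfold row_defect, T. 
  assert (E : Rpower (Y * Y) (- (1 + s / 2)) * Y = Rpower Y (-1 - s)).
  { replace (Y * Y) with (Y ^ 2) by ring. rewrite <- (Rpower_pow 2 Y HY), Rpower_mult, <- Rpower_S by easy.
    f_equal. simpl. field. }
  rewrite E. field. lra. }
rewrite !Hpt, HT. rewrite plus_IZR, opp_IZR, <- INR_IZR_INZ.
assert (A1 := Rle_abs x0). assert (A2 := Rle_abs x). assert (A3 := Rle_abs (- x)). rewrite Rabs_Ropp in A3.
destruct (Hx0 (x + (INR N + 1)) ltac:(lra)) as [H1 _].
destruct (Hx0 (- (x - INR N)) ltac:(lra)) as [_ H2].
replace (- - (x - INR N)) with (x + - INR N) in H2 by ring.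
replace (prim s ((x + (INR N + 1))%R, Y) - prim s ((x + - INR N)%R, Y) - RtoC (- T - T))%C
  with ((prim s ((x + (INR N + 1))%R, Y) - (- RtoC T)) - (prim s ((x + - INR N)%R, Y) - RtoC T))%C
  by (rewrite RtoC_minus, RtoC_opp; ring).
eapply Rle_lt_trans; [apply Cmod_triangle|]. rewrite Cmod_opp. lra.
Qed.

Lemma lfold_RtoC {I} (g : I -> R) L : lfold Cplus (RtoC 0) (fun i => RtoC (g i)) L = RtoC (lsum g L).
Proof.
unfold lfold, lsum. induction L as [|a L IH]; simpl; [easy|]. now rewrite IH, <- RtoC_plus.
Qed.

(** Telescoping confines [s zeta (1 + s)] to the interval from [1] to [1 + s]; hence the zeta function has
    a simple pole at [1] with residue [1]. *)
Lemma zeta_pole s Z : 0 < s ->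
  is_fsum all_nat (fun k => RtoC (s * Rpower (1 + INR k) (-1 - s))) Z -> Cmod (Z - 1)%C <= s.
Proof.
intros Hs HZ. set (g := fun k => s * Rpower (1 + INR k) (-1 - s)) in *.
assert (Hg : forall k, 0 <= g k) by (intros k; apply Rmult_le_pos; [lra|apply Rlt_le, Rpower_pos]).
assert (Hlow : forall n, 1 - Rpower (1 + INR n) (- s) <= lsum g (seq 0 n)).
{ induction n as [|n IH].
  - unfold lsum; simpl. rewrite Rplus_0_r. unfold Rpower. rewrite ln_1, Rmult_0_r, exp_0. lra.
  - rewrite seq_S, lsum_app. change (lsum g [(0 + n)%nat]) with (g n + 0).
    assert (Hn := pos_INR n).
    destruct (Rpower_step (1 + INR n) s) as [_ H]; [lra|lra|].
    rewrite S_INR. replace (1 + (INR n + 1)) with (1 + INR n + 1) by ring. unfold g at 2. lra. }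
assert (Hup : forall n, lsum g (seq 0 (S n)) <= s + (1 - Rpower (1 + INR n) (- s))).
{ induction n as [|n IH].
  - unfold lsum; simpl. unfold g; simpl. rewrite !Rplus_0_r. unfold Rpower.
    rewrite ln_1, !Rmult_0_r, exp_0. lra.
  - rewrite seq_S, lsum_app. change (lsum g [(0 + S n)%nat]) with (g (S n) + 0).
    assert (Hn := pos_INR n).
    destruct (Rpower_step (1 + INR n) s) as [H _]; [lra|lra|].
    unfold g at 2. rewrite S_INR. replace (1 + (INR n + 1)) with (1 + INR n + 1) by ring. lra. }
apply le_epsilon. intros eps Heps.
set (d := Rmin eps (1 / 2)). assert (Hd : 0 < d) by (apply Rmin_pos; lra).
assert (Hde : d <= eps) by apply Rmin_l.
destruct (INR_unbounded (Rpower d (- / s))) as [N HN].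
assert (HNd : Rpower (1 + INR N) (- s) <= d).
{ apply Rle_trans with (Rpower (Rpower d (- / s)) (- s)).
  - apply Rpower_nonpos_anti; [apply Rpower_pos|lra|lra].
  - rewrite Rpower_mult. replace (- / s * - s) with 1 by (field; lra). rewrite Rpower_1; lra. }
apply (fam_closed (op := Cplus) (e := RtoC 0) all_nat (fun k => RtoC (g k))); [exact HZ|].
exists (seq 0 N). split; [apply Forall_forall; easy|].
intros L HL _ Hi. rewrite lfold_RtoC, <- RtoC_minus, Cmod_R.
assert (H1 : lsum g (seq 0 N) <= lsum g L) by (apply lsum_incl; [apply seq_NoDup|easy|easy|auto]).
assert (H2 : lsum g L <= lsum g (seq 0 (S (list_max L)))) by now apply lsum_le_prefix.
specialize (Hlow N). specialize (Hup (list_max L)).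
pose proof (Rpower_pos (1 + INR (list_max L)) (- s)).
apply Rabs_le. lra.
Qed.

Lemma hecke_summable tau s : 0 < Im tau -> 0 < s ->
  summable nonzero (fun p => Cmod (hecke s (pt tau p))).
Proof.
intros Ht Hs. apply summable_ext with (2 := lattice_summable tau (2 + s) Ht ltac:(lra)).
intros p Hp. symmetry. apply Cmod_hecke. now apply pt_neq0.
Qed.

Lemma hecke_0 w : 0 < Cmod w -> hecke 0 w = (/ w ^ 2)%C.
Proof. intros H. unfold hecke. rewrite Rpower_O by easy. f_equal. ring. Qed.

(** Hecke's trick. The increments of the primitive along the rows are subtracted from the summands; what
    remains is dominated by [|w|^(-3)], so the limit may be taken term by term. The increments add up to
    a constant times [s zeta (1 + s)], and contribute the term [- pi / (2 Im tau)]. *)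
Lemma hecke_limit tau : 0 < Im tau -> exists (e2 : Z -> C) (tot : C),
  (forall m, (0 < m)%Z ->
    filterlim (fun N => lfold Cplus (RtoC 0) (fun n => / pt tau (m, n) ^ 2)%C (zs N)) eventually (locally (e2 m))) /\
  is_fsum (fun m => (0 < m)%Z) e2 tot /\
  forall E, (forall s, 0 < s -> is_fsum upper (fun p => hecke s (pt tau p)) (E s)) ->
    filterlim E (at_right 0) (locally (tot - RtoC (PI / (2 * Im tau)))%C).
Proof.
intros Ht. set (y := Im tau) in *.
destruct (hecke_err_bound y Ht) as [K [HK Hbound]].
set (g := fun p => K * Rpower (Cmod (pt tau p)) (- (3))).
assert (Hg : summable upper g).
{ apply summable_scal; [easy|]. apply summable_subset with (1 := upper_nonzero).
  apply lattice_summable; [easy|lra]. }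
assert (Hgb : forall s, 0 <= s <= 1 -> forall p, upper p -> Cmod (hecke_err s (pt tau p)) <= g p).
{ intros s Hs p Hp. apply Hbound; [easy|]. now apply Im_pt_upper. }
assert (Her : forall s, exists l, 0 <= s <= 1 -> is_fsum upper (fun p => hecke_err s (pt tau p)) l).
{ intros s. destruct (excluded_middle_informative (0 <= s <= 1)) as [Hs|Hs].
  - destruct (fsum_exists upper (fun p => hecke_err s (pt tau p)) g Hg (Hgb s Hs)) as [l Hl]. now exists l.
  - now exists (RtoC 0). }
apply skolem in Her. destruct Her as [er Her].
assert (He2 : forall m, exists l, is_fsum (fun p => upper p /\ fst p = m) (fun p => hecke_err 0 (pt tau p)) l).
{ intros m. apply (fsum_exists _ _ g).
  - apply summable_subset with (2 := Hg). tauto.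
  - intros p [Hp _]. apply Hgb; [lra|easy]. }
apply skolem in He2. destruct He2 as [e2 He2].
exists e2, (er 0). split; [|split].
(* at s = 0 the increments along a row cancel, so the errors add up to the symmetric row sums of w^(-2) *)
- intros m Hm.
  assert (H1 := row_seq upper _ m _ (fun n => Hm) (He2 m)).
  assert (H2 := row_telescope tau m 0 Ht Hm (Rle_refl _)).
  replace (row_defect 0 (IZR m * Im tau)) with 0 in H2 by (unfold row_defect; field).
  assert (H3 := clim_plus eventually _ _ _ _ H1 H2).
  replace (e2 m + 0)%C with (e2 m) in H3 by ring.
  revert H3. apply filterlim_ext. intros N. rewrite <- (lfold_op Cplus_monoid).
  apply lfold_ext. intros n _. unfold hecke_err. rewrite hecke_0.
  + ring.
  + apply pt_neq0; [easy|]. now apply upper_nonzero.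
- apply (fam_fubini Cplus_monoid fst upper (fun m => (0 < m)%Z) (fun p => hecke_err 0 (pt tau p))).
  + easy.
  + intros m _. apply He2.
  + apply Her. lra.
- (* z s is the family s / n^(1 + s), and c s the constant in front of s zeta (1 + s) *)
  intros E HE.
  set (z := fun s k => s * Rpower (1 + INR k) (-1 - s)).
  assert (Hz : forall s, exists l, 0 < s -> is_fsum all_nat (fun k => RtoC (z s k)) l).
  { intros s. destruct (Rlt_dec 0 s) as [Hs|Hs]; [|now exists (RtoC 0)].
    destruct (fsum_exists all_nat (fun k => RtoC (z s k)) (z s)) as [l Hl].
    - apply summable_scal; [lra|]. apply summable_ext with (2 := summable_nat_pow (1 + s) ltac:(lra)).
      intros k _. f_equal. ring.
    - intros k _. rewrite Cmod_R, Rabs_right; [lra|]. apply Rle_ge, Rmult_le_pos; [lra|apply Rlt_le, Rpower_pos].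
    - now exists l. }
  apply skolem in Hz. destruct Hz as [zt Hzt].
  set (c := fun s => - (Rpower y (-1 - s) * theta_sup (1 + s / 2) / (1 + s / 2))).
  assert (Hdec : forall s, 0 < s <= 1 -> E s = (er s + RtoC (c s) * zt s)%C).
  { intros s Hs. specialize (HE s ltac:(lra)). assert (Hers := Her s ltac:(lra)).
    set (delta := fun p => (prim s (pt tau p + 1) - prim s (pt tau p))%C).
    assert (HD : is_fsum upper delta (E s - er s)%C).
    { apply fam_ext with (2 := fsum_minus _ _ _ _ _ HE Hers).
      intros p _. unfold delta, hecke_err. ring. }
    assert (Hrow : is_fsum (fun m => (0 < m)%Z) (fun m => RtoC (row_defect s (IZR m * y))) (E s - er s)%C).
    { apply (fam_fubini Cplus_monoid fst upper (fun m => (0 < m)%Z) delta); [easy| |easy].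
      intros m Hm.
      destruct (fsum_exists (fun p => upper p /\ fst p = m) delta
        (fun p => Cmod (hecke s (pt tau p)) + g p)) as [l Hl].
      - apply summable_subset with (A' := upper); [tauto|]. apply summable_plus; [|easy].
        apply summable_subset with (1 := upper_nonzero). apply hecke_summable; [easy|lra].
      - intros p [Hp _]. specialize (Hgb s ltac:(lra) p Hp).
        replace (delta p) with (hecke s (pt tau p) - hecke_err s (pt tau p))%C by (unfold delta, hecke_err; ring).
        eapply Rle_trans; [apply Cmod_triangle|]. rewrite Cmod_opp. lra.
      - assert (H1 := row_seq upper _ m _ (fun n => Hm) Hl).
        assert (H2 := row_telescope tau m s Ht Hm ltac:(lra)).
        fold y in H2. rewrite <- (clim_unique eventually _ _ _ H1 H2). exact Hl. }
    assert (Hnat : is_fsum (fun m => (0 < m)%Z) (fun m => RtoC (row_defect s (IZR m * y))) (RtoC (c s) * zt s)%C).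
    { apply (fam_reindex Cplus_monoid (fun k => Z.of_nat (S k)) all_nat).
      - intros; lia.
      - intros; lia.
      - intros m Hm. exists (Z.to_nat m - 1)%nat. split; [easy|lia].
      - apply fam_ext with (2 := fsum_scal _ _ (RtoC (c s)) _ (Hzt s ltac:(lra))).
        intros k _. rewrite <- RtoC_mult. f_equal. unfold c, z, row_defect.
        rewrite <- INR_IZR_INZ, S_INR. assert (Hk := pos_INR k).
        rewrite <- (Rpower_mult_distr (INR k + 1) y) by lra.
        rewrite (Rplus_comm 1 (INR k)). field. lra. }
    assert (Heq := fam_unique _ _ _ _ Hrow Hnat).
    rewrite <- Heq. ring. }
  apply (clim_ext_loc (at_right 0) (fun s => er s + RtoC (c s) * zt s)%C).
  { apply at_right_0_iff. exists 1. split; [lra|]. intros s Hs. symmetry. apply Hdec. lra. }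
  replace (er 0 - RtoC (PI / (2 * y)))%C with (er 0 + RtoC (- (/ y * (PI / 2) / 1)) * 1)%C.
  2: { replace (PI / (2 * y)) with (/ y * (PI / 2) / 1) by (field; lra). rewrite RtoC_opp. ring. }
  apply (clim_plus (at_right 0)); [|apply (clim_mult (at_right 0))].
  + apply (fsum_tannery (at_right 0) upper (fun s p => hecke_err s (pt tau p)) g (fun p => hecke_err 0 (pt tau p))); [easy| | | |].
    * apply at_right_0_iff. exists 1. split; [lra|]. intros s Hs p Hp. apply Hgb; [lra|easy].
    * intros p Hp. apply hecke_err_lim. eapply Rlt_le_trans; [exact Ht|]. now apply Im_pt_upper.
    * apply at_right_0_iff. exists 1. split; [lra|]. intros s Hs. apply Her. lra.
    * apply Her. lra.
  + apply (clim_RtoC (at_right 0)).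
    set (h := fun s => - (Rpower y (-1 - s) / (1 + s / 2))).
    assert (Hh : filterlim h (at_right 0) (locally (h 0))).
    { apply rlim_at_right_of_ex_derive. unfold h, Rpower. auto_derive. lra. }
    apply (filterlim_ext (fun s => h s * theta_sup (1 + s / 2))).
    { intros s. unfold h, c, Rdiv. ring. }
    replace (- (/ y * (PI / 2) / 1)) with (h 0 * (PI / 2)).
    2: { unfold h. replace (-1 - 0) with (-1) by ring. rewrite Rpower_m1 by easy. field. lra. }
    eapply (filterlim_comp_2 (F := at_right 0)); [exact Hh|exact theta_sup_lim|].
    apply (filterlim_mult (K := R_AbsRing)).
  + apply (clim_iff (at_right 0)). intros eps Heps. apply at_right_0_iff.
    exists eps. split; [easy|]. intros s Hs.
    eapply Rle_lt_trans; [apply (zeta_pole s)|]; [lra|apply Hzt; lra|lra].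
Qed.

(** * The A-hat genus as a product over the lattice *)

(** One lattice point from each pair [w], [- w]: these pairs give the same element of [X tau s]. *)
Definition half (p : Z * Z) : Prop := (0 < fst p \/ (fst p = 0 /\ 0 < snd p))%Z.
Definition primitive (p : Z * Z) : Prop := half p /\ Z.gcd (fst p) (snd p) = 1%Z.

(** Every point of the half lattice is a multiple of exactly one primitive point, by a positive integer [k + 1].
    So a product over the lattice is a product over the primitive points, the index set of [X tau s], and over
    [k], the index of the factors in Euler's product for a single element of [X tau s]. *)
Definition multiple (q : nat * (Z * Z)) : Z * Z :=
  ((Z.of_nat (S (fst q)) * fst (snd q))%Z, (Z.of_nat (S (fst q)) * snd (snd q))%Z).

Definition pairs (q : nat * (Z * Z)) : Prop := all_nat (fst q) /\ primitive (snd q).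

Lemma half_nonzero p : half p -> nonzero p.
Proof. intros H ->. unfold half in H. simpl in H. lia. Qed.

Lemma pairs_nonzero q : pairs q -> nonzero (snd q).
Proof. intros [_ [H _]]. now apply half_nonzero. Qed.

Lemma multiple_half q : pairs q -> half (multiple q).
Proof. destruct q as [k [m n]]. intros [_ [H _]]. unfold half, multiple in *. cbn [fst snd] in *. nia. Qed.

Lemma multiple_inj q q' : pairs q -> pairs q' -> multiple q = multiple q' -> q = q'.
Proof.
destruct q as [k [m n]], q' as [k' [m' n']]. intros [_ [_ G]] [_ [_ G']].
unfold multiple. cbn [fst snd] in *. intros H.
assert (H1 := f_equal fst H). assert (H2 := f_equal snd H). cbn [fst snd] in H1, H2.
assert (E : Z.of_nat (S k) = Z.of_nat (S k')).
{ assert (A : Z.gcd (Z.of_nat (S k) * m) (Z.of_nat (S k) * n) = Z.of_nat (S k)).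
  { rewrite Z.gcd_mul_mono_l_nonneg, G by lia. lia. }
  assert (A' : Z.gcd (Z.of_nat (S k') * m') (Z.of_nat (S k') * n') = Z.of_nat (S k')).
  { rewrite Z.gcd_mul_mono_l_nonneg, G' by lia. lia. }
  rewrite H1, H2 in A. congruence. }
rewrite <- E in H1, H2. apply Z.mul_reg_l in H1, H2; try lia. subst. f_equal. lia.
Qed.

Lemma multiple_surj p : half p -> exists q, pairs q /\ multiple q = p.
Proof.
destruct p as [m n]. intros H.
set (g := Z.gcd m n).
assert (Hg : (0 < g)%Z).
{ assert (Hg0 : (0 <= g)%Z) by apply Z.gcd_nonneg. assert (g <> 0)%Z; [|lia].
  intros H0. assert (m = 0 /\ n = 0)%Z as [-> ->].
  { split; [now apply (Z.gcd_eq_0_l m n)|now apply (Z.gcd_eq_0_r m n)]. }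
  unfold half in H. simpl in H. lia. }
destruct (Z.gcd_divide_l m n) as [m' Hm]. destruct (Z.gcd_divide_r m n) as [n' Hn].
fold g in Hm, Hn.
exists ((Z.to_nat g - 1)%nat, (m', n')).
assert (Es : Z.of_nat (S (Z.to_nat g - 1)) = g) by lia.
split; [split; [easy|split]|].
- unfold half in *. cbn [fst snd] in *. nia.
- cbn [fst snd]. assert (E : g = (g * Z.gcd m' n')%Z).
  { rewrite <- Z.gcd_mul_mono_l_nonneg by lia.
    rewrite (Z.mul_comm g m'), (Z.mul_comm g n'), <- Hm, <- Hn. reflexivity. }
  nia.
- unfold multiple. cbn [fst snd]. rewrite Es. f_equal; lia.
Qed.

Lemma pt_multiple tau q : pt tau (multiple q) = (RtoC (INR (fst q) + 1) * pt tau (snd q))%C.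
Proof.
destruct q as [k [m n]]. unfold pt, multiple. cbn [fst snd].
rewrite !mult_IZR, <- INR_IZR_INZ, S_INR, !RtoC_mult. ring.
Qed.

Lemma hecke_multiple tau s q : 0 < Im tau -> pairs q ->
  hecke s (pt tau (multiple q)) =
  (RtoC (Rpower (1 + INR (fst q)) (- (2 + s))) * hecke s (pt tau (snd q)))%C.
Proof.
intros Ht Hq. assert (Hw := pt_neq0 tau _ Ht (pairs_nonzero _ Hq)).
rewrite pt_multiple. unfold hecke. assert (Hk := pos_INR (fst q)).
set (w := pt tau (snd q)) in *. set (k := INR (fst q)) in *.
assert (Hw0 : w <> RtoC 0) by now apply Cmod_gt_0.
rewrite Cmod_mult, Cmod_R, Rabs_right by lra.
rewrite <- Rpower_mult_distr by lra. rewrite Rpower_Ropp, Rpower_plus.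
replace 2 with (INR 2) by (simpl; lra). rewrite (Rpower_pow 2) by lra.
rewrite (Rplus_comm 1 k).
assert (Hp1 := Rpower_pos (k + 1) s). assert (Hp2 := Rpower_pos (Cmod w) s).
rewrite RtoC_inv, !RtoC_mult, RtoC_pow by (apply Rmult_integral_contrapositive; split; [apply pow_nonzero|]; lra).
field. repeat split; try (intros H; apply RtoC_inj in H; lra). easy.
Qed.

Lemma hecke_opp s w : hecke s (- w)%C = hecke s w.
Proof. unfold hecke. rewrite Cmod_opp. f_equal. ring. Qed.

Lemma primitive_nonzero p : primitive p -> nonzero p.
Proof. intros [H _]. now apply half_nonzero. Qed.

Lemma pt_inj tau p p' : 0 < Im tau -> pt tau p = pt tau p' -> p = p'.
Proof.
intros Ht H. assert (H1 := Im_pt tau p). assert (H2 := Im_pt tau p').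
assert (H3 := Re_pt tau p). assert (H4 := Re_pt tau p').
destruct p as [m n], p' as [m' n']. cbn [fst snd] in *.
assert (Em : IZR m = IZR m') by (apply Rmult_eq_reg_r with (Im tau); [congruence|lra]).
rewrite H, Em in *. apply eq_IZR in Em. subst m'. f_equal. apply eq_IZR. lra.
Qed.

Lemma pt_opp tau m n : pt tau (- m, - n)%Z = (- pt tau (m, n))%C.
Proof. unfold pt. cbn [fst snd]. rewrite !opp_IZR, !RtoC_opp. ring. Qed.

(** The points of [X tau s] are indexed bijectively by the primitive lattice points up to sign;
    for [s > 0] the modulus of [w] can be read off the value. *)
Lemma hecke_primitive_inj tau s p p' : 0 < Im tau -> 0 < s -> primitive p -> primitive p' ->
  hecke s (pt tau p) = hecke s (pt tau p') -> p = p'.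
Proof.
intros Ht Hs Hp Hp' H.
assert (H1 := pt_neq0 tau p Ht (primitive_nonzero _ Hp)).
assert (H2 := pt_neq0 tau p' Ht (primitive_nonzero _ Hp')).
set (w := pt tau p) in *. set (w' := pt tau p') in *.
assert (Hm : Cmod w = Cmod w').
{ assert (HC := f_equal Cmod H). rewrite !Cmod_hecke in HC by easy.
  unfold Rpower in HC. apply exp_inv in HC. apply ln_inv; [easy|easy|].
  apply Rmult_eq_reg_l with (- (2 + s)); [easy|lra]. }
assert (Hw : w <> RtoC 0) by now apply Cmod_gt_0.
assert (Hw' : w' <> RtoC 0) by now apply Cmod_gt_0.
assert (Hsq : ((w - w') * (w + w'))%C = 0).
{ unfold hecke in H. rewrite <- Hm in H.
  set (r := RtoC (Rpower (Cmod w) s)) in *.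
  assert (Hr : r <> RtoC 0).
  { intros H0. apply RtoC_inj in H0. pose proof (Rpower_pos (Cmod w) s). lra. }
  assert (E : (w ^ 2 * r)%C = (w' ^ 2 * r)%C).
  { replace (w ^ 2 * r)%C with (/ / (w ^ 2 * r))%C by (field; now split).
    rewrite H. field. now split. }
  replace ((w - w') * (w + w'))%C with ((w ^ 2 * r - w' ^ 2 * r) / r)%C by (field; easy).
  rewrite E. field. easy. }
destruct (Ceq_dec (w - w')%C 0) as [E|E].
- apply (pt_inj tau); [easy|]. apply Cmod_sub_eq0. fold w w'. rewrite E. apply Cmod_0.
- assert (E2 : (w + w')%C = 0).
  { destruct (Ceq_dec (w + w')%C 0) as [|E2]; [easy|]. exfalso. now apply (Cmult_neq_0 _ _ E E2). }
  exfalso. destruct p as [m n], p' as [m' n'].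
  assert (E3 : (m, n) = (- m', - n')%Z).
  { apply (pt_inj tau); [easy|]. rewrite pt_opp. fold w w'.
    replace w with ((w + w') - w')%C by ring. rewrite E2. ring. }
  injection E3 as -> ->. destruct Hp as [Hp _], Hp' as [Hp' _].
  unfold half in Hp, Hp'. cbn [fst snd] in *. lia.
Qed.

Lemma X_iff tau s x : X tau s x <-> exists p, primitive p /\ hecke s (pt tau p) = x.
Proof.
split.
- intros [m [n [G ->]]]. cbv zeta.
  destruct (Z_lt_le_dec m 0) as [Hm|Hm]; [|destruct (Z_lt_le_dec 0 m) as [Hm'|Hm']].
  + exists (- m, - n)%Z. split.
    * split; [unfold half; cbn [fst snd]; lia|]. cbn [fst snd]. now rewrite Z.gcd_opp_l, Z.gcd_opp_r.
    * rewrite pt_opp, hecke_opp. reflexivity.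
  + exists (m, n). split; [|reflexivity]. split; [unfold half; cbn [fst snd]; lia|easy].
  + assert (m = 0)%Z by lia. subst m. destruct (Z_lt_le_dec 0 n) as [Hn|Hn].
    * exists (0, n)%Z. split; [|reflexivity]. split; [unfold half; cbn [fst snd]; lia|easy].
    * exists (- 0, - n)%Z. rewrite pt_opp, hecke_opp. split; [|reflexivity].
      assert (n <> 0)%Z by (intros ->; discriminate).
      split; [unfold half; cbn [fst snd]; lia|]. cbn [fst snd]. now rewrite Z.gcd_opp_l, Z.gcd_opp_r.
- intros [[m n] [[_ G] <-]]. exists m, n. split; [easy|]. reflexivity.
Qed.

(** Euler's factors of [sinh h / h], for [h^2 = w / 4]. *)
Definition ahat_factor (w : C) (k : nat) : C := (1 + w * RtoC (inv_square k / (4 * (PI * PI))))%C.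

(** The reciprocal [T] of [Q_Ahat] is entire in [w], so it is a product of factors without any exception, and
    the poles of [Q_Ahat] are the zeros of [T]. *)
Lemma Q_Ahat_recip w : exists T, is_fprod all_nat (ahat_factor w) T /\
  (T = 0 -> Q_Ahat_pole w) /\ (~ Q_Ahat_pole w -> Q_Ahat w = (/ T)%C) /\
  ((forall k, ahat_factor w k <> RtoC 0) -> T <> RtoC 0) /\ (Q_Ahat_pole w -> T = 0).
Proof.
destruct (Ceq_dec w 0) as [->|Hw].
- exists (RtoC 1). repeat split.
  + apply fam_ext with (f := fun _ => RtoC 1); [intros; unfold ahat_factor; ring|].
    apply (clim_ext_loc (fin_sub all_nat) (fun _ => RtoC 1)); [|apply filterlim_const].
    apply filter_forall. intros L. unfold lfold. induction L as [|a L IH]; simpl; [easy|]. rewrite <- IH. ring.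
  + now apply C1_nz in H.
  + now apply C1_nz in H.
  + intros _. unfold Q_Ahat. destruct (Ceq_dec 0 0); [field|easy].
  + intros _. apply C1_nz.
  + intros [H _]. easy.
- set (c := (Csqrt w / 2)%C).
  assert (H2 : RtoC 2 <> RtoC 0) by (intros H; apply RtoC_inj in H; lra).
  assert (Hcc : (c * c)%C = (w / 4)%C).
  { unfold c. rewrite <- (Csqrt_sqr w) at 3. field; repeat split; intros H; apply RtoC_inj in H; lra. }
  assert (Hc : c <> RtoC 0).
  { intros H0. rewrite H0 in Hcc. apply Hw. replace w with (4 * (w / 4))%C by (field; intros H; apply RtoC_inj in H; lra).
    rewrite <- Hcc. ring. }
  assert (Hprod : is_fprod all_nat (ahat_factor w) (Csinh c / c)%C).
  { apply fam_ext with (2 := Csinh_fprod c Hc). intros k _. unfold sinh_factor, ahat_factor.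
    rewrite Hcc. assert (Hpi := PI_RGT_0).
    replace (inv_square k / (PI * PI)) with (4 * (inv_square k / (4 * (PI * PI)))) by (field; lra).
    rewrite (RtoC_mult 4). field; intros H; apply RtoC_inj in H; lra. }
  exists (Csinh c / c)%C. split; [easy|]. split; [|split; [|split]].
  + intros H. split; [easy|]. fold c. replace (Csinh c) with (Csinh c / c * c)%C by (field; easy).
    rewrite H. ring.
  + intros Hp. unfold Q_Ahat. destruct (Ceq_dec w 0); [easy|]. fold c.
    assert (Csinh c <> RtoC 0) by (intros H; apply Hp; now split).
    field. now split.
  + intros Hk. apply (fprod_neq0 all_nat (ahat_factor w)
      (fun k => (Cmod w / (4 * (PI * PI))) * inv_square k)); [| |easy|easy].
    * apply summable_scal; [|apply inv_square_summable].
      apply Rdiv_le_0_compat; [apply Cmod_ge_0|]. pose proof PI_RGT_0. nra.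
    * intros k _. unfold ahat_factor.
      match goal with |- Cmod (_ + ?u - _)%C <= _ => replace (1 + u - 1)%C with u by ring end.
      rewrite Cmod_mult, Cmod_R, Rabs_right.
      -- right. unfold Rdiv. ring.
      -- apply Rle_ge, Rdiv_le_0_compat; [apply Rlt_le, inv_square_pos|]. pose proof PI_RGT_0. nra.
  + intros [_ Hp]. fold c in Hp. rewrite Hp. field. easy.
Qed.

Lemma pairs_summable (b : Z * Z -> R) : summable primitive b ->
  summable pairs (fun q => inv_square (fst q) * b (snd q)).
Proof. intros H. exact (summable_prod _ _ _ _ inv_square_summable H). Qed.

(** The reciprocal of the genus is an absolutely convergent product over [pairs], which vanishes only together
    with one of its factors; grouping the factors that belong to the same primitive point gives the
    product over [X tau s] by Fubini. *)
Lemma Ahat_product tau s t : 0 < Im tau -> 0 < s ->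
  exists l, is_fprod pairs (fun q => ahat_factor (hecke s (pt tau (snd q)) * t) (fst q)) l /\
   (~ Ahat_pole (X tau s) t ->
     is_Cprod (X tau s) (fun x => Q_Ahat (x * t)%C) (/ l)%C) /\
   ((forall q, pairs q -> ahat_factor (hecke s (pt tau (snd q)) * t) (fst q) <> RtoC 0) ->
     ~ Ahat_pole (X tau s) t).
Proof.
intros Ht Hs. set (f := fun q => ahat_factor (hecke s (pt tau (snd q)) * t) (fst q)).
assert (Hpi := PI_RGT_0).
set (g := fun q : nat * (Z * Z) => (Cmod t / (4 * (PI * PI))) * (inv_square (fst q) * Cmod (hecke s (pt tau (snd q))))).
assert (Hg : summable pairs g).
{ apply summable_scal; [apply Rdiv_le_0_compat; [apply Cmod_ge_0|nra]|].
  apply (pairs_summable (fun p => Cmod (hecke s (pt tau p)))).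
  apply summable_subset with (1 := primitive_nonzero). now apply hecke_summable. }
assert (Hfg : forall q, pairs q -> Cmod (f q - 1)%C <= g q).
{ intros q _. unfold f, g, ahat_factor.
  match goal with |- Cmod (_ + ?u - _)%C <= _ => replace (1 + u - 1)%C with u by ring end.
  rewrite !Cmod_mult, Cmod_R, Rabs_right.
  - right. field. lra.
  - apply Rle_ge, Rdiv_le_0_compat; [apply Rlt_le, inv_square_pos|nra]. }
destruct (fprod_exists pairs f g Hg Hfg) as [l Hl].
exists l. split; [easy|].
(* T p is the product over k at the primitive point p *)
destruct (skolem _ (fun p => Q_Ahat_recip (hecke s (pt tau p) * t)%C)) as [T HT].
assert (HTl : is_fprod primitive T l).
{ apply (fam_fubini Cmult_monoid snd pairs primitive f); [now intros q [_ Hq]| |easy].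
  intros p Hp. destruct (HT p) as [H _].
  apply (fam_reindex Cmult_monoid (fun k => (k, p)) all_nat); [..|exact H].
  - congruence.
  - intros k _. now repeat split; try apply Hp.
  - intros [k p'] [_ E]. exists k. simpl in E. now subst p'. }
assert (Hpole : forall p, primitive p -> Q_Ahat_pole (hecke s (pt tau p) * t)%C -> Ahat_pole (X tau s) t).
{ intros p Hp H. exists (hecke s (pt tau p)). split; [|easy]. apply X_iff. now exists p. }
split.
- intros Hnp.
  assert (HT0 : forall p, primitive p -> T p <> RtoC 0).
  { intros p Hp H0. apply Hnp, (Hpole p Hp). now apply HT. }
  assert (Hl0 : l <> RtoC 0).
  { apply (fprod_neq0 pairs f g l Hg Hfg Hl). intros [k p] [_ Hp] H0. apply (HT0 p Hp).
    destruct (HT p) as [H _]. exact (fprod_zero all_nat _ _ k I H0 H). }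
  change (is_fprod (X tau s) (fun x => Q_Ahat (x * t)%C) (/ l)%C).
  apply (fam_reindex Cmult_monoid (fun p => hecke s (pt tau p)) primitive).
  + intros p p'. now apply hecke_primitive_inj.
  + intros p Hp. apply X_iff. now exists p.
  + intros x Hx. now apply X_iff in Hx.
  + apply fam_ext with (2 := fprod_inv primitive T l Hl0 HT0 HTl).
    intros p Hp. symmetry. apply HT. intros H. apply Hnp. now apply (Hpole p).
- intros Hk [x [Hx Hp]]. apply X_iff in Hx. destruct Hx as [p [Hprim <-]].
  destruct (HT p) as [_ [_ [_ [H1 H2]]]]. apply H1; [|now apply H2].
  intros k. apply (Hk (k, p)). now split.
Qed.

(** * The limit of the genus *)

(** Weierstrass' primary factor. *)
Definition primary (a : C) : C := ((1 - a) * Cexp a)%C.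

(** [primary a = 1 - a^2 / 2 + ...] for small [a]; for [|a| >= 1 / 2] the crude bound is absorbed by [4 |a|^2]. The
    quadratic bound turns the terms [z^2 / w^2], not summable over the lattice, into summable ones. *)
Lemma primary_bound A a : Cmod a <= A ->
  Cmod (primary a - 1)%C <= (31 + 4 * ((1 + A) * exp A + 1)) * Cmod a ^ 2.
Proof.
intros Ha. assert (Ha0 := Cmod_ge_0 a). assert (HA : 0 <= (1 + A) * exp A + 1).
{ assert (0 <= (1 + A) * exp A) by (apply Rmult_le_pos; [lra|apply Rlt_le, exp_pos]). lra. }
assert (H1a : Cmod (1 - a)%C <= 1 + Cmod a).
{ eapply Rle_trans; [apply Cmod_triangle|]. rewrite Cmod_opp, Cmod_1. lra. }
destruct (Rlt_dec (Cmod a) (1 / 2)) as [H|H].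
- unfold primary. replace ((1 - a) * Cexp a - 1)%C with ((1 - a) * (Cexp a - 1 - a) - a * a)%C by ring.
  eapply Rle_trans; [apply Cmod_triangle|]. rewrite Cmod_opp, !Cmod_mult.
  assert (H2 := Cexp_sub1_local a H).
  assert (H3 : Cmod (1 - a)%C * Cmod (Cexp a - 1 - a)%C <= (3 / 2) * (20 * Cmod a ^ 2)).
  { apply Rmult_le_compat; try apply Cmod_ge_0; lra. }
  assert (0 <= 4 * ((1 + A) * exp A + 1) * Cmod a ^ 2) by (apply Rmult_le_pos; [lra|apply pow2_ge_0]).
  nra.
- assert (H2 : Cmod (primary a - 1)%C <= (1 + A) * exp A + 1).
  { eapply Rle_trans; [apply Cmod_triangle|]. rewrite Cmod_opp, Cmod_1. unfold primary. rewrite Cmod_mult, Cmod_Cexp.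
    apply Rplus_le_compat_r. apply Rmult_le_compat; [apply Cmod_ge_0|apply Rlt_le, exp_pos|lra|].
    apply exp_mono. eapply Rle_trans; [apply Rle_abs|]. eapply Rle_trans; [apply re_le_Cmod|easy]. }
  assert (1 / 4 <= Cmod a ^ 2) by nra.
  assert (0 <= 31 * Cmod a ^ 2) by nra. nra.
Qed.

Lemma primary_cont a : filterlim primary (locally a) (locally (primary a)).
Proof.
unfold primary. apply (clim_mult (locally a)); [|apply Cexp_cont].
apply (clim_minus (locally a)); [apply filterlim_const|apply filterlim_id].
Qed.

Definition row0 (p : Z * Z) : Prop := (fst p = 0 /\ 0 < snd p)%Z.

Lemma fsum_union {I} (A B : I -> Prop) f l l' :
  (forall i, A i -> ~ B i) -> (exists t, is_fsum (fun i => A i \/ B i) f t) ->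
  is_fsum A f l -> is_fsum B f l' -> is_fsum (fun i => A i \/ B i) f (l + l')%C.
Proof.
intros Hd [t Ht] Hl Hl'.
set (phi := fun i => if excluded_middle_informative (A i) then true else false).
assert (HA : forall i, (A i \/ B i) /\ phi i = true <-> A i).
{ intros i. unfold phi. destruct (excluded_middle_informative (A i)); intuition congruence. }
assert (HB : forall i, (A i \/ B i) /\ phi i = false <-> B i).
{ intros i. unfold phi. specialize (Hd i). destruct (excluded_middle_informative (A i)); intuition congruence. }
assert (H : is_fsum (fun _ : bool => True) (fun b => if b then l else l') t).
{ apply (fam_fubini Cplus_monoid phi (fun i => A i \/ B i) (fun _ => True) f); [easy| |easy].
  intros [|] _.
  - apply fam_subset_ext with (2 := Hl). intros i. symmetry. apply HA.
  - apply fam_subset_ext with (2 := Hl'). intros i. symmetry. apply HB. }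
assert (H2 := fam_finite Cplus_monoid (fun _ : bool => True) (fun b => if b then l else l') [true; false]
  ltac:(repeat constructor; simpl; intuition congruence) ltac:(repeat constructor)
  ltac:(intros [|] _ Hn; exfalso; apply Hn; simpl; auto)).
assert (E := fam_unique _ _ _ _ H H2). unfold lfold in E. simpl in E.
replace (l + l')%C with (l + (l' + 0))%C by ring. now rewrite <- E.
Qed.

Lemma zeta_exists s : 0 <= s -> exists l, is_fsum all_nat (fun k => RtoC (Rpower (1 + INR k) (- (2 + s)))) l.
Proof.
intros Hs. apply (fsum_exists all_nat _ (fun k => Rpower (1 + INR k) (- (2 + s)))).
- apply summable_nat_pow. lra.
- intros k _. rewrite Cmod_R, Rabs_right; [lra|apply Rle_ge, Rlt_le, Rpower_pos].
Qed.

(** The first term is [1], and the others add up to at most [1] by a telescoping comparison. *)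
Lemma zeta_neq0 s l : 0 <= s ->
  is_fsum all_nat (fun k => RtoC (Rpower (1 + INR k) (- (2 + s)))) l -> l <> RtoC 0.
Proof.
intros Hs Hl H0.
assert (Hge : Cmod (l - 2)%C <= 1).
{ set (g := fun k => Rpower (1 + INR k) (- (2 + s))) in *.
  assert (Hg1 : g 0%nat = 1). { unfold g, Rpower. simpl. rewrite Rplus_0_r, ln_1, Rmult_0_r. apply exp_0. }
  assert (Hgp : forall k, 0 <= g k) by (intros k; apply Rlt_le, Rpower_pos).
  assert (Hup : forall n, lsum g (seq 0 (S n)) <= 2 - Rpower (1 + INR n) (- (1))).
  { induction n as [|n IH].
    - unfold lsum. simpl. rewrite Hg1, !Rplus_0_r. unfold Rpower. rewrite ln_1, Rmult_0_r, exp_0. lra.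
    - rewrite seq_S, lsum_app. change (lsum g [(0 + S n)%nat]) with (g (S n) + 0).
      assert (Hn := pos_INR n). destruct (Rpower_step (1 + INR n) 1) as [H _]; [lra|lra|].
      assert (g (S n) <= Rpower (1 + INR n + 1) (-1 - 1)).
      { unfold g. rewrite S_INR. replace (1 + (INR n + 1)) with (1 + INR n + 1) by ring.
        apply Rle_Rpower; lra. }
      rewrite S_INR. replace (1 + (INR n + 1)) with (1 + INR n + 1) by ring. lra. }
  apply (fam_closed (op := Cplus) (e := RtoC 0) all_nat (fun k => RtoC (g k))); [exact Hl|].
  exists [0%nat]. split; [now repeat constructor|]. intros L HL _ Hi.
  rewrite lfold_RtoC, <- RtoC_minus, Cmod_R.
  assert (H1 : lsum g [0%nat] <= lsum g L) by (apply lsum_incl; [repeat constructor; easy|easy|easy|auto]).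
  assert (H2 : lsum g L <= lsum g (seq 0 (S (list_max L)))) by now apply lsum_le_prefix.
  specialize (Hup (list_max L)). pose proof (Rpower_pos (1 + INR (list_max L)) (- (1))).
  unfold lsum in H1 at 1. simpl in H1. rewrite Hg1 in H1. apply Rabs_le. lra. }
rewrite H0, Cmod_sub_sym in Hge. replace (2 - 0)%C with (RtoC 2) in Hge by ring.
rewrite Cmod_R, Rabs_right in Hge by lra. lra.
Qed.

Lemma fsum_pairs (a : nat -> C) (b : Z * Z -> C) la lb t :
  is_fsum all_nat a la -> is_fsum primitive b lb ->
  is_fsum pairs (fun q => a (fst q) * b (snd q))%C t -> t = (la * lb)%C.
Proof.
intros Ha Hb Ht.
assert (H : is_fsum primitive (fun p => la * b p)%C t).
{ apply (fam_fubini Cplus_monoid snd pairs primitive (fun q => a (fst q) * b (snd q))%C); [now intros q [_ Hq]| |easy].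
  intros p Hp. apply (fam_reindex Cplus_monoid (fun k => (k, p)) all_nat).
  - congruence.
  - intros k _. now repeat split; try apply Hp.
  - intros [k p'] [_ E]. exists k. simpl in E. now subst p'.
  - replace (la * b p)%C with (b p * la)%C by ring.
    apply fam_ext with (2 := fsum_scal _ _ (b p) _ Ha). intros k _. simpl. ring. }
exact (fam_unique _ _ _ _ H (fsum_scal _ _ la _ Hb)).
Qed.

Lemma ahat_factor_eq z x k : ahat_factor (x * (2 * PI * Ci * z) ^ 2)%C k = (1 - z * z * x * RtoC (inv_square k))%C.
Proof.
unfold ahat_factor.
assert (Hpi := PI_RGT_0).
assert (Hci : (Ci * Ci)%C = RtoC (-1)) by (apply injective_projections; simpl; ring).
replace (x * (2 * PI * Ci * z) ^ 2)%C with (x * z * z * (RtoC (4 * (PI * PI)) * (Ci * Ci)))%C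
  by (rewrite !RtoC_mult; ring).
rewrite Hci.
replace (x * z * z * (RtoC (4 * (PI * PI)) * RtoC (-1)) * RtoC (inv_square k / (4 * (PI * PI))))%C
  with (- (x * z * z) * RtoC (4 * (PI * PI) * (inv_square k / (4 * (PI * PI)))))%C by (rewrite (RtoC_mult (4 * (PI * PI))); ring).
replace (4 * (PI * PI) * (inv_square k / (4 * (PI * PI)))) with (inv_square k) by (field; lra).
ring.
Qed.

Lemma Cprod_eq A f l : is_Cprod A f l -> Cprod A f = l.
Proof.
intros H. apply (iota_unique (V := C_CompleteNormedModule)); [|exact H].
intros l' H'. exact (clim_unique (finite_subsets A) _ _ _ H' H).
Qed.

(** The reciprocal of the genus is the product of the [1 - a] with [a = z^2 hecke s w / k^2] over all pairs, and
    [1 - a] is [primary a] times [exp (- a)]. The products of the primary factors are dominated uniformly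
    in [s]; they tend to the product over the half lattice for [s = 0], which is nonzero off the lattice, so
    that there are no poles for small [s]. The sum of the [a] is
    [z^2 zeta 2 / zeta (2 + s)] times the sum of [hecke s] over the half lattice, and that sum consists of
    [zeta (2 + s)] from the row [m = 0] and the sum over the rows [m > 0] in Hecke's limit. *)
Lemma Ahat_limit tau z corr tot zeta2 : 0 < Im tau -> ~ nonzero_lattice_point tau z ->
  (forall E, (forall s, 0 < s -> is_fsum upper (fun p => hecke s (pt tau p)) (E s)) ->
    filterlim E (at_right 0) (locally (tot - corr)%C)) ->
  is_fsum all_nat (fun k => RtoC (inv_square k)) zeta2 ->
  exists W, is_fprod half (fun p => primary (z * z / pt tau p ^ 2))%C W /\
    at_right 0 (fun s => ~ Ahat_pole (X tau s) ((2 * PI * Ci * z) ^ 2)%C) /\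
    filterlim (fun s => Ahat (X tau s) ((2 * PI * Ci * z) ^ 2)%C) (at_right 0)
      (locally (/ (W * Cexp (- (z * z * (zeta2 + (tot - corr))))))%C).
Proof.
intros Ht Hz Hhecke Hzeta2.
destruct (pt_min tau Ht) as [d [Hd Hmin]].
assert (Hw0 : forall q, pairs q -> d <= Cmod (pt tau (snd q))) by (intros q Hq; apply Hmin, pairs_nonzero, Hq).
set (a := fun (s : R) (q : nat * (Z * Z)) => (z * z * (RtoC (inv_square (fst q)) * hecke s (pt tau (snd q))))%C).
set (Z2 := Cmod z ^ 2). assert (HZ2 : 0 <= Z2) by apply pow2_ge_0.
assert (Hisq1 : forall k, inv_square k <= 1).
{ intros k. unfold inv_square. rewrite <- Rinv_1. apply Rinv_le_contravar; [lra|]. pose proof (pos_INR k). nra. }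
assert (Hdi : 1 <= / d) by (rewrite <- Rinv_1; apply Rinv_le_contravar; lra).
(* uniformly for s between 0 and 1, as |w| ^ (- s) <= 1 / d *)
assert (Ha : forall s q, 0 <= s <= 1 -> pairs q ->
  Cmod (a s q) <= Z2 * / d * (inv_square (fst q) * Rpower (Cmod (pt tau (snd q))) (-2))).
{ intros s q Hs Hq. specialize (Hw0 q Hq). unfold a.
  rewrite !Cmod_mult, Cmod_R, Cmod_hecke by lra.
  rewrite (Rabs_right (inv_square (fst q))) by (apply Rle_ge, Rlt_le, inv_square_pos).
  replace (- (2 + s)) with (-2 + - s) by ring. rewrite Rpower_plus.
  assert (Hp : Rpower (Cmod (pt tau (snd q))) (- s) <= / d).
  { apply Rle_trans with (Rpower d (- s)); [apply Rpower_nonpos_anti; lra|].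
    rewrite <- (Rpower_m1 d) by lra. unfold Rpower. apply exp_mono.
    assert (ln d <= 0) by (rewrite <- ln_1; apply ln_le; lra). nra. }
  replace (Cmod z * Cmod z) with Z2 by (unfold Z2; ring).
  set (i := inv_square (fst q)). set (r := Rpower _ (-2)) in *.
  assert (0 <= Z2 * (i * r)).
  { apply Rmult_le_pos; [easy|]. apply Rmult_le_pos; [apply Rlt_le, inv_square_pos|apply Rlt_le, Rpower_pos]. }
  replace (Z2 * (i * (r * Rpower (Cmod (pt tau (snd q))) (- s))))
    with (Z2 * (i * r) * Rpower (Cmod (pt tau (snd q))) (- s)) by ring.
  replace (Z2 * / d * (i * r)) with (Z2 * (i * r) * / d) by ring.
  now apply Rmult_le_compat_l. }
set (A := Z2 * / d * (/ d * / d)).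
assert (HA : forall s q, 0 <= s <= 1 -> pairs q -> Cmod (a s q) <= A).
{ intros s q Hs Hq. eapply Rle_trans; [now apply Ha|]. unfold A.
  apply Rmult_le_compat_l; [apply Rmult_le_pos; lra|].
  rewrite <- (Rmult_1_l (/ d * / d)). apply Rmult_le_compat; [apply Rlt_le, inv_square_pos|apply Rlt_le, Rpower_pos|auto|].
  specialize (Hw0 q Hq). rewrite <- Rinv_mult, <- Rpower_m2 by lra. apply Rpower_nonpos_anti; lra. }
set (K := (31 + 4 * ((1 + A) * exp A + 1)) * (Z2 * / d) ^ 2).
set (g := fun q => K * (inv_square (fst q) * Rpower (Cmod (pt tau (snd q))) (- (4)))).
assert (HAp : 0 <= A) by (unfold A; apply Rmult_le_pos; apply Rmult_le_pos; lra).
assert (Hc0 : 0 <= 31 + 4 * ((1 + A) * exp A + 1)).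
{ assert (0 <= (1 + A) * exp A) by (apply Rmult_le_pos; [lra|apply Rlt_le, exp_pos]). lra. }
assert (Hg : summable pairs g).
{ apply summable_scal; [apply Rmult_le_pos; [easy|apply pow2_ge_0]|].
  apply (pairs_summable (fun p => Rpower (Cmod (pt tau p)) (- (4)))).
  apply summable_subset with (1 := primitive_nonzero). apply lattice_summable; [easy|lra]. }
assert (Hb : forall s q, 0 <= s <= 1 -> pairs q -> Cmod (primary (a s q) - 1)%C <= g q).
{ intros s q Hs Hq. eapply Rle_trans; [apply (primary_bound A), HA; easy|]. unfold g, K.
  rewrite Rmult_assoc. apply Rmult_le_compat_l; [easy|].
  specialize (Ha s q Hs Hq). specialize (Hw0 q Hq).
  eapply Rle_trans; [apply pow_incr; split; [apply Cmod_ge_0|exact Ha]|].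
  rewrite Rpow_mult_distr. apply Rmult_le_compat_l; [apply pow2_ge_0|].
  rewrite Rpow_mult_distr.
  replace (Rpower (Cmod (pt tau (snd q))) (-2) ^ 2) with (Rpower (Cmod (pt tau (snd q))) (- (4))).
  2: { rewrite <- Rpower_pow by apply Rpower_pos. rewrite Rpower_mult. f_equal. simpl. ring. }
  apply Rmult_le_compat_r; [apply Rlt_le, Rpower_pos|].
  pose proof (inv_square_pos (fst q)). specialize (Hisq1 (fst q)). nra. }
assert (HG : forall s, exists l, 0 <= s <= 1 -> is_fprod pairs (fun q => primary (a s q)) l).
{ intros s. destruct (excluded_middle_informative (0 <= s <= 1)) as [Hs|Hs]; [|now exists (RtoC 0)].
  destruct (fprod_exists pairs (fun q => primary (a s q)) g Hg) as [l Hl]; [intros q Hq; now apply Hb|].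
  now exists l. }
apply skolem in HG. destruct HG as [G HG].
assert (HGlim : filterlim G (at_right 0) (locally (G 0))).
{ apply (fprod_tannery (at_right 0) pairs (fun s q => primary (a s q)) g (fun q => primary (a 0 q))); [easy|..].
  - apply at_right_0_iff. exists 1. split; [lra|]. intros s Hs q Hq. apply Hb; [lra|easy].
  - intros q Hq. eapply filterlim_comp; [|apply primary_cont].
    unfold a. apply (clim_mult (at_right 0)); [apply filterlim_const|].
    apply (clim_mult (at_right 0)); [apply filterlim_const|]. apply hecke_lim.
    specialize (Hw0 q Hq). lra.
  - apply at_right_0_iff. exists 1. split; [lra|]. intros s Hs. apply HG. lra.
  - apply HG. lra. }
assert (HG0 : is_fprod pairs (fun q => primary (z * z / pt tau (multiple q) ^ 2))%C (G 0)).
{ apply fam_ext with (2 := HG 0 ltac:(lra)). intros q Hq. f_equal. unfold a.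
  specialize (Hw0 q Hq). rewrite hecke_0, pt_multiple by lra. unfold inv_square.
  assert (pt tau (snd q) <> RtoC 0) by (apply Cmod_gt_0; lra).
  assert (Hk := pos_INR (fst q)).
  assert (RtoC (INR (fst q) + 1) <> RtoC 0) by (intros H1; apply RtoC_inj in H1; lra).
  rewrite RtoC_inv, RtoC_mult by nra. field. now split. }
assert (HW : is_fprod half (fun p => primary (z * z / pt tau p ^ 2))%C (G 0)).
{ apply (fam_reindex Cmult_monoid multiple pairs); [exact multiple_inj|exact multiple_half|exact multiple_surj|exact HG0]. }
assert (HW0 : G 0 <> RtoC 0).
{ apply (fprod_neq0 pairs (fun q => primary (a 0 q)) g); [easy|intros q Hq; apply Hb; [lra|easy]|apply HG; lra|].
  intros q Hq. unfold primary. apply Cmult_neq_0; [|apply Cexp_neq0]. intros H0.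
  assert (H1 : a 0 q = 1). { replace (a 0 q) with (1 - (1 - a 0 q))%C by ring. rewrite H0. ring. }
  unfold a in H1. specialize (Hw0 q Hq). rewrite hecke_0 in H1 by lra.
  set (w := pt tau (snd q)) in *. assert (Hw : w <> RtoC 0) by (apply Cmod_gt_0; lra).
  assert (Hk := pos_INR (fst q)). set (k := RtoC (INR (fst q) + 1)).
  assert (Hk0 : k <> RtoC 0) by (intros H2; apply RtoC_inj in H2; lra).
  unfold inv_square in H1. rewrite RtoC_inv, RtoC_mult in H1 by nra. fold k in H1.
  assert (H2 : ((z - k * w) * (z + k * w))%C = 0).
  { replace ((z - k * w) * (z + k * w))%C with ((z * z * (/ (k * k) * / w ^ 2)) * (k * k * w ^ 2) - k * k * w ^ 2)%C
      by (field; now split).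
    rewrite H1. ring. }
  assert (Hkw : (k * w)%C = pt tau (multiple q)) by (symmetry; apply pt_multiple).
  assert (Hkw0 : (k * w)%C <> RtoC 0) by now apply Cmult_neq_0.
  apply Hz. destruct (multiple q) as [m n].
  destruct (Ceq_dec (z - k * w)%C 0) as [E|E].
  - assert (Ez : z = (k * w)%C) by (replace z with ((z - k * w) + k * w)%C by ring; rewrite E; ring).
    split; [now rewrite Ez|]. exists m, n. rewrite Ez, Hkw. reflexivity.
  - assert (Ez : z = (- (k * w))%C).
    { destruct (Ceq_dec (z + k * w)%C 0) as [E2|E2].
      - replace z with ((z + k * w) - k * w)%C by ring. rewrite E2. ring.
      - exfalso. now apply (Cmult_neq_0 _ _ E E2). }
    split.
    + rewrite Ez. intros H3. apply Hkw0. replace (k * w)%C with (- - (k * w))%C by ring. rewrite H3. ring.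
    + exists (- m)%Z, (- n)%Z. rewrite Ez, Hkw, <- pt_opp. reflexivity. }
exists (G 0). split; [easy|].
assert (Hzs : forall s, exists l, 0 <= s -> is_fsum all_nat (fun k => RtoC (Rpower (1 + INR k) (- (2 + s)))) l).
{ intros s. destruct (Rle_dec 0 s) as [Hs|Hs]; [|now exists (RtoC 0)].
  destruct (zeta_exists s Hs) as [l Hl]. now exists l. }
apply skolem in Hzs. destruct Hzs as [zt Hzt].
assert (HEs : forall s, exists l, 0 < s -> is_fsum upper (fun p => hecke s (pt tau p)) l).
{ intros s. destruct (Rlt_dec 0 s) as [Hs|Hs]; [|now exists (RtoC 0)].
  destruct (fsum_exists upper (fun p => hecke s (pt tau p)) _ 
    (summable_subset _ _ _ upper_nonzero (hecke_summable tau s Ht Hs))) as [l Hl]; [intros; lra|]. now exists l. }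
apply skolem in HEs. destruct HEs as [E HE].
assert (HElim := Hhecke E HE).
assert (Hz0 : zt 0 = zeta2).
{ apply (fam_unique (op := Cplus) (e := RtoC 0) all_nat (fun k => RtoC (inv_square k))); [|easy].
  apply fam_ext with (2 := Hzt 0 (Rle_refl 0)). intros k _. f_equal. unfold inv_square.
  replace (- (2 + 0)) with (-2) by ring. rewrite Rpower_m2 by (pose proof (pos_INR k); lra). f_equal. ring. }
assert (Hztlim : filterlim zt (at_right 0) (locally (zt 0))).
{ apply (fsum_tannery (at_right 0) all_nat (fun s k => RtoC (Rpower (1 + INR k) (- (2 + s)))) inv_square
    (fun k => RtoC (Rpower (1 + INR k) (- (2 + 0))))); [apply inv_square_summable|..].
  - apply at_right_0_iff. exists 1. split; [lra|]. intros s Hs k _.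
    rewrite Cmod_R, Rabs_right by apply Rle_ge, Rlt_le, Rpower_pos. assert (Hk := pos_INR k).
    unfold inv_square. replace ((INR k + 1) * (INR k + 1)) with ((1 + INR k) * (1 + INR k)) by ring.
    rewrite <- Rpower_m2 by lra. apply Rle_Rpower; lra.
  - intros k _. apply (clim_RtoC (at_right 0)).
    apply rlim_at_right_of_ex_derive. unfold Rpower. auto_derive. easy.
  - apply at_right_0_iff. exists 1. split; [lra|]. intros s Hs. apply Hzt. lra.
  - apply Hzt. lra. }
(* the pairs (k, w) carry k^(-2) where hecke s (k w) would have k^(-2 - s): whence the ratio of zeta values *)
assert (HS : forall s, 0 < s <= 1 -> is_fsum pairs (a s) (z * z * (zeta2 * / zt s * (zt s + E s)))%C).
{ intros s Hs.
  assert (Hhs := hecke_summable tau s Ht ltac:(lra)).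
  destruct (fsum_exists primitive (fun p => hecke s (pt tau p)) _
    (summable_subset _ _ _ primitive_nonzero Hhs)) as [sg Hsg]; [intros; lra|].
  assert (Hps : forall c : nat -> C, (forall k, Cmod (c k) <= inv_square k) ->
    exists l, is_fsum pairs (fun q => c (fst q) * hecke s (pt tau (snd q)))%C l).
  { intros c Hc. apply (fsum_exists pairs _ (fun q => inv_square (fst q) * Cmod (hecke s (pt tau (snd q))))).
    - apply (pairs_summable (fun p => Cmod (hecke s (pt tau p)))). now apply summable_subset with (1 := primitive_nonzero).
    - intros q _. rewrite Cmod_mult. apply Rmult_le_compat_r; [apply Cmod_ge_0|auto]. }
  destruct (Hps (fun k => RtoC (inv_square k))) as [t1 Ht1].
  { intros k. rewrite Cmod_R, Rabs_right; [lra|apply Rle_ge, Rlt_le, inv_square_pos]. }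
  destruct (Hps (fun k => RtoC (Rpower (1 + INR k) (- (2 + s))))) as [t2 Ht2].
  { intros k. rewrite Cmod_R, Rabs_right by apply Rle_ge, Rlt_le, Rpower_pos. assert (Hk := pos_INR k).
    unfold inv_square. replace ((INR k + 1) * (INR k + 1)) with ((1 + INR k) * (1 + INR k)) by ring.
    rewrite <- Rpower_m2 by lra. apply Rle_Rpower; lra. }
  assert (E1 := fsum_pairs _ (fun p => hecke s (pt tau p)) _ _ _ Hzeta2 Hsg Ht1).
  assert (E2 := fsum_pairs _ (fun p => hecke s (pt tau p)) _ _ _ (Hzt s ltac:(lra)) Hsg Ht2).
  (* by homogeneity t2 is the sum over the half lattice *)
  assert (Hhalf : is_fsum half (fun p => hecke s (pt tau p)) t2).
  { apply (fam_reindex Cplus_monoid multiple pairs); [exact multiple_inj|exact multiple_half|exact multiple_surj|].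
    apply fam_ext with (2 := Ht2). intros q Hq. symmetry. now apply hecke_multiple. }
  assert (Hrow0 : is_fsum row0 (fun p => hecke s (pt tau p)) (zt s)).
  { apply (fam_reindex Cplus_monoid (fun k => (0, Z.of_nat (S k))%Z) all_nat).
    - intros i j _ _ H. injection H. lia.
    - intros k _. unfold row0. cbn [fst snd]. lia.
    - intros [m n] [Hm Hn]. cbn [fst snd] in *. exists (Z.to_nat n - 1)%nat. split; [easy|]. f_equal; lia.
    - apply fam_ext with (2 := Hzt s ltac:(lra)). intros k _. unfold hecke, pt. cbn [fst snd].
      rewrite <- INR_IZR_INZ, S_INR. assert (Hk := pos_INR k).
      replace (0 * tau + RtoC (INR k + 1))%C with (RtoC (INR k + 1)) by ring.
      rewrite Cmod_R, Rabs_right, <- RtoC_pow, <- RtoC_mult by lra.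
      rewrite <- (Rpower_pow 2), <- Rpower_plus by lra.
      rewrite <- RtoC_inv by (apply Rgt_not_eq, Rpower_pos).
      rewrite <- Rpower_Ropp, (Rplus_comm 1). f_equal. }
  assert (Et2 : t2 = (zt s + E s)%C).
  { replace (zt s + E s)%C with (E s + zt s)%C by ring.
    apply (fam_unique (op := Cplus) (e := RtoC 0) (fun p => upper p \/ row0 p) (fun p => hecke s (pt tau p))); [exact Hhalf|].
    apply fsum_union; [unfold upper, row0; intros; lia|exists t2; exact Hhalf|apply HE; lra|exact Hrow0]. }
  assert (Hzn := zeta_neq0 s _ ltac:(lra) (Hzt s ltac:(lra))).
  assert (Esg : sg = (/ zt s * (zt s + E s))%C).
  { rewrite <- Et2, E2. field. easy. }
  replace (zeta2 * / zt s * (zt s + E s))%C with t1 by (rewrite E1, Esg; ring).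
  now apply fsum_scal. }
assert (HL : forall s, 0 < s <= 1 -> is_fprod pairs
   (fun q => ahat_factor (hecke s (pt tau (snd q)) * (2 * PI * Ci * z) ^ 2) (fst q))
   (G s * Cexp (- (z * z * (zeta2 * / zt s * (zt s + E s)))))%C).
{ intros s Hs.
  assert (H1 : is_fprod pairs (fun q => Cexp (- (a s q)))
    (Cexp (- (z * z * (zeta2 * / zt s * (zt s + E s)))))%C).
  { apply (fam_morphism (op := Cplus) (e := RtoC 0) pairs (fun q => - a s q)%C Cexp);
      [apply Cexp_0|apply Cexp_plus|apply Cexp_cont|].
    replace (- (z * z * (zeta2 * / zt s * (zt s + E s))))%C
      with ((-1) * (z * z * (zeta2 * / zt s * (zt s + E s))))%C by ring.
    apply fam_ext with (2 := fsum_scal _ _ (-1) _ (HS s Hs)). intros; ring. }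
  apply fam_ext with (2 := fam_op Cmult_monoid _ _ _ _ _ (HG s ltac:(lra)) H1).
  intros q _. rewrite ahat_factor_eq. unfold primary. rewrite Cexp_opp. unfold a.
  set (u := Cexp _). assert (Hu : u <> RtoC 0) by apply Cexp_neq0. field. easy. }
assert (HGne : at_right 0 (fun s => G s <> RtoC 0)).
{ assert (Hm : 0 < Cmod (G 0)) by now apply Cmod_gt_0.
  generalize (proj1 (clim_iff (at_right 0) _ _) HGlim _ Hm). apply filter_imp. intros s Hs H0.
  rewrite H0, Cmod_sub_sym in Hs. replace (G 0 - 0)%C with (G 0) in Hs by ring. lra. }
assert (Hsmall : at_right 0 (fun s => 0 < s <= 1)).
{ apply at_right_0_iff. exists 1. split; [lra|]. intros s Hs. lra. }
assert (Hnp : at_right 0 (fun s => ~ Ahat_pole (X tau s) ((2 * PI * Ci * z) ^ 2)%C)).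
{ generalize (filter_and _ _ HGne Hsmall). apply filter_imp. intros s [H0 Hs].
  destruct (Ahat_product tau s ((2 * PI * Ci * z) ^ 2)%C Ht ltac:(lra)) as [l [_ [_ H2]]].
  apply H2. intros q Hq H3.
  assert (H4 := fprod_zero _ _ _ q Hq H3 (HL s Hs)).
  apply (Cmult_neq_0 _ _ H0 (Cexp_neq0 (- (z * z * (zeta2 * / zt s * (zt s + E s)))))). exact H4. }
split; [easy|].
apply (clim_ext_loc (at_right 0)
  (fun s => / (G s * Cexp (- (z * z * (zeta2 * / zt s * (zt s + E s))))))%C).
{ generalize (filter_and _ _ Hnp Hsmall). apply filter_imp. intros s [H0 Hs].
  destruct (Ahat_product tau s ((2 * PI * Ci * z) ^ 2)%C Ht ltac:(lra)) as [l [H1 [H2 _]]].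
  rewrite (fam_unique _ _ _ _ (HL s Hs) H1). symmetry. apply Cprod_eq. now apply H2. }
apply (clim_inv (at_right 0)); [apply Cmult_neq_0; [easy|apply Cexp_neq0]|].
apply (clim_mult (at_right 0)); [easy|].
eapply filterlim_comp; [|apply Cexp_cont].
apply (clim_opp (at_right 0)). apply (clim_mult (at_right 0)); [apply filterlim_const|].
assert (Hzn := zeta_neq0 0 _ (Rle_refl 0) (Hzt 0 (Rle_refl 0))). rewrite Hz0 in Hzn, Hztlim.
replace (zeta2 + (tot - corr))%C with (zeta2 * / zeta2 * (zeta2 + (tot - corr)))%C by (field; easy).
apply (clim_mult (at_right 0)).
- apply (clim_mult (at_right 0)); [apply filterlim_const|]. now apply (clim_inv (at_right 0)).
- now apply (clim_plus (at_right 0)).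
Qed.

(** * The q-product *)

(** The Taylor coefficients in [v] of the product of the [1 - v q^m] over [m >= 1]; the recursion expresses the
    functional equation [P(v) = (1 - v q) P(v q)]. Defined by its power series, the product is differentiable in [v]
    without a theorem on locally uniform limits; the product formula is recovered by iterating the
    functional equation. *)
Fixpoint qcoef (q : C) (n : nat) : C :=
  match n with
  | O => RtoC 1
  | S p => (- (q ^ S p / (1 - q ^ S p)) * qcoef q p)%C
  end.

Definition qprod (q v : C) : C := ps (qcoef q) v.

Lemma pow_lim0 r : 0 <= r < 1 -> forall eps, 0 < eps -> exists N, forall n, (N <= n)%nat -> r ^ n < eps.
Proof.
intros Hr eps Heps. assert (H := is_lim_seq_geom r ltac:(rewrite Rabs_right; lra)).
destruct (proj1 (rlim_iff eventually _ _) H eps Heps) as [N HN]. exists N. intros n Hn.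
specialize (HN n Hn). rewrite Rminus_0_r in HN. eapply Rle_lt_trans; [apply Rle_abs|exact HN].
Qed.

Lemma one_minus_qpow q n : Cmod q < 1 -> 1 - Cmod q <= Cmod (1 - q ^ S n)%C.
Proof.
intros Hq. assert (H0 := Cmod_ge_0 q).
assert (H1 : Cmod q ^ S n <= Cmod q).
{ simpl. assert (Cmod q ^ n <= 1) by (rewrite <- (pow1 n); apply pow_incr; lra). nra. }
assert (H2 : Cmod 1 <= Cmod (1 - q ^ S n)%C + Cmod (q ^ S n)%C).
{ replace (RtoC 1) with ((1 - q ^ S n) + q ^ S n)%C at 1 by ring. apply Cmod_triangle. }
rewrite Cmod_1, Cmod_pow in H2. lra.
Qed.

Lemma qcoef_bound q r : Cmod q < 1 -> 0 <= r -> geom_bounded (qcoef q) r.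
Proof.
intros Hq Hr. assert (H0 := Cmod_ge_0 q).
set (b := fun n => Cmod (qcoef q n) * r ^ n).
assert (Hb : forall n, 0 <= b n) by (intros n; apply Rmult_le_pos; [apply Cmod_ge_0|now apply pow_le]).
(* from some index on the terms decrease *)
destruct (pow_lim0 (Cmod q) (conj H0 Hq) ((1 - Cmod q) / (r + 1))) as [N HN]; [apply Rdiv_lt_0_compat; lra|].
assert (Hdec : forall n, (N <= n)%nat -> b (S n) <= b n).
{ intros n Hn. unfold b. simpl qcoef. set (qp := (q * q ^ n)%C).
  assert (Hq1 := one_minus_qpow q n Hq). simpl Cpow in Hq1. fold qp in Hq1.
  assert (Hqp : Cmod qp <= (1 - Cmod q) / (r + 1)).
  { unfold qp. change (q * q ^ n)%C with (q ^ S n)%C. rewrite Cmod_pow. apply Rlt_le, HN. lia. }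
  rewrite Cmod_mult, Cmod_opp, Cmod_div by (apply Cmod_gt_0; lra).
  simpl pow.
  apply Rle_trans with (1 * (Cmod (qcoef q n) * r ^ n)); [|lra].
  replace (Cmod qp / Cmod (1 - qp) * Cmod (qcoef q n) * (r * r ^ n))
    with (Cmod qp / Cmod (1 - qp) * r * (Cmod (qcoef q n) * r ^ n)) by ring.
  apply Rmult_le_compat_r; [apply Hb|].
  replace (Cmod qp / Cmod (1 - qp) * r) with (Cmod qp * r / Cmod (1 - qp)) by (unfold Rdiv; ring).
  apply Rle_div_l; [lra|]. rewrite Rmult_1_l. eapply Rle_trans; [|exact Hq1].
  apply Rle_div_r in Hqp; [|lra]. pose proof (Cmod_ge_0 qp). nra. }
exists (lsum b (seq 0 (S N))). intros n. fold (b n).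
assert (Hle : forall k, (k <= N)%nat -> b k <= lsum b (seq 0 (S N))).
{ intros k Hk. replace (b k) with (lsum b [k]) by (unfold lsum; simpl; ring).
  apply lsum_incl; [repeat constructor; easy|apply seq_NoDup| |auto].
  intros i [<-|[]]. apply in_seq. lia. }
destruct (Nat.le_gt_cases n N) as [Hn|Hn]; [now apply Hle|].
apply Rle_trans with (b N); [|now apply Hle].
replace n with (N + (n - N))%nat by lia. generalize (n - N)%nat. intros k.
induction k as [|k IH]; [rewrite Nat.add_0_r; lra|].
eapply Rle_trans; [|exact IH]. rewrite Nat.add_succ_r. apply Hdec. lia.
Qed.

Lemma qprod_deriv q v : Cmod q < 1 -> exists l, cderiv (qprod q) v l.
Proof.
intros Hq. assert (Hv := Cmod_ge_0 v). eexists. apply (ps_deriv _ (Cmod v + 1)); [apply qcoef_bound; lra|lra].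
Qed.

Lemma qprod_0 q : qprod q 0 = 1.
Proof. unfold qprod. now rewrite ps_0. Qed.

Lemma qprod_series q v : Cmod q < 1 -> is_series (fun n => qcoef q n * v ^ n)%C (qprod q v).
Proof.
intros Hq. assert (Hv := Cmod_ge_0 v).
apply (ps_fsum _ (Cmod v + 1)); [apply qcoef_bound; lra|lra].
Qed.

Lemma qcoef_step q v n : (1 - q ^ S n)%C <> RtoC 0 ->
  (qcoef q (S n) * v ^ S n - qcoef q (S n) * (v * q) ^ S n)%C =
  (- (v * q) * (qcoef q n * (v * q) ^ n))%C.
Proof.
cbn [qcoef]. rewrite !Cpow_mult_l. simpl Cpow.
generalize (q ^ n)%C (v ^ n)%C (qcoef q n). intros a b c H. field. easy.
Qed.

Lemma qprod_functional q v : Cmod q < 1 -> qprod q v = ((1 - v * q) * qprod q (v * q))%C.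
Proof.
intros Hq.
assert (S1 := is_series_minus _ _ _ _ (qprod_series q v Hq) (qprod_series q (v * q)%C Hq)).
set (d := fun n => plus (qcoef q n * v ^ n)%C (opp (qcoef q n * (v * q) ^ n)%C)) in S1.
assert (S2 : is_series (fun n => d (S n)) (qprod q v - qprod q (v * q))%C).
{ apply (is_series_incr_1 d).
  match goal with |- is_series _ ?u => replace u with (plus (qprod q v) (opp (qprod q (v * q)))) end; [exact S1|].
  unfold d. cring. }
assert (S3 := is_series_scal (- (v * q))%C _ _ (qprod_series q (v * q)%C Hq)).
assert (E : (qprod q v - qprod q (v * q))%C = (- (v * q) * qprod q (v * q))%C).
{ apply (clim_unique eventually (sum_n (fun n => d (S n)))); [exact S2|].
  apply (is_series_ext (K := C_AbsRing) (V := C_NormedModule)) with (2 := S3). intros n. symmetry.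
  apply qcoef_step. apply Cmod_gt_0. assert (H := one_minus_qpow q n Hq). lra. }
replace (qprod q v) with ((qprod q v - qprod q (v * q)) + qprod q (v * q))%C by ring.
rewrite E. ring.
Qed.

Lemma qprod_finite q v M : Cmod q < 1 ->
  qprod q v = (lfold Cmult (RtoC 1) (fun m => 1 - v * q ^ S m)%C (seq 0 M) * qprod q (v * q ^ M))%C.
Proof.
intros Hq. induction M as [|M IH].
- unfold lfold. simpl. replace (v * 1)%C with v by ring. ring.
- rewrite seq_S, (lfold_app Cmult_monoid), IH. rewrite (qprod_functional q (v * q ^ M)) by easy.
  unfold lfold at 3. cbn [map fold_right]. rewrite Nat.add_0_l. simpl Cpow.
  replace (v * q ^ M * q)%C with (v * (q * q ^ M))%C by ring. ring.
Qed.

Lemma qpow_lim q v : Cmod q < 1 -> filterlim (fun M => v * q ^ M)%C eventually (locally (RtoC 0)).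
Proof.
intros Hq. replace (RtoC 0) with (v * 0)%C by ring. apply (clim_mult eventually); [apply filterlim_const|].
apply (clim_iff eventually). intros eps Heps.
destruct (pow_lim0 (Cmod q) (conj (Cmod_ge_0 q) Hq) eps Heps) as [N HN]. exists N. intros n Hn.
replace (q ^ n - 0)%C with (q ^ n)%C by ring. rewrite Cmod_pow. auto.
Qed.

Lemma qprod_tail q v : Cmod q < 1 ->
  filterlim (fun M => qprod q (v * q ^ M)) eventually (locally (RtoC 1)).
Proof.
intros Hq. destruct (qprod_deriv q 0 Hq) as [l Hl]. apply cderiv_cont in Hl. rewrite qprod_0 in Hl.
eapply filterlim_comp; [now apply qpow_lim|exact Hl].
Qed.

Lemma qprod_lim q v : Cmod q < 1 ->
  filterlim (fun M => lfold Cmult (RtoC 1) (fun m => 1 - v * q ^ S m)%C (seq 0 M)) eventually (locally (qprod q v)).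
Proof.
intros Hq. assert (H := qprod_tail q v Hq).
apply (clim_ext_loc eventually (fun M => qprod q v * / qprod q (v * q ^ M))%C).
- generalize (proj1 (clim_iff eventually _ _) H 1 ltac:(lra)). apply filter_imp. intros M HM.
  rewrite (qprod_finite q v M Hq) at 1. field. intros H0. rewrite H0 in HM.
  rewrite Cmod_sub_sym in HM. replace (1 - 0)%C with (RtoC 1) in HM by ring. rewrite Cmod_1 in HM. lra.
- assert (H1 : filterlim (fun M => qprod q v * / qprod q (v * q ^ M))%C eventually (locally (qprod q v * / 1)%C)).
  { apply (clim_mult eventually (fun _ => qprod q v)); [apply filterlim_const|].
    apply (clim_inv eventually (fun M => qprod q (v * q ^ M))); [apply C1_nz|exact H]. }
  replace (qprod q v * / 1)%C with (qprod q v) in H1 by field. exact H1.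
Qed.

Lemma qprod_neq0 q v : Cmod q < 1 -> (forall m, (1 - v * q ^ S m)%C <> RtoC 0) -> qprod q v <> RtoC 0.
Proof.
intros Hq Hm. destruct (proj1 (clim_iff eventually _ _) (qprod_tail q v Hq) 1 ltac:(lra)) as [M HM].
specialize (HM M (le_n _)). rewrite (qprod_finite q v M Hq).
apply Cmult_neq_0; [now apply lprod_neq0|]. intros H0. rewrite H0 in HM.
rewrite Cmod_sub_sym in HM. replace (1 - 0)%C with (RtoC 1) in HM by ring. rewrite Cmod_1 in HM. lra.
Qed.

(** * The lattice product by rows *)

Lemma qexp_mod tau : 0 < Im tau -> Cmod (qexp tau) < 1.
Proof.
intros Ht. unfold qexp. rewrite Cmod_Cexp, <- exp_0. apply exp_increasing.
destruct tau as [a b]. simpl in *. pose proof PI_RGT_0. nra.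
Qed.

Definition shifted (v : C) (N : nat) : C := lfold Cmult (RtoC 1) (fun n => v + IZR n)%C (zs N).

(** Partial products of [sin (pi v) / pi]. *)
Definition partial_sine (v : C) (N : nat) : C :=
  (v * lfold Cmult (RtoC 1) (fun k => 1 - v * v * RtoC (inv_square k))%C (seq 0 N))%C.

Lemma zs_S N : Permutation (zs (S N)) (Z.of_nat (S N) :: (- Z.of_nat (S N))%Z :: zs N).
Proof.
apply NoDup_Permutation; [apply zs_NoDup| |].
- constructor; [|constructor]; [|rewrite zs_In; lia|apply zs_NoDup].
  simpl In. rewrite zs_In. lia.
- intros n. cbn [In]. rewrite !zs_In. lia.
Qed.

(** [(-1)^N N!^2]. *)
Fixpoint sine_const (N : nat) : C :=
  match N with O => RtoC 1 | S n => (sine_const n * - RtoC ((INR n + 1) * (INR n + 1)))%C end.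

Lemma sine_const_neq0 N : sine_const N <> RtoC 0.
Proof.
induction N as [|n IH]; [apply C1_nz|]. cbn [sine_const]. apply Cmult_neq_0; [easy|].
intros H. rewrite <- RtoC_opp in H. apply RtoC_inj in H. pose proof (pos_INR n). nra.
Qed.

Lemma shifted_eq v N : shifted v N = (sine_const N * partial_sine v N)%C.
Proof.
induction N as [|N IH].
- unfold shifted, partial_sine, zs, lfold. simpl. ring.
- unfold shifted in *. rewrite (lfold_perm Cmult_monoid _ _ _ (zs_S N)).
  unfold lfold in *. cbn [map fold_right]. rewrite IH. unfold partial_sine, lfold. rewrite seq_S, map_app, fold_right_app.
  change (fold_right Cmult 1%C (map ?h [(0 + N)%nat])) with (Cmult (h N) 1%C). cbn [map fold_right sine_const].
  change (0 + N)%nat with N.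
  assert (E : forall (a : C) L, fold_right Cmult a L = (fold_right Cmult (RtoC 1) L * a)%C).
  { intros a L. induction L as [|b L IHL]; simpl; [ring|]. rewrite IHL. ring. }
  rewrite (E (_ * 1)%C). rewrite opp_IZR, <- INR_IZR_INZ, S_INR.
  assert (Hk := pos_INR N). set (k := INR N + 1).
  assert (Hi : (RtoC (k * k) * RtoC (inv_square N))%C = 1).
  { rewrite <- RtoC_mult. f_equal. unfold inv_square, k. field. lra. }
  set (F := fold_right _ _ _). rewrite RtoC_opp.
  replace ((v + k) * ((v + - k) * (sine_const N * (v * F))))%C
    with (sine_const N * (v * F) * (v * v - RtoC (k * k)))%C by (rewrite RtoC_mult; ring).
  replace (sine_const N * - RtoC (k * k) * (v * (F * ((1 - v * v * RtoC (inv_square N)) * 1))))%C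
    with (sine_const N * (v * F) * (v * v * (RtoC (k * k) * RtoC (inv_square N)) - RtoC (k * k)))%C by ring.
  rewrite Hi. ring.
Qed.

(** Euler's product in the form that also covers [h = 0]. *)
Lemma sinh_fprod_total h : is_fprod all_nat (sinh_factor h) (Cexp (- h) * expm1_over (2 * h))%C.
Proof.
destruct (Ceq_dec h 0) as [->|Hh].
- replace (- 0)%C with (RtoC 0) by ring. replace (2 * 0)%C with (RtoC 0) by ring.
  rewrite Cexp_0, expm1_over_0. replace (1 * 1)%C with (RtoC 1) by ring.
  apply fam_ext with (f := fun _ => RtoC 1).
  + intros k _. unfold sinh_factor. ring.
  + apply (clim_ext_loc (fin_sub all_nat) (fun _ => RtoC 1)); [|apply filterlim_const].
    apply filter_forall. intros L. unfold lfold. induction L as [|a L IH]; simpl; [easy|]. rewrite <- IH. ring.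
- replace (Cexp (- h) * expm1_over (2 * h))%C with (Csinh h / h)%C; [now apply Csinh_fprod|].
  rewrite Csinh_expm1. field. easy.
Qed.

Lemma PICi_sq : (PI * Ci * (PI * Ci))%C = (- RtoC (PI * PI))%C.
Proof. apply injective_projections; simpl; ring. Qed.

Lemma sine_factor v k : sinh_factor (PI * Ci * v) k = (1 - v * v * RtoC (inv_square k))%C.
Proof.
unfold sinh_factor. assert (Hpi := PI_RGT_0).
replace (PI * Ci * v * (PI * Ci * v))%C with (PI * Ci * (PI * Ci) * (v * v))%C by ring.
assert (E : (RtoC (PI * PI) * RtoC (inv_square k / (PI * PI)))%C = RtoC (inv_square k)).
{ rewrite <- RtoC_mult. f_equal. field. lra. }
rewrite PICi_sq, <- E. ring.
Qed.

Lemma PICi_neq0 : (PI * Ci)%C <> RtoC 0.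
Proof.
apply Cmult_neq_0; [|apply Cmod_gt_0; rewrite Cmod_Ci; lra].
intros H. apply RtoC_inj in H. pose proof PI_RGT_0. lra.
Qed.

Lemma Csinh_over c v : c <> RtoC 0 ->
  (Csinh (c * v) / c)%C = (v * (Cexp (- (c * v)) * expm1_over (2 * (c * v))))%C.
Proof. intros H. rewrite Csinh_expm1. field. easy. Qed.

Lemma partial_sine_lim v : filterlim (partial_sine v) eventually (locally (Csinh (PI * Ci * v) / (PI * Ci))%C).
Proof.
rewrite (Csinh_over _ v PICi_neq0).
unfold partial_sine. apply (clim_mult eventually); [apply filterlim_const|].
apply fprod_nat_seq. apply fam_ext with (2 := sinh_fprod_total (PI * Ci * v)).
intros k _. apply sine_factor.
Qed.

Lemma sine_neq0 v : (forall n, v <> RtoC (IZR n)) -> (Csinh (PI * Ci * v) / (PI * Ci))%C <> RtoC 0.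
Proof.
intros Hv.
rewrite (Csinh_over _ v PICi_neq0).
apply Cmult_neq_0; [exact (Hv 0%Z)|].
apply (fprod_neq0 all_nat (sinh_factor (PI * Ci * v)) (fun k => Cmod (v * v) * inv_square k)).
- apply summable_scal; [apply Cmod_ge_0|apply inv_square_summable].
- intros k _. rewrite sine_factor.
  match goal with |- Cmod (_ - ?u - _)%C <= _ => replace (1 - u - 1)%C with (- u)%C by ring end.
  rewrite Cmod_opp, (Cmod_mult (v * v)), Cmod_R, Rabs_right; [lra|apply Rle_ge, Rlt_le, inv_square_pos].
- apply sinh_fprod_total.
- intros k _ H. rewrite sine_factor in H.
  assert (Hk := pos_INR k). set (c := RtoC (INR k + 1)).
  assert (Ec : (c * c * RtoC (inv_square k))%C = 1).
  { unfold c, inv_square. rewrite <- !RtoC_mult. f_equal. field. lra. }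
  assert (E : ((c - v) * (c + v))%C = 0).
  { replace ((c - v) * (c + v))%C with (c * c * (1 - v * v * RtoC (inv_square k)) + v * v * (c * c * RtoC (inv_square k) - 1))%C by ring.
    rewrite H, Ec. ring. }
  assert (Ek : c = RtoC (IZR (Z.of_nat (S k)))) by (unfold c; rewrite <- INR_IZR_INZ, S_INR; easy).
  destruct (Ceq_dec (c - v)%C 0) as [E1|E1].
  + apply (Hv (Z.of_nat (S k))). rewrite <- Ek. symmetry. apply Cmod_sub_eq0. rewrite E1. apply Cmod_0.
  + destruct (Ceq_dec (c + v)%C 0) as [E2|E2]; [|now apply (Cmult_neq_0 _ _ E1 E2)].
    apply (Hv (- Z.of_nat (S k))%Z). rewrite opp_IZR, RtoC_opp, <- Ek.
    replace v with ((c + v) - c)%C by ring. rewrite E2. ring.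
Qed.

Lemma Csinh_q v : Csinh (PI * Ci * v) = (- (Cexp (- (PI * Ci * v)) / 2) * (1 - Cexp (2 * PI * Ci * v)))%C.
Proof.
unfold Csinh. replace (2 * PI * Ci * v)%C with (PI * Ci * v + PI * Ci * v)%C by ring.
rewrite Cexp_plus, Cexp_opp. assert (H := Cexp_neq0 (PI * Ci * v)). field. easy.
Qed.

(** The infinite product for the reciprocal of the characteristic series, up to a Gaussian factor: with
    [x = 2 pi i z] it is [sinh (x / 2) / (x / 2)] times the product of the
    [(1 - exp x q^m) (1 - exp (- x) q^m) / (1 - q^m)^2]. *)
Definition denom (tau z : C) : C :=
  let x := (2 * PI * Ci * z)%C in let q := qexp tau in
  (Cexp (- (x / 2)) * expm1_over x * (qprod q (Cexp x) * qprod q (Cexp (- x))) / (qprod q 1 * qprod q 1))%C.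

Lemma qexp_one_minus tau m : 0 < Im tau -> (1 - 1 * qexp tau ^ S m)%C <> RtoC 0.
Proof.
intros Ht. assert (Hq := qexp_mod tau Ht).
replace (1 - 1 * qexp tau ^ S m)%C with (1 - qexp tau ^ S m)%C by ring.
apply Cmod_gt_0. assert (H := one_minus_qpow (qexp tau) m Hq). lra.
Qed.

(** The factor of [denom] that comes from the row of index [m + 1]. *)
Definition row_ratio (tau z : C) (m : nat) : C :=
  let x := (2 * PI * Ci * z)%C in let q := qexp tau in
  ((1 - Cexp x * q ^ S m) * (1 - Cexp (- x) * q ^ S m) / ((1 - 1 * q ^ S m) * (1 - 1 * q ^ S m)))%C.

(** With [u = (m + 1) tau] the factors are [(u + z + n) (u - z + n) / (u + n)^2]; symmetric products over [n] are
    sines, at [u + z], [u - z] and [u], and [exp (2 pi i u)] is a power of [q]. *)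
Lemma row_product tau z m : 0 < Im tau ->
  filterlim (fun N => lfold Cmult (RtoC 1) (fun n => 1 - z * z / pt tau (Z.of_nat (S m), n) ^ 2)%C (zs N))
    eventually (locally (row_ratio tau z m)).
Proof.
intros Ht. set (u := (IZR (Z.of_nat (S m)) * tau)%C).
assert (Hu : forall n, (u + IZR n)%C = pt tau (Z.of_nat (S m), n)) by reflexivity.
assert (Hu0 : forall n, (u + IZR n)%C <> RtoC 0).
{ intros n. rewrite Hu. apply Cmod_gt_0, pt_neq0; [easy|]. intros H. injection H. lia. }
assert (Hn0 : forall n, u <> RtoC (IZR n)).
{ intros n H. apply (Hu0 (- n)%Z). rewrite H, opp_IZR, RtoC_opp. ring. }
apply (clim_ext_loc eventually
  (fun N => partial_sine (u + z) N * partial_sine (u - z) N * / (partial_sine u N * partial_sine u N))%C).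
- apply filter_forall. intros N.
  assert (E : (lfold Cmult (RtoC 1) (fun n => 1 - z * z / pt tau (Z.of_nat (S m), n) ^ 2)%C (zs N)
     * (shifted u N * shifted u N))%C = (shifted (u + z) N * shifted (u - z) N)%C).
  { unfold shifted. rewrite <- !(lfold_op Cmult_monoid). apply lfold_ext. intros n _.
    rewrite <- Hu. field. apply Hu0. }
  assert (Hs : shifted u N <> RtoC 0) by (apply lprod_neq0; intros n _; apply Hu0).
  rewrite !shifted_eq in E. rewrite shifted_eq in Hs.
  set (P := lfold _ _ _ _) in *. assert (Hc := sine_const_neq0 N).
  assert (Hp : partial_sine u N <> RtoC 0) by (intros H; apply Hs; rewrite H; ring).
  set (c := sine_const N) in *. set (p := partial_sine u N) in *.
  replace P with (P * (c * p * (c * p)) / (c * c * (p * p)))%C by (field; now split).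
  rewrite E. field. now split.
- assert (Hs := sine_neq0 u Hn0). assert (Hpi := PICi_neq0). set (ci := (PI * Ci)%C) in *.
  replace (row_ratio tau z m) with
    ((Csinh (ci * (u + z)) / ci) * (Csinh (ci * (u - z)) / ci) *
     / ((Csinh (ci * u) / ci) * (Csinh (ci * u) / ci)))%C.
  { assert (HS : forall v, filterlim (partial_sine v) eventually (locally (Csinh (ci * v) / ci)%C))
      by exact partial_sine_lim.
    apply (clim_mult eventually (fun N => partial_sine (u + z) N * partial_sine (u - z) N)%C).
    - apply (clim_mult eventually (partial_sine (u + z)) (partial_sine (u - z))); apply HS.
    - apply (clim_inv eventually (fun N => partial_sine u N * partial_sine u N)%C); [now apply Cmult_neq_0|].
      apply (clim_mult eventually (partial_sine u) (partial_sine u)); apply HS. }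
  assert (Hs2 : Csinh (ci * u) <> RtoC 0).
  { intros H. apply Hs. rewrite H. unfold Cdiv. ring. }
  transitivity (Csinh (ci * (u + z)) * Csinh (ci * (u - z)) / (Csinh (ci * u) * Csinh (ci * u)))%C.
  { field. now split. }
  unfold ci in *.
  unfold row_ratio. rewrite !Csinh_q.
  assert (Eq : Cexp (2 * PI * Ci * u) = (qexp tau ^ S m)%C).
  { unfold qexp. rewrite <- Cexp_nat. f_equal. unfold u. rewrite <- INR_IZR_INZ. ring. }
  replace (2 * PI * Ci * (u + z))%C with (2 * PI * Ci * z + 2 * PI * Ci * u)%C by ring.
  replace (2 * PI * Ci * (u - z))%C with (- (2 * PI * Ci * z) + 2 * PI * Ci * u)%C by ring.
  rewrite !(Cexp_plus _ (2 * PI * Ci * u)), Eq.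
  assert (Ee : (Cexp (- (PI * Ci * (u + z))) * Cexp (- (PI * Ci * (u - z))))%C =
    (Cexp (- (PI * Ci * u)) * Cexp (- (PI * Ci * u)))%C) by (rewrite <- !Cexp_plus; f_equal; ring).
  assert (H1 := qexp_one_minus tau m Ht).
  assert (H2 := Cexp_neq0 (- (PI * Ci * u))).
  set (A := Cexp (- (PI * Ci * (u + z)))) in *. set (B := Cexp (- (PI * Ci * (u - z)))) in *.
  set (D := Cexp (- (PI * Ci * u))) in *.
  set (a := Cexp (2 * PI * Ci * z)). set (b := Cexp (- (2 * PI * Ci * z))). set (Q := (qexp tau ^ S m)%C) in *.
  replace (- (A / 2) * (1 - a * Q) * (- (B / 2) * (1 - b * Q)))%C
    with ((A * B) * ((1 - a * Q) * (1 - b * Q)) / 4)%C by (field).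
  rewrite Ee. assert (H3 : (1 - Q)%C <> RtoC 0) by (intros H; apply H1; rewrite <- H; ring).
  set (R1 := (1 - 1 * Q)%C) in *. replace (1 - Q)%C with R1 by (unfold R1; ring). field. now split.
Qed.

Lemma lprod_primary {I} (f : I -> C) L :
  lfold Cmult (RtoC 1) (fun i => primary (f i)) L =
  (lfold Cmult (RtoC 1) (fun i => 1 - f i)%C L * Cexp (lfold Cplus (RtoC 0) f L))%C.
Proof.
unfold lfold, primary. induction L as [|a L IH]; simpl; [rewrite Cexp_0; ring|].
rewrite IH, Cexp_plus. ring.
Qed.

(** By rows: within the row [m] the exponentials of the primary factors multiply to [exp (z^2 e2 m)], and over all
    rows to the inverse of the exponential in the statement. So Eisenstein's row sums cancel, and what the rows
    leave behind multiplies to [denom]. *)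
Lemma half_product tau z e2 tot zeta2 W : 0 < Im tau ->
  (forall m, (0 < m)%Z ->
    filterlim (fun N => lfold Cplus (RtoC 0) (fun n => / pt tau (m, n) ^ 2)%C (zs N)) eventually (locally (e2 m))) ->
  is_fsum (fun m => (0 < m)%Z) e2 tot ->
  is_fsum all_nat (fun k => RtoC (inv_square k)) zeta2 ->
  is_fprod half (fun p => primary (z * z / pt tau p ^ 2))%C W ->
  (W * Cexp (- (z * z * (zeta2 + tot))))%C = denom tau z.
Proof.
intros Ht He2 Htot Hz2 HW. set (f := fun p => primary (z * z / pt tau p ^ 2)%C) in *.
set (x := (2 * PI * Ci * z)%C). set (q := qexp tau).
assert (Hq : Cmod q < 1) by now apply qexp_mod.
destruct (pt_min tau Ht) as [d [Hd Hmin]].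
set (A := Cmod (z * z) * / (d * d)).
set (g := fun p => (31 + 4 * ((1 + A) * exp A + 1)) * (Cmod (z * z)%C ^ 2 * Rpower (Cmod (pt tau p)) (- (4)))).
assert (Hzz := Cmod_ge_0 (z * z)).
assert (HA : 0 <= A) by (apply Rmult_le_pos; [easy|apply Rlt_le, Rinv_0_lt_compat; nra]).
assert (Hg : summable nonzero g).
{ apply summable_scal.
  - assert (0 <= (1 + A) * exp A) by (apply Rmult_le_pos; [lra|apply Rlt_le, exp_pos]). lra.
  - apply summable_scal; [apply pow2_ge_0|]. apply lattice_summable; [easy|lra]. }
assert (Hf : forall p, nonzero p -> Cmod (f p - 1)%C <= g p).
{ intros p Hp. assert (Hw := Hmin p Hp). assert (Hw0 : pt tau p <> RtoC 0) by (apply Cmod_gt_0; lra).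
  assert (E : Cmod (z * z / pt tau p ^ 2)%C = Cmod (z * z) * / (Cmod (pt tau p) * Cmod (pt tau p))).
  { rewrite Cmod_div, Cmod_pow by now apply Cpow_nz. unfold Rdiv. do 2 f_equal. ring. }
  unfold f. eapply Rle_trans; [apply (primary_bound A)|].
  - rewrite E. apply Rmult_le_compat_l; [easy|]. apply Rinv_le_contravar; nra.
  - right. unfold g. f_equal. rewrite E, Rpow_mult_distr. f_equal.
    rewrite <- Rpower_m2, <- Rpower_pow, Rpower_mult by (try apply Rpower_pos; lra). f_equal. simpl. ring. }
(* c j is the product over the row of index j *)
set (c := fun j => match j with
  | O => (Cexp (- (x / 2)) * expm1_over x * Cexp (z * z * zeta2))%C
  | S m => (row_ratio tau z m * Cexp (z * z * e2 (Z.of_nat (S m))))%C end).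
assert (Hc : is_fprod all_nat c W).
{ apply (fam_fubini Cmult_monoid (fun p => Z.to_nat (fst p)) half all_nat f); [easy| |exact HW].
  intros [|m] _; cbn [c].
  - apply (fam_reindex Cmult_monoid (fun k => (0, Z.of_nat (S k))%Z) all_nat).
    + intros i j _ _ H. injection H. lia.
    + intros k _. unfold half. cbn [fst snd]. lia.
    + intros [m n] [Hh Hm]. unfold half in Hh. cbn [fst snd] in *. exists (Z.to_nat n - 1)%nat.
      split; [easy|]. f_equal; lia.
    + assert (H1 : is_fprod all_nat (fun k => 1 - z * z * RtoC (inv_square k))%C (Cexp (- (x / 2)) * expm1_over x)%C).
      { assert (Hx2 : (PI * Ci * z)%C = (x / 2)%C) by (unfold x; field).
        assert (Hx : (2 * (PI * Ci * z))%C = x) by (unfold x; ring).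
        assert (H := sinh_fprod_total (PI * Ci * z)). rewrite Hx in H. rewrite Hx2 in H at 2.
        apply fam_ext with (2 := H). intros k _. apply sine_factor. }
      assert (H2 : is_fprod all_nat (fun k => Cexp (z * z * RtoC (inv_square k))) (Cexp (z * z * zeta2))).
      { apply (fam_morphism (op := Cplus) (e := RtoC 0) all_nat (fun k => z * z * RtoC (inv_square k))%C Cexp);
          [apply Cexp_0|apply Cexp_plus|apply Cexp_cont|]. now apply fsum_scal. }
      apply fam_ext with (2 := fam_op Cmult_monoid _ _ _ _ _ H1 H2).
      intros k _. unfold f, primary.
      assert (E : (z * z / pt tau (0%Z, Z.of_nat (S k)) ^ 2)%C = (z * z * RtoC (inv_square k))%C).
      { unfold pt, inv_square. cbn [fst snd]. rewrite <- INR_IZR_INZ, S_INR. assert (Hk := pos_INR k).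
        assert (RtoC (INR k + 1) <> RtoC 0) by (intros H; apply RtoC_inj in H; lra).
        rewrite RtoC_inv, RtoC_mult by nra. replace (0 * tau + RtoC (INR k + 1))%C with (RtoC (INR k + 1)) by ring.
        field. easy. }
      now rewrite E.
  - assert (Hm : (0 < Z.of_nat (S m))%Z) by lia.
    destruct (fprod_exists (fun p => half p /\ Z.to_nat (fst p) = S m) f g) as [l Hl].
    + apply summable_subset with (2 := Hg). intros p [Hp _]. now apply half_nonzero.
    + intros p [Hp _]. apply Hf. now apply half_nonzero.
    + assert (H0 : is_fprod (fun p => upper p /\ fst p = Z.of_nat (S m)) f l).
      { apply fam_subset_ext with (2 := Hl). intros [m' n]. unfold half, upper. cbn [fst snd]. lia. }
      assert (H1 := row_seq upper f (Z.of_nat (S m)) l (fun n => Hm) H0).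
      assert (H2 := row_product tau z m Ht).
      assert (H3 := He2 (Z.of_nat (S m)) Hm).
      assert (H4 : filterlim (fun N => Cexp (lfold Cplus (RtoC 0) (fun n => z * z / pt tau (Z.of_nat (S m), n) ^ 2)%C (zs N)))
        eventually (locally (Cexp (z * z * e2 (Z.of_nat (S m)))))).
      { eapply filterlim_comp; [|apply Cexp_cont].
        apply (clim_ext_loc eventually (fun N => z * z * lfold Cplus (RtoC 0) (fun n => / pt tau (Z.of_nat (S m), n) ^ 2)%C (zs N))%C).
        - apply filter_forall. intros N. unfold lfold. induction (zs N) as [|a L IH]; cbn [map fold_right]; [ring|].
          rewrite <- IH. unfold Cdiv. ring.
        - apply (clim_mult eventually); [apply filterlim_const|exact H3]. }
      assert (H5 := clim_mult eventually _ _ _ _ H2 H4).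
      assert (El : l = (row_ratio tau z m * Cexp (z * z * e2 (Z.of_nat (S m))))%C).
      { refine (clim_unique eventually _ _ _ H1 _).
        apply (clim_ext_loc eventually) with (2 := H5). apply filter_forall. intros N.
        symmetry. apply lprod_primary. }
      rewrite <- El. exact Hl. }
(* all limits are taken over the first M rows *)
assert (L1 : filterlim (fun M => lfold Cmult (RtoC 1) c (seq 0 (S M))) eventually (locally W)).
{ apply (fam_seq (op := Cmult) (e := RtoC 1) all_nat c W (fun M => seq 0 (S M))); [..|exact Hc].
  - intros n. apply seq_NoDup.
  - intros n. now apply Forall_forall.
  - intros i _. exists i. intros n Hn. apply in_seq. lia. }
assert (L2 : filterlim (fun M => lfold Cplus (RtoC 0) (fun m => e2 (Z.of_nat (S m))) (seq 0 M)) eventually (locally tot)).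
{ assert (H := fam_seq (op := Cplus) (e := RtoC 0) (fun m => (0 < m)%Z) e2 tot (fun M => map (fun k => Z.of_nat (S k)) (seq 0 M))).
  apply (filterlim_ext (fun M => lfold Cplus (RtoC 0) e2 (map (fun k => Z.of_nat (S k)) (seq 0 M)))).
  - intros M. apply lfold_map.
  - apply H; [..|exact Htot].
    + intros n. apply (NoDup_map_inj _ all_nat); [intros; lia|now apply Forall_forall|apply seq_NoDup].
    + intros n. apply Forall_map, Forall_forall. intros k _. lia.
    + intros i Hi. exists (Z.to_nat i). intros n Hn. apply in_map_iff. exists (Z.to_nat i - 1)%nat.
      rewrite in_seq. lia. }
assert (L3 : filterlim (fun M => Cexp (- (z * z * (zeta2 + lfold Cplus (RtoC 0) (fun m => e2 (Z.of_nat (S m))) (seq 0 M)))))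
  eventually (locally (Cexp (- (z * z * (zeta2 + tot)))))).
{ eapply filterlim_comp; [|apply Cexp_cont]. apply (clim_opp eventually).
  apply (clim_mult eventually); [apply filterlim_const|]. apply (clim_plus eventually); [apply filterlim_const|exact L2]. }
assert (L4 := clim_mult eventually _ _ _ _ L1 L3).
assert (Hp1 : qprod q 1 <> RtoC 0) by (apply qprod_neq0; [easy|]; intros m; now apply qexp_one_minus).
refine (clim_unique eventually _ _ _ L4 _).
set (PM := fun v M => lfold Cmult (RtoC 1) (fun m => 1 - v * q ^ S m)%C (seq 0 M)).
apply (clim_ext_loc eventually (fun M => Cexp (- (x / 2)) * expm1_over x *
   (PM (Cexp x) M * PM (Cexp (- x)) M) * / (PM 1 M * PM 1 M))%C).
- apply filter_forall. intros M.
  rewrite <- cons_seq, <- seq_shift.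
  change (lfold Cmult (RtoC 1) c (0%nat :: ?L)) with (c 0%nat * lfold Cmult (RtoC 1) c L)%C.
  rewrite lfold_map.
  assert (Hne : PM (RtoC 1) M <> RtoC 0).
  { apply lprod_neq0. intros m _. now apply qexp_one_minus. }
  assert (E : (lfold Cmult (RtoC 1) (fun i => c (S i)) (seq 0 M) * (PM 1 M * PM 1 M))%C =
    (PM (Cexp x) M * PM (Cexp (- x)) M *
     Cexp (z * z * lfold Cplus (RtoC 0) (fun m => e2 (Z.of_nat (S m))) (seq 0 M)))%C).
  { clear Hne. unfold PM, lfold. induction (seq 0 M) as [|a L IH]; cbn [map fold_right].
    - replace (z * z * 0)%C with (RtoC 0) by ring. rewrite Cexp_0. ring.
    - change (c (S a)) with (row_ratio tau z a * Cexp (z * z * e2 (Z.of_nat (S a))))%C. unfold row_ratio. cbv zeta. fold x q.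
      set (S1 := fold_right Cmult 1%C (map (fun m => 1 - Cexp x * q ^ S m)%C L)) in *.
      set (S2 := fold_right Cmult 1%C (map (fun m => 1 - Cexp (- x) * q ^ S m)%C L)) in *.
      set (S3 := fold_right Cmult 1%C (map (fun m => 1 - 1 * q ^ S m)%C L)) in *.
      set (S4 := fold_right Cmult 1%C (map (fun i => c (S i)) L)) in *.
      set (S5 := fold_right Cplus 0%C (map (fun m => e2 (Z.of_nat (S m))) L)) in *.
      assert (Ha := qexp_one_minus tau a Ht). fold q in Ha.
      rewrite (Cmult_plus_distr_l (z * z)), Cexp_plus.
      set (r1 := (1 - Cexp x * q ^ S a)%C). set (r2 := (1 - Cexp (- x) * q ^ S a)%C).
      set (r3 := (1 - 1 * q ^ S a)%C) in *. set (ee := Cexp (z * z * e2 (Z.of_nat (S a)))).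
      transitivity (r1 * r2 * ee * (S4 * (S3 * S3)))%C; [field; easy|]. rewrite IH. ring. }
  set (S4 := lfold Cmult (RtoC 1) (fun i => c (S i)) (seq 0 M)) in *.
  set (S5 := lfold Cplus (RtoC 0) (fun m => e2 (Z.of_nat (S m))) (seq 0 M)) in *.
  set (p1 := PM (RtoC 1) M) in *.
  replace S4 with (S4 * (p1 * p1) / (p1 * p1))%C by (field; easy). rewrite E. cbn [c].
  replace (- (z * z * (zeta2 + S5)))%C with (- (z * z * zeta2) + - (z * z * S5))%C by ring.
  rewrite (Cexp_plus (- (z * z * zeta2))), !(Cexp_opp (z * z * _)).
  assert (H1 := Cexp_neq0 (z * z * zeta2)). assert (H2 := Cexp_neq0 (z * z * S5)).
  field. now repeat split.
- unfold denom. fold x q. unfold Cdiv at 1.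
  assert (HP : forall v, filterlim (PM v) eventually (locally (qprod q v))) by (intros v; now apply qprod_lim).
  apply (clim_mult eventually).
  + apply (clim_mult eventually); [apply filterlim_const|]. apply (clim_mult eventually); apply HP.
  + apply (clim_inv eventually); [now apply Cmult_neq_0|]. apply (clim_mult eventually); apply HP.
Qed.

(** * Analytic continuation of the characteristic series *)

(** Differentiability near a point, with the derivatives in Caratheodory's form. *)
Definition holo (f : C -> C) (z : C) : Prop :=
  exists d, 0 < d /\ forall w, Cmod (w - z)%C < d -> exists l, cderiv f w l.

Lemma holo_holomorphic f z : holo f z -> holomorphic_at f z.
Proof.
intros [d [Hd H]]. apply locally_Cmod. exists d. split; [easy|]. intros w Hw.
destruct (H w Hw) as [l Hl]. eapply cderiv_ex_derive; exact Hl.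
Qed.

Lemma holo_everywhere f z : (forall w, exists l, cderiv f w l) -> holo f z.
Proof. intros H. exists 1. split; [lra|]. intros w _. apply H. Qed.

Lemma cderiv_affine a b z : cderiv (fun w => a * w + b)%C z a.
Proof.
eapply cderiv_eq; [|apply cderiv_plus; [apply cderiv_scal, cderiv_id|apply cderiv_const]]. ring.
Qed.

Lemma holo_mult f g z : holo f z -> holo g z -> holo (fun w => f w * g w)%C z.
Proof.
intros [d [Hd H]] [d' [Hd' H']]. exists (Rmin d d'). split; [now apply Rmin_pos|].
intros w Hw. destruct (H w) as [l Hl]; [eapply Rlt_le_trans; [exact Hw|apply Rmin_l]|].
destruct (H' w) as [l' Hl']; [eapply Rlt_le_trans; [exact Hw|apply Rmin_r]|].
eexists. apply cderiv_mult; eassumption.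
Qed.

Lemma holo_cont f z : holo f z -> filterlim f (locally z) (locally (f z)).
Proof.
intros [d [Hd H]]. destruct (H z) as [l Hl].
- replace (z - z)%C with (RtoC 0) by ring. now rewrite Cmod_0.
- eapply cderiv_cont; exact Hl.
Qed.

Lemma holo_neq0_near f z : holo f z -> f z <> RtoC 0 ->
  exists d, 0 < d /\ forall w, Cmod (w - z)%C < d -> f w <> RtoC 0.
Proof.
intros Hf H0. assert (Hm : 0 < Cmod (f z)) by now apply Cmod_gt_0.
assert (H := proj1 (clim_iff (locally z) f (f z)) (holo_cont f z Hf) _ Hm).
apply locally_Cmod in H. destruct H as [d [Hd H]]. exists d. split; [easy|]. intros w Hw E.
specialize (H w Hw). rewrite E, Cmod_sub_sym in H. replace (f z - 0)%C with (f z) in H by ring. lra.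
Qed.

Lemma holo_inv f z : holo f z -> f z <> RtoC 0 -> holo (fun w => / f w)%C z.
Proof.
intros Hf H0. destruct (holo_neq0_near f z Hf H0) as [d [Hd Hn]].
destruct Hf as [d' [Hd' H]]. exists (Rmin d d'). split; [now apply Rmin_pos|].
intros w Hw. destruct (H w) as [l Hl]; [eapply Rlt_le_trans; [exact Hw|apply Rmin_r]|].
eexists. apply cderiv_inv; [apply Hn; eapply Rlt_le_trans; [exact Hw|apply Rmin_l]|exact Hl].
Qed.

(** Meromorphy at a point, in the same form. *)
Definition mero (f : C -> C) (z : C) : Prop :=
  exists (N : nat) (g : C -> C), holo g z /\ exists d, 0 < d /\
    forall w, Cmod (w - z)%C < d -> w <> z -> f w = (g w / (w - z) ^ N)%C.

Lemma mero_meromorphic f z : mero f z -> meromorphic_at f z.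
Proof.
intros [N [g [Hg [d [Hd H]]]]]. exists N, g. split; [now apply holo_holomorphic|].
unfold locally', within. apply locally_Cmod. exists d. split; [easy|]. intros w Hw Hn. now apply H.
Qed.

Lemma holo_mero f z : holo f z -> mero f z.
Proof.
intros H. exists 0%nat, f. split; [easy|]. exists 1. split; [lra|]. intros w _ _. simpl. field.
Qed.

Lemma mero_mult f g z : mero f z -> mero g z -> mero (fun w => f w * g w)%C z.
Proof.
intros [N [h [Hh [d [Hd H]]]]] [N' [h' [Hh' [d' [Hd' H']]]]].
exists (N + N')%nat, (fun w => h w * h' w)%C. split; [now apply holo_mult|].
exists (Rmin d d'). split; [now apply Rmin_pos|]. intros w Hw Hn.
rewrite H, H'; try easy; try (eapply Rlt_le_trans; [exact Hw|]; first [apply Rmin_l|apply Rmin_r]).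
assert (Hz : (w - z)%C <> RtoC 0) by (intros E; apply Hn, Cmod_sub_eq0; rewrite E; apply Cmod_0).
assert (H1 : ((w - z) ^ N)%C <> RtoC 0) by now apply Cpow_nz.
assert (H2 : ((w - z) ^ N')%C <> RtoC 0) by now apply Cpow_nz.
rewrite Cpow_add_r. field. now split.
Qed.

Lemma mero_ext f g z : (exists d, 0 < d /\ forall w, Cmod (w - z)%C < d -> w <> z -> f w = g w) ->
  mero f z -> mero g z.
Proof.
intros [d [Hd E]] [N [h [Hh [d' [Hd' H']]]]]. exists N, h. split; [easy|].
exists (Rmin d d'). split; [now apply Rmin_pos|]. intros w Hw Hn.
rewrite <- E, H'; try easy; eapply Rlt_le_trans; [exact Hw|apply Rmin_r|exact Hw|apply Rmin_l].
Qed.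

Lemma Cinv_0 : (/ 0)%C = 0.
Proof. apply injective_projections; simpl; unfold Rdiv; ring. Qed.

Lemma Cinv_mult_total a b : (/ (a * b))%C = (/ a * / b)%C.
Proof.
destruct (Ceq_dec a 0) as [->|Ha]; [replace (0 * b)%C with (RtoC 0) by ring; rewrite Cinv_0; ring|].
destruct (Ceq_dec b 0) as [->|Hb]; [replace (a * 0)%C with (RtoC 0) by ring; rewrite Cinv_0; ring|].
field. now split.
Qed.

Lemma expm1_over_scaled_holo k z0 z : holo (fun w => expm1_over (k * w + z0))%C z.
Proof.
apply holo_everywhere. intros w. destruct (expm1_over_deriv (k * w + z0)) as [l Hl].
eexists. apply (cderiv_comp expm1_over (fun w => k * w + z0)%C); [exact Hl|apply cderiv_affine].
Qed.

(** At a zero [z] of the denominator it equals [- k (w - z) E (k (w - z))], where [E x = (exp x - 1) / x] does not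
    vanish at [0]. *)
Lemma mero_inv_exp c k z : k <> RtoC 0 -> mero (fun w => / (1 - c * Cexp (k * w)))%C z.
Proof.
intros Hk. destruct (Ceq_dec (1 - c * Cexp (k * z))%C 0) as [E|E].
- assert (Hexp : forall w, (1 - c * Cexp (k * w))%C = (- k * (w - z) * expm1_over (k * w + - (k * z)))%C).
  { intros w. replace (k * w)%C with (k * z + (k * w + - (k * z)))%C at 1 by ring. rewrite Cexp_plus.
    replace (- k * (w - z) * expm1_over (k * w + - (k * z)))%C
      with (- ((k * w + - (k * z)) * expm1_over (k * w + - (k * z))))%C by ring.
    rewrite expm1_over_eq.
    assert (Hc : (c * Cexp (k * z))%C = 1).
    { replace (c * Cexp (k * z))%C with (1 - (1 - c * Cexp (k * z)))%C by ring. rewrite E. ring. }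
    rewrite Cmult_assoc, Hc. ring. }
  exists 1%nat, (fun w => / (- k) * / expm1_over (k * w + - (k * z)))%C. split.
  + apply holo_mult; [apply holo_everywhere; intros w; eexists; apply cderiv_const|].
    apply (holo_inv (fun w => expm1_over (k * w + - (k * z)))%C); [apply expm1_over_scaled_holo|].
    replace (k * z + - (k * z))%C with (RtoC 0) by ring. rewrite expm1_over_0. apply C1_nz.
  + exists 1. split; [lra|]. intros w _ _. rewrite Hexp, !Cinv_mult_total. unfold Cdiv.
    replace ((w - z) ^ 1)%C with (w - z)%C by (simpl; ring). ring.
- apply holo_mero, (holo_inv (fun w => 1 - c * Cexp (k * w))%C); [|easy].
  apply holo_everywhere. intros w. eexists.
  apply (cderiv_ext_loc (fun w => - c * Cexp (k * w + 0) + 1)%C).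
  + exists 1. split; [lra|]. intros v _. replace (k * v + 0)%C with (k * v)%C by ring. ring.
  + apply cderiv_plus; [apply cderiv_scal|apply cderiv_const].
    apply (cderiv_comp Cexp (fun w => k * w + 0)%C); [apply Cexp_deriv|apply cderiv_affine].
Qed.

Lemma mero_inv_expm1 k z : k <> RtoC 0 -> mero (fun w => / expm1_over (k * w))%C z.
Proof.
intros Hk. destruct (Ceq_dec z 0) as [->|Hz].
- apply holo_mero. apply (holo_inv (fun w => expm1_over (k * w))%C).
  + destruct (expm1_over_scaled_holo k 0 0) as [d [Hd H]]. exists d. split; [easy|]. intros w Hw.
    destruct (H w Hw) as [l Hl]. exists l. apply cderiv_ext_loc with (2 := Hl).
    exists 1. split; [lra|]. intros v _. f_equal. ring.
  + replace (k * 0)%C with (RtoC 0) by ring. rewrite expm1_over_0. apply C1_nz.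
- apply (mero_ext (fun w => (- k * w + 0) * / (1 - 1 * Cexp (k * w)))%C).
  + exists (Cmod z). split; [now apply Cmod_gt_0|]. intros w Hw _.
    assert (Hw0 : w <> RtoC 0).
    { intros ->. rewrite Cmod_sub_sym in Hw. replace (z - 0)%C with z in Hw by ring. lra. }
    assert (Hkw : (- k * w)%C <> RtoC 0).
    { apply Cmult_neq_0; [|easy]. intros H. apply Hk. replace k with (- - k)%C by ring. rewrite H. ring. }
    replace (1 - 1 * Cexp (k * w))%C with (- k * w * expm1_over (k * w))%C.
    * rewrite Cinv_mult_total. replace ((- k * w + 0) * (/ (- k * w) * / expm1_over (k * w)))%C
        with ((- k * w) * / (- k * w) * / expm1_over (k * w))%C by ring.
      rewrite Cinv_r by easy. ring.
    * replace (- k * w * expm1_over (k * w))%C with (- (k * w * expm1_over (k * w)))%C by ring.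
      rewrite expm1_over_eq. ring.
  + apply mero_mult; [|now apply mero_inv_exp].
    apply holo_mero, holo_everywhere. intros w. eexists. apply cderiv_affine.
Qed.

Lemma qprod_exp_deriv q k w : Cmod q < 1 -> exists l, cderiv (fun w => qprod q (Cexp (k * w))) w l.
Proof.
intros Hq. destruct (qprod_deriv q (Cexp (k * w)) Hq) as [l Hl]. eexists.
apply (cderiv_comp (qprod q) (fun w => Cexp (k * w))); [exact Hl|].
apply (cderiv_ext_loc (fun w => Cexp (k * w + 0))).
- exists 1. split; [lra|]. intros v _. f_equal. ring.
- apply (cderiv_comp Cexp (fun w => k * w + 0)%C); [apply Cexp_deriv|apply cderiv_affine].
Qed.

(** By the functional equation finitely many factors split off so that what remains of the product does not
    vanish at [z]. *)
Lemma mero_inv_qprod q k z : Cmod q < 1 -> k <> RtoC 0 -> mero (fun w => / qprod q (Cexp (k * w)))%C z.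
Proof.
intros Hq Hk.
destruct (proj1 (clim_iff eventually _ _) (qprod_tail q (Cexp (k * z)) Hq) 1 ltac:(lra)) as [M HM].
specialize (HM M (le_n _)).
assert (H0 : qprod q (Cexp (k * z) * q ^ M) <> RtoC 0).
{ intros E. rewrite E, Cmod_sub_sym in HM. replace (1 - 0)%C with (RtoC 1) in HM by ring. rewrite Cmod_1 in HM. lra. }
apply (mero_ext (fun w => / lfold Cmult (RtoC 1) (fun m => 1 - Cexp (k * w) * q ^ S m)%C (seq 0 M) *
   / qprod q (Cexp (k * w) * q ^ M))%C).
{ exists 1. split; [lra|]. intros w _ _. now rewrite (qprod_finite q (Cexp (k * w)) M Hq), Cinv_mult_total. }
apply mero_mult.
- induction (seq 0 M) as [|m L IH].
  + apply holo_mero, holo_everywhere. intros w. exists (RtoC 0). exact (cderiv_const (/ 1)%C w).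
  + apply (mero_ext (fun w => / (1 - q ^ S m * Cexp (k * w)) *
      / lfold Cmult (RtoC 1) (fun m => 1 - Cexp (k * w) * q ^ S m)%C L)%C).
    * exists 1. split; [lra|]. intros w _ _.
      change (lfold Cmult (RtoC 1) ?f (m :: L)) with (f m * lfold Cmult (RtoC 1) f L)%C. cbv beta.
      rewrite Cinv_mult_total. do 2 f_equal. ring.
    * apply mero_mult; [now apply mero_inv_exp|easy].
- apply holo_mero. apply (holo_inv (fun w => qprod q (Cexp (k * w) * q ^ M))); [|easy].
  apply holo_everywhere. intros w. destruct (qprod_deriv q (Cexp (k * w) * q ^ M) Hq) as [l Hl]. eexists.
  apply (cderiv_comp (qprod q) (fun w => Cexp (k * w) * q ^ M)%C); [exact Hl|].
  apply (cderiv_ext_loc (fun w => q ^ M * Cexp (k * w + 0))%C).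
  + exists 1. split; [lra|]. intros v _. replace (k * v + 0)%C with (k * v)%C by ring. ring.
  + apply cderiv_scal. apply (cderiv_comp Cexp (fun w => k * w + 0)%C); [apply Cexp_deriv|apply cderiv_affine].
Qed.

Lemma C2PIi_neq0 : (2 * PI * Ci)%C <> RtoC 0.
Proof.
replace (2 * PI * Ci)%C with (2 * (PI * Ci))%C by ring. apply Cmult_neq_0; [|apply PICi_neq0].
intros H. apply RtoC_inj in H. lra.
Qed.

Lemma one_minus_exp_neq0 v : (forall n, v <> RtoC (IZR n)) -> (1 - Cexp (2 * PI * Ci * v))%C <> RtoC 0.
Proof.
intros Hv H. assert (H1 := sine_neq0 v Hv). apply H1. rewrite Csinh_q, H. unfold Cdiv. ring.
Qed.

(** A factor [1 - exp (2 pi i (m tau + z))] of the product vanishes only if [m tau + z] is an integer. *)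
Lemma denom_neq0 tau z : 0 < Im tau -> ~ nonzero_lattice_point tau z -> denom tau z <> RtoC 0.
Proof.
intros Ht Hz. set (x := (2 * PI * Ci * z)%C). set (q := qexp tau).
assert (Hq : Cmod q < 1) by now apply qexp_mod.
assert (Hlat : forall m n : Z, (m <> 0 \/ n <> 0)%Z -> z <> (IZR m * tau + IZR n)%C).
{ intros m n Hmn E. apply Hz. split; [|now exists m, n].
  rewrite E. change (pt tau (m, n) <> RtoC 0). apply Cmod_gt_0, pt_neq0; [easy|].
  intros H. injection H. lia. }
assert (Hqp : forall v, (forall m, (1 - v * q ^ S m)%C <> RtoC 0) -> qprod q v <> RtoC 0) by (intros; now apply qprod_neq0).
assert (Hqn : forall m, (q ^ S m)%C = Cexp (2 * PI * Ci * (INR (S m) * tau))).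
{ intros m. unfold q, qexp. rewrite <- Cexp_nat. f_equal. ring. }
assert (Hp1 : qprod q 1 <> RtoC 0) by (apply Hqp; intros m; now apply qexp_one_minus).
unfold denom. cbv zeta. fold x q. unfold Cdiv at 1. apply Cmult_neq_0.
- apply Cmult_neq_0; [apply Cmult_neq_0; [apply Cexp_neq0|]|apply Cmult_neq_0].
  + destruct (Ceq_dec z 0) as [Ez|Ez].
    * unfold x. rewrite Ez. replace (2 * PI * Ci * 0)%C with (RtoC 0) by ring. rewrite expm1_over_0. apply C1_nz.
    * intros H. apply (one_minus_exp_neq0 z).
      -- intros n E. destruct (Z.eq_dec n 0) as [->|Hn]; [now apply Ez|].
         apply (Hlat 0%Z n); [lia|]. rewrite E. ring.
      -- fold x. replace (1 - Cexp x)%C with (- (Cexp x - 1))%C by ring. rewrite <- expm1_over_eq, H. ring.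
  + apply Hqp. intros m. rewrite Hqn, <- Cexp_plus. unfold x. rewrite <- Cmult_plus_distr_l.
    apply one_minus_exp_neq0. intros n E. apply (Hlat (- Z.of_nat (S m))%Z n); [lia|].
    rewrite opp_IZR, <- INR_IZR_INZ, <- E, RtoC_opp. ring.
  + apply Hqp. intros m. rewrite Hqn, <- Cexp_plus. unfold x.
    replace (- (2 * PI * Ci * z) + 2 * PI * Ci * (INR (S m) * tau))%C with (2 * PI * Ci * (INR (S m) * tau - z))%C by ring.
    apply one_minus_exp_neq0. intros n E. apply (Hlat (Z.of_nat (S m))%Z (- n)%Z); [lia|].
    rewrite opp_IZR, <- INR_IZR_INZ, RtoC_opp, <- E. ring.
- rewrite Cinv_mult_total. assert (H := Cmult_neq_0 _ _ Hp1 Hp1). intros E. apply C1_nz.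
  replace (RtoC 1) with (qprod q 1 * qprod q 1 * (/ qprod q 1 * / qprod q 1))%C by (field; easy).
  rewrite E. ring.
Qed.

Lemma denom_deriv tau z : 0 < Im tau -> exists l, cderiv (denom tau) z l.
Proof.
intros Ht. set (q := qexp tau). assert (Hq : Cmod q < 1) by now apply qexp_mod.
set (k := (2 * PI * Ci)%C).
destruct (qprod_exp_deriv q k z Hq) as [l1 H1]. destruct (qprod_exp_deriv q (- k) z Hq) as [l2 H2].
destruct (expm1_over_deriv (k * z + 0)) as [l3 H3].
assert (H4 := cderiv_comp expm1_over (fun w => k * w + 0)%C z _ _ H3 (cderiv_affine k 0 z)).
assert (H5 := cderiv_comp Cexp (fun w => - (k / 2) * w + 0)%C z _ _ (Cexp_deriv _) (cderiv_affine (- (k / 2)) 0 z)).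
assert (H6 := cderiv_mult _ _ _ _ _ (cderiv_mult _ _ _ _ _ H5 H4) (cderiv_mult _ _ _ _ _ H1 H2)).
assert (H7 := cderiv_scal (/ (qprod q 1 * qprod q 1)) _ _ _ H6).
eexists. apply cderiv_ext_loc with (2 := H7). exists 1. split; [lra|]. intros w _.
unfold denom. cbv zeta. fold q k.
replace (k * w + 0)%C with (k * w)%C by ring.
replace (- (k / 2) * w + 0)%C with (- (k * w / 2))%C by (unfold Cdiv; ring).
replace (- k * w)%C with (- (k * w))%C by ring. unfold Cdiv. ring.
Qed.

(** The exponent of the characteristic series starts in weight four; the Gaussian factor removes the term of
    weight two from the logarithm of [1 / denom]. *)
Definition Q_Witten (tau z : C) : C :=
  (Cexp (- ((2 * PI * Ci * z) ^ 2 * (G2k 1 tau / 2))) * / denom tau z)%C.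

Lemma gauss_deriv tau z : exists l, cderiv (fun w => Cexp (- ((2 * PI * Ci * w) ^ 2 * (G2k 1 tau / 2))))%C z l.
Proof.
set (k := (2 * PI * Ci)%C). set (g := (G2k 1 tau / 2)%C). eexists.
apply (cderiv_ext_loc (fun w => Cexp (- (k * k * g) * (w * w)))%C).
- exists 1. split; [lra|]. intros w _. f_equal. fold k. ring.
- apply (cderiv_comp Cexp (fun w => - (k * k * g) * (w * w))%C); [apply Cexp_deriv|].
  apply cderiv_scal. apply cderiv_mult; apply cderiv_id.
Qed.

Lemma Q_Witten_holomorphic tau z : 0 < Im tau -> ~ nonzero_lattice_point tau z ->
  holomorphic_at (Q_Witten tau) z.
Proof.
intros Ht Hz. apply holo_holomorphic. unfold Q_Witten. apply holo_mult.
- apply holo_everywhere. intros w. apply gauss_deriv.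
- apply (holo_inv (denom tau)); [|now apply denom_neq0].
  apply holo_everywhere. intros w. now apply denom_deriv.
Qed.

Lemma Q_Witten_meromorphic tau z : 0 < Im tau -> meromorphic_at (Q_Witten tau) z.
Proof.
intros Ht. apply mero_meromorphic. set (q := qexp tau). assert (Hq : Cmod q < 1) by now apply qexp_mod.
set (k := (2 * PI * Ci)%C). assert (Hk : k <> RtoC 0) by exact C2PIi_neq0.
assert (Hk' : (- k)%C <> RtoC 0).
{ intros H. apply Hk. replace k with (- - k)%C by ring. rewrite H. ring. }
apply (mero_mult (fun w => Cexp (- ((2 * PI * Ci * w) ^ 2 * (G2k 1 tau / 2))))%C (fun w => / denom tau w)%C).
{ apply holo_mero, holo_everywhere. intros w. apply gauss_deriv. }
apply (mero_ext (fun w => / Cexp (- (k / 2) * w + 0) * / expm1_over (k * w) *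
  (/ qprod q (Cexp (k * w)) * / qprod q (Cexp (- k * w))) * (qprod q 1 * qprod q 1))%C).
{ assert (Hp : qprod q 1 <> RtoC 0) by (apply qprod_neq0; [easy|]; intros m; now apply qexp_one_minus).
  exists 1. split; [lra|]. intros w _ _. unfold denom, Cdiv. cbv zeta. fold q k. rewrite !Cinv_mult_total.
  replace (- (k * / 2) * w + 0)%C with (- (k * w * / 2))%C by ring.
  replace (- k * w)%C with (- (k * w))%C by ring.
  assert (Ei : (/ / qprod q 1)%C = qprod q 1) by (field; easy). rewrite Ei. ring. }
apply mero_mult; [apply mero_mult; [apply mero_mult|apply mero_mult]|].
- apply holo_mero. apply (holo_inv (fun w => Cexp (- (k / 2) * w + 0))); [|apply Cexp_neq0].
  apply holo_everywhere. intros w. eexists.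
  apply (cderiv_comp Cexp (fun w => - (k / 2) * w + 0)%C); [apply Cexp_deriv|apply cderiv_affine].
- now apply mero_inv_expm1.
- now apply mero_inv_qprod.
- now apply mero_inv_qprod.
- apply holo_mero, holo_everywhere. intros w. eexists. apply cderiv_const.
Qed.

(** * The Taylor expansion of the logarithm: Bernoulli numbers *)

Lemma cderiv_unique f z l m : cderiv f z l -> cderiv f z m -> l = m.
Proof.
intros [p [Hp [Hpz Hpl]]] [q [Hq [Hqz Hql]]].
apply Cmod_sub_eq0. apply Rle_antisym; [|apply Cmod_ge_0]. apply le_epsilon. intros eps Heps.
assert (He : 0 < eps / 2) by lra.
assert (H := filter_and _ _ (proj1 (clim_iff (locally z) _ _) Hpl _ He) (proj1 (clim_iff (locally z) _ _) Hql _ He)).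
apply locally_Cmod in H. destruct H as [d [Hd H]].
set (w := (z + RtoC (d / 2))%C).
assert (Ew : (w - z)%C = RtoC (d / 2)) by (unfold w; ring).
destruct (H w) as [H1 H2]. { rewrite Ew, Cmod_R, Rabs_right; lra. }
assert (Hpq : p w = q w).
{ assert (Hne : RtoC (d / 2) <> RtoC 0) by (intros E; apply RtoC_inj in E; lra).
  assert (E : (p w * RtoC (d / 2))%C = (q w * RtoC (d / 2))%C).
  { rewrite <- Ew. replace (p w * (w - z))%C with (f w - f z)%C by (rewrite (Hp w); ring). rewrite (Hq w). ring. }
  replace (p w) with (p w * RtoC (d / 2) / RtoC (d / 2))%C by (field; easy). rewrite E. field. easy. }
eapply Rle_trans; [apply (Cmod_tri3 _ (p w))|]. rewrite (Cmod_sub_sym l). rewrite <- Hpq in H2. lra.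
Qed.

Lemma bernoulli_upto_eq n k : (k <= n)%nat -> bernoulli_upto n k = bernoulli k.
Proof.
intros H. induction n as [|n IH]; [now replace k with 0%nat by lia|].
destruct (Nat.eq_dec k (S n)) as [->|Hk]; [easy|]. rewrite <- IH by lia.
simpl. destruct (Nat.leb_spec k n); [easy|lia].
Qed.

(** The coefficients of [x / (exp x - 1)]. *)
Definition bcoef (n : nat) : R := bernoulli n / INR (fact n).

Lemma bcoef_rec n : bcoef (S n) = - sum_f_R0 (fun j => bcoef j / INR (fact (n + 2 - j))) n.
Proof.
unfold bcoef at 1. unfold bernoulli. cbn [bernoulli_upto].
destruct (Nat.leb_spec (S n) n) as [|_]; [lia|].
rewrite (sum_eq _ (fun j => INR (fact (n + 2)) * (bcoef j / INR (fact (n + 2 - j))))).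
- replace (sum_f_R0 (fun j => INR (fact (n + 2)) * (bcoef j / INR (fact (n + 2 - j)))) n)
    with (INR (fact (n + 2)) * sum_f_R0 (fun j => bcoef j / INR (fact (n + 2 - j))) n).
  + replace (n + 2)%nat with (S (S n)) by lia. rewrite (fact_simpl (S n)), mult_INR.
    replace (S n + 1)%nat with (S (S n)) by lia.
    assert (H1 := INR_fact_neq_0 (S n)). assert (H2 : INR (S (S n)) <> 0) by now apply not_0_INR.
    field. now split.
  + rewrite scal_sum. apply sum_eq. intros; ring.
- intros j Hj. rewrite bernoulli_upto_eq by easy. unfold Binomial.C, bcoef.
  replace (S n + 1)%nat with (n + 2)%nat by lia.
  field. split; apply INR_fact_neq_0.
Qed.

Lemma inv_fact_sum n : sum_f_R0 (fun j => / INR (fact (n + 2 - j))) n <= 1 - / 2 ^ S n.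
Proof.
assert (Hf : forall k, / INR (fact (k + 2)) <= / 2 ^ S k).
{ intros k. apply Rinv_le_contravar; [apply pow_lt; lra|].
  induction k as [|k IH]; [simpl; lra|].
  replace (S k + 2)%nat with (S (k + 2)) by lia. rewrite fact_simpl, mult_INR.
  rewrite <- tech_pow_Rmult. assert (2 <= INR (S (k + 2))) by (apply (le_INR 2); lia).
  apply Rmult_le_compat; [lra|apply pow_le; lra|easy|easy]. }
induction n as [|n IH].
- simpl. lra.
- rewrite decomp_sum by lia. rewrite Nat.sub_0_r. simpl pred.
  replace (sum_f_R0 (fun i => / INR (fact (S n + 2 - S i))) n)
    with (sum_f_R0 (fun j => / INR (fact (n + 2 - j))) n) by (apply sum_eq; intros; do 3 f_equal; lia).
  specialize (Hf (S n)). assert (E : / 2 ^ S n = / 2 ^ S (S n) + / 2 ^ S (S n)).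
  { rewrite <- (tech_pow_Rmult 2 (S n)). field. apply pow_nonzero. lra. }
  lra.
Qed.

Lemma bcoef_bound n : Rabs (bcoef n) <= 1.
Proof.
induction n as [n IH] using lt_wf_ind. destruct n as [|n].
- unfold bcoef, bernoulli. simpl. rewrite Rabs_right; lra.
- rewrite bcoef_rec, Rabs_Ropp.
  eapply Rle_trans; [apply Rsum_abs|].
  apply Rle_trans with (sum_f_R0 (fun j => / INR (fact (n + 2 - j))) n).
  + apply sum_Rle. intros j Hj. unfold Rdiv. rewrite Rabs_mult.
    assert (Hp := Rinv_0_lt_compat _ (INR_fact_lt_0 (n + 2 - j))).
    rewrite (Rabs_right (/ _)) by lra. specialize (IH j ltac:(lia)). pose proof (Rabs_pos (bcoef j)). nra.
  + eapply Rle_trans; [apply inv_fact_sum|]. assert (0 < / 2 ^ S n) by (apply Rinv_0_lt_compat, pow_lt; lra). lra.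
Qed.

Lemma geom_bounded_1 (a : nat -> R) : (forall n, Rabs (a n) <= 1) -> geom_bounded (fun n => RtoC (a n)) 1.
Proof. intros H. exists 1. intros n. rewrite pow1, Cmod_R, Rmult_1_r. apply H. Qed.

(** The Cauchy product, by Fubini on the family of all products of terms. *)
Lemma cauchy_product (u v : nat -> C) U V :
  summable all_nat (fun n => Cmod (u n)) -> summable all_nat (fun n => Cmod (v n)) ->
  is_fsum all_nat u U -> is_fsum all_nat v V ->
  is_fsum all_nat (fun n => lfold Cplus (RtoC 0) (fun i => u i * v (n - i)%nat)%C (seq 0 (S n))) (U * V)%C.
Proof.
intros Su Sv Hu Hv.
set (A := fun p : nat * nat => all_nat (fst p) /\ all_nat (snd p)).
set (f := fun p : nat * nat => (u (fst p) * v (snd p))%C).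
destruct (fsum_exists A f _ (summable_prod _ _ _ _ Su Sv)) as [T HT].
{ intros p _. unfold f. rewrite Cmod_mult. lra. }
assert (ET : T = (U * V)%C).
{ apply (fam_unique (op := Cplus) (e := RtoC 0) all_nat (fun i => V * u i)%C).
  - apply (fam_fubini Cplus_monoid fst A all_nat f); [easy| |easy].
    intros i _. apply (fam_reindex Cplus_monoid (fun j => (i, j)) all_nat).
    + congruence.
    + intros j _. now repeat split.
    + intros [i' j] [_ E]. exists j. simpl in E. now subst i'.
    + replace (V * u i)%C with (u i * V)%C by ring. now apply fsum_scal.
  - replace (U * V)%C with (V * U)%C by ring. now apply fsum_scal. }
rewrite <- ET. apply (fam_fubini Cplus_monoid (fun p => fst p + snd p)%nat A all_nat f); [easy| |easy].
intros n _. rewrite <- (lfold_map Cplus (RtoC 0) f (fun i => (i, (n - i)%nat))).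
apply (fam_finite Cplus_monoid).
- apply (NoDup_map_inj _ all_nat); [intros; congruence|now apply Forall_forall|apply seq_NoDup].
- apply Forall_map, Forall_forall. intros i Hi. apply in_seq in Hi. cbn [fst snd]. split; [now split|lia].
- intros [i j] [_ E] Hn. exfalso. apply Hn, in_map_iff. cbn [fst snd] in E. exists i.
  rewrite in_seq. split; [f_equal; lia|lia].
Qed.

Definition beta (x : C) : C := ps (fun n => RtoC (bcoef n)) x.

Lemma sum_f_lsum (f : nat -> R) n : lsum f (seq 0 (S n)) = sum_f_R0 f n.
Proof.
induction n as [|n IH]; [unfold lsum; simpl; ring|].
rewrite seq_S, lsum_app, IH. unfold lsum. simpl. ring.
Qed.

(** The recursion of the Bernoulli numbers says that [beta] is the inverse of [(exp x - 1) / x]. *)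
Lemma beta_inverse x : Cmod x < 1 -> (beta x * expm1_over x)%C = 1.
Proof.
intros Hx. assert (Hx0 := Cmod_ge_0 x).
destruct (ps_fsum _ 1 x (geom_bounded_1 _ bcoef_bound) Hx) as [Sb [Fb _]].
destruct (ps_fsum _ 1 x (expm1_bound 1 ltac:(lra)) Hx) as [Se [Fe _]].
assert (H := cauchy_product _ _ _ _ Sb Se Fb Fe).
refine (fam_unique _ _ _ _ H _).
assert (H0 : is_fsum all_nat (fun n => if Nat.eqb n 0 then RtoC 1 else RtoC 0)
   (lfold Cplus (RtoC 0) (fun n => if Nat.eqb n 0 then RtoC 1 else RtoC 0) [0%nat])).
{ apply (fam_finite Cplus_monoid); [repeat constructor; easy|repeat constructor|].
  intros [|n] _ Hn; [exfalso; apply Hn; now left|easy]. }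
replace (lfold Cplus (RtoC 0) (fun n => if Nat.eqb n 0 then RtoC 1 else RtoC 0) [0%nat]) with (RtoC 1) in H0
  by (unfold lfold; simpl; ring).
apply fam_ext with (2 := H0). intros n _. symmetry.
rewrite (lfold_ext _ (fun i => x ^ n * RtoC (bcoef i / INR (fact (S n - i))))%C).
2: { intros i Hi. apply in_seq in Hi. unfold inv_fact.
  replace (S (n - i)) with (S n - i)%nat by lia.
  replace (x ^ n)%C with (x ^ i * x ^ (n - i))%C by (rewrite <- Cpow_add_r; f_equal; lia).
  unfold Rdiv. rewrite RtoC_mult. ring. }
assert (E : forall (g : nat -> R) L, lfold Cplus (RtoC 0) (fun i => x ^ n * RtoC (g i))%C L = (x ^ n * RtoC (lsum g L))%C).
{ intros g L. unfold lfold, lsum. induction L as [|a L IH]; simpl; [ring|]. rewrite IH, RtoC_plus. ring. }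
rewrite E, sum_f_lsum. destruct n as [|n].
- simpl. unfold bcoef, bernoulli. simpl. replace (1 / 1 / 1) with 1 by field. ring.
- rewrite tech5. replace (S (S n) - S n)%nat with 1%nat by lia.
  rewrite bcoef_rec. cbn [Nat.eqb].
  replace (sum_f_R0 (fun i => bcoef i / INR (fact (S (S n) - i))) n)
    with (sum_f_R0 (fun j => bcoef j / INR (fact (n + 2 - j))) n) by (apply sum_eq; intros; do 3 f_equal; lia).
  replace (_ + _ / INR (fact 1)) with 0 by (simpl; field). ring.
Qed.

(** The function [log (exp (x / 2) x / (exp x - 1))] has the derivative [(1 - b(x)) / x] with [b] the even part
    of [x / (exp x - 1)]; its terms of positive degree are integrated. The division by [0] makes
    the constant coefficient [0]. *)
Definition lcoef (n : nat) : R := - (bcoef n * ((1 + (-1) ^ n) / 2)) / INR n.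

Lemma neg1_pow n : (-1) ^ n = 1 \/ (-1) ^ n = -1.
Proof. induction n as [|n [IH|IH]]; simpl; [left; lra|right; lra|left; lra]. Qed.

Lemma lcoef_bound n : Rabs (lcoef n) <= 1.
Proof.
unfold lcoef, Rdiv. destruct n as [|n].
- simpl. rewrite Rinv_0, Rmult_0_r, Rabs_R0. lra.
- assert (H := bcoef_bound (S n)).
  assert (H1 : 1 <= INR (S n)) by (apply (le_INR 1); lia).
  assert (H2 : 0 < / INR (S n) <= 1).
  { split; [apply Rinv_0_lt_compat; lra|]. rewrite <- Rinv_1. apply Rinv_le_contravar; lra. }
  rewrite Rabs_mult, Rabs_Ropp, Rabs_mult, (Rabs_right (/ _)) by lra.
  assert (H3 : Rabs ((1 + (-1) ^ S n) * / 2) <= 1).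
  { destruct (neg1_pow (S n)) as [-> | ->]; apply Rabs_le; lra. }
  pose proof (Rabs_pos (bcoef (S n))). pose proof (Rabs_pos ((1 + (-1) ^ S n) * / 2)).
  assert (Rabs (bcoef (S n)) * Rabs ((1 + (-1) ^ S n) * / 2) <= 1) by nra. nra.
Qed.

Definition logsinh (x : C) : C := ps (fun n => RtoC (lcoef n)) x.
Definition logsinh' (x : C) : C := ps (fun n => INR (S n) * RtoC (lcoef (S n)))%C x.

Lemma Cpow_opp x n : ((- x) ^ n)%C = (RtoC ((-1) ^ n) * x ^ n)%C.
Proof. induction n as [|n IH]; simpl; [ring|]. rewrite IH, RtoC_mult. ring. Qed.

Lemma logsinh'_eq x : Cmod x < 1 -> (x * logsinh' x)%C = (1 - (beta x + beta (- x)) / 2)%C.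
Proof.
intros Hx. assert (Hx0 := Cmod_ge_0 x).
assert (Hl := geom_bounded_1 _ lcoef_bound). assert (Hb := geom_bounded_1 _ bcoef_bound).
set (r := (Cmod x + 1) / 2).
destruct (ps_fsum _ r x (geom_bounded_derivative _ 1 r ltac:(unfold r; lra) Hl) ltac:(unfold r; lra)) as [_ [_ S1]].
destruct (ps_fsum _ 1 x Hb Hx) as [_ [_ S2]].
destruct (ps_fsum _ 1 (- x)%C Hb ltac:(rewrite Cmod_opp; lra)) as [_ [_ S3]].
fold (beta x) in S2. fold (beta (- x)%C) in S3. fold (logsinh' x) in S1.
assert (S4 := is_series_scal (/ 2)%C _ _ (is_series_plus _ _ _ _ S2 S3)).
set (T := fun n => scal (/ 2)%C (plus (RtoC (bcoef n) * x ^ n)%C (RtoC (bcoef n) * (- x) ^ n)%C)) in S4.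
assert (S5 : is_series (fun n => T (S n)) ((beta x + beta (- x)) / 2 - 1)%C).
{ apply (is_series_incr_1 T).
  match goal with |- is_series _ ?u => replace u with (scal (/ 2)%C (plus (beta x) (beta (- x)))) end; [exact S4|].
  unfold T. change plus with Cplus. change scal with Cmult.
  match goal with |- @eq _ ?a ?b => change (@eq C a b) end.
  unfold bcoef, bernoulli. simpl. replace (1 / 1) with 1 by field. field. }
assert (S6 := is_series_scal (- x)%C _ _ S1).
assert (E : (- x * logsinh' x)%C = ((beta x + beta (- x)) / 2 - 1)%C).
{ apply (clim_unique eventually (sum_n (fun n => T (S n)))); [|exact S5].
  apply (is_series_ext (K := C_AbsRing) (V := C_NormedModule)) with (2 := S6). intros n.
  unfold T. change plus with Cplus. change scal with Cmult.
  match goal with |- @eq _ ?a ?b => change (@eq C a b) end.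
  rewrite Cpow_opp. unfold lcoef. set (e := (-1) ^ S n). set (b := bcoef (S n)).
  assert (Hn : INR (S n) <> 0) by now apply not_0_INR.
  replace (RtoC (INR (S n)) * RtoC (- (b * ((1 + e) / 2)) / INR (S n)))%C with (RtoC (- (b * ((1 + e) / 2)))).
  2: { rewrite <- RtoC_mult. f_equal. field. easy. }
  replace (- (b * ((1 + e) / 2))) with (- (b + b * e) * / 2) by field.
  rewrite RtoC_mult, RtoC_opp, RtoC_plus, RtoC_mult, RtoC_inv by lra. simpl Cpow. ring. }
replace (x * logsinh' x)%C with (- (- x * logsinh' x))%C by ring. rewrite E. ring.
Qed.

Lemma expm1_over_opp x : expm1_over (- x) = (Cexp (- x) * expm1_over x)%C.
Proof.
destruct (Ceq_dec x 0) as [->|Hx].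
- replace (- 0)%C with (RtoC 0) by ring. rewrite expm1_over_0, Cexp_0. ring.
- assert (H1 := expm1_over_eq x). assert (H2 := expm1_over_eq (- x)).
  rewrite Cexp_opp in *. assert (H0 := Cexp_neq0 x).
  replace (expm1_over (- x)) with (- (- x * expm1_over (- x)) / x)%C by (field; easy).
  rewrite H2. replace (expm1_over x) with (x * expm1_over x / x)%C by (field; easy). rewrite H1.
  field. now split.
Qed.

(** [exp (logsinh x) = exp (x / 2) x / (exp x - 1)]: both sides satisfy the same differential equation. *)
Lemma logsinh_exp x : Cmod x < 1 ->
  (Cexp (logsinh x) * (Cexp (- (x / 2)) * expm1_over x))%C = 1.
Proof.
intros Hx. set (h := fun w => (Cexp (logsinh w) * (Cexp (- (w / 2)) * expm1_over w))%C).
assert (Hl := geom_bounded_1 _ lcoef_bound).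
assert (Hh : h x = h 0).
{ apply (cderiv_zero_const h 1 x); [|easy]. intros w Hw. unfold h.
  assert (D1 : cderiv logsinh w (logsinh' w)) by exact (ps_deriv (fun n => RtoC (lcoef n)) 1 w Hl Hw).
  destruct (expm1_over_deriv w) as [s Hs].
  assert (D2 : cderiv (fun w => Cexp (- (w / 2))) w (Cexp (- (w / 2)) * - / 2)%C).
  { apply (cderiv_comp Cexp (fun w => - (w / 2))%C); [apply Cexp_deriv|].
    apply (cderiv_ext_loc (fun w => - / 2 * w + 0)%C); [|apply cderiv_affine].
    exists 1. split; [lra|]. intros v _. unfold Cdiv. ring. }
  (* differentiating w E(w) = exp w - 1 determines the derivative s of E away from w = 0 *)
  assert (Es : (expm1_over w + w * s)%C = Cexp w).
  { assert (D3 := cderiv_mult _ _ _ _ _ (cderiv_id w) Hs). cbv beta in D3.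
    replace (expm1_over w + w * s)%C with (1 * expm1_over w + w * s)%C by ring.
    apply (cderiv_unique Cexp w); [|apply Cexp_deriv].
    apply (cderiv_ext_loc (fun w => w * expm1_over w + 1)%C).
    - exists 1. split; [lra|]. intros v _. rewrite expm1_over_eq. ring.
    - eapply cderiv_eq; [|apply cderiv_plus; [exact D3|apply cderiv_const]]. ring. }
  assert (D := cderiv_mult _ _ _ _ _ (cderiv_comp Cexp logsinh w _ _ (Cexp_deriv _) D1) (cderiv_mult _ _ _ _ _ D2 Hs)). cbv beta in D.
  eapply cderiv_eq; [|exact D].
  set (S0 := expm1_over w) in *. set (F := Cexp (logsinh w)). set (E := Cexp (- (w / 2))).
  replace (F * logsinh' w * (E * S0) + F * (E * - / 2 * S0 + E * s))%C
    with (F * E * (logsinh' w * S0 - / 2 * S0 + s))%C by ring.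
  assert (HK : (w * (logsinh' w * S0 - / 2 * S0 + s))%C = 0).
  { assert (H1 := logsinh'_eq w Hw). assert (H2 := beta_inverse w Hw).
    assert (H3 := beta_inverse (- w) ltac:(rewrite Cmod_opp; lra)).
    rewrite expm1_over_opp in H3. fold S0 in H2, H3. rewrite Cexp_opp in H3.
    assert (He := Cexp_neq0 w). assert (H4 := expm1_over_eq w). fold S0 in H4.
    assert (HS0 : S0 <> RtoC 0).
    { intros H. rewrite H in H2. replace (beta w * 0)%C with (RtoC 0) in H2 by ring. apply RtoC_inj in H2. lra. }
    assert (Hbm : beta (- w) = (Cexp w * beta w)%C).
    { replace (beta (- w)) with (beta (- w) * (/ Cexp w * S0) * (Cexp w * / S0))%C by (field; now split).
      rewrite H3. replace (beta w) with (beta w * S0 * / S0)%C by (field; easy). rewrite H2. ring. }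
    replace (w * (logsinh' w * S0 - / 2 * S0 + s))%C with (w * logsinh' w * S0 - / 2 * (w * S0) + ((S0 + w * s) - S0))%C by ring.
    rewrite H1, Es, Hbm, H4.
    replace ((1 - (beta w + Cexp w * beta w) / 2) * S0)%C with (S0 - (beta w * S0 * (1 + Cexp w)) / 2)%C by (unfold Cdiv; ring).
    rewrite H2. field. }
  destruct (Ceq_dec w 0) as [Ew|Ew].
  - (* at the origin, where the factor w carries no information, the coefficients give the derivatives *)
    assert (Es0 : s = RtoC (/ 2)).
    { apply (cderiv_unique expm1_over w s); [easy|]. rewrite Ew.
      eapply cderiv_eq; [|apply (ps_deriv _ 1); [apply expm1_bound; lra|rewrite Cmod_0; lra]].
      rewrite ps_0. unfold inv_fact. rewrite <- RtoC_mult. f_equal. simpl. field. }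
    assert (El : logsinh' w = RtoC 0).
    { rewrite Ew. unfold logsinh'. rewrite ps_0, <- RtoC_mult. f_equal. unfold lcoef. simpl. field. }
    rewrite Es0, El. unfold S0. rewrite Ew, expm1_over_0, RtoC_inv by lra. ring.
  - replace (logsinh' w * S0 - / 2 * S0 + s)%C with (w * (logsinh' w * S0 - / 2 * S0 + s) / w)%C by (field; easy).
    rewrite HK. unfold Cdiv. ring. }
unfold h in Hh. rewrite Hh. unfold logsinh. rewrite ps_0.
replace (RtoC (lcoef 0)) with (RtoC 0).
2: { f_equal. unfold lcoef, Rdiv. simpl. rewrite Rinv_0. ring. }
replace (- (0 / 2))%C with (RtoC 0) by (unfold Cdiv; ring). rewrite Cexp_0, expm1_over_0. ring.
Qed.

Lemma even_series (u : nat -> C) l : is_series u l -> u 0%nat = 0 -> (forall k, u (S (2 * k)) = 0) ->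
  is_series (fun k => u (2 * k + 2)%nat) l.
Proof.
intros H H0 Hodd.
assert (Hs : filterlim (fun k => (2 * k + 2)%nat) eventually eventually) by (apply eventually_subseq; intros n; lia).
assert (H1 := filterlim_comp _ _ _ _ _ _ _ _ Hs H).
unfold is_series. apply (clim_ext_loc eventually) with (2 := H1). apply filter_forall. intros n.
induction n as [|n IH].
- change (2 * 0 + 2)%nat with 2%nat. rewrite !sum_Sn, !sum_O, H0. rewrite (Hodd 0%nat : u 1%nat = 0). cring.
- replace (2 * S n + 2)%nat with (S (S (2 * n + 2))) by lia. rewrite !sum_Sn, IH.
  replace (S (2 * n + 2)) with (S (2 * (n + 1))) at 1 by lia. rewrite Hodd.
  replace (2 * S n + 2)%nat with (S (S (2 * n + 2))) by lia. cring.
Qed.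

Lemma logsinh_series x : Cmod x < 1 ->
  is_series (fun k => RtoC (- (bernoulli (2 * (k + 1)) / INR (2 * (k + 1)))) * x ^ (2 * (k + 1)) / INR (fact (2 * (k + 1))))%C
    (logsinh x).
Proof.
intros Hx. destruct (ps_fsum _ 1 x (geom_bounded_1 _ lcoef_bound) Hx) as [_ [_ H]]. fold (logsinh x) in H.
apply even_series in H.
- revert H. apply is_series_ext. intros k. replace (2 * k + 2)%nat with (2 * (k + 1))%nat by lia.
  unfold lcoef, bcoef. rewrite pow_1_even.
  assert (H1 := INR_fact_neq_0 (2 * (k + 1))). assert (H2 : INR (2 * (k + 1)) <> 0) by (apply not_0_INR; lia).
  set (B := bernoulli _). set (N := INR (2 * (k + 1))) in *. set (F := INR (fact _)) in *.
  replace (- (B / F * ((1 + 1) / 2)) / N) with (- (B / N) * / F) by (field; now split).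
  rewrite RtoC_mult, RtoC_inv by easy. unfold Cdiv.
  match goal with |- @eq _ ?a ?b => change (@eq C a b) end. ring.
- unfold lcoef, Rdiv. simpl. rewrite Rinv_0, Rmult_0_r. ring.
- intros k. unfold lcoef. rewrite pow_1_odd. unfold Rdiv.
  replace (- (bcoef (S (2 * k)) * ((1 + -1) * / 2)) * / INR (S (2 * k))) with 0 by ring. ring.
Qed.

(** * The Taylor expansion of the logarithm: divisor sums *)

(** [- log (1 - y)]; the term of index [0] vanishes because [/ 0 = 0]. *)
Definition log_series (y : C) : C := ps (fun d => RtoC (/ INR d)) y.

Lemma log_coef_bound d : Rabs (/ INR d) <= 1.
Proof.
destruct d as [|d]; [simpl; rewrite Rinv_0, Rabs_R0; lra|].
assert (1 <= INR (S d)) by (apply (le_INR 1); lia).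
rewrite Rabs_right by (apply Rle_ge, Rlt_le, Rinv_0_lt_compat; lra).
rewrite <- Rinv_1. apply Rinv_le_contravar; lra.
Qed.

Lemma log_series_exp y : Cmod y < 1 -> (Cexp (log_series y) * (1 - y))%C = 1.
Proof.
intros Hy. set (h := fun w => (Cexp (log_series w) * (-1 * w + 1))%C).
assert (Hl := geom_bounded_1 _ log_coef_bound).
assert (H1b : geom_bounded (fun _ => RtoC 1) 1).
{ exists 1. intros n. rewrite pow1, Cmod_1. lra. }
assert (Hh : h y = h 0).
{ apply (cderiv_zero_const h 1 y); [|easy]. intros w Hw.
  assert (D1 := ps_deriv (fun d => RtoC (/ INR d)) 1 w Hl Hw).
  rewrite (ps_ext _ (fun _ => RtoC 1)) in D1.
  2: { intros n. rewrite <- RtoC_mult. f_equal. apply Rinv_r. now apply not_0_INR. }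
  set (g := ps (fun _ => RtoC 1) w) in *.
  destruct (ps_fsum _ 1 w H1b Hw) as [_ [_ S1]]. fold g in S1.
  assert (Hg : (w * g)%C = (g - 1)%C).
  { assert (S2 : is_series (fun n => 1 * w ^ S n)%C (g - 1)%C).
    { apply (is_series_incr_1 (fun n => 1 * w ^ n)%C).
      match goal with |- is_series _ ?u => replace u with g end; [exact S1|]. cring. }
    apply (clim_unique eventually (sum_n (fun n => 1 * w ^ S n)%C)); [|exact S2].
    apply (is_series_ext (K := C_AbsRing) (V := C_NormedModule)) with (2 := is_series_scal w _ _ S1).
    intros n. cring. }
  assert (D := cderiv_mult _ _ _ _ _ (cderiv_comp Cexp log_series w _ _ (Cexp_deriv _) D1) (cderiv_affine (-1) 1 w)).
  cbv beta in D. eapply cderiv_eq; [|exact D].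
  replace (Cexp (log_series w) * g * (-1 * w + 1) + Cexp (log_series w) * -1)%C
    with (Cexp (log_series w) * (g - w * g - 1))%C by ring.
  rewrite Hg. ring. }
unfold h in Hh. replace (1 - y)%C with (-1 * y + 1)%C by ring. rewrite Hh.
unfold log_series. rewrite ps_0. simpl. rewrite Rinv_0, Cexp_0. ring.
Qed.

Lemma fsum_shift (f : nat -> C) l : summable all_nat (fun n => Cmod (f n)) -> is_fsum all_nat f l ->
  is_fsum all_nat (fun n => f (S n)) (l - f 0%nat)%C.
Proof.
intros Hs Hl. apply series_is_fsum.
- apply (summable_inj S all_nat all_nat (fun n => Cmod (f n))); [intros; congruence|easy|easy].
- apply (is_series_incr_1 f).
  match goal with |- is_series _ ?u => replace u with l end; [now apply fsum_is_series|]. cring.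
Qed.

(** The triple expansion of the logarithm of the [q]-product: the terms [y^d / d] of [- log (1 - y)] at
    [y = exp x q^m], [exp (- x) q^m] and (twice, negatively) [q^m], with [exp (d x) + exp (- d x) - 2] expanded in
    powers of [x]. All indices are shifted by one. Summation over [k] first gives the product, summation
    over [m] and [d] first gives the divisor sums. *)
Definition lterm (q x : C) (i : nat * nat * nat) : C :=
  let M := S (fst (fst i)) in let D := S (snd (fst i)) in let K := (2 * S (snd i))%nat in
  (q ^ (M * D) / INR D * (2 * (INR D * x) ^ K / INR (fact K)))%C.

Definition all2 (p : nat * nat) : Prop := all_nat (fst p) /\ all_nat (snd p).
Definition all3 (i : nat * nat * nat) : Prop := all2 (fst i) /\ all_nat (snd i).

Lemma geom_summable r : 0 <= r < 1 -> summable all_nat (fun n => r ^ n).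
Proof.
intros Hr. apply summable_of_series; [intros n; now apply pow_le|].
apply ex_series_geom. rewrite Rabs_right; lra.
Qed.

Lemma even_exp_bound a L : 0 <= a -> NoDup L ->
  lsum (fun k => a ^ (2 * S k) / INR (fact (2 * S k))) L <= exp a.
Proof.
intros Ha HL. set (g := fun n => / INR (fact n) * a ^ n).
rewrite (lsum_le _ (fun k => g (2 * S k)%nat)).
2: { intros k _. unfold g, Rdiv. rewrite Rmult_comm. lra. }
rewrite <- (lsum_map g (fun k => (2 * S k)%nat)).
apply exp_lsum_le; [easy|].
apply (NoDup_map_inj _ all_nat); [intros; lia|now apply Forall_forall|easy].
Qed.

(** The sum over [k] is at most [2 |q|^(m d) exp (d |x|)], and [exp (d |x|) <= |q|^(- d / 2)]. *)
Lemma lterm_summable tau x : 0 < Im tau -> Cmod x <= PI * Im tau ->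
  summable all3 (fun i => Cmod (lterm (qexp tau) x i)).
Proof.
intros Ht Hx. set (y := Im tau) in *. set (q := qexp tau).
assert (Hpi := PI_RGT_0). assert (Hx0 := Cmod_ge_0 x).
assert (Hqm : Cmod q = exp (- (2 * PI * y))).
{ unfold q, qexp, y. rewrite Cmod_Cexp. f_equal. destruct tau as [a b]. simpl. ring. }
set (r := exp (- (PI * y / 2))).
assert (Hr : 0 <= r < 1).
{ unfold r. split; [apply Rlt_le, exp_pos|]. rewrite <- exp_0. apply exp_increasing. nra. }
assert (Hr0 : 0 < r) by apply exp_pos.
apply (summable_dep all2 (fun i => Cmod (lterm q x i)) (fun _ => all_nat)
  (fun p => 2 * (r ^ fst p * r ^ snd p))).
- intros; apply Cmod_ge_0.
- intros [m d] _ L HL _. set (M := S m). set (D := S d).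
  assert (HD : 1 <= INR D) by (apply (le_INR 1); unfold D; lia).
  assert (HM : 1 <= INR M) by (apply (le_INR 1); unfold M; lia).
  assert (Hterm : forall k, Cmod (lterm q x (m, d, k)) =
    2 * (Cmod q ^ (M * D) / INR D) * ((INR D * Cmod x) ^ (2 * S k) / INR (fact (2 * S k)))).
  { intros k. unfold lterm. cbn [fst snd]. fold M D.
    assert (Hf := INR_fact_lt_0 (2 * S k)).
    rewrite Cmod_mult, Cmod_div, (Cmod_div (2 * _)), Cmod_mult, !Cmod_pow, Cmod_mult, !Cmod_R by
      (intros H; apply RtoC_inj in H; lra).
    rewrite !Rabs_right by lra. unfold Rdiv. ring. }
  rewrite (lsum_le _ (fun k => 2 * (Cmod q ^ (M * D) / INR D) * ((INR D * Cmod x) ^ (2 * S k) / INR (fact (2 * S k)))))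
    by (intros k _; rewrite Hterm; lra).
  rewrite lsum_scal.
  assert (HDx : 0 <= INR D * Cmod x) by nra.
  assert (Hqp : 0 <= Cmod q ^ (M * D)) by apply pow_le, Cmod_ge_0.
  apply Rle_trans with (2 * (Cmod q ^ (M * D) / INR D) * exp (INR D * Cmod x)).
  { apply Rmult_le_compat_l; [|now apply even_exp_bound].
    apply Rmult_le_pos; [lra|]. apply Rdiv_le_0_compat; lra. }
  rewrite Rmult_assoc. apply Rmult_le_compat_l; [lra|].
  apply Rle_trans with (Cmod q ^ (M * D) * exp (INR D * Cmod x)).
  { apply Rmult_le_compat_r; [apply Rlt_le, exp_pos|]. apply Rle_div_l; nra. }
  (* compare exponents, using 2 M D >= M + D *)
  cbn [fst snd]. rewrite <- pow_add, Hqm, <- !Rpower_pow by (try apply exp_pos; easy).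
  unfold r, Rpower. rewrite !ln_exp, <- exp_plus. apply exp_mono.
  rewrite mult_INR, plus_INR.
  assert (Em : INR m = INR M - 1) by (unfold M; rewrite S_INR; ring).
  assert (Ed : INR d = INR D - 1) by (unfold D; rewrite S_INR; ring).
  rewrite Em, Ed. assert (HMD : INR D <= INR M * INR D) by nra.
  assert (HMD2 : INR M + INR D <= 2 * (INR M * INR D)) by nra.
  assert (HDxy : INR D * Cmod x <= INR D * (PI * y)) by (apply Rmult_le_compat_l; lra).
  assert (Hpy : 0 < PI * y) by (apply Rmult_lt_0_compat; easy).
  set (P := PI * y) in *. replace (2 * PI * y) with (2 * P) by (unfold P; ring). nra.
- apply summable_scal; [lra|]. exact (summable_prod _ _ _ _ (geom_summable r Hr) (geom_summable r Hr)).
Qed.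

Lemma cosh_series y : is_fsum all_nat (fun k => 2 * y ^ (2 * S k) / INR (fact (2 * S k)))%C
  (Cexp y + Cexp (- y) - 2)%C.
Proof.
assert (Hy := Cmod_ge_0 y).
assert (Hb : geom_bounded inv_fact (Cmod y + 1)) by (apply inv_fact_bound; lra).
destruct (ps_fsum inv_fact (Cmod y + 1) y Hb ltac:(lra)) as [_ [_ H1]].
destruct (ps_fsum inv_fact (Cmod y + 1) (- y)%C Hb ltac:(rewrite Cmod_opp; lra)) as [_ [_ H2]].
rewrite Cexp_series in H1, H2.
set (u := fun n => match n with O => RtoC 0 | _ => (inv_fact n * y ^ n + inv_fact n * (- y) ^ n)%C end).
assert (Hu : is_series u (Cexp y + Cexp (- y) - 2)%C).
{ apply is_series_decr_1. 
  apply (is_series_ext (fun n => plus (inv_fact (S n) * y ^ S n)%C (inv_fact (S n) * (- y) ^ S n)%C)); [easy|].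
  apply (is_series_incr_1 (fun n => plus (inv_fact n * y ^ n)%C (inv_fact n * (- y) ^ n)%C)).
  match goal with |- is_series _ ?v => replace v with (plus (Cexp y) (Cexp (- y))) end; [now apply (is_series_plus (V := C_NormedModule))|].
  change plus with Cplus. change opp with Copp. unfold u, inv_fact. simpl. rewrite Rinv_1.
  match goal with |- @eq _ ?a ?b => change (@eq C a b) end. ring. }
apply even_series in Hu; [|easy|].
- apply series_is_fsum.
  + split; [intros; apply Cmod_ge_0|]. exists (2 * exp (Cmod y)). intros L HL _.
    rewrite (lsum_le _ (fun k => 2 * (Cmod y ^ (2 * S k) / INR (fact (2 * S k))))).
    * rewrite lsum_scal. apply Rmult_le_compat_l; [lra|]. now apply even_exp_bound.
    * intros k _. assert (Hf := INR_fact_lt_0 (2 * S k)).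
      rewrite Cmod_div, Cmod_mult, Cmod_pow, !Cmod_R, !Rabs_right by (try (intros H; apply RtoC_inj in H); lra).
      right. unfold Rdiv. ring.
  + apply (is_series_ext (K := C_AbsRing) (V := C_NormedModule)) with (2 := Hu). intros k.
    replace (2 * k + 2)%nat with (2 * S k)%nat by lia.
    unfold u. destruct (2 * S k)%nat as [|n] eqn:E; [lia|]. rewrite <- E. rewrite Cpow_opp, pow_1_even.
    assert (Hf := INR_fact_neq_0 (2 * S k)). unfold inv_fact. rewrite RtoC_inv by easy. unfold Cdiv.
    match goal with |- @eq _ ?a ?b => change (@eq C a b) end. ring.
- intros k. unfold u. rewrite Cpow_opp, pow_1_odd. ring.
Qed.

(** The equation is stated in exponentiated form, so that no branch of the logarithm has to be chosen. *)
Lemma lterm_sum_product tau x T : 0 < Im tau -> Cmod x <= PI * Im tau ->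
  is_fsum all3 (lterm (qexp tau) x) T ->
  let q := qexp tau in
  (Cexp T * (qprod q (Cexp x) * qprod q (Cexp (- x))))%C = (qprod q 1 * qprod q 1)%C.
Proof.
intros Ht Hx HT q. fold q in HT. assert (Hq : Cmod q < 1) by now apply qexp_mod.
assert (Hs := lterm_summable tau x Ht Hx). fold q in Hs.
set (s := fun p : nat * nat => let D := S (snd p) in
  (q ^ (S (fst p) * D) / INR D * (Cexp (INR D * x) + Cexp (- (INR D * x)) - 2))%C).
assert (H1 : is_fsum all2 s T).
{ apply (fam_fubini Cplus_monoid fst all3 all2 (lterm q x)); [now intros i [Hi _]| |easy].
  intros [m d] _. apply (fam_reindex Cplus_monoid (fun k => ((m, d), k)) all_nat).
  - congruence.
  - intros k _. now repeat split.
  - intros [p k] [_ E]. exists k. simpl in E. now subst p.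
  - unfold s, lterm. cbn [fst snd]. apply fsum_scal, cosh_series. }
(* |exp v| <= |q|^(- 1 / 2), so the logarithms are evaluated inside the unit disc *)
assert (Hpi := PI_RGT_0).
assert (Hqm : Cmod q = exp (- (2 * PI * Im tau))).
{ unfold q, qexp. rewrite Cmod_Cexp. f_equal. destruct tau as [a b]. simpl. ring. }
assert (Harg : forall v m, Cmod v <= Cmod x -> Cmod (Cexp v * q ^ S m)%C < 1).
{ intros v m Hv. rewrite Cmod_mult, Cmod_pow, Cmod_Cexp.
  assert (Hre : Re v <= PI * Im tau).
  { eapply Rle_trans; [apply Rle_abs|]. eapply Rle_trans; [apply re_le_Cmod|]. lra. }
  assert (Hqs : Cmod q ^ S m <= Cmod q).
  { simpl. assert (Cmod q ^ m <= 1) by (rewrite <- (pow1 m); apply pow_incr; split; [apply Cmod_ge_0|lra]).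
    pose proof (Cmod_ge_0 q). nra. }
  apply Rle_lt_trans with (exp (PI * Im tau) * Cmod q).
  - apply Rmult_le_compat; [apply Rlt_le, exp_pos|apply pow_le, Cmod_ge_0|now apply exp_mono|easy].
  - rewrite Hqm, <- exp_plus, <- exp_0. apply exp_increasing. nra. }
assert (Hargs : forall m, Cmod (Cexp x * q ^ S m)%C < 1 /\ Cmod (Cexp (- x) * q ^ S m)%C < 1 /\ Cmod (1 * q ^ S m)%C < 1).
{ intros m. split; [apply Harg; lra|split; [apply Harg; rewrite Cmod_opp; lra|]].
  rewrite <- Cexp_0. apply Harg. rewrite Cmod_0. apply Cmod_ge_0. }
assert (Hlog : forall y, Cmod y < 1 -> is_fsum all_nat (fun d => RtoC (/ INR (S d)) * y ^ S d)%C (log_series y)).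
{ intros y Hy. destruct (ps_fsum _ 1 y (geom_bounded_1 _ log_coef_bound) Hy) as [Sy [Fy _]].
  assert (H := fsum_shift _ _ Sy Fy). cbv beta in H. simpl (INR 0) in H. rewrite Rinv_0 in H.
  replace (log_series y) with (ps (fun d => RtoC (/ INR d)) y - 0 * y ^ 0)%C by (unfold log_series; ring). exact H. }
set (lm := fun m => (log_series (Cexp x * q ^ S m) + log_series (Cexp (- x) * q ^ S m) - 2 * log_series (1 * q ^ S m))%C).
assert (H2 : is_fsum all_nat lm T).
{ apply (fam_fubini Cplus_monoid fst all2 all_nat s); [easy| |easy].
  intros m _. apply (fam_reindex Cplus_monoid (fun d => (m, d)) all_nat).
  - congruence.
  - intros k _. now repeat split.
  - intros [m' k] [_ E]. exists k. simpl in E. now subst m'.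
  - destruct (Hargs m) as [A1 [A2 A3]].
    apply fam_ext with (2 := fsum_minus _ _ _ _ _ (fam_op Cplus_monoid _ _ _ _ _ (Hlog _ A1) (Hlog _ A2)) (fsum_scal _ _ 2 _ (Hlog _ A3))).
    intros d _. unfold s. cbn [fst snd]. set (D := S d).
    assert (HD : INR D <> 0) by now apply not_0_INR.
    replace (- (INR D * x))%C with (INR D * - x)%C by ring.
    rewrite !Cexp_nat, !Cpow_mult_l, Cpow_1_l, Cpow_mult_r, RtoC_inv by easy. unfold Cdiv. ring. }
assert (L1 : filterlim (fun N => lfold Cplus (RtoC 0) lm (seq 0 N)) eventually (locally T)).
{ apply (fam_seq (op := Cplus) (e := RtoC 0) all_nat lm T (fun N => seq 0 N)); [..|exact H2].
  - intros n. apply seq_NoDup.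
  - intros n. now apply Forall_forall.
  - intros i _. exists (S i). intros n Hn. apply in_seq. lia. }
assert (L2 := filterlim_comp _ _ _ _ _ _ _ _ L1 (Cexp_cont T)).
assert (L3 := clim_mult eventually _ _ _ _ L2 (clim_mult eventually _ _ _ _ (qprod_lim q (Cexp x) Hq) (qprod_lim q (Cexp (- x)) Hq))).
refine (clim_unique eventually _ _ _ L3 _).
apply (clim_ext_loc eventually (fun M => lfold Cmult (RtoC 1) (fun m => 1 - 1 * q ^ S m)%C (seq 0 M) *
  lfold Cmult (RtoC 1) (fun m => 1 - 1 * q ^ S m)%C (seq 0 M))%C).
- apply filter_forall. intros N. unfold lfold. induction (seq 0 N) as [|m L IH]; cbn [map fold_right].
  + rewrite Cexp_0. ring.
  + rewrite Cexp_plus.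
    set (S1 := fold_right Cmult 1%C (map (fun m => 1 - Cexp x * q ^ S m)%C L)) in *.
    set (S2 := fold_right Cmult 1%C (map (fun m => 1 - Cexp (- x) * q ^ S m)%C L)) in *.
    set (S3 := fold_right Cmult 1%C (map (fun m => 1 - 1 * q ^ S m)%C L)) in *.
    set (S4 := fold_right Cplus 0%C (map lm L)) in *.
    destruct (Hargs m) as [A1 [A2 A3]].
    assert (E1 := log_series_exp _ A1). assert (E2 := log_series_exp _ A2). assert (E3 := log_series_exp _ A3).
    set (r1 := (1 - Cexp x * q ^ S m)%C) in *. set (r2 := (1 - Cexp (- x) * q ^ S m)%C) in *.
    set (r3 := (1 - 1 * q ^ S m)%C) in *.
    assert (El : (Cexp (lm m) * (r1 * r2))%C = (r3 * r3)%C).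
    { replace (lm m) with (log_series (Cexp x * q ^ S m) + log_series (Cexp (- x) * q ^ S m) +
        - (log_series (1 * q ^ S m) + log_series (1 * q ^ S m)))%C by (unfold lm; ring).
      rewrite Cexp_plus, (Cexp_plus (log_series (Cexp x * q ^ S m))),
        (Cexp_opp (log_series (1 * q ^ S m) + log_series (1 * q ^ S m))),
        (Cexp_plus (log_series (1 * q ^ S m))).
      set (e1 := Cexp (log_series (Cexp x * q ^ S m))) in *. set (e2 := Cexp (log_series (Cexp (- x) * q ^ S m))) in *.
      assert (Hne := Cexp_neq0 (log_series (1 * q ^ S m))).
      set (e3 := Cexp (log_series (1 * q ^ S m))) in *.
      assert (Er3 : r3 = (/ e3)%C). { replace r3 with (e3 * r3 * / e3)%C by (field; easy). rewrite E3. ring. }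
      replace (e1 * e2 * / (e3 * e3) * (r1 * r2))%C with ((e1 * r1) * (e2 * r2) * / (e3 * e3))%C by ring.
      rewrite E1, E2, Er3. field. easy. }
    transitivity ((r3 * r3) * (S3 * S3))%C; [ring|]. rewrite IH, <- El. ring.
- apply (clim_mult eventually); now apply qprod_lim.
Qed.

Definition divisor_part (q : C) (nu n : nat) : C := (INR (sum_div_pow nu (S n)) * q ^ S n)%C.

(** The pairs with product [n + 1] correspond to the divisors of [n + 1], by their second component. *)
Lemma divisor_fibre q nu n :
  is_fsum (fun p => all2 p /\ (S (fst p) * S (snd p) - 1)%nat = n)
    (fun p => q ^ (S (fst p) * S (snd p)) * INR (S (snd p)) ^ nu)%C (divisor_part q nu n).
Proof.
set (Ld := filter (fun d => Nat.eqb (Nat.modulo (S n) d) 0) (seq 1 (S n))).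
assert (HLd : forall d, In d Ld <-> (1 <= d)%nat /\ exists m, (1 <= m)%nat /\ (m * d = S n)%nat).
{ intros d. unfold Ld. rewrite filter_In, in_seq, Nat.eqb_eq. split.
  - intros [H1 H2]. split; [lia|]. apply Nat.Div0.mod_divides in H2. destruct H2 as [m Hm].
    exists m. split; [|lia]. destruct m; lia.
  - intros [H1 [m [H2 H3]]]. split.
    + split; [easy|]. nia.
    + rewrite <- H3. apply Nat.Div0.mod_mul. }
apply (fam_reindex Cplus_monoid (fun d => ((S n / d - 1)%nat, (d - 1)%nat)) (fun d => In d Ld)).
- intros d d' H H'. apply HLd in H, H'. intros E. injection E as _ E. lia.
- intros d H. apply HLd in H. destruct H as [H1 [m [H2 H3]]]. cbn [fst snd]. split; [easy|].
  rewrite <- H3, Nat.div_mul by lia. replace (S (m - 1)) with m by lia. replace (S (d - 1)) with d by lia. lia.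
- intros [m d] [_ E]. cbn [fst snd] in E. exists (S d). rewrite HLd. split.
  + split; [lia|]. exists (S m). lia.
  + replace (S n) with (S m * S d)%nat by lia. rewrite Nat.div_mul by lia. f_equal; lia.
- replace (divisor_part q nu n) with (lfold Cplus (RtoC 0) (fun d => RtoC (INR d ^ nu) * q ^ S n)%C Ld).
  + apply fam_ext with (f := fun d => (RtoC (INR d ^ nu) * q ^ S n)%C).
    * intros d H. apply HLd in H. destruct H as [H1 [m [H2 H3]]]. cbn [fst snd].
      rewrite <- H3, Nat.div_mul by lia. replace (S (m - 1)) with m by lia. replace (S (d - 1)) with d by lia.
      rewrite H3, RtoC_pow. ring.
    * apply (fam_finite Cplus_monoid (fun d => In d Ld)); [apply NoDup_filter, seq_NoDup|now apply Forall_forall|easy].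
  + unfold divisor_part, sum_div_pow. fold Ld. clear HLd. induction Ld as [|d L IH].
    * unfold lfold. simpl. ring.
    * unfold lfold in *. cbn [map fold_right list_sum]. rewrite IH.
      unfold list_sum. cbn [fold_right]. rewrite plus_INR, RtoC_plus, pow_INR. ring.
Qed.

Lemma lterm_sum_divisors tau x T : 0 < Im tau -> Cmod x <= PI * Im tau ->
  is_fsum all3 (lterm (qexp tau) x) T ->
  is_series (fun k => 2 * Cseries (fun n => INR (sum_div_pow (2 * (k + 1) - 1) (S n)) * qexp tau ^ S n) *
     x ^ (2 * (k + 1)) / INR (fact (2 * (k + 1))))%C T.
Proof.
intros Ht Hx HT. set (q := qexp tau) in *.
assert (Hpi := PI_RGT_0).
(* absolute convergence of the double series for each k, from the triple series at a real point *)
set (x0 := RtoC (PI * Im tau)).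
assert (Hx0 : 0 < PI * Im tau) by now apply Rmult_lt_0_compat.
assert (Hs := lterm_summable tau x0 Ht ltac:(unfold x0; rewrite Cmod_R, Rabs_right; lra)). fold q in Hs.
set (v := fun (k : nat) (p : nat * nat) => (q ^ (S (fst p) * S (snd p)) * INR (S (snd p)) ^ (2 * (k + 1) - 1))%C).
assert (Hlt : forall z k p, lterm q z (p, k) = (2 * z ^ (2 * (k + 1)) / INR (fact (2 * (k + 1))) * v k p)%C).
{ intros z k [m d]. unfold lterm, v. cbn [fst snd]. replace (2 * S k)%nat with (2 * (k + 1))%nat by lia.
  assert (HD : RtoC (INR (S d)) <> RtoC 0) by (intros H; apply RtoC_inj in H; now apply (not_0_INR (S d))).
  assert (HF : RtoC (INR (fact (2 * (k + 1)))) <> RtoC 0) by (intros H; apply RtoC_inj in H; now apply (INR_fact_neq_0 (2 * (k + 1)))).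
  rewrite Cpow_mult_l. replace (INR (S d) ^ (2 * (k + 1)))%C with (INR (S d) * INR (S d) ^ (2 * (k + 1) - 1))%C.
  - field. now split.
  - change (INR (S d) * INR (S d) ^ (2 * (k + 1) - 1))%C with (INR (S d) ^ S (2 * (k + 1) - 1))%C. f_equal. lia. }
assert (Hv : forall k, summable all2 (fun p => Cmod (v k p))).
{ intros k. set (c := Cmod (2 * x0 ^ (2 * (k + 1)) / INR (fact (2 * (k + 1))))).
  assert (Hc : 0 < c).
  { apply Cmod_gt_0. unfold Cdiv. apply Cmult_neq_0; [apply Cmult_neq_0|].
    - intros H; apply RtoC_inj in H; lra.
    - apply Cpow_nz. intros H; apply RtoC_inj in H; lra.
    - intros H. assert (HF := INR_fact_lt_0 (2 * (k + 1))).
      rewrite <- RtoC_inv in H by lra. apply RtoC_inj in H. pose proof (Rinv_0_lt_compat _ HF). lra. }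
  apply summable_ext with (g := fun p => / c * Cmod (lterm q x0 (p, k))).
  - intros p _. rewrite Hlt, Cmod_mult. fold c. field. lra.
  - apply summable_scal; [apply Rlt_le, Rinv_0_lt_compat; lra|].
    apply (summable_inj (fun p => (p, k)) all2 all3 (fun i => Cmod (lterm q x0 i))); [congruence| |easy].
    intros p Hp. now split. }
assert (HV : forall k, exists l, is_fsum all2 (v k) l).
{ intros k. apply (fsum_exists all2 (v k) _ (Hv k)). intros; lra. }
destruct (skolem _ HV) as [V HV'].
assert (EV : forall k, Cseries (fun n => INR (sum_div_pow (2 * (k + 1) - 1) (S n)) * q ^ S n)%C = V k).
{ intros k. apply Cseries_eq, fsum_is_series.
  apply (fam_fubini Cplus_monoid (fun p => S (fst p) * S (snd p) - 1)%nat all2 all_nat (v k)); [easy| |apply HV'].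
  intros n _. apply divisor_fibre. }
apply fsum_is_series.
apply (fam_fubini Cplus_monoid snd all3 all_nat (lterm q x)); [easy| |easy].
intros k _. apply (fam_reindex Cplus_monoid (fun p => (p, k)) all2).
- congruence.
- intros p Hp. now repeat split; try apply Hp.
- intros [p k'] [[Hp _] E]. exists p. simpl in E. now subst k'.
- rewrite EV. replace (2 * V k * x ^ (2 * (k + 1)) / INR (fact (2 * (k + 1))))%C
    with (2 * x ^ (2 * (k + 1)) / INR (fact (2 * (k + 1))) * V k)%C by (unfold Cdiv; ring).
  apply fam_ext with (2 := fsum_scal _ _ _ _ (HV' k)). intros p _. symmetry. apply Hlt.
Qed.

(** * The characteristic series near the origin, and the limit *)

(** [exp (logsinh x)] and [exp T], with [T] the sum of [lterm], are the reciprocals of the two parts of [denom]. Added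
    term by term, the Bernoulli numbers and the divisor sums form the Eisenstein series [G2k]; the term of index
    [0] is compensated by the Gaussian factor. *)
Lemma Q_Witten_series tau : 0 < Im tau ->
  locally (RtoC 0) (fun z : C => exists l : C, is_series (Q_W_term tau z) l /\ Q_Witten tau z = Cexp l).
Proof.
intros Ht. assert (Hpi := PI_RGT_0). assert (Hpy : 0 < PI * Im tau) by now apply Rmult_lt_0_compat.
apply locally_Cmod. exists (Rmin 1 (PI * Im tau) / (2 * PI)). split.
{ apply Rdiv_lt_0_compat; [apply Rmin_pos; lra|lra]. }
intros z Hz. replace (z - 0)%C with z in Hz by ring.
set (x := (2 * PI * Ci * z)%C).
assert (Hx : Cmod x < Rmin 1 (PI * Im tau)).
{ unfold x. rewrite !Cmod_mult, Cmod_Ci, !Cmod_R, !Rabs_right by lra.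
  apply (Rlt_div_r _ _ (2 * PI)) in Hz; lra. }
assert (Hx1 := Rlt_le_trans _ _ _ Hx (Rmin_l _ _)).
assert (Hx2 := Rlt_le_trans _ _ _ Hx (Rmin_r _ _)).
destruct (fsum_exists all3 (lterm (qexp tau) x) _ (lterm_summable tau x Ht (Rlt_le _ _ Hx2))) as [T HT]; [intros; lra|].
set (f := fun k => (G2k (k + 1) tau * x ^ (2 * (k + 1)) / INR (fact (2 * (k + 1))))%C).
assert (Sf : is_series f (logsinh x + T)%C).
{ apply (is_series_ext (K := C_AbsRing) (V := C_NormedModule)) with
    (2 := is_series_plus _ _ _ _ (logsinh_series x Hx1) (lterm_sum_divisors tau x T Ht (Rlt_le _ _ Hx2) HT)).
  intros k. unfold f, G2k. change plus with Cplus. unfold Cdiv.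
  match goal with |- @eq _ ?a ?b => change (@eq C a b) end. rewrite RtoC_opp. ring. }
exists ((logsinh x + T) - f 0%nat)%C. split.
- assert (S1 : is_series (fun k => f (S k)) ((logsinh x + T) - f 0%nat)%C).
  { apply (is_series_incr_1 f).
    match goal with |- is_series _ ?v => replace v with (logsinh x + T)%C end; [exact Sf|]. cring. }
  apply (is_series_ext (K := C_AbsRing) (V := C_NormedModule)) with (2 := S1). intros j.
  unfold f, Q_W_term. fold x. replace (S j + 1)%nat with (j + 2)%nat by lia. reflexivity.
- assert (H1 := logsinh_exp x Hx1). assert (H2 := lterm_sum_product tau x T Ht (Rlt_le _ _ Hx2) HT). cbv zeta in H2.
  unfold Q_Witten, denom. cbv zeta. fold x. set (q := qexp tau) in *.
  assert (Hp1 : qprod q 1 <> RtoC 0).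
  { apply qprod_neq0; [now apply qexp_mod|]. intros m. now apply qexp_one_minus. }
  unfold Cminus at 1. rewrite (Cexp_plus (logsinh x + T)), (Cexp_plus (logsinh x)).
  replace (- f 0%nat)%C with (- (x ^ 2 * (G2k 1 tau / 2)))%C.
  2: { unfold f. change (0 + 1)%nat with 1%nat. change (2 * 1)%nat with 2%nat. change (INR (fact 2)) with 2.
       unfold Cdiv. ring. }
  set (A := Cexp (logsinh x)) in *. set (B := (Cexp (- (x / 2)) * expm1_over x)%C) in *.
  set (P := (qprod q (Cexp x) * qprod q (Cexp (- x)))%C) in *. set (p := qprod q 1) in *.
  assert (HB : B <> RtoC 0).
  { intros H. rewrite H in H1. apply C1_nz. rewrite <- H1. ring. }
  assert (HP : P <> RtoC 0).
  { intros H. rewrite H in H2. apply (Cmult_neq_0 _ _ Hp1 Hp1). rewrite <- H2. ring. }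
  rewrite Cmult_comm. f_equal.
  replace (A * Cexp T)%C with ((A * B) * (Cexp T * P) / (B * P))%C by (field; now split).
  rewrite H1, H2. field. now repeat split.
Qed.

Theorem corollary1p3 (tau : C) (Htau : 0 < Im tau) :
  (* the products defining A-hat converge away from their poles *)
  (forall (s : R) (t : C), 0 < s ->
     ~ Ahat_pole (X tau s) t -> Ahat_converges (X tau s) t) /\
  exists QW : C -> C,
    is_Q_W tau QW /\
    forall z : C, ~ nonzero_lattice_point tau z ->
      at_right 0 (fun s : R => ~ Ahat_pole (X tau s) ((2 * PI * Ci * z) ^ 2)%C) /\
      filterlim (fun s : R => Ahat (X tau s) ((2 * PI * Ci * z) ^ 2)%C)
        (at_right 0)
        (locally (Cexp ((2 * PI * Ci * z) ^ 2 * (G2_star tau / 2)) * QW z)%C).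
Proof.
split.
- intros s t Hs Hnp. destruct (Ahat_product tau s t Htau Hs) as [l [_ [H _]]].
  exists (/ l)%C. now apply H.
- exists (Q_Witten tau). split.
  { split; [now apply Q_Witten_series|]. split; intros z; [now apply Q_Witten_meromorphic|now apply Q_Witten_holomorphic]. }
  intros z Hz.
  destruct (hecke_limit tau Htau) as [e2 [tot [He2 [Htot HE]]]].
  destruct (zeta_exists 0 (Rle_refl 0)) as [zeta2 Hz2].
  assert (Hzeta2 : is_fsum all_nat (fun k => RtoC (inv_square k)) zeta2).
  { apply fam_ext with (2 := Hz2). intros k _. f_equal. unfold inv_square.
    replace (- (2 + 0)) with (-2) by ring. rewrite Rpower_m2 by (pose proof (pos_INR k); lra). f_equal. ring. }
  destruct (Ahat_limit tau z _ tot zeta2 Htau Hz HE Hzeta2) as [W [HW [Hnp Hlim]]].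
  split; [easy|].
  assert (HD := half_product tau z e2 tot zeta2 W Htau He2 Htot Hzeta2 HW).
  assert (Hd0 := denom_neq0 tau z Htau Hz).
  match goal with |- filterlim _ _ (locally ?l) => match type of Hlim with filterlim _ _ (locally ?l') =>
    replace l with l'; [exact Hlim|] end end.
  (* Hecke's correction c becomes the non-holomorphic part of G2_star: k^2 / (8 pi Im tau) = - z^2 c *)
set (c := RtoC (PI / (2 * Im tau))).
  replace (- (z * z * (zeta2 + (tot - c))))%C with (- (z * z * (zeta2 + tot)) + z * z * c)%C by ring.
  rewrite Cexp_plus, Cmult_assoc, HD. unfold Q_Witten, G2_star.
  set (k := (2 * PI * Ci * z)%C).
  assert (Hpi := PI_RGT_0).
  assert (Ek : (k ^ 2 * RtoC (/ (4 * PI * Im tau)))%C = (- (2 * (z * z * c)))%C).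
  { assert (Hci : (Ci * Ci)%C = RtoC (-1)) by (apply injective_projections; simpl; ring).
    replace (k ^ 2)%C with (RtoC (4 * (PI * PI)) * (Ci * Ci) * (z * z))%C by (unfold k; rewrite !RtoC_mult; ring).
    rewrite Hci. unfold c.
    replace (- (2 * (z * z * RtoC (PI / (2 * Im tau)))))%C with (RtoC (- (PI / Im tau)) * (z * z))%C.
    - replace (- (PI / Im tau)) with (4 * (PI * PI) * -1 * / (4 * PI * Im tau)) by (field; lra).
      rewrite !RtoC_mult. ring.
    - replace (PI / Im tau) with (2 * (PI / (2 * Im tau))) by (field; lra). rewrite RtoC_opp, RtoC_mult. ring. }
  replace (k ^ 2 * ((RtoC (/ (4 * PI * Im tau)) + G2k 1 tau) / 2))%C
    with (- (z * z * c) + k ^ 2 * (G2k 1 tau / 2))%C.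
  2: { replace (k ^ 2 * ((RtoC (/ (4 * PI * Im tau)) + G2k 1 tau) / 2))%C
         with ((k ^ 2 * RtoC (/ (4 * PI * Im tau))) / 2 + k ^ 2 * (G2k 1 tau / 2))%C by (unfold Cdiv; ring).
       rewrite Ek. field. }
  rewrite Cexp_plus, !Cexp_opp.
  assert (H1 := Cexp_neq0 (z * z * c)). assert (H2 := Cexp_neq0 (k ^ 2 * (G2k 1 tau / 2))).
  field. now repeat split.
Qed.
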